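(* Let $p>1$ and let $P$ and $Q$ be two compactly supported probability distributions on $\mathbb{R}^d$, with supports contained in $\overline{B(0,R)}$, $R>0$, that fit the spiked transport model with spike $v\in\mathbb{S}^{d-1}$. Assume furthermore that $P$ and $Q$ satisfy condition (CC): for every $u\in\mathbb{S}^{d-1}$, the support of $P_u$ or the support of $Q_u$ is an interval. Let $P_n$ and $Q_n$ be the empirical measures of $n$ i.i.d. samples from $P$ and from $Q$, respectively, the two samples being independent. Then, as $n\to\infty$, $$\sqrt n\left(MSW_p^p(P_n,Q_n)-MSW_p^p(P,Q)\right)\xrightarrow{d}\mathbb{G}(v),$$ where $\mathbb{G}$ is the tight zero-mean Gaussian process on $\mathbb{S}^{d-1}$ with covariance $$\begin{aligned}\mathbb{E}\,\mathbb{G}(u)\mathbb{G}(w)={}&\int f_u(u^\top x)f_w(w^\top x)\,dP(x)-\int f_u(u^\top x)\,dP(x)\int f_w(w^\top x)\,dP(x)\\&+\int f_u^c(u^\top y)f_w^c(w^\top y)\,dQ(y)-\int f_u^c(u^\top y)\,dQ(y)\int f_w^c(w^\top y)\,dQ(y),\end{aligned}$$ and $f_u\in\mathcal{C}$ is the unique Kantorovich potential for $(P_u,Q_u)$.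
   Context: Spiked transport model with (one-dimensional) spike $v\in\mathbb{S}^{d-1}$: let $L=\mathrm{span}(v)$, let $X,Y$ be random variables with values in $L$, and let $Z$ be a random variable independent of $(X,Y)$ and supported on the orthogonal complement $L^\perp$. $P$ and $Q$ fit the model if $P=\mathrm{law}(X+Z)$ and $Q=\mathrm{law}(Y+Z)$ for some such $X,Y,Z$. For a probability measure $P$ on $\mathbb{R}^d$ and $u\in\mathbb{S}^{d-1}$, $P_u$ is the law of $u^\top X$ where $X\sim P$. The max-sliced Wasserstein distance is $MSW_p^p(P,Q)=\sup_{u\in\mathbb{S}^{d-1}}W_p^p(P_u,Q_u)$. $W_p^p(\mu,\nu)=\inf_{\pi\in\Pi(\mu,\nu)}\int\|x-y\|^p\,d\pi(x,y)$ over couplings. For $\mu,\nu$ supported in $[-R,R]$, duality gives $W_p^p(\mu,\nu)=\sup_{f}\int f\,d\mu+\int f^c\,d\nu$ over functions $f:[-R,R]\to\mathbb{R}$, where $f^c(y)=\inf_{x\in[-R,R]}\{|x-y|^p-f(x)\}$. $\mathcal{C}$ is the class of $f:[-R,R]\to\mathbb{R}$ with $f(0)=0$ and $\|f\|_{\mathrm{Lip}}\le p(2R)^{p-1}$; the supremum is attained in $\mathcal{C}$, and a maximizer in $\mathcal{C}$ is called a Kantorovich potential for $(\mu,\nu)$. The paper takes as a known (cited) fact that (CC) guarantees uniqueness of the Kantorovich potential in $\mathcal{C}$ for each pair $(P_u,Q_u)$. The process $\mathbb{G}$ is the weak limit in $\ell^\infty(\mathbb{S}^{d-1})$ of $\sqrt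 n\,(W_p^p(P_{n\cdot},Q_{n\cdot})-W_p^p(P_\cdot,Q_\cdot))$. *)

(* Defs.v *)
From HB Require Import structures.
From mathcomp Require Import all_boot all_order all_algebra.
From mathcomp Require Import all_classical all_reals all_analysis.

Set Implicit Arguments.
Unset Strict Implicit.
Unset Printing Implicit Defensive.
Import Order.TTheory GRing.Theory Num.Theory.
Import numFieldNormedType.Exports.
Local Open Scope classical_set_scope.
Local Open Scope ring_scope.

(* The library norm on matrices is the sup norm, hence a separate Euclidean
   structure; the two norms have the same open sets. *)
Definition dotp (R : realType) (d : nat) (u x : 'rV[R]_d) : R :=
  (u *m x^T) ord0 ord0.

Definition l2norm (R : realType) (d : nat) (x : 'rV[R]_d) : R :=
  Num.sqrt (dotp x x).

Definition sphere (R : realType) (d : nat) : set 'rV[R]_d :=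
  [set u | l2norm u = 1].
Arguments sphere : clear implicits.

Definition l2ball (R : realType) (d : nat) (r : R) : set 'rV[R]_d :=
  [set x | l2norm x <= r].
Arguments l2ball {R} d r.

Definition borel_rV (R : realType) (d : nat) :=
  g_sigma_algebraType (@open 'rV[R]_d).

Definition msupport (R : realType) (T : topologicalType)
    (mu : set T -> \bar R) : set T :=
  [set x | forall U, open U -> U x -> (0 < mu U)%E].

Definition has_law d d' (Om : measurableType d) (T : measurableType d')
    (R : realType) (Pr : probability Om R) (X : Om -> T)
    (mu : set T -> \bar R) : Prop :=
  forall A : set T, measurable A -> Pr (X @^-1` A) = mu A.

Definition independent2 d d1 d2 (Om : measurableType d)
    (T1 : measurableType d1) (T2 : measurableType d2) (R : realType)
    (Pr : probability Om R) (X : Om -> T1) (Y : Om -> T2) : Prop :=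
  forall (A : set T1) (B : set T2), measurable A -> measurable B ->
    Pr (X @^-1` A `&` Y @^-1` B) = (Pr (X @^-1` A) * Pr (Y @^-1` B))%E.

Definition mutually_independent d d' (Om : measurableType d)
    (T : measurableType d') (R : realType) (Pr : probability Om R)
    (I : choiceType) (X : I -> Om -> T) : Prop :=
  forall (s : seq I) (A : I -> set T), uniq s ->
    (forall i, measurable (A i)) ->
    Pr (\bigcap_(i in [set` s]) (X i @^-1` A i)) =
      (\prod_(i <- s) Pr (X i @^-1` A i))%E.

Definition cvg_in_distribution d d' (Om : measurableType d)
    (Om' : measurableType d') (R : realType) (Pr : probability Om R)
    (Pr' : probability Om' R) (T : nat -> Om -> R) (L : Om' -> R) : Prop :=
  [/\ forall n, measurable_fun setT (T n), measurable_fun setT L &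
    forall h : R -> R, continuous h -> (exists M, forall x, `|h x| <= M) ->
      (fun n => \int[Pr]_w h (T n w)) @ \oo --> \int[Pr']_w h (L w)].

(* R^d-valued random vectors; (v : 'rV_d) as a row space is the line L. *)
Definition spiked_transport_model (R : realType) (d : nat) (v : 'rV[R]_d)
    (P Q : probability (borel_rV R d) R) : Prop :=
  exists (dO : measure_display) (Om : measurableType dO)
    (Pr : probability Om R) (X Y Z : {RV Pr >-> borel_rV R d}),
  [/\ forall w, ((X w : 'rV[R]_d) <= v)%MS /\ ((Y w : 'rV[R]_d) <= v)%MS,
      Pr [set w | dotp v (Z w) = 0] = 1%E,
      independent2 Pr (fun w => (X w, Y w)) Z,
      has_law Pr (fun w => (X w : 'rV[R]_d) + Z w : borel_rV R d) P &
      has_law Pr (fun w => (Y w : 'rV[R]_d) + Z w : borel_rV R d) Q].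

Definition proj1d (R : realType) (d : nat)
    (mu : set (borel_rV R d) -> \bar R) (u : 'rV[R]_d) : set R -> \bar R :=
  pushforward mu (fun x : borel_rV R d => dotp u x : R).

Definition coupling (R : realType) (mu nu : set R -> \bar R)
    (pi : probability (R * R)%type R) : Prop :=
  has_law pi fst mu /\ has_law pi snd nu.

(* Wpp and MSWpp are the p-th powers W_p^p and MSW_p^p: no root is taken. *)
Definition Wpp (R : realType) (p : R) (mu nu : set R -> \bar R) : \bar R :=
  ereal_inf [set (\int[pi]_z (`|z.1 - z.2| `^ p)%:E)%E
            | pi in [set pi | coupling mu nu pi]].

Definition MSWpp (R : realType) (d : nat) (p : R)
    (mu nu : set (borel_rV R d) -> \bar R) : \bar R :=
  ereal_sup [set Wpp p (proj1d mu u) (proj1d nu u) | u in sphere R d].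

(* Functions on [-r, r] are represented by total functions whose values
   outside [-r, r] are never used. *)
Definition ctransform (R : realType) (p r : R) (f : R -> R) (y : R) : R :=
  inf [set `|x - y| `^ p - f x | x in `[- r, r]].

Definition class_C (R : realType) (p r : R) (f : R -> R) : Prop :=
  f 0 = 0 /\
  forall x y, x \in `[- r, r] -> y \in `[- r, r] ->
    `|f x - f y| <= p * (2 * r) `^ (p - 1) * `|x - y|.

Definition dual_value (R : realType) (p r : R) (mu nu : set R -> \bar R)
    (f : R -> R) : \bar R :=
  (\int[mu]_(x in `[(- r)%R, r]) (f x)%:E +
   \int[nu]_(y in `[(- r)%R, r]) (ctransform p r f y)%:E)%E.

Definition kantorovich_potential (R : realType) (p r : R)
    (mu nu : set R -> \bar R) (f : R -> R) : Prop :=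
  class_C p r f /\
  forall g, class_C p r g ->
    (dual_value p r mu nu g <= dual_value p r mu nu f)%E.

Definition condition_CC (R : realType) (d : nat)
    (P Q : set (borel_rV R d) -> \bar R) : Prop :=
  forall u, sphere R d u ->
    is_interval (msupport (proj1d P u)) \/ is_interval (msupport (proj1d Q u)).

Definition empirical (R : realType) (d : nat) (n : nat)
    (x : nat -> borel_rV R d) : {measure set (borel_rV R d) -> \bar R} :=
  mscale ((n%:R : R)^-1)%:nng (msum (fun i => \d_(x i)) n).

(* The integrals run over the closed ball, which carries P and Q and on which
   u^T x stays in the domain [-r, r] of the potentials. *)
Definition limit_cov (R : realType) (d : nat) (p r : R)
    (P Q : probability (borel_rV R d) R) (f : 'rV[R]_d -> R -> R)
    (u w : 'rV[R]_d) : R :=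
  let F u (x : borel_rV R d) := f u (dotp u x) in
  let Fc u (y : borel_rV R d) := ctransform p r (f u) (dotp u y) in
  \int[P]_(x in l2ball d r) (F u x * F w x)
  - (\int[P]_(x in l2ball d r) F u x) * (\int[P]_(x in l2ball d r) F w x)
  + \int[Q]_(y in l2ball d r) (Fc u y * Fc w y)
  - (\int[Q]_(y in l2ball d r) Fc u y) * (\int[Q]_(y in l2ball d r) Fc w y).

(* The library's normal_prob is not the Dirac mass at standard deviation 0. *)
Definition gaussian_law (R : realType) (m s : R) : set R -> \bar R :=
  if s == 0 then \d_m else normal_prob m s.

Definition gaussian_process_on d (Om : measurableType d) (R : realType)
    (Pr : probability Om R) (T : Type) (A : set T) (G : T -> Om -> R) : Prop :=
  forall (n : nat) (t : 'I_n -> T) (a : 'I_n -> R), (forall i, A (t i)) ->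
    exists m s : R, 0 <= s /\
      has_law Pr (fun w => \sum_(i < n) a i * G (t i) w) (gaussian_law m s).

(* The topology of {uniform` A -> R} is that of uniform convergence on A, so
   bounded functions form l^oo(A) up to their values outside A. Because of
   these values the topology is not Hausdorff and compact sets need not be
   closed; closedness makes the event in the last clause measurable. *)
Definition tight_in_linfty d (Om : measurableType d) (R : realType)
    (Pr : probability Om R) (T : choiceType) (A : set T)
    (G : T -> Om -> R) : Prop :=
  let path (w : Om) : {uniform` A -> R} := fun t => G t w in
  [/\ forall w, exists M, forall t, A t -> `|G t w| <= M,
      forall U : set {uniform` A -> R}, open U -> measurable (path @^-1` U) &
      forall e : R, 0 < e -> exists K : set {uniform` A -> R},
        [/\ compact K, closed K & ((1 - e)%:E <= Pr (path @^-1` K))%E]].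

Definition tight_centered_gaussian d (Om : measurableType d) (R : realType)
    (Pr : probability Om R) (T : choiceType) (A : set T)
    (cov : T -> T -> R) (G : T -> {RV Pr >-> R}) : Prop :=
  [/\ tight_in_linfty Pr A (fun t => G t : Om -> R),
      gaussian_process_on Pr A (fun t => G t : Om -> R),
      forall t, A t -> ('E_Pr[G t] = 0)%E &
      forall s t, A s -> A t ->
        ('E_Pr[(fun w => G s w * G t w)%R] = (cov s t)%:E)%E].

(* Main.v *)
Require Import Defs.
From HB Require Import structures.
From mathcomp Require Import all_boot all_order all_algebra.
From mathcomp Require Import finmap.
From mathcomp Require Import all_classical all_reals all_analysis.
From mathcomp Require Import measurable_realfun lra ring zify.
Set Implicit Arguments.
Unset Strict Implicit.
Unset Printing Implicit Defensive.
Import Order.TTheory GRing.Theory Num.Theory.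
Import numFieldNormedType.Exports.
Local Open Scope classical_set_scope.
Local Open Scope ring_scope.

(** Index the dual problem by all pairs [t = (u, g)] of a direction [u] and a
    function [g] of the class [C]. Write [D t] for the dual value
    [int g (u^T x) dP + int g^c (u^T y) dQ]. By duality on the line
    ([duality]) the max-sliced distance is the supremum of [D] ([MSWpp_sup]), and
    the same holds for the empirical measures. With [E_n] the centred empirical
    dual value times [sqrt n], the statistic is therefore the supremum over [t] of
    [E_n t + sqrt n (D t - max D)].

    In the spiked model the supremum of [D] is attained at [tv = (v, f_v)]. Moving
    the spike coordinates optimally while [Z] stays fixed shows that
    [W (P_u, Q_u) <= |u^T v|^p W (P_v, Q_v)] ([spiked_dval]). Any other maximiser
    carries the same centred functions almost surely ([maximiser_dvar0]): if
    [W (P_v, Q_v) > 0], then [u = v] or [u = - v], and condition (CC) gives the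
    potential up to a constant ([potential_unique]); if it vanishes, then [P_u] and
    [Q_u] agree for every [u], so [0] is a potential and (CC) leaves only the
    constants.

    Two facts make [tv] decide the limit. The set of indices is compact, so
    near-maximisers of [D] have an increment [E_n t - E_n tv] of small variance
    ([near_max]). And [E_n] is asymptotically equicontinuous ([emp_sup]): [C] has
    finite nets of [exp (O (2 ^ m))] cells of diameter [O (2 ^- m)], and Hoeffding's
    inequality makes chaining over them converge. Near-maximisers thus contribute at
    most [E_n tv + o(1)], all other indices are ruled out by the factor [sqrt n],
    and the statistic differs from [E_n tv] by a quantity that vanishes in
    probability. The central limit theorem for bounded variables, by Lindeberg's
    replacement ([lindeberg], [portmanteau_smooth]), gives the limit [N (0, s^2)],
    with [s^2] the variance of [G v]. This is [msw_limit].

    The law of [G v] for any tight centred Gaussian process [G] with the given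
    covariance is determined by its mean and variance, so the convergence holds for
    every such [G]. The process exists ([gaussian_limit_exists]): the binary digits
    of a uniform number yield a sequence of independent Gaussian variables
    ([nrm_comb]), the Cholesky factor of the covariance on a countable net turns it
    into a Gaussian family ([gauss_family]), and the chaining argument, now with
    Gaussian tails, extends the family to the whole sphere with paths whose
    oscillation on the cells of the net is controlled. Such paths lie in compact
    sets of functions up to a small probability, and each open set of paths is an
    event since countably many step functions approximate them ([codes_tight]). *)

(** * Bounded measurable functions *)

Definition bmf d (T : measurableType d) (R : realType) (f : T -> R) : Prop :=
  measurable_fun setT f /\ exists M, forall x, `|f x| <= M.

Section Bmf.
Context d (T : measurableType d) (R : realType).
Implicit Types f g : T -> R.

Lemma bmf_cst (c : R) : bmf (fun _ : T => c).
Proof. by split; [exact: measurable_cst|exists `|c|]. Qed.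

Lemma bmfD f g : bmf f -> bmf g -> bmf (fun x => f x + g x).
Proof.
move=> [mf [M fM]] [mg [N gN]]; split; first exact: measurable_funD.
by exists (M + N) => x; rewrite (le_trans (ler_normD _ _))// lerD.
Qed.

Lemma bmfM f g : bmf f -> bmf g -> bmf (fun x => f x * g x).
Proof.
move=> [mf [M fM]] [mg [N gN]]; split; first exact: measurable_funM.
by exists (M * N) => x; rewrite normrM ler_pM.
Qed.

Lemma bmfZ (c : R) f : bmf f -> bmf (fun x => c * f x).
Proof. by move=> bf; apply: bmfM => //; exact: bmf_cst. Qed.

Lemma bmfN f : bmf f -> bmf (fun x => - f x).
Proof.
move=> [mf [M fM]]; split; first exact: measurableT_comp.
by exists M => x; rewrite normrN.
Qed.

Lemma bmfB f g : bmf f -> bmf g -> bmf (fun x => f x - g x).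
Proof. by move=> bf bg; apply: bmfD => //; exact: bmfN. Qed.

Lemma bmf_norm f : bmf f -> bmf (fun x => `|f x|).
Proof.
move=> [mf [M fM]]; split; first exact: measurableT_comp.
by exists M => x; rewrite normr_id.
Qed.

Lemma bmf_sum (I : Type) (s : seq I) (F : I -> T -> R) :
  (forall i, bmf (F i)) -> bmf (fun x => \sum_(i <- s) F i x).
Proof.
move=> bF; elim: s => [|i s IH].
  by under eq_fun do rewrite big_nil; exact: bmf_cst.
by under eq_fun do rewrite big_cons; exact: bmfD.
Qed.

Lemma bmf_indic (A : set T) : measurable A -> bmf (\1_A : T -> R).
Proof.
move=> mA; split; first exact: measurable_indic.
by exists 1 => x; rewrite indicE ger0_norm// lern1 leq_b1.
Qed.

End Bmf.

Lemma bmf_comp d d' (T : measurableType d) (T' : measurableType d')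
    (R : realType) (f : T' -> R) (g : T -> T') :
  bmf f -> measurable_fun setT g -> bmf (fun x => f (g x)).
Proof.
move=> [mf [M fM]] mg; split; last by exists M.
exact: (measurableT_comp mf mg).
Qed.

Lemma probT d (T : measurableType d) (R : realType) (P : probability T R) :
  (P : {measure set T -> \bar R}) setT = 1%E.
Proof. exact: probability_setT. Qed.

Lemma probC d (T : measurableType d) (R : realType) (P : probability T R) A :
  measurable A -> (P : {measure set T -> \bar R}) (~` A) = (1 - P A)%E.
Proof. exact: probability_setC. Qed.

Section Expect.
Context d (T : measurableType d) (R : realType) (P : probability T R).
Implicit Types f g : T -> R.

Lemma bmf_integrable f : bmf f -> P.-integrable setT (EFin \o f).
Proof.
move=> [mf [M fM]]; apply: measurable_bounded_integrable => //.
  by rewrite probT ltry.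
exists M; split; first exact: num_real.
by move=> x Mx y _ /=; rewrite (le_trans (fM y))// ltW.
Qed.

Lemma EFin_expect f : bmf f ->
  (\int[P]_x (f x)%:E)%E = (\int[P]_x f x)%:E.
Proof.
move=> bf; rewrite /Rintegral fineK//.
exact: (integrable_fin_num measurableT (bmf_integrable bf)).
Qed.

Lemma expectD f g : bmf f -> bmf g ->
  \int[P]_x (f x + g x) = \int[P]_x f x + \int[P]_x g x.
Proof. by move=> bf bg; rewrite RintegralD//; exact: bmf_integrable. Qed.

Lemma expectB f g : bmf f -> bmf g ->
  \int[P]_x (f x - g x) = \int[P]_x f x - \int[P]_x g x.
Proof. by move=> bf bg; rewrite RintegralB//; exact: bmf_integrable. Qed.

Lemma expectZ c f : bmf f -> \int[P]_x (c * f x) = c * \int[P]_x f x.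
Proof. by move=> bf; rewrite RintegralZl//; exact: bmf_integrable. Qed.

Lemma expect_cst (c : R) : \int[P]_x c = c.
Proof. by rewrite Rintegral_cst// probT mulr1. Qed.

Lemma expect_sum (I : Type) (s : seq I) (F : I -> T -> R) :
  (forall i, bmf (F i)) ->
  \int[P]_x (\sum_(i <- s) F i x) = \sum_(i <- s) \int[P]_x F i x.
Proof.
move=> bF; elim: s => [|i s IH].
  rewrite big_nil -[RHS]expect_cst; apply: eq_Rintegral => x _.
  by rewrite big_nil.
rewrite big_cons -IH -expectD//; last exact: bmf_sum.
by apply: eq_Rintegral => x _; rewrite big_cons.
Qed.

Lemma expect_le f g : bmf f -> bmf g -> (forall x, f x <= g x) ->
  \int[P]_x f x <= \int[P]_x g x.
Proof.
by move=> bf bg fg; apply: le_Rintegral => //; exact: bmf_integrable.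
Qed.

Lemma expect_norm f : bmf f -> `|\int[P]_x f x| <= \int[P]_x `|f x|.
Proof. by move=> bf; apply: le_normr_Rintegral => //; exact: bmf_integrable. Qed.

Lemma expect_norm_le f c : bmf f -> (forall x, `|f x| <= c) ->
  `|\int[P]_x f x| <= c.
Proof.
move=> bf fc; rewrite (le_trans (expect_norm bf))// -[leRHS]expect_cst.
by apply: expect_le => //; [exact: bmf_norm|exact: bmf_cst].
Qed.

Lemma expect_indic A : measurable A -> \int[P]_x (\1_A x : R) = fine (P A).
Proof. by move=> mA; rewrite /Rintegral integral_indic// setIT. Qed.

Lemma prob_fine A : measurable A -> (fine (P A))%:E = P A.
Proof. by move=> mA; rewrite fineK// fin_num_measure. Qed.

Lemma expect_ae f g A : measurable A -> P A = 1%E -> bmf f -> bmf g ->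
  (forall x, A x -> f x = g x) -> \int[P]_x f x = \int[P]_x g x.
Proof.
move=> mA PA [mf _] [mg _] fg; congr fine.
apply: ae_eq_integral => //; [exact/measurable_EFinP|exact/measurable_EFinP|].
exists (~` A); split; first exact: measurableC.
  by rewrite probC// PA subee.
by move=> x /= h; apply: contra_not h => Ax _; rewrite fg.
Qed.

(** Off the event the difference is at most twice the common bound. *)
Lemma expect_close f g A e M : measurable A -> bmf f -> bmf g -> 0 <= e ->
  (forall x, A x -> `|f x - g x| <= e) -> (forall x, `|f x| <= M) ->
  (forall x, `|g x| <= M) ->
  `|\int[P]_x f x - \int[P]_x g x| <= e + 2 * M * fine (P (~` A)).
Proof.
move=> mA bf bg e0 fg fM gM; rewrite -expectB//.
have bI : bmf (\1_(~` A) : T -> R) by apply/bmf_indic/measurableC.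
apply: (le_trans (expect_norm (bmfB bf bg))).
apply: (@le_trans _ _ (\int[P]_x (e + 2 * M * \1_(~` A) x))).
  apply: expect_le; first exact/bmf_norm/bmfB.
    by apply: bmfD; [exact: bmf_cst|exact: bmfZ].
  move=> x; rewrite indicE; have [xA|xA] := boolP (x \in ~` A).
    rewrite mulr1 (le_trans (ler_normB _ _))//.
    have := fM x; have := gM x; lra.
  rewrite mulr0 addr0 fg//; apply: contrapT => nA.
  by move/negP: xA; apply; rewrite inE.
rewrite expectD//; [|exact: bmf_cst|exact: bmfZ].
by rewrite expect_cst expectZ// expect_indic//; exact: measurableC.
Qed.

(** Markov's inequality. *)
Lemma markov_bmf f A c : measurable A -> bmf f -> (forall x, 0 <= f x) ->
  (forall x, A x -> c <= f x) -> c * fine (P A) <= \int[P]_x f x.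
Proof.
move=> mA bf f0 Af; have bI := bmf_indic R mA.
rewrite -expect_indic// -expectZ//; apply: expect_le => //; first exact: bmfZ.
move=> x; rewrite indicE; have [xA|xA] := boolP (x \in A).
  by rewrite mulr1 Af// -inE.
by rewrite mulr0.
Qed.

End Expect.

Definition law d d' (T : measurableType d) (T' : measurableType d')
    (R : realType) (P : probability T R) (f : T -> T')
    (mf : measurable_fun setT f) : probability T' R :=
  distribution P (HB.pack f (@isMeasurableFun.Build _ _ _ _ f mf) : {mfun T >-> T'}).

Lemma lawE d d' (T : measurableType d) (T' : measurableType d')
    (R : realType) (P : probability T R) (f : T -> T')
    (mf : measurable_fun setT f) A : law P mf A = P (f @^-1` A).
Proof. by []. Qed.

Lemma expect_law d d' (T : measurableType d) (T' : measurableType d')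
    (R : realType) (P : probability T R) (f : T -> T')
    (mf : measurable_fun setT f) (g : T' -> R) : bmf g ->
  \int[law P mf]_x g x = \int[P]_x g (f x).
Proof.
move=> bg; congr fine.
have mg : measurable_fun setT (fun y => (g y)%:E).
  by apply/measurable_EFinP; case: bg.
rewrite [LHS](integral_pushforward mf mg)//.
exact: (bmf_integrable P (bmf_comp bg mf)).
Qed.

Lemma expect_has_law d d' (T : measurableType d) (T' : measurableType d')
    (R : realType) (P : probability T R) (f : T -> T')
    (mu : probability T' R) (g : T' -> R) :
  measurable_fun setT f -> has_law P f mu -> bmf g ->
  \int[mu]_x g x = \int[P]_x g (f x).
Proof.
move=> mf fmu bg; rewrite -(expect_law P mf bg); congr fine.
by apply: eq_measure_integral => A mA _; exact/esym/fmu.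
Qed.

Section Product.
Context d1 d2 (T1 : measurableType d1) (T2 : measurableType d2) (R : realType).
Variables (P1 : probability T1 R) (P2 : probability T2 R).

Lemma bmf_section1 (f : T1 * T2 -> R) x : bmf f -> bmf (fun y => f (x, y)).
Proof. by move=> bf; apply: (bmf_comp bf); exact: measurable_pair1. Qed.

Lemma bmf_section2 (f : T1 * T2 -> R) y : bmf f -> bmf (fun x => f (x, y)).
Proof. by move=> bf; apply: (bmf_comp bf); exact: measurable_pair2. Qed.

Lemma bmf_fubini_F (f : T1 * T2 -> R) : bmf f ->
  bmf (fun x => \int[P2]_y f (x, y)).
Proof.
move=> bf; have [mf [M fM]] := bf; split; last first.
  by exists M => x; apply: expect_norm_le => //; exact: bmf_section1.
apply/measurable_EFinP => /=.
rewrite [X in measurable_fun _ X](_ : _ =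
    (fun x => \int[P2]_y (EFin \o f) (x, y)))%E; last first.
  apply/funext => x /=; rewrite -EFin_expect//; exact: bmf_section1.
exact: (measurable_fubini_F (bmf_integrable (P1 \x P2)%E bf)).
Qed.

Lemma expect_prod (f : T1 * T2 -> R) : bmf f ->
  \int[(P1 \x P2)%E]_z f z = \int[P1]_x \int[P2]_y f (x, y).
Proof.
move=> bf; congr fine.
rewrite -(integral12_prod_meas1 (bmf_integrable (P1 \x P2)%E bf)).
apply: eq_integral => x _; rewrite /fubini_F/=.
by rewrite -EFin_expect//; exact: bmf_section1.
Qed.

End Product.

(** * The cost of power type and its derivative *)

Section Cost.
Context (R : realType) (p : R) (p_gt1 : 1 < p).

Let p_gt0 : 0 < p. Proof. by move: p_gt1; lra. Qed.

Definition cost (t : R) : R := `|t| `^ p.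
Definition dcost (t : R) : R := p * (Num.sg t * `|t| `^ (p - 1)).

Lemma cost_ge0 t : 0 <= cost t.
Proof. exact: powR_ge0. Qed.

Lemma costN t : cost (- t) = cost t.
Proof. by rewrite /cost normrN. Qed.

(** Convexity of [b `^ p] on the half-line is Young's inequality for [b] and
    [a `^ (p - 1)]. *)
Lemma powR_tangent (s a b : R) : 1 < s -> 0 <= a -> 0 <= b ->
  a `^ s + s * a `^ (s - 1) * (b - a) <= b `^ s.
Proof.
move=> s1 a0 b0; have s0 : 0 < s by lra.
have q0 : 0 < s / (s - 1) by rewrite divr_gt0//; lra.
have E : s^-1 + (s / (s - 1))^-1 = 1.
  by field; rewrite ?gt_eqF//; lra.
have := conjugate_powR b0 (powR_ge0 a (s - 1)) s0 q0 E.
rewrite -powRrM (_ : (s - 1) * (s / (s - 1)) = s); last first.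
  by field; rewrite ?gt_eqF//; lra.
have := mulr_powRB1 a0 s0.
set A := a `^ (s - 1); set As := a `^ s; set Bs := b `^ s => HA H.
have {H} : s * (b * A) <= s * (Bs / s + As / (s / (s - 1))).
  by rewrite ler_pM2l.
rewrite (_ : s * (Bs / s + As / (s / (s - 1))) = Bs + (s - 1) * As); last first.
  by field; rewrite ?gt_eqF//; lra.
rewrite -HA; nra.
Qed.

Lemma cost_tangent a b : cost a + dcost a * (b - a) <= cost b.
Proof.
apply: le_trans (powR_tangent p_gt1 (normr_ge0 a) (normr_ge0 b)).
rewrite lerD2l /dcost -!mulrA ler_pM2l// mulrCA [leRHS]mulrC mulrC.
have A0 := powR_ge0 `|a| (p - 1).
rewrite ler_wpM2l// mulrBr -normrEsg lerB//.
rewrite (le_trans (ler_norm _))// normrM.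
by rewrite normr_sg; case: eqP => _; rewrite ?mul0r ?mul1r// normr_ge0.
Qed.

Lemma dcostN t : dcost (- t) = - dcost t.
Proof. by rewrite /dcost normrN sgrN mulNr mulrN. Qed.

Lemma dcost_lt a b : a < b -> dcost a < dcost b.
Proof.
have s0 : 0 < p - 1 by move: p_gt1; lra.
have pos x y : 0 <= x -> x < y -> dcost x < dcost y.
  move=> x0 xy; rewrite /dcost ltr_pM2l//.
  have y0 : 0 < y by lra.
  rewrite (gtr0_sg y0) mul1r (gtr0_norm y0).
  move: x0; rewrite le_eqVlt => /predU1P[<-|x0].
    by rewrite sgr0 mul0r powR_gt0.
  rewrite (gtr0_sg x0) mul1r (gtr0_norm x0); apply: gt0_ltr_powR => //.
  - by rewrite nnegrE ltW.
  - by rewrite nnegrE ltW.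
move=> ab; have [a0|a0] := leP 0 a; first exact: pos.
have [b0|b0] := ltP 0 b.
  have d0 : dcost 0 = 0 by rewrite /dcost sgr0 mul0r mulr0.
  have := pos _ _ (lexx 0) b0; rewrite d0; apply: lt_trans.
  by rewrite -[a]opprK dcostN oppr_lt0 -d0; apply: pos => //; lra.
rewrite -[a]opprK -[b]opprK !(dcostN (- _)) ltrN2; apply: pos; lra.
Qed.

Lemma dcost_le a b : a <= b -> dcost a <= dcost b.
Proof. by rewrite le_eqVlt => /predU1P[->//|/dcost_lt/ltW]. Qed.

Lemma cost_tangent_lt a b : a != b -> cost a + dcost a * (b - a) < cost b.
Proof.
move=> ab; pose m := (a + b) / 2.
have H1 := cost_tangent m b; have H2 := cost_tangent a m.
apply: lt_le_trans H1.
suff : dcost a * (b - a) < dcost a * (m - a) + dcost m * (b - m) by move: H2; lra.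
rewrite -subr_gt0 (_ : _ - _ = (dcost m - dcost a) * (b - a) / 2); last first.
  by rewrite /m; field.
rewrite divr_gt0//; move/eqP : ab => ab.
have [lt|lt|//] := ltgtP a b.
  by rewrite mulr_gt0// subr_gt0//; apply: dcost_lt; rewrite /m; lra.
by rewrite nmulr_rgt0 subr_lt0//; apply: dcost_lt; rewrite /m; lra.
Qed.

(** Strict convexity forbids crossings between pairs that cannot be improved by
    swapping. *)
Lemma cost_swap_lt x1 x2 y1 y2 : x1 < x2 -> y2 < y1 ->
  cost (x1 - y2) + cost (x2 - y1) < cost (x1 - y1) + cost (x2 - y2).
Proof.
move=> x12 y21.
have [BC|CB] := leP (x1 - y2) (x2 - y1).
  have H1 : cost (x2 - y1) + dcost (x2 - y1) * (y1 - y2) < cost (x2 - y2).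
    have := @cost_tangent_lt (x2 - y1) (x2 - y2).
    rewrite (_ : x2 - y2 - (x2 - y1) = y1 - y2); last by ring.
    by apply; apply/eqP; move: y21; lra.
  have := cost_tangent (x1 - y2) (x1 - y1).
  rewrite (_ : x1 - y1 - (x1 - y2) = - (y1 - y2)); last by ring.
  have := dcost_le BC; nra.
have H1 : cost (x1 - y2) + dcost (x1 - y2) * (x2 - x1) < cost (x2 - y2).
  have := @cost_tangent_lt (x1 - y2) (x2 - y2).
  rewrite (_ : x2 - y2 - (x1 - y2) = x2 - x1); last by ring.
  by apply; apply/eqP; move: x12; lra.
have := cost_tangent (x2 - y1) (x1 - y1).
rewrite (_ : x1 - y1 - (x2 - y1) = - (x2 - x1)); last by ring.
have := dcost_le (ltW CB); nra.
Qed.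

Lemma dcost_bound r t : `|t| <= 2 * r -> `|dcost t| <= p * (2 * r) `^ (p - 1).
Proof.
move=> tr; rewrite /dcost normrM (gtr0_norm p_gt0) ler_pM2l// normrM.
rewrite norm_powR// normr_id normr_sg.
have H : `|t| `^ (p - 1) <= (2 * r) `^ (p - 1).
  apply: ge0_ler_powR => //; rewrite ?nnegrE//; first by move: p_gt1; lra.
  exact: le_trans tr.
case: eqP => _; first by rewrite mul0r powR_ge0.
by rewrite mul1r.
Qed.

Lemma cost_lipschitz r a b : `|a| <= 2 * r -> `|b| <= 2 * r ->
  `|cost a - cost b| <= p * (2 * r) `^ (p - 1) * `|a - b|.
Proof.
move=> ar br; wlog le : a b ar br / cost b <= cost a.
  move=> W; have [|/ltW] := leP (cost b) (cost a); first exact: W.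
  by move=> ab; have := W b a br ar ab; rewrite (distrC b a) (distrC (cost b)).
rewrite ger0_norm ?subr_ge0//.
have := cost_tangent a b => H.
have D := dcost_bound ar.
apply: (@le_trans _ _ (`|dcost a| * `|a - b|)); last by rewrite ler_wpM2r.
rewrite -normrM (le_trans _ (ler_norm _))//; lra.
Qed.

(** Continuity of the derivative, in the form of an affine modulus: this holds
    with no smoothness beyond that of [x `^ (p - 1)], also for [p < 2]. *)
Lemma powR_modulus (s M e : R) : 0 < s -> 0 <= M -> 0 < e ->
  exists2 C, 0 <= C & forall a b, 0 <= a -> a <= b -> b <= M ->
    b `^ s - a `^ s <= e + C * (b - a).
Proof.
move=> s0 M0 e0; pose h := e `^ s^-1.
have h0 : 0 < h by exact: powR_gt0.
have hs : h `^ s = e by rewrite /h -powRrM mulVf ?gt_eqF// powRr1// ltW.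
have C0 : 0 <= (1 + s) * M `^ s / h.
  by rewrite divr_ge0 ?mulr_ge0 ?powR_ge0//; lra.
exists ((1 + s) * M `^ s / h) => // a b a0 ab bM.
have b0 : 0 <= b by lra.
have [bh|hb] := leP b h.
  have : b `^ s <= h `^ s by apply: ge0_ler_powR; rewrite ?nnegrE//; lra.
  rewrite hs => H; have := powR_ge0 a s.
  have : 0 <= (1 + s) * M `^ s / h * (b - a) by rewrite mulr_ge0//; lra.
  lra.
have bp : 0 < b by lra.
pose t := a / b.
have t0 : 0 <= t by rewrite divr_ge0.
have t1 : t <= 1 by rewrite ler_pdivrMr// mul1r.
have aE : a = t * b by rewrite /t divfK// gt_eqF.
have key : 1 - t `^ s <= (1 + s) * (1 - t).
  have [s1|s1] := ltP 1 s.
    have := powR_tangent s1 ler01 t0; rewrite !powR1; nra.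
  move: t0; rewrite le_eqVlt => /predU1P[<-|t0].
    by rewrite powR0 ?gt_eqF//; lra.
  have := @ger1_powR _ t s; rewrite t0 t1 => /(_ isT s1); nra.
have bs : b `^ s <= M `^ s by apply: ge0_ler_powR; rewrite ?nnegrE//; lra.
apply: (@le_trans _ _ ((1 + s) * M `^ s / h * (b - a))); last by lra.
rewrite {1}aE powRM//.
have -> : b `^ s - t `^ s * b `^ s = b `^ s * (1 - t `^ s) by ring.
apply: (@le_trans _ _ (b `^ s * ((1 + s) * (1 - t)))).
  by rewrite ler_wpM2l// powR_ge0.
apply: (@le_trans _ _ (M `^ s * ((1 + s) * (1 - t)))).
  by rewrite ler_wpM2r// mulr_ge0//; lra.
have -> : b - a = (1 - t) * b by rewrite {1}aE; ring.
have -> : (1 + s) * M `^ s / h * ((1 - t) * b) =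
   M `^ s * ((1 + s) * (1 - t)) * (b / h) by ring.
rewrite ler_peMr//; first by rewrite !mulr_ge0 ?powR_ge0//; lra.
by rewrite ler_pdivlMr// mul1r ltW.
Qed.

Lemma dcost_modulus r e : 0 <= r -> 0 < e ->
  exists2 C, 0 <= C & forall a b, - r <= a -> a <= b -> b <= r ->
    dcost b - dcost a <= e + C * (b - a).
Proof.
move=> r0 e0; have s0 : 0 < p - 1 by move: p_gt1; lra.
have e1 : 0 < e / p / 2 by rewrite !divr_gt0.
have [C C0 HC] := powR_modulus s0 r0 e1.
exists (p * C); first by rewrite mulr_ge0// ltW.
have pe : p * (e / p / 2) = e / 2 by field; rewrite gt_eqF.
have dE x : 0 <= x -> dcost x = p * x `^ (p - 1).
  move=> x0; rewrite /dcost (ger0_norm x0); move: x0.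
  rewrite le_eqVlt => /predU1P[<-|x0]; first by rewrite powR0 ?mulr0// gt_eqF.
  by rewrite gtr0_sg// mul1r.
have pos a b : 0 <= a -> a <= b -> b <= r -> dcost b - dcost a <= e / 2 + p * C * (b - a).
  move=> a0 ab br; rewrite !dE//; last by lra.
  rewrite -mulrBr -pe -[p * C * _]mulrA -mulrDr ler_pM2l//; exact: HC.
move=> a b ra ab br; have [a0|a0] := leP 0 a.
  by have := pos _ _ a0 ab br; lra.
have [b0|b0] := leP b 0.
  have := pos (- b) (- a); rewrite !dcostN => H.
  have {}H := H ltac:(lra) ltac:(lra) ltac:(lra).
  by rewrite (_ : b - a = - a - - b); [lra|ring].
have d0 : dcost 0 = 0 by rewrite dE// powR0 ?mulr0// gt_eqF.
have H1 := pos 0 b (lexx 0) (ltW b0) br.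
have H2 := pos 0 (- a) (lexx 0) ltac:(lra) ltac:(lra).
move: H1 H2; rewrite dcostN d0; lra.
Qed.

End Cost.

(** An error that is bounded by the mesh times a monotone increment disappears
    under subdivision. *)
Lemma telescope_le (R : realType) (a b e : R) (Psi K : R -> R) :
  a < b ->
  (forall s t, a <= s -> s < t -> t <= b ->
     Psi t - Psi s <= (t - s) * (e + (K t - K s))) ->
  Psi b - Psi a <= (b - a) * e.
Proof.
move=> ab H; have ba : 0 < b - a by lra.
have main (N : nat) : Psi b - Psi a <= (b - a) * e + (b - a) * (K b - K a) / N.+1%:R.
  pose s (j : nat) := a + (b - a) * j%:R / N.+1%:R.
  have N0 : 0 < N.+1%:R :> R by rewrite ltr0n.
  have s0 : s 0%N = a by rewrite /s mulr0 mul0r addr0.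
  have sN : s N.+1 = b by rewrite /s mulfK ?gt_eqF//; ring.
  have ds j : s j.+1 - s j = (b - a) / N.+1%:R by rewrite /s -natr1; ring.
  have d0 : 0 < (b - a) / N.+1%:R by rewrite divr_gt0.
  have smono i j : (i <= j)%N -> s i <= s j.
    by move=> ij; rewrite /s lerD2l ler_pM2r ?invr_gt0// ler_pM2l// ler_nat.
  have step j : (j <= N.+1)%N ->
      Psi (s j) - Psi a <= (b - a) / N.+1%:R * (j%:R * e + (K (s j) - K a)).
    elim: j => [_|j IH jN]; first by rewrite s0 !subrr mul0r addr0 mulr0.
    have h1 : Psi (s j.+1) - Psi (s j) <=
        (b - a) / N.+1%:R * (e + (K (s j.+1) - K (s j))).
      rewrite -(ds j); apply: H; [by rewrite -s0 smono|by rewrite -subr_gt0 ds|].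
      by rewrite -sN smono.
    have := IH (ltnW jN); move: h1; set D := (b - a) / _.
    rewrite -[in j.+1%:R]natr1; nra.
  have := step N.+1 (leqnn _); rewrite sN => /le_trans; apply.
  rewrite le_eqVlt; apply/orP; left; apply/eqP; field.
  by rewrite gt_eqF// ltr_pwDr.
apply/ler_addgt0Pr => d d0.
have [K0|K0] := leP ((b - a) * (K b - K a)) 0.
  apply: le_trans (main 0%N) _; rewrite divr1; lra.
have [N NP] : exists N : nat, (b - a) * (K b - K a) / d < N.+1%:R.
  exists (Num.truncn ((b - a) * (K b - K a) / d)).
  exact: truncnS_gt.
apply: le_trans (main N) _; rewrite lerD2l.
by move: NP; rewrite ltr_pdivrMr// [ltRHS]mulrC ler_pdivrMr ?ltr0n// => /ltW.
Qed.

(** * The dual class and the c-transform *)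

Section Clamp.
Context (R : realType) (r : R) (r_ge0 : 0 <= r).

Definition clamp (x : R) : R := Num.max (- r) (Num.min r x).

Lemma clamp_itv x : clamp x \in `[- r, r].
Proof.
rewrite in_itv/= /clamp le_max lexx/= ge_max ge_min lexx/= andbT.
by move: r_ge0; lra.
Qed.

Lemma clamp_id x : x \in `[- r, r] -> clamp x = x.
Proof.
rewrite in_itv/= => /andP[h1 h2].
by rewrite /clamp (min_idPr h2) (max_idPr h1).
Qed.

Lemma clampP x : [\/ x < - r /\ clamp x = - r, - r <= x <= r /\ clamp x = x |
  r < x /\ clamp x = r].
Proof.
rewrite /clamp; have [rx|xr] := ltP r x.
  by apply: Or33; split=> //; apply/max_idPr; move: r_ge0; lra.
have [xr'|rx'] := ltP x (- r).
  by apply: Or31; split=> //; apply/max_idPl; lra.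
by apply: Or32; split.
Qed.

Lemma clamp_lip x y : `|clamp x - clamp y| <= `|x - y|.
Proof.
rewrite ler_norml; have := ler_norm (x - y).
have := ler_norm (y - x); rewrite (distrC y) => H1 H2.
have [[? ->]|[? ->]|[? ->]] := clampP x;
  have [[? ->]|[? ->]|[? ->]] := clampP y; move: r_ge0; lra.
Qed.

Lemma normr_itv x : (x \in `[- r, r]) = (`|x| <= r).
Proof. by rewrite in_itv/= ler_norml. Qed.

End Clamp.

Lemma lip_measurable (R : realType) (f : R -> R) L :
  (forall x y, `|f x - f y| <= L * `|x - y|) -> measurable_fun setT f.
Proof.
move=> H; apply: continuous_measurable_fun => x; apply/cvgrPdist_le => e e0.
have L1 : 0 < `|L| + 1 by rewrite ltr_wpDl.
near=> y; apply: (le_trans (H x y)).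
apply: (@le_trans _ _ ((`|L| + 1) * `|x - y|)).
  by rewrite ler_wpM2r// (le_trans (ler_norm _))// lerDl.
rewrite mulrC -ler_pdivlMr//; near: y.
by apply: cvgr_dist_le => //; rewrite divr_gt0.
Unshelve. all: by end_near. Qed.

Section ClassC.
Context (R : realType) (p r : R) (p_gt1 : 1 < p) (r_gt0 : 0 < r).
Implicit Types f g : R -> R.

Definition lipC : R := p * (2 * r) `^ (p - 1).
(** A common bound of the functions of the dual class and their transforms. *)
Definition bndC : R := (2 * r) `^ p + lipC * r.

Let r_ge0 : 0 <= r. Proof. exact: ltW. Qed.
Ltac plra := move: p_gt1 r_gt0; lra.

Lemma lipC_gt0 : 0 < lipC.
Proof. by rewrite /lipC mulr_gt0 ?powR_gt0//; plra. Qed.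

Lemma bndC_gt0 : 0 < bndC.
Proof.
by rewrite /bndC addr_gt0//; [apply: powR_gt0; plra|apply: mulr_gt0 => //; exact: lipC_gt0].
Qed.

Lemma itv_dist x y : x \in `[- r, r] -> y \in `[- r, r] -> `|x - y| <= 2 * r.
Proof. by rewrite !in_itv/= => /andP[? ?] /andP[? ?]; rewrite ler_norml; lra. Qed.

Lemma itv0 : (0 : R) \in `[- r, r].
Proof. by rewrite in_itv/=; plra. Qed.

Lemma classC0 : class_C p r (fun=> 0 : R).
Proof.
by split => // x y _ _; rewrite subrr normr0 mulr_ge0// ltW// lipC_gt0.
Qed.

Lemma classC_bound f x : class_C p r f -> x \in `[- r, r] -> `|f x| <= lipC * r.
Proof.
move=> [f0 fL] xr; have := fL x 0 xr itv0; rewrite f0 !subr0 => /le_trans; apply.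
by rewrite -/lipC ler_wpM2l -?normr_itv// ltW// lipC_gt0.
Qed.

Let ct_set f y := [set `|x - y| `^ p - f x | x in `[- r, r]].

Let ct_has_inf f y : class_C p r f -> has_inf (ct_set f y).
Proof.
move=> fC; split.
  by exists (`|0 - y| `^ p - f 0), 0 => //=; exact: itv0.
exists (- (lipC * r)) => _ [x xr <-].
have := classC_bound fC xr; have := powR_ge0 `|x - y| p.
by rewrite ler_norml => ? /andP[? ?]; lra.
Qed.

Lemma ct_le f x y : class_C p r f -> x \in `[- r, r] ->
  ctransform p r f y <= cost p (x - y) - f x.
Proof.
move=> fC xr; apply: ge_inf; last by exists x.
by have [] := ct_has_inf y fC.
Qed.

Lemma ct_ge f y c : class_C p r f ->
  (forall x, x \in `[- r, r] -> c <= cost p (x - y) - f x) ->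
  c <= ctransform p r f y.
Proof.
move=> fC H; apply: lb_le_inf; first by have [] := ct_has_inf y fC.
by move=> _ [x xr <-]; exact: H.
Qed.

Lemma ct_dist f g y e : class_C p r f -> class_C p r g ->
  (forall x, x \in `[- r, r] -> `|f x - g x| <= e) ->
  `|ctransform p r f y - ctransform p r g y| <= e.
Proof.
move=> fC gC H; rewrite ler_norml; apply/andP; split.
  suff : ctransform p r g y - e <= ctransform p r f y by lra.
  apply: ct_ge => // x xr; have := ct_le y gC xr.
  by have := H x xr; rewrite ler_norml => /andP[]; lra.
suff : ctransform p r f y - e <= ctransform p r g y by lra.
apply: ct_ge => // x xr; have := ct_le y fC xr.
by have := H x xr; rewrite ler_norml => /andP[]; lra.
Qed.

(** A lower envelope of costs inherits their Lipschitz constant. *)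
Lemma ct_lip f y y' : class_C p r f -> y \in `[- r, r] -> y' \in `[- r, r] ->
  `|ctransform p r f y - ctransform p r f y'| <= lipC * `|y - y'|.
Proof.
move=> fC; wlog suff : y y' /
    y \in `[- r, r] -> y' \in `[- r, r] ->
    ctransform p r f y - ctransform p r f y' <= lipC * `|y - y'|.
  move=> W yr y'r; rewrite ler_norml; apply/andP; split; last exact: W.
  by rewrite lerNl opprB distrC; exact: W.
move=> yr y'r.
suff : ctransform p r f y - lipC * `|y - y'| <= ctransform p r f y' by lra.
apply: ct_ge => // x xr; have := ct_le y fC xr.
have := cost_lipschitz p_gt1 (itv_dist xr yr) (itv_dist xr y'r).
rewrite -/lipC (_ : x - y - (x - y') = - (y - y')); last by ring.
by rewrite normrN ler_norml => /andP[]; lra.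
Qed.

Lemma ct_bound f y : class_C p r f -> y \in `[- r, r] ->
  `|ctransform p r f y| <= bndC.
Proof.
move=> fC yr; rewrite ler_norml; apply/andP; split.
  apply: ct_ge => // x xr; have := classC_bound fC xr.
  rewrite ler_norml => /andP[_ ?]; have := cost_ge0 p (x - y).
  by have := powR_ge0 (2 * r) p; rewrite /bndC; lra.
have := ct_le y fC itv0; have [-> _] := fC.
have : cost p (0 - y) <= (2 * r) `^ p.
  apply: ge0_ler_powR; rewrite ?nnegrE//; [plra|plra|exact: itv_dist itv0 yr].
have : 0 <= lipC * r by rewrite mulr_ge0// ltW// lipC_gt0.
rewrite /bndC; lra.
Qed.

(** Total, globally Lipschitz versions: these do not depend on the values
    outside [[-r, r]]. *)
Definition fbar f x := f (clamp r x).
Definition cbar f y := ctransform p r f (clamp r y).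

Lemma fbar_lip f x y : class_C p r f -> `|fbar f x - fbar f y| <= lipC * `|x - y|.
Proof.
move=> [_ fL]; apply: (le_trans (fL _ _ (clamp_itv _ _) (clamp_itv _ _))) => //.
by rewrite ler_wpM2l ?clamp_lip// ltW// lipC_gt0.
Qed.

Lemma cbar_lip f x y : class_C p r f -> `|cbar f x - cbar f y| <= lipC * `|x - y|.
Proof.
move=> fC; apply: (le_trans (ct_lip fC (clamp_itv _ _) (clamp_itv _ _))) => //.
by rewrite ler_wpM2l ?clamp_lip// ltW// lipC_gt0.
Qed.

Lemma fbar_bound f x : class_C p r f -> `|fbar f x| <= bndC.
Proof.
move=> fC; apply: (le_trans (classC_bound fC (clamp_itv _ _))) => //.
by rewrite /bndC lerDr powR_ge0.
Qed.

Lemma cbar_bound f x : class_C p r f -> `|cbar f x| <= bndC.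
Proof. by move=> fC; exact: (ct_bound fC (clamp_itv _ _)). Qed.

Lemma fbar_bmf f : class_C p r f -> bmf (fbar f).
Proof.
move=> fC; split; last by exists bndC => x; exact: fbar_bound.
by apply: lip_measurable => x y; exact: fbar_lip.
Qed.

Lemma cbar_bmf f : class_C p r f -> bmf (cbar f).
Proof.
move=> fC; split; last by exists bndC => x; exact: cbar_bound.
by apply: lip_measurable => x y; exact: cbar_lip.
Qed.

Lemma fbar_cbar_le f x y : class_C p r f -> x \in `[- r, r] -> y \in `[- r, r] ->
  fbar f x + cbar f y <= cost p (x - y).
Proof.
move=> fC xr yr; rewrite /fbar /cbar !clamp_id//.
by have := ct_le y fC xr; lra.
Qed.

Lemma cost_measurable : measurable_fun setT (cost p).
Proof.
apply: (@measurableT_comp _ _ _ _ _ _ (fun x : R => x `^ p) _ (fun x : R => `|x|)).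
  exact: measurable_powR.
exact: normr_measurable.
Qed.

(** Both laws live on the segment, where truncating the variable changes nothing. *)
Lemma dual_valueE (mu nu : probability R R) f : class_C p r f ->
  mu `[- r, r]%classic = 1%E -> nu `[- r, r]%classic = 1%E ->
  dual_value p r mu nu f = (\int[mu]_x fbar f x + \int[nu]_y cbar f y)%:E.
Proof.
move=> fC mu1 nu1; rewrite /dual_value EFinD.
have aux (m : probability R R) (g h : R -> R) : m `[- r, r]%classic = 1%E -> bmf g ->
    (forall x, x \in `[- r, r] -> h x = g x) ->
    (\int[m]_(x in `[(- r)%R, r]) (h x)%:E = (\int[m]_x g x)%:E)%E.
  move=> m1 bg hg; rewrite -EFin_expect//.
  rewrite (eq_integral (fun x => (g x)%:E)); last first.
    by move=> x; rewrite inE/= => xr; rewrite hg.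
  have mI : measurable (`[- r, r]%classic : set R) by exact: measurable_itv.
  rewrite (@negligible_integral _ _ _ m setT (~` `[- r, r]) _ _ measurableT)//.
  - by rewrite setTD setCK.
  - exact: measurableC.
  - exact: (bmf_integrable m bg).
  - by rewrite probC// m1 subee.
congr (_ + _)%E; apply: aux => //.
- exact: fbar_bmf.
- by move=> x xr; rewrite /fbar clamp_id.
- exact: cbar_bmf.
- by move=> x xr; rewrite /cbar clamp_id.
Qed.

(** Truncating both variables makes the cost bounded, hence integrable against
    every coupling. *)
Definition ccost (z : R * R) := cost p (clamp r z.1 - clamp r z.2).

Lemma ccost_bmf : bmf ccost.
Proof.
have mc : measurable_fun setT (clamp r).
  by apply: (@lip_measurable _ _ 1) => x y; rewrite mul1r; exact: clamp_lip.
split.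
  apply: (@measurableT_comp _ _ _ _ _ _ (cost p) _
    (fun z : R * R => clamp r z.1 - clamp r z.2)).
    exact: cost_measurable.
  apply: measurable_funB; first exact: (measurableT_comp mc measurable_fst).
  exact: (measurableT_comp mc measurable_snd).
exists ((2 * r) `^ p) => z; rewrite ger0_norm ?cost_ge0//.
apply: ge0_ler_powR; rewrite ?nnegrE//; [plra|plra|].
by apply: itv_dist; exact: clamp_itv.
Qed.

Lemma coupling_itv (mu nu : probability R R) (pi : probability (R * R)%type R) :
  mu `[- r, r]%classic = 1%E -> nu `[- r, r]%classic = 1%E ->
  coupling mu nu pi ->
  (pi : {measure set _ -> \bar R})
    (~` (fst @^-1` `[- r, r] `&` snd @^-1` `[- r, r])) = 0%E.
Proof.
move=> mu1 nu1 [pi1 pi2].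
have mI : measurable (`[- r, r]%classic : set R) by exact: measurable_itv.
rewrite setCI; apply: null_set_setU.
- by apply: measurableC; rewrite -[X in measurable X]setTI; exact: measurable_fst.
- by apply: measurableC; rewrite -[X in measurable X]setTI; exact: measurable_snd.
- apply: etrans (pi1 _ (measurableC mI)) _.
  by rewrite probC// mu1 subee.
- apply: etrans (pi2 _ (measurableC mI)) _.
  by rewrite probC// nu1 subee.
Qed.

Lemma coupling_cost (mu nu : probability R R) (pi : probability (R * R)%type R) :
  mu `[- r, r]%classic = 1%E -> nu `[- r, r]%classic = 1%E ->
  coupling mu nu pi ->
  (\int[pi]_z (`|z.1 - z.2| `^ p)%:E)%E = (\int[pi]_z ccost z)%:E.
Proof.
move=> mu1 nu1 cpl; rewrite -EFin_expect; last exact: ccost_bmf.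
have mI : measurable (`[- r, r]%classic : set R) by exact: measurable_itv.
apply: ae_eq_integral => //.
- apply/measurable_EFinP.
  apply: (@measurableT_comp _ _ _ _ _ _ (cost p) _ (fun z : R * R => z.1 - z.2)).
    exact: cost_measurable.
  exact: measurable_funB.
- by apply/measurable_EFinP; case: ccost_bmf.
exists (~` (fst @^-1` `[- r, r] `&` snd @^-1` `[- r, r])); split.
- apply: measurableC; apply: measurableI; rewrite -[X in measurable X]setTI.
    exact: measurable_fst.
  exact: measurable_snd.
- exact: coupling_itv cpl.
move=> z /= h [z1 z2]; apply: h => _.
by rewrite /ccost !clamp_id.
Qed.

(** The inequality [f x + f^c y <= |x - y|^p], integrated along a coupling, which
    lives on the square of the segment. *)
Lemma weak_duality (mu nu : probability R R) (pi : probability (R * R)%type R) f :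
  class_C p r f -> mu `[- r, r]%classic = 1%E -> nu `[- r, r]%classic = 1%E ->
  coupling mu nu pi ->
  \int[mu]_x fbar f x + \int[nu]_y cbar f y <= \int[pi]_z ccost z.
Proof.
move=> fC mu1 nu1 [pi1 pi2].
rewrite (expect_has_law measurable_fst pi1 (fbar_bmf fC)).
rewrite (expect_has_law measurable_snd pi2 (cbar_bmf fC)).
have b1 := bmf_comp (fbar_bmf fC) (@measurable_fst _ _ R R).
have b2 := bmf_comp (cbar_bmf fC) (@measurable_snd _ _ R R).
rewrite -expectD//; apply: expect_le; [exact: bmfD|exact: ccost_bmf|].
move=> z; have := ct_le (clamp r z.2) fC (clamp_itv r_ge0 z.1).
by rewrite /ccost /fbar /cbar; lra.
Qed.

Lemma Wpp_ge_dual (mu nu : probability R R) f :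
  class_C p r f -> mu `[- r, r]%classic = 1%E -> nu `[- r, r]%classic = 1%E ->
  ((\int[mu]_x fbar f x + \int[nu]_y cbar f y)%:E <= Wpp p mu nu)%E.
Proof.
move=> fC mu1 nu1; apply: le_ereal_inf_tmp => _ [pi /= cpl <-].
by rewrite (coupling_cost mu1 nu1 cpl) lee_fin; exact: weak_duality.
Qed.

Lemma Wpp_le_coupling (mu nu : probability R R) (pi : probability (R * R)%type R) :
  mu `[- r, r]%classic = 1%E -> nu `[- r, r]%classic = 1%E ->
  coupling mu nu pi -> (Wpp p mu nu <= (\int[pi]_z ccost z)%:E)%E.
Proof.
move=> mu1 nu1 cpl; rewrite -(coupling_cost mu1 nu1 cpl).
by apply: ereal_inf_lbound; exists pi.
Qed.

End ClassC.

(** * Quantile functions *)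

(** Half-lines generate the Borel sets and are stable under intersections. *)
Lemma finite_measure_unique (R : realType) (mu nu : {measure set R -> \bar R}) :
  (mu setT < +oo)%E ->
  (forall x, mu `]x, +oo[%classic = nu `]x, +oo[%classic) ->
  forall A, measurable A -> mu A = nu A.
Proof.
move=> mu_fin H; apply: (measure_unique (@RGenOInfty.G R) (fun k => `]- k%:R, +oo[%classic)).
- exact: RGenOInfty.measurableE.
- move=> _ _ [x ->] [y ->]; exists (Num.max x y); apply/seteqP; split => z /=;
    rewrite !in_itv/= !andbT gt_max; first by case=> -> ->.
  by move=> /andP[].
- by move=> i; eexists.
- apply/seteqP; split => // x _; exists (Num.truncn `|x|).+1 => //=.
  rewrite in_itv/= andbT ltrNl.
  by rewrite (le_lt_trans _ (truncnS_gt _))// -normrN ler_norm.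
- by move=> _ [x ->].
- move=> k; apply: (le_lt_trans _ mu_fin); apply: le_measure; rewrite ?inE//.
Qed.

Lemma probability_cdf_unique (R : realType) (P Q : probability R R) :
  (forall x, P `]-oo, x]%classic = Q `]-oo, x]%classic) ->
  forall A, measurable A -> P A = Q A.
Proof.
move=> PQ; apply: finite_measure_unique => [|x]; first by rewrite probT ltry.
rewrite -setCitvl (probC P (measurable_itv `]-oo, x])) (probC Q (measurable_itv `]-oo, x])).
by rewrite PQ.
Qed.

Section Unif.
Context (R : realType).

(** The identity, as a map between the two presentations of the Borel sets of
    the line. *)
Lemma measurable_idR :
  @measurable_fun _ _ (measurableTypeR R) R setT idfun.
Proof. by move=> _ A mA; rewrite setTI. Qed.

Definition unif : probability R R :=
  law [the probability (measurableTypeR R) R of uniform_prob (@ltr01 R)]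
    measurable_idR.

Lemma unifE (A : set R) : measurable A ->
  unif A = lebesgue_measure (A `&` `[0, 1]%classic).
Proof.
move=> mA; have mI : measurable (`[0, 1]%classic : set R) by exact: measurable_itv.
have := @integral_uniform R 0 1 ltr01 (EFin \o \1_A).
rewrite integral_indic// setIT subr0 invr1 mul1e integral_indic//.
by apply => [|x]; [exact/measurable_EFinP/measurable_indic|rewrite lee_fin].
Qed.

Lemma unif_oo : unif `]0, 1[%classic = 1%E.
Proof.
rewrite unifE; last exact: measurable_itv.
rewrite setIidl; last exact: subset_itv_oo_cc.
by rewrite lebesgue_measure_itv/= lte_fin ltr01 oppr0 adde0.
Qed.

Lemma unif_le (c : R) : 0 <= c <= 1 -> unif `]-oo, c]%classic = c%:E.
Proof.
move=> /andP[c0 c1]; rewrite unifE; last exact: measurable_itv.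
rewrite (_ : _ `&` _ = `[0, c]%classic); last first.
  apply/seteqP; split => x /=; rewrite !in_itv/=; first by case=> -> /andP[->].
  by move=> /andP[-> xc]; rewrite xc (le_trans xc).
rewrite lebesgue_measure_itv/= lte_fin; case: ltP => c0'; last first.
  by congr EFin; apply/eqP; rewrite eq_le c0.
by rewrite oppr0 adde0.
Qed.

Lemma unif_setI (A : set R) : measurable A -> unif A = unif (A `&` `]0, 1[%classic).
Proof.
move=> mA; have mI : measurable (`]0, 1[%classic : set R) by exact: measurable_itv.
rewrite -[in LHS](setIT A) -(setUv `]0, 1[%classic) setIUr measureU//; last 3 first.
- exact: measurableI.
- by apply: measurableI => //; exact: measurableC.
- by rewrite -setIIr setICr setI0.
rewrite [X in (_ + X)%E](_ : _ = 0%E) ?adde0//.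
apply/eqP; rewrite -measure_le0.
have /le_trans : (unif (A `&` ~` `]0%R, 1%R[%classic) <= unif (~` `]0%R, 1%R[%classic))%E.
  by apply: le_measure; rewrite ?inE//; [apply: measurableI|]; rewrite //; exact: measurableC.
by apply; rewrite probC// unif_oo subee.
Qed.

End Unif.

Section Quantile.
Context (R : realType) (mu : probability R R).

Let F (x : R) : R := fine (mu `]-oo, x]%classic).

Let FE x : mu `]-oo, x]%classic = (F x)%:E.
Proof. by rewrite prob_fine//; exact: measurable_itv. Qed.

Let F_le x y : x <= y -> F x <= F y.
Proof.
move=> xy; rewrite -lee_fin -!FE; apply: le_measure; rewrite ?inE.
- exact: measurable_itv.
- exact: measurable_itv.
- by apply: subset_itvl; rewrite bnd_simp.
Qed.

Let F01 x : 0 <= F x <= 1.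
Proof.
rewrite fine_ge0 ?measure_ge0//= -lee_fin -FE.
by apply: probability_le1; exact: measurable_itv.
Qed.

Let idm : {mfun R >-> R} :=
  HB.pack (@idfun R) (@isMeasurableFun.Build _ _ _ _ (@idfun R) (@measurable_id _ R setT)).

Let cdfE x : cdf (idm : {RV mu >-> R}) x = (F x)%:E.
Proof. by rewrite -FE. Qed.

Definition quantile (t : R) : R :=
  if 0 < t < 1 then inf [set x | (t%:E <= mu `]-oo, x]%classic)%E] else 0.

(** The Galois connection between quantile and distribution functions: the law
    and the monotonicity of the quantile function are read off from it. *)
Lemma quantile_le (t x : R) : 0 < t < 1 ->
  (quantile t <= x) = (t%:E <= mu `]-oo, x]%classic)%E.
Proof.
move=> t01; rewrite /quantile t01; have /andP[t0 t1] := t01.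
set S := [set x | _].
have SE y : S y = (t <= F y) :> Prop by rewrite /S /= FE lee_fin.
have [a Sa] : S !=set0.
  have := @cvg_cdfy1 _ _ _ mu (idm : {RV mu >-> R}).
  move=> /fine_cvgP[_] /cvgr_ge /(_ t t1) [M [_ HM]].
  by exists (M + 1); rewrite SE; have /= := HM (M + 1); rewrite cdfE; apply; lra.
have [b Sb] : has_lbound S.
  have := @cvg_cdfNy0 _ _ _ mu (idm : {RV mu >-> R}).
  move=> /fine_cvgP[_] /cvgr_lt /(_ t t0) [M [_ HM]].
  have {}HM : F (M - 1) < t by have /= := HM (M - 1); rewrite cdfE; apply; lra.
  exists (M - 1) => y; rewrite SE => ty; rewrite leNgt; apply/negP => yM.
  by have := F_le (ltW yM); lra.
rewrite FE lee_fin; apply/idP/idP => [H|H]; last first.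
  by apply: ge_inf; [exists b|rewrite SE].
rewrite -lee_fin -cdfE.
have := @cdf_right_continuous _ _ _ mu (idm : {RV mu >-> R}) x.
apply: cvge_ge; near=> y; rewrite cdfE lee_fin.
have xy : x < y by near: y; exact: nbhs_right_gt.
have [s Ss sy] : exists2 s, S s & s < y.
  by apply: inf_lt; [exists a|exact: le_lt_trans xy].
by move: Ss; rewrite SE => /le_trans; apply; exact/F_le/ltW.
Unshelve. all: by end_near. Qed.

Lemma quantile_nd (s t : R) : 0 < s -> s <= t -> t < 1 -> quantile s <= quantile t.
Proof.
move=> s0 st t1; have t01 : 0 < t < 1 by lra.
rewrite quantile_le; last by lra.
by rewrite (@le_trans _ _ t%:E) ?lee_fin// -quantile_le.
Qed.

Lemma measurable_quantile : measurable_fun setT quantile.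
Proof.
pose q t := if 0 < t < 1 then quantile t else 0.
have -> : quantile = q.
  by apply/funext => t; rewrite /q /quantile; case: ifP.
apply: (measurability (@RGenOInfty.G R)); first exact: RGenOInfty.measurableE.
move=> _ /= [_ [x ->] <-]; rewrite setTI.
have [c cE] : exists c : R, mu `]-oo, x]%classic = c%:E by exists (F x).
have -> : q @^-1` `]x, +oo[ =
    (`]0, 1[%classic `&` `]c, +oo[%classic) `|`
    (~` `]0, 1[%classic `&` (if x < 0 then setT else set0)).
  apply/seteqP; split => t /=; rewrite !in_itv/= !andbT /q.
    case: ifPn => [t01|t01].
      by rewrite ltNge quantile_le// cE lee_fin -ltNge => ?; left.
    by move=> ->; right; split => //; exact/negP.
  move=> [[t01 ct]|[/negP/negbTE ->]]; last by case: ifP.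
  by rewrite t01 ltNge quantile_le// cE lee_fin -ltNge.
apply: measurableU; apply: measurableI; try exact: measurable_itv.
  by apply: measurableC; exact: measurable_itv.
by case: ifP => _; [exact: measurableT|exact: measurable0].
Qed.

Lemma quantile_law : has_law (unif R) quantile mu.
Proof.
suff H A : measurable A -> law (unif R) measurable_quantile A = mu A.
  by move=> A mA; exact: H.
apply: probability_cdf_unique => x; rewrite lawE unif_setI; last first.
  by rewrite -[X in measurable X]setTI; apply: measurable_quantile.
have -> : quantile @^-1` `]-oo, x] `&` `]0, 1[%classic =
    `]-oo, F x]%classic `&` `]0, 1[%classic.
  apply/seteqP; split => t /=; rewrite !in_itv/= => -[h t01]; split=> //.
    by move: h; rewrite quantile_le// FE lee_fin.
  by rewrite quantile_le// FE lee_fin.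
by rewrite -unif_setI ?unif_le ?F01 ?FE//; exact: measurable_itv.
Qed.

Lemma quantile_itv (r t : R) : mu `[- r, r]%classic = 1%E -> 0 < t < 1 ->
  quantile t \in `[- r, r].
Proof.
move=> mu1 t01; have /andP[t0 t1] := t01; rewrite in_itv/=; apply/andP; split.
  rewrite leNgt; apply/negP => qr.
  have : (t%:E <= mu `]-oo, quantile t]%classic)%E by rewrite -quantile_le.
  apply/negP; rewrite -ltNge (@le_lt_trans _ _ 0%E)//.
  have /le_trans : (mu `]-oo, quantile t]%classic <= mu (~` `[(- r)%R, r]%classic))%E.
    apply: le_measure; rewrite ?inE; [exact: measurable_itv| |].
      by apply: measurableC; exact: measurable_itv.
    by move=> x /=; rewrite !in_itv/= => xq /andP[]; lra.
  apply; rewrite probC; first by rewrite mu1 subee.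
  exact: measurable_itv.
rewrite quantile_le// (@le_trans _ _ 1%E)//; first by rewrite lee_fin ltW.
rewrite -mu1; apply: le_measure; rewrite ?inE; try exact: measurable_itv.
by move=> x /=; rewrite !in_itv/= => /andP[].
Qed.

End Quantile.

(** * Duality on a segment of the line *)

(** Two-sided bounds on increments are all that is needed of a primitive, and
    these hold without any continuity of [g]. *)
Lemma primitive_exists (R : realType) (r L : R) (g : R -> R) : 0 < r ->
  measurable_fun setT g -> (forall s, s \in `[- r, r] -> `|g s| <= L) ->
  exists f : R -> R, f 0 = 0 /\
    forall a b A B, - r <= a -> a <= b -> b <= r ->
      (forall s, a < s -> s <= b -> A <= g s <= B) ->
      A * (b - a) <= f b - f a <= B * (b - a).
Proof.
move=> r0 mg gL; pose mu := @lebesgue_measure R.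
have mg' : @measurable_fun _ _ (measurableTypeR R) R setT g.
  by move=> _ A mA; exact: mg.
have fin (i : interval R) : [set` i] `<=` `[- r, r]%classic ->
    (mu [set` i] < +oo)%E.
  move=> ir; have mi : measurable [set` i] by exact: measurable_itv.
  have mr : measurable (`[- r, r]%classic : set R) by exact: measurable_itv.
  apply: (@le_lt_trans _ _ (mu `[(- r)%R, r]%classic)).
    by apply: le_measure; rewrite ?inE.
  by rewrite /mu lebesgue_measure_itv/= lte_fin; case: ifP => _; rewrite -?EFinB ltry.
have intg (i : interval R) : [set` i] `<=` `[- r, r]%classic ->
    mu.-integrable [set` i] (EFin \o g).
  move=> ir; apply: measurable_bounded_integrable; first exact: measurable_itv.
  - exact: fin.
  - exact: measurable_funTS.
  - exists L; split; first exact: num_real.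
    by move=> x Lx y /= yi; rewrite (le_trans (gL _ (ir _ yi)))// ltW.
pose I x := \int[mu]_(t in [set` Interval (BLeft (- r)) (BRight x)]) g t.
exists (fun x => I x - I 0); split; first by rewrite subrr.
move=> a b A B ra ab br AB.
have -> : I b - I 0 - (I a - I 0) = I b - I a by ring.
have sub : `]a, b]%classic `<=` `[- r, r]%classic.
  by move=> x /=; rewrite !in_itv/= => /andP[? ?]; lra.
rewrite /I Rintegral_itvB//; last first.
  by apply: intg => x /=; rewrite !in_itv/= => /andP[-> ?]; lra.
have mi : measurable (`]a, b]%classic : set (measurableTypeR R)).
  exact: measurable_itv.
have cstE c : \int[mu]_(x in `]a, b]%classic) c = c * (b - a).
  rewrite Rintegral_cst//; rewrite [X in fine X](_ : _ = (b - a)%:E)//.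
  apply: etrans (lebesgue_measure_itv `]a, b]) _; rewrite /= lte_fin.
  by case: ltP => // ba; congr EFin; lra.
have icst c : mu.-integrable `]a, b]%classic (EFin \o cst c).
  apply: measurable_bounded_integrable => //; first exact: fin.
  exact: bounded_cst.
rewrite -(cstE A) -(cstE B); apply/andP; split; apply: le_Rintegral => //;
  rewrite ?intg ?icst// => x /=; rewrite in_itv/= => /andP[? ?];
  by have /andP[] := AB x ltac:(assumption) ltac:(assumption).
Qed.

Section Duality.
Context (R : realType) (p r : R) (p_gt1 : 1 < p) (r_gt0 : 0 < r).
Context (mu nu : probability R R).
Hypotheses (mu1 : mu `[- r, r]%classic = 1%E) (nu1 : nu `[- r, r]%classic = 1%E).

Let r_ge0 : 0 <= r. Proof. exact: ltW. Qed.
Ltac plra := move: p_gt1 r_gt0; lra.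

Let q1 := quantile mu.
Let q2 := quantile nu.

Let q12_measurable : measurable_fun setT (fun t => (q1 t, q2 t)).
Proof. by apply: measurable_fun_pair; exact: measurable_quantile. Qed.

Definition quantile_coupling : probability (R * R)%type R :=
  law (unif R) q12_measurable.

Lemma quantile_couplingP : coupling mu nu quantile_coupling.
Proof. by split => A mA; [exact: (quantile_law mu)|exact: (quantile_law nu)]. Qed.

(** A monotone transport map; on the fibres of the coupling it is squeezed
    between the values to the left and to the right. *)
Let Tset s := [set q2 t | t in [set t | 0 < t < 1 /\ q1 t < s]] `|` [set - r].
Let T s := sup (Tset s).

Let Tset_sup s : has_sup (Tset s).
Proof.
split; first by exists (- r); right.
exists r => _ [[t [t01 _] <-]|->]; last by plra.
by have := quantile_itv nu1 t01; rewrite in_itv/= => /andP[].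
Qed.

Let T_itv s : T s \in `[- r, r].
Proof.
rewrite in_itv/=; apply/andP; split.
  by apply: ub_le_sup; [case: (Tset_sup s)|right].
apply: ge_sup; first by case: (Tset_sup s).
move=> _ [[t [t01 _] <-]|->]; last by plra.
by have := quantile_itv nu1 t01; rewrite in_itv/= => /andP[].
Qed.

Let T_nd : {homo T : s t / s <= t}.
Proof.
move=> s t st; apply: ge_sup; first by case: (Tset_sup s).
move=> y Ty; apply: ub_le_sup; first by case: (Tset_sup t).
case: Ty => [[u [u01 us] <-]|->]; last by right.
by left; exists u => //; split=> //; exact: lt_le_trans st.
Qed.

Let T_ge s t : 0 < t < 1 -> q1 t < s -> q2 t <= T s.
Proof.
by move=> t01 ts; apply: ub_le_sup; [case: (Tset_sup s)|left; exists t].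
Qed.

Let T_le s t : 0 < t < 1 -> s <= q1 t -> T s <= q2 t.
Proof.
move=> t01 st; apply: ge_sup; first by case: (Tset_sup s).
move=> _ [[u [u01 us] <-]|->]; last first.
  by have := quantile_itv nu1 t01; rewrite in_itv/= => /andP[].
apply: quantile_nd; [by case/andP: u01| |by case/andP: t01].
rewrite leNgt; apply/negP => tu.
have : q1 t <= q1 u by apply: quantile_nd; [case/andP: t01|exact: ltW|case/andP: u01].
lra.
Qed.

(** Let [f] be a primitive of [s |-> k (s - T s)], with [k] the derivative of the
    cost. Along a point [(x, y)] of the quantile coupling, [T] lies below [y] to
    the left of [x] and above [y] to its right, and [k] is monotone: hence
    [f x' - f x <= |x' - y|^p - |x - y|^p] for all [x'], so that [f x + f^c y]
    equals [|x - y|^p] there. *)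
Lemma strong_duality : exists f, class_C p r f /\
  \int[mu]_x fbar r f x + \int[nu]_y cbar p r f y =
    \int[quantile_coupling]_z ccost p r z.
Proof.
pose g s := dcost p (s - T s).
have mg : measurable_fun setT g.
  apply: (@measurableT_comp _ _ _ _ _ _ (dcost p) _ (fun s : R => s - T s)).
    apply: nondecreasing_measurable => //.
    by move=> x y; exact: dcost_le.
  apply: measurable_funB => //.
  exact: nondecreasing_measurable.
have gL s : s \in `[- r, r] -> `|g s| <= lipC p r.
  by move=> sr; apply: dcost_bound => //; apply: itv_dist.
have [f [f0 fP]] := primitive_exists r_gt0 mg gL.
have fC : class_C p r f.
  split=> // x y; wlog xy : x y / x <= y.
    move=> W xr yr; have [xy|/ltW yx] := leP x y; first exact: W.
    by rewrite distrC (distrC x); exact: W.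
  rewrite !in_itv/= => /andP[rx xr] /andP[ry yr].
  have := fP x y (- lipC p r) (lipC p r) rx xy yr.
  rewrite -/(lipC p r) distrC (distrC x) (@ger0_norm _ (y - x)) ?subr_ge0//.
  move=> H; rewrite ler_norml -mulNr; apply: H => s xs sy.
  by rewrite -ler_norml gL// in_itv/=; lra.
exists f; split=> //.
have key t : 0 < t < 1 -> fbar r f (q1 t) + cbar p r f (q2 t) = ccost p r (q1 t, q2 t).
  move=> t01; have x0r := quantile_itv mu1 t01; have y0r := quantile_itv nu1 t01.
  rewrite /fbar /cbar /ccost/= !clamp_id//.
  move: x0r y0r; rewrite -/q1 -/q2; set x0 := q1 t; set y0 := q2 t => x0r y0r.
  suff H x : x \in `[- r, r] -> f x - f x0 <= cost p (x - y0) - cost p (x0 - y0).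
    apply/eqP; rewrite eq_le; apply/andP; split.
      by have := ct_le p_gt1 r_gt0 y0 fC x0r; lra.
    suff : cost p (x0 - y0) - f x0 <= ctransform p r f y0 by lra.
    by apply: ct_ge => // x xr; have := H x xr; lra.
  move: x0r; rewrite !in_itv/= => /andP[rx0 x0r] /andP[rx xr].
  have [xx0|x0x|->] := ltgtP x x0; last by rewrite !subrr.
    suff : (cost p (x0 - y0) - f x0) - (cost p (x - y0) - f x) <= (x0 - x) * 0.
      by lra.
    apply: (@telescope_le _ _ _ _ (fun s => cost p (s - y0) - f s)
      (fun s => dcost p (s - y0))) => // a b xa ab bx0.
    have /andP[h _] : dcost p (a - y0) * (b - a) <= f b - f a <= lipC p r * (b - a).
      apply: fP; [lra|lra|lra|] => s as_ sb; apply/andP; split.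
        by apply: dcost_le => //; have := T_le t01 (le_trans sb bx0); rewrite -/y0; lra.
      by rewrite (le_trans (ler_norm _))// gL// in_itv/=; lra.
    have := cost_tangent p_gt1 (b - y0) (a - y0).
    rewrite (_ : a - y0 - (b - y0) = - (b - a)); last by ring.
    nra.
  suff : (f x - cost p (x - y0)) - (f x0 - cost p (x0 - y0)) <= (x - x0) * 0.
    by lra.
  apply: (@telescope_le _ _ _ _ (fun s => f s - cost p (s - y0))
    (fun s => dcost p (s - y0))) => // a b xa ab bx0.
  have /andP[_ h] : - lipC p r * (b - a) <= f b - f a <= dcost p (b - y0) * (b - a).
    apply: fP; [lra|lra|lra|] => s as_ sb; apply/andP; split.
      have : `|g s| <= lipC p r by rewrite gL// in_itv/=; lra.
      by rewrite ler_norml => /andP[].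
    apply: dcost_le => //.
    by have := T_ge t01 (le_lt_trans xa as_); rewrite -/y0; lra.
  have := cost_tangent p_gt1 (a - y0) (b - y0).
  rewrite (_ : b - y0 - (a - y0) = b - a); last by ring.
  nra.
have bf := fbar_bmf p_gt1 r_gt0 fC; have bc := cbar_bmf p_gt1 r_gt0 fC.
have m1 := measurable_quantile mu; have m2 := measurable_quantile nu.
rewrite (expect_has_law m1 (quantile_law mu) bf).
rewrite (expect_has_law m2 (quantile_law nu) bc).
rewrite /quantile_coupling (expect_law _ q12_measurable (ccost_bmf p_gt1 r_gt0)).
have b1 := bmf_comp bf m1; have b2 := bmf_comp bc m2.
rewrite -expectD//.
apply: (@expect_ae _ _ R (unif R) _ _ (`]0, 1[%classic : set R)).
- exact: measurable_itv.
- exact: unif_oo.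
- exact: bmfD.
- by apply: (bmf_comp (ccost_bmf p_gt1 r_gt0)); exact: q12_measurable.
- by move=> t /=; rewrite in_itv/=; exact: key.
Qed.

Definition dualR (f : R -> R) : R :=
  \int[mu]_x fbar r f x + \int[nu]_y cbar p r f y.

(** The potential and the quantile coupling certify each other's optimality. *)
Lemma duality : exists f, [/\ class_C p r f,
  Wpp p mu nu = (dualR f)%:E,
  dualR f = \int[quantile_coupling]_z ccost p r z &
  forall g, class_C p r g -> dualR g <= dualR f].
Proof.
have [f [fC fE]] := strong_duality; exists f; split => //.
  apply/eqP; rewrite eq_le; apply/andP; split; last exact: Wpp_ge_dual.
  by rewrite /dualR fE; apply: Wpp_le_coupling => //; exact: quantile_couplingP.
move=> g gC; rewrite /dualR fE.
by apply: weak_duality => //; exact: quantile_couplingP.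
Qed.

End Duality.

(** * Supports *)

Section Support.
Context d (T : measurableType d) (S : ptopologicalType) (R : realType).
Context (mu : {measure set T -> \bar R}) (i : T -> S).
Hypothesis mo : forall U : set S, open U -> measurable (i @^-1` U).

(** Finitely many null open sets cover the compact set. *)
Lemma compact_null (K : set S) : compact K ->
  (forall x, K x -> exists U, [/\ open U, U x & mu (i @^-1` U) = 0%E]) ->
  exists V, [/\ open V, K `<=` V & mu (i @^-1` V) = 0%E].
Proof.
move=> cK H.
pose U x := if pselect (K x) is left h then projT1 (cid (H x h)) else set0.
have UP x : K x -> [/\ open (U x), U x x & mu (i @^-1` U x) = 0%E].
  by move=> Kx; rewrite /U; case: pselect => // h; case: cid.
have U0 x : open (U x) /\ mu (i @^-1` U x) = 0%E.
  have [/UP[]//|nK] := pselect (K x).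
  rewrite /U; case: pselect => // _; split; first exact: open0.
  by rewrite preimage_set0 measure0.
move: cK; rewrite compact_cover => /(_ S K U).
move=> /(_ (fun x _ => (U0 x).1)) [].
  by move=> x Kx; exists x => //; have [] := UP _ Kx.
move=> D DK KD; exists (\bigcup_(x in [set` D]) U x); split => //.
  by apply: bigcup_open => x _; exact: (U0 x).1.
rewrite bigcup_fset.
have : open (\big[setU/set0]_(x <- D) U x) /\
    mu (i @^-1` (\big[setU/set0]_(x <- D) U x)) = 0%E.
  elim: (finmap.enum_fset D) => [|x s [IH1 IH2]].
    by rewrite big_nil preimage_set0 measure0; split => //; exact: open0.
  have [h1 h2] := U0 x.
  rewrite big_cons; split; first exact: openU.
  by rewrite preimage_setU; apply: null_set_setU => //; exact: mo.
by case.
Qed.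

Lemma msupport_null (nu : set S -> \bar R) (K : nat -> set S) :
  (forall A, nu A = mu (i @^-1` A)) ->
  (forall n, compact (K n)) -> (forall n, K n `<=` ~` msupport nu) ->
  exists V, [/\ open V, \bigcup_n K n `<=` V & mu (i @^-1` V) = 0%E].
Proof.
move=> nuE cK KS.
have H n : exists V, [/\ open V, K n `<=` V & mu (i @^-1` V) = 0%E].
  apply: compact_null => // x /KS nx.
  apply: contrapT => h; apply: nx => U oU Ux; rewrite nuE lt_neqAle measure_ge0 andbT.
  by apply/eqP => m0; apply: h; exists U.
pose V n := projT1 (cid (H n)).
have VP n : [/\ open (V n), K n `<=` V n & mu (i @^-1` V n) = 0%E].
  by rewrite /V; case: cid.
exists (\bigcup_n V n); split.
- by apply: bigcup_open => n _; have [] := VP n.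
- by apply: subset_bigcup => n _; have [] := VP n.
rewrite preimage_bigcup; apply/negligibleP.
  by apply: bigcupT_measurable => n; apply: mo; have [] := VP n.
apply: negligible_bigcup => n; apply/negligibleP; have [oV _ V0] := VP n => //.
exact: mo.
Qed.

End Support.

Lemma closed_msupport (S : topologicalType) (R : realType) (nu : set S -> \bar R) :
  closed (msupport nu).
Proof.
move=> x clx U oU Ux; have [y [Sy Uy]] := clx U (open_nbhs_nbhs (conj oU Ux)).
exact: Sy.
Qed.

Lemma lip_continuous (R : realType) (f : R -> R) L :
  (forall x y, `|f x - f y| <= L * `|x - y|) -> continuous f.
Proof.
move=> H x; apply/cvgrPdist_le => e e0.
have L1 : 0 < `|L| + 1 by rewrite ltr_wpDl.
near=> y; apply: (le_trans (H x y)).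
apply: (@le_trans _ _ ((`|L| + 1) * `|x - y|)).
  by rewrite ler_wpM2r// (le_trans (ler_norm _))// lerDl.
rewrite mulrC -ler_pdivlMr//; near: y.
by apply: cvgr_dist_le => //; rewrite divr_gt0.
Unshelve. all: by end_near. Qed.

(** The complement of the support is a countable union of compact sets that avoid
    it. *)
Lemma msupport_line (R : realType) (mu : probability R R) :
  mu (msupport (mu : set R -> \bar R)) = 1%E.
Proof.
set S := msupport _; have cS : closed S by exact: closed_msupport.
have oS : open (~` S) by exact: closed_openC.
pose K n := `[- n%:R, n%:R]%classic `&`
  [set x | forall y : R, `|y - x| < n.+1%:R^-1 -> ~ S y].
have cK n : compact (K n).
  apply: compact_closedI; first exact: segment_compact.
  rewrite (_ : [set x | _] = \bigcap_(y in S) [set x | n.+1%:R^-1 <= `|y - x|]).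
    apply: closed_bigI => y Sy.
    rewrite (_ : [set x | _] = (fun x => `|y - x|) @^-1` [set z | n.+1%:R^-1 <= z])//.
    apply: closed_comp; last exact: closed_ge.
    by move=> x _; apply: cvg_norm; apply: cvgB; [exact: cvg_cst|exact: cvg_id].
  apply/seteqP; split => x /=.
    by move=> H y Sy /=; rewrite leNgt; apply/negP => /H.
  by move=> H y yx Sy; have /= := H y Sy; rewrite leNgt yx.
have KS n : K n `<=` ~` S.
  by move=> x [_ H]; apply: H; rewrite subrr normr0 invr_gt0 ltr0n.
have mo (U : set R) : open U -> measurable (idfun @^-1` U).
  exact: open_measurable.
have [V [oV KV V0]] := msupport_null (nu := mu : set R -> \bar R) mo (fun _ => erefl) cK KS.
have mS : measurable S by exact: closed_measurable.
suff nS : mu (~` S) = 0%E.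
  by rewrite -[S]setCK probC ?nS ?sube0//; exact: measurableC.
apply/eqP; rewrite -measure_le0 -V0; apply: le_measure; rewrite ?inE.
- exact: measurableC.
- exact: open_measurable.
move=> x Sx; apply: KV.
have /nbhs_ballP[e /= e0 eS] : nbhs x (~` S) by exact: open_nbhs_nbhs.
pose n := Num.truncn (`|x| + e^-1).
have nP : `|x| + e^-1 < n.+1%:R by exact: truncnS_gt.
have ei : 0 < e^-1 by rewrite invr_gt0.
exists n.+1 => //; split.
  by rewrite /= in_itv/= -ler_norml; lra.
move=> y yx; apply: eS; rewrite /ball/= distrC (lt_le_trans yx)//.
rewrite -[leRHS]invrK lef_pV2 ?posrE ?ltr0n//.
have : n.+1%:R <= n.+2%:R :> R by rewrite ler_nat.
have := normr_ge0 x; lra.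
Qed.

(** * Uniqueness of potentials *)

Section Unique.
Context (R : realType) (p r : R) (p_gt1 : 1 < p) (r_gt0 : 0 < r).

Lemma gap_opp (a a' b b' c : R) : a + a' = c -> b + b' = c ->
  a' - b' = - (a - b).
Proof. by move=> e1 e2; apply/eqP; rewrite -subr_eq0; apply/eqP; lra. Qed.

(** On an interval that is covered by contact points, two potentials have the
    same increments: both are squeezed between one-sided tangents of the cost,
    and the gap is governed by the modulus of its derivative along the monotone
    contact set. *)
Lemma contact_const (I : set R) (y_ f f' g g' : R -> R) :
  is_interval I ->
  (forall x, I x -> x \in `[- r, r] /\ y_ x \in `[- r, r]) ->
  (forall x y, x \in `[- r, r] -> y \in `[- r, r] -> f x + f' y <= cost p (x - y)) ->
  (forall x y, x \in `[- r, r] -> y \in `[- r, r] -> g x + g' y <= cost p (x - y)) ->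
  (forall x, I x -> f x + f' (y_ x) = cost p (x - y_ x)) ->
  (forall x, I x -> g x + g' (y_ x) = cost p (x - y_ x)) ->
  forall a b, I a -> I b -> f a - g a = f b - g b.
Proof.
move=> itvI Iy.
have main (f1 f1' g1 g1' : R -> R) a b : a < b -> I a -> I b ->
    (forall x y, x \in `[- r, r] -> y \in `[- r, r] -> f1 x + f1' y <= cost p (x - y)) ->
    (forall x y, x \in `[- r, r] -> y \in `[- r, r] -> g1 x + g1' y <= cost p (x - y)) ->
    (forall x, I x -> f1 x + f1' (y_ x) = cost p (x - y_ x)) ->
    (forall x, I x -> g1 x + g1' (y_ x) = cost p (x - y_ x)) ->
    f1 b - g1 b <= f1 a - g1 a.
  clear f f' g g'; move: f1 f1' g1 g1' => f f' g g' ab Ia Ib hf hg fE gE.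
  rewrite -subr_le0.
  have two : f b - g b - (f a - g a) = (f b - g b) - (f a - g a) by [].
  apply/ler_addgt0Pr => e e0; rewrite add0r.
  have e1 : 0 < e / (b - a) by rewrite divr_gt0// subr_gt0.
  have rr : 0 <= 2 * r by move: r_gt0; lra.
  have [C C0 HC] := dcost_modulus p_gt1 rr e1.
  have -> : e = (b - a) * (e / (b - a)) by field; rewrite gt_eqF// subr_gt0.
  have Iab x : a <= x -> x <= b -> I x by move=> ax xb; apply: (itvI a b); rewrite ?ax.
  have := @telescope_le _ a b (e / (b - a)) (fun x => f x - g x)
    (fun x => C * (x + y_ x)) ab.
  apply => s t as_ st tb.
  have Is : I s by apply: Iab => //; lra.
  have It : I t by apply: Iab => //; lra.
  have [sr ysr] := Iy _ Is; have [tr ytr] := Iy _ It.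
  have mono : y_ s <= y_ t.
    rewrite leNgt; apply/negP => yts.
    have := cost_swap_lt p_gt1 st yts.
    have := hf _ _ sr ytr; have := hf _ _ tr ysr.
    have := fE _ Is; have := fE _ It; lra.
  have h1 : f t - f s <= dcost p (t - y_ s) * (t - s).
    have := hf _ _ tr ysr; have := fE _ Is.
    have := cost_tangent p_gt1 (t - y_ s) (s - y_ s).
    rewrite (_ : s - y_ s - (t - y_ s) = - (t - s)); last by ring.
    lra.
  have h2 : dcost p (s - y_ t) * (t - s) <= g t - g s.
    have := hg _ _ sr ytr; have := gE _ It.
    have := cost_tangent p_gt1 (s - y_ t) (t - y_ t).
    rewrite (_ : t - y_ t - (s - y_ t) = t - s); last by ring.
    lra.
  have h3 : dcost p (t - y_ s) - dcost p (s - y_ t) <=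
      e / (b - a) + C * (t - y_ s - (s - y_ t)).
    move: sr ysr tr ytr; rewrite !in_itv/= => /andP[? ?] /andP[? ?] /andP[? ?] /andP[? ?].
    by apply: HC; lra.
  nra.
move=> hf hg fE gE a b Ia Ib.
have le u v : u < v -> I u -> I v -> f u - g u = f v - g v.
  move=> uv Iu Iv; have := main f f' g g' u v uv Iu Iv hf hg fE gE.
  by have := main g g' f f' u v uv Iu Iv hg hf gE fE; lra.
have [ab|ba|->//] := ltgtP a b; first exact: le.
exact/esym/le.
Qed.

(** The image of a compact set of full measure is closed and of full measure, so it
    contains the support. *)
Lemma support_partner (mu : probability R R) (pi : probability (R * R)%type R)
    (i : R * R -> R) (G : set (R * R)) :
  measurable_fun setT i -> continuous i -> has_law pi i mu ->
  compact G -> measurable G -> pi G = 1%E ->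
  forall x, msupport (mu : set R -> \bar R) x -> exists2 z, G z & i z = x.
Proof.
move=> mi ci law_i cG mG G1 x Sx; apply: contrapT => nz.
have cA : compact (i @` G).
  by apply: continuous_compact => //; exact: continuous_subspaceT.
have clA : closed (i @` G) by apply: compact_closed => //; exact: norm_hausdorff.
have Ux : (~` (i @` G)) x by move=> [z Gz zx]; apply: nz; exists z.
have := Sx _ (closed_openC clA) Ux; apply/negP; rewrite -leNgt.
have mA : measurable (~` (i @` G)).
  by apply: measurableC; exact: closed_measurable.
rewrite -(law_i _ mA).
have /le_trans : (pi (i @^-1` (~` (i @` G))) <= pi (~` G))%E.
  apply: le_measure; rewrite ?inE; last by move=> z /= h Gz; apply: h; exists z.
    by rewrite -[X in measurable X]setTI; exact: mi.
  exact: measurableC.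
by apply; rewrite probC// G1 subee.
Qed.

Lemma bmf_eq_measurable (h : R -> R) c : bmf h -> measurable [set x | h x = c].
Proof.
move=> [mh _]; rewrite (_ : [set x | _] = setT `&` h @^-1` [set c]).
  by apply: mh => //; exact: measurable_set1.
by rewrite setTI.
Qed.

Lemma prob_full (d : measure_display) (T : measurableType d) (P : probability T R)
    (A B : set T) : measurable A -> measurable B -> A `<=` B -> P A = 1%E -> P B = 1%E.
Proof.
move=> mA mB AB A1; apply/eqP; rewrite eq_le probability_le1//= -A1.
by apply: le_measure; rewrite ?inE.
Qed.

Lemma prob_setI (d : measure_display) (T : measurableType d) (P : probability T R)
    (A B : set T) : measurable A -> measurable B -> P A = 1%E -> P B = 1%E ->
  P (A `&` B) = 1%E.
Proof.
move=> mA mB A1 B1; have mAB : measurable (A `&` B) by exact: measurableI.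
have n0 : (P : {measure set T -> \bar R}) (~` (A `&` B)) = 0%E.
  rewrite setCI; apply: null_set_setU; try exact: measurableC.
    by rewrite probC// A1 subee.
  by rewrite probC// B1 subee.
by rewrite -[A `&` B]setCK; rewrite (probC P (measurableC mAB)) n0 sube0.
Qed.

Lemma expect_eq0 (d : measure_display) (T : measurableType d) (P : probability T R)
    (h : T -> R) : bmf h -> (forall x, 0 <= h x) -> \int[P]_x h x = 0 ->
  P [set x | h x = 0] = 1%E.
Proof.
move=> bh h0 hE.
have mE : measurable [set x | h x = 0].
  rewrite (_ : [set x | _] = setT `&` h @^-1` [set 0]); last by rewrite setTI.
  by case: bh => mh _; apply: mh => //; exact: measurable_set1.
have mh : measurable_fun setT (EFin \o h) by apply/measurable_EFinP; case: bh.
have : ae_eq P setT (EFin \o h) (cst 0%E).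
  apply/(ae_eq_integral_abs P measurableT mh).
  under eq_integral do rewrite /= ger0_norm//.
  by rewrite EFin_expect// hE.
move=> [N [mN N0 sub]].
have sub' : ~` N `<=` [set x | h x = 0].
  move=> x nNx; apply: contrapT => hx; apply: nNx; apply: sub => /= /(_ I) [] //.
apply: (prob_full _ mE sub'); first exact: measurableC.
by rewrite probC// N0 sube0.
Qed.

Context (mu nu : probability R R).
Hypotheses (mu1 : mu `[- r, r]%classic = 1%E) (nu1 : nu `[- r, r]%classic = 1%E).

(** The points where both potentials satisfy [f x + f^c y = |x - y|^p] form a
    compact set that carries the optimal coupling. Every point of an interval
    support has a partner in it, and there [contact_const] leaves no freedom but a
    constant; the partners then carry the opposite constant. *)
Lemma potential_unique f g :
  is_interval (msupport (mu : set R -> \bar R)) \/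
  is_interval (msupport (nu : set R -> \bar R)) ->
  class_C p r f -> class_C p r g ->
  (forall h, class_C p r h -> dualR p r mu nu h <= dualR p r mu nu f) ->
  dualR p r mu nu g = dualR p r mu nu f ->
  exists c, mu [set x | fbar r f x - fbar r g x = c] = 1%E /\
            nu [set y | cbar p r f y - cbar p r g y = - c] = 1%E.
Proof.
move=> CC fC gC fmax gf.
have [f0 [f0C _ f0E f0max]] := duality p_gt1 r_gt0 mu1 nu1.
have fE : dualR p r mu nu f = \int[quantile_coupling mu nu]_z ccost p r z.
  by rewrite -f0E; apply/eqP; rewrite eq_le f0max ?fmax.
have gE := etrans gf fE.
pose pi := quantile_coupling mu nu.
have [pi1 pi2] : coupling mu nu pi by exact: quantile_couplingP.
pose sq := `[- r, r]%classic `*` `[- r, r]%classic : set (R * R).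
pose Gam h := [set z : R * R | ccost p r z - (fbar r h z.1 + cbar p r h z.2) = 0].
have bmf_gap h : class_C p r h ->
    bmf (fun z : R * R => ccost p r z - (fbar r h z.1 + cbar p r h z.2)).
  move=> hC; apply: bmfB; first exact: ccost_bmf.
  by apply: bmfD; [apply: (bmf_comp (fbar_bmf p_gt1 r_gt0 hC))|
    apply: (bmf_comp (cbar_bmf p_gt1 r_gt0 hC))].
have Gam1 h : class_C p r h ->
    dualR p r mu nu h = \int[pi]_z ccost p r z -> pi (Gam h) = 1%E.
  move=> hC hE; apply: expect_eq0; first exact: bmf_gap.
    move=> z; rewrite subr_ge0 /ccost /fbar /cbar.
    have := ct_le p_gt1 r_gt0 (clamp r z.2) hC (clamp_itv (ltW r_gt0) z.1).
    by lra.
  have b1 := bmf_comp (fbar_bmf p_gt1 r_gt0 hC) (@measurable_fst _ _ R R).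
  have b2 := bmf_comp (cbar_bmf p_gt1 r_gt0 hC) (@measurable_snd _ _ R R).
  rewrite expectB; [|exact: ccost_bmf|exact: bmfD].
  rewrite expectD// -(expect_has_law measurable_fst pi1 (fbar_bmf p_gt1 r_gt0 hC)).
  rewrite -(expect_has_law measurable_snd pi2 (cbar_bmf p_gt1 r_gt0 hC)).
  by rewrite -/(dualR p r mu nu h) hE subrr.
have mGam h : class_C p r h -> measurable (Gam h).
  move=> hC; rewrite (_ : Gam h = setT `&`
      (fun z : R * R => ccost p r z - (fbar r h z.1 + cbar p r h z.2)) @^-1` [set 0]).
    by have [mh _] := bmf_gap h hC; apply: mh => //; exact: measurable_set1.
  by rewrite setTI.
have msq : measurable sq by apply: measurableX; exact: measurable_itv.
have sq1 : pi sq = 1%E.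
  have := coupling_itv mu1 nu1 (conj pi1 pi2); rewrite -/pi => n0.
  have -> : sq = ~` (~` (fst @^-1` `[- r, r] `&` snd @^-1` `[- r, r])).
    by rewrite setCK.
  by rewrite probC ?n0 ?sube0//; exact: measurableC.
have cl_cont : continuous (clamp r).
  by apply: (@lip_continuous _ _ 1) => x y; rewrite mul1r clamp_lip// ltW.
have ccost_cont : continuous (ccost p r).
  pose c2 x := cost p (clamp (2 * r) x).
  have r2 : 0 <= 2 * r by move: r_gt0; lra.
  have c2c : continuous c2.
    apply: (@lip_continuous _ _ (lipC p r)) => x y.
    apply: le_trans (cost_lipschitz p_gt1 _ _) _.
    - by rewrite -normr_itv; exact: clamp_itv.
    - by rewrite -normr_itv; exact: clamp_itv.
    - by rewrite ler_wpM2l ?clamp_lip// ltW// lipC_gt0.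
  have -> : ccost p r = fun z => c2 (clamp r z.1 - clamp r z.2).
    apply/funext => z; rewrite /c2 clamp_id// normr_itv.
    by apply: itv_dist; apply: clamp_itv; exact: ltW.
  move=> z; apply: (continuous_comp (f := fun z : R * R => clamp r z.1 - clamp r z.2) (g := c2)).
    by apply: cvgB; (apply: continuous_comp; [|exact: cl_cont]); [exact: cvg_fst|exact: cvg_snd].
  exact: c2c.
have cGam h : class_C p r h -> closed (Gam h).
  move=> hC; rewrite (_ : Gam h =
      (fun z : R * R => ccost p r z - (fbar r h z.1 + cbar p r h z.2)) @^-1` [set 0])//.
  apply: closed_comp; last exact: closed_eq.
  have fc : continuous (fbar r h).
    by apply: (@lip_continuous _ _ (lipC p r)) => x y; exact: fbar_lip.
  have cc : continuous (cbar p r h).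
    by apply: (@lip_continuous _ _ (lipC p r)) => x y; exact: cbar_lip.
  move=> z _; apply: cvgB; first exact: ccost_cont.
  apply: cvgD.
    by apply: (continuous_comp (f := fst) (g := fbar r h)); [exact: cvg_fst|exact: fc].
  by apply: (continuous_comp (f := snd) (g := cbar p r h)); [exact: cvg_snd|exact: cc].
pose G := sq `&` (Gam f `&` Gam g).
have mG : measurable G.
  by apply: measurableI => //; apply: measurableI; exact: mGam.
have G1 : pi G = 1%E.
  apply: prob_setI => //; first by apply: measurableI; exact: mGam.
  by apply: prob_setI; [exact: mGam|exact: mGam|exact: Gam1|exact: Gam1].
have cG : compact G.
  apply: compact_closedI.
    by apply: compact_setX; exact: segment_compact.
  by apply: closedI; exact: cGam.
have Gin z : G z -> [/\ z.1 \in `[- r, r], z.2 \in `[- r, r],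
    fbar r f z.1 + cbar p r f z.2 = cost p (z.1 - z.2) &
    fbar r g z.1 + cbar p r g z.2 = cost p (z.1 - z.2)].
  move=> [[z1 z2] [/= h1 h2]]; split => //.
    by move: h1; rewrite /Gam/= /ccost (clamp_id z1) (clamp_id z2) => /subr0_eq.
  by move: h2; rewrite /Gam/= /ccost (clamp_id z1) (clamp_id z2) => /subr0_eq.
have mdf := bmfB (fbar_bmf p_gt1 r_gt0 fC) (fbar_bmf p_gt1 r_gt0 gC).
have mdc := bmfB (cbar_bmf p_gt1 r_gt0 fC) (cbar_bmf p_gt1 r_gt0 gC).
have hle h : class_C p r h -> forall x y, x \in `[- r, r] -> y \in `[- r, r] ->
    fbar r h x + cbar p r h y <= cost p (x - y).
  by move=> hC x y; exact: fbar_cbar_le.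
(* both coordinates of almost every contact point carry the same constant *)
have fin c : pi (G `&` [set z | fbar r f z.1 - fbar r g z.1 = c]) = 1%E ->
    mu [set x | fbar r f x - fbar r g x = c] = 1%E /\
    nu [set y | cbar p r f y - cbar p r g y = - c] = 1%E.
  have mc : measurable [set z : R * R | fbar r f z.1 - fbar r g z.1 = c].
    have [mh _] := bmf_comp mdf (@measurable_fst _ _ R R).
    rewrite (_ : [set z | _] = setT `&` (fun z : R * R => fbar r f z.1 - fbar r g z.1) @^-1` [set c]).
      by apply: mh => //; exact: measurable_set1.
    by rewrite setTI.
  move=> h; have m1 := bmf_eq_measurable c mdf; have m2 := bmf_eq_measurable (- c) mdc.
  split.
    rewrite -(pi1 _ m1); apply: (prob_full _ _ _ h); first exact: measurableI.
      by rewrite -[X in measurable X]setTI; exact: measurable_fst.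
    by move=> z [].
  rewrite -(pi2 _ m2); apply: (prob_full _ _ _ h); first exact: measurableI.
    by rewrite -[X in measurable X]setTI; exact: measurable_snd.
  by move=> z [/Gin[_ _ e1 e2] /= <-]; rewrite (gap_opp e1 e2).
have pre (i : R * R -> R) (m : probability R R) : measurable_fun setT i ->
    has_law pi i m -> pi (i @^-1` msupport (m : set R -> \bar R)) = 1%E.
  move=> mi li; have mS : measurable (msupport (m : set R -> \bar R)).
    by apply: closed_measurable; exact: closed_msupport.
  by rewrite (li _ mS) msupport_line.
have mpre (i : R * R -> R) (m : probability R R) : measurable_fun setT i ->
    measurable (i @^-1` msupport (m : set R -> \bar R)).
  move=> mi; rewrite -[X in measurable X]setTI; apply: mi => //.
  by apply: closed_measurable; exact: closed_msupport.
have full (i : R * R -> R) (m : probability R R) (B : set (R * R)) :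
    measurable_fun setT i -> has_law pi i m -> measurable B ->
    (forall z, G z -> msupport (m : set R -> \bar R) (i z) -> B z) ->
    pi (G `&` B) = 1%E.
  move=> mi li mB h.
  apply: (prob_full (A := G `&` i @^-1` msupport (m : set R -> \bar R))).
  - by apply: measurableI => //; exact: mpre.
  - exact: measurableI.
  - by move=> z [Gz zS]; split => //; exact: h.
  - by apply: prob_setI => //; [exact: mpre|exact: pre].
have mB c : measurable [set z : R * R | fbar r f z.1 - fbar r g z.1 = c].
  have [mh _] := bmf_comp mdf (@measurable_fst _ _ R R).
  rewrite (_ : [set z | _] = setT `&` (fun z : R * R => fbar r f z.1 - fbar r g z.1) @^-1` [set c]).
    by apply: mh => //; exact: measurable_set1.
  by rewrite setTI.
have ne (m : probability R R) : exists x, msupport (m : set R -> \bar R) x.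
  apply: contrapT => h; have := msupport_line m.
  rewrite (_ : msupport _ = set0) ?measure0.
    by move/eqP; rewrite eqe eq_sym oner_eq0.
  by apply/seteqP; split => // x Sx; apply: h; exists x.
case: CC => itvS.
- have [x0 Sx0] := ne mu.
  have part x : msupport (mu : set R -> \bar R) x -> exists y, G (x, y).
    move=> Sx; have [[z1 z2] Gz /= <-] :=
      support_partner measurable_fst (fun z => cvg_fst) pi1 cG mG G1 Sx.
    by exists z2.
  pose y_ x := if pselect (exists y, G (x, y)) is left h then projT1 (cid h) else 0.
  have yP x : msupport (mu : set R -> \bar R) x -> G (x, y_ x).
    by move=> /part h; rewrite /y_; case: pselect => // h'; case: cid.
  exists (fbar r f x0 - fbar r g x0); apply: fin.
  apply: (full _ _ _ measurable_fst pi1 (mB _)) => z Gz zS /=.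
  apply: (contact_const itvS (y_ := y_) (f' := cbar p r f) (g' := cbar p r g)) => //.
  + by move=> x /yP /Gin[].
  + exact: hle.
  + exact: hle.
  + by move=> x /yP /Gin[].
  + by move=> x /yP /Gin[].
- have [y0 Sy0] := ne nu.
  have part y : msupport (nu : set R -> \bar R) y -> exists x, G (x, y).
    move=> Sy; have [[z1 z2] Gz /= <-] :=
      support_partner measurable_snd (fun z => cvg_snd) pi2 cG mG G1 Sy.
    by exists z1.
  pose x_ y := if pselect (exists x, G (x, y)) is left h then projT1 (cid h) else 0.
  have xP y : msupport (nu : set R -> \bar R) y -> G (x_ y, y).
    by move=> /part h; rewrite /x_; case: pselect => // h'; case: cid.
  exists (- (cbar p r f y0 - cbar p r g y0)); apply: fin.
  apply: (full _ _ _ measurable_snd pi2 (mB _)) => z Gz zS /=.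
  suff : cbar p r f z.2 - cbar p r g z.2 = cbar p r f y0 - cbar p r g y0.
    have [_ _ e1 e2] := Gin _ Gz; rewrite (gap_opp e1 e2) => <-.
  by rewrite opprK.
  have sw h : class_C p r h -> forall y x, y \in `[- r, r] -> x \in `[- r, r] ->
      cbar p r h y + fbar r h x <= cost p (y - x).
    move=> hC y x yr xr; rewrite addrC -(costN p (y - x)) opprB.
    exact: fbar_cbar_le.
  apply: (contact_const itvS (y_ := x_) (f' := fbar r f) (g' := fbar r g)) => //.
  + by move=> y /xP /Gin[].
  + exact: sw.
  + exact: sw.
  + by move=> y /xP /Gin[_ _ /= e1 _]; rewrite addrC e1 -(costN p (y - _)) opprB.
  + by move=> y /xP /Gin[_ _ /= _ e1]; rewrite addrC e1 -(costN p (y - _)) opprB.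
Qed.

End Unique.

(** * Sums of independent bounded variables *)

Section Indep.
Context d (Om : measurableType d) (R : realType) (Pr : probability Om R).

Lemma mutually_independent_comp d1 d2 (T : measurableType d1)
    (T' : measurableType d2) (I : choiceType) (X : I -> Om -> T) (g : I -> T -> T') :
  (forall i, measurable_fun setT (g i)) ->
  mutually_independent Pr X -> mutually_independent Pr (fun i w => g i (X i w)).
Proof.
move=> mg mi s A us mA.
have := mi s (fun i => g i @^-1` A i) us; apply => i.
by rewrite -[X in measurable X]setTI; exact: mg.
Qed.

Lemma preimage_meas d1 (T : measurableType d1) (f : Om -> T) (A : set T) :
  measurable_fun setT f -> measurable A -> measurable (f @^-1` A).
Proof. by move=> mf mA; rewrite -[X in measurable X]setTI; exact: mf. Qed.

(** Rectangles generate the product sigma-algebra and are stable under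
    intersections. *)
Lemma pair_indep_event d1 d2 (T1 : measurableType d1) (T2 : measurableType d2)
    (U : Om -> T1) (V : Om -> T2) (E : set Om) :
  measurable_fun setT U -> measurable_fun setT V -> measurable E ->
  (forall A B, measurable A -> measurable B ->
    Pr (U @^-1` A `&` V @^-1` B `&` E) = (Pr (U @^-1` A `&` V @^-1` B) * Pr E)%E) ->
  forall C, measurable C -> Pr ((fun w => (U w, V w)) @^-1` C `&` E) =
    (Pr ((fun w => (U w, V w)) @^-1` C) * Pr E)%E.
Proof.
move=> mU mV mE H C mC; pose UV w := (U w, V w).
have mUV : measurable_fun setT UV by exact: measurable_fun_pair.
pose m1 := pushforward (mrestr Pr mE) UV.
have e0 : 0 <= fine (Pr E) by rewrite fine_ge0.
pose m2 := mscale (NngNum e0) (law Pr mUV).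
pose G := [set A `*` B | A in @measurable _ T1 & B in @measurable _ T2].
have m2E A : m2 A = (Pr (UV @^-1` A) * Pr E)%E.
  by rewrite /m2 /mscale/= prob_fine// muleC.
have key : forall A, measurable A -> m1 A = m2 A.
  apply: (measure_unique G (fun=> setT)).
  - by rewrite /G; exact: measurable_prod_measurableType.
  - move=> _ _ [A mA [B mB <-]] [A' mA' [B' mB' <-]].
    exists (A `&` A'); first exact: measurableI.
    exists (B `&` B'); first exact: measurableI.
    by rewrite setXI.
  - by move=> _; exists setT => //; exists setT => //; rewrite setXTT.
  - by rewrite bigcup_const.
  - move=> _ [A mA [B mB <-]]; apply: (etrans _ (esym (m2E (A `*` B)))).
    exact: H.
  - move=> _; suff : (m1 setT < +oo)%E by [].
    rewrite /m1 /pushforward /mrestr preimage_setT setTI.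
    by rewrite -ge0_fin_numE// fin_num_measure.
by rewrite -m2E -key.
Qed.

Lemma indep_expect d1 d2 (T1 : measurableType d1) (T2 : measurableType d2)
    (U : Om -> T1) (V : Om -> T2) (phi : T1 * T2 -> R) :
  measurable_fun setT U -> measurable_fun setT V -> independent2 Pr U V ->
  bmf phi ->
  \int[Pr]_w phi (U w, V w) = \int[Pr]_w \int[Pr]_w' phi (U w, V w').
Proof.
move=> mU mV UV bphi.
have mUV : measurable_fun setT (fun w => (U w, V w)) by exact: measurable_fun_pair.
transitivity (\int[law Pr mUV]_z phi z); first by rewrite expect_law.
transitivity (\int[(law Pr mU \x law Pr mV)%E]_z phi z).
  congr fine; apply: eq_measure_integral => A mA _; apply/esym.
  exact: product_measure_unique.
rewrite expect_prod// (expect_law _ mU (bmf_fubini_F (law Pr mU) (law Pr mV) bphi)).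
by apply: eq_Rintegral => w _; rewrite expect_law//; exact: bmf_section1.
Qed.

Lemma indep_mul (U V : Om -> R) : bmf U -> bmf V -> independent2 Pr U V ->
  \int[Pr]_w (U w * V w) = \int[Pr]_w U w * \int[Pr]_w V w.
Proof.
move=> bU bV UV; have [mU [M UM]] := bU; have [mV [N VN]] := bV.
pose c (M x : R) := clamp `|M| x.
have cE M' x : `|x| <= M' -> c M' x = x.
  by move=> h; rewrite /c clamp_id// normr_itv (le_trans h)// ler_norm.
have cb M' : bmf (c M').
  split; first by apply: (@lip_measurable _ _ 1) => x y; rewrite mul1r clamp_lip.
  by exists `|M'| => x; rewrite -normr_itv clamp_itv.
pose phi (z : R * R) := c M z.1 * c N z.2.
have bphi : bmf phi.
  by apply: bmfM; [exact: (bmf_comp (cb M))|exact: (bmf_comp (cb N))].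
transitivity (\int[Pr]_w phi (U w, V w)).
  by apply: eq_Rintegral => w _; rewrite /phi/= !cE.
rewrite (indep_expect mU mV UV bphi) mulrC -expectZ//.
apply: eq_Rintegral => w _; rewrite mulrC -expectZ//.
by apply: eq_Rintegral => w' _; rewrite /phi/= !cE.
Qed.

Context (I : choiceType) (Z : I -> Om -> R).
Hypothesis mZ : forall i, measurable_fun setT (Z i).
Hypothesis indZ : mutually_independent Pr Z.

Let S (s : seq I) w := \sum_(i <- s) Z i w.

Let mS s : measurable_fun setT (S s).
Proof. by apply: measurable_sum => i; exact: mZ. Qed.

Let cyl (B : I -> set R) (t : seq I) := \bigcap_(i in [set` t]) (Z i @^-1` B i).

Let cyl_cons B i t : cyl B (i :: t) = Z i @^-1` B i `&` cyl B t.
Proof.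
apply/seteqP; split => w.
  move=> h; split; first by apply: h; rewrite /= mem_head.
  by move=> j jt; apply: h; rewrite /= in_cons jt orbT.
by move=> [hi ht] j /=; rewrite in_cons => /predU1P[->//|]; exact: ht.
Qed.

Let mcyl B t : (forall i, measurable (B i)) -> measurable (cyl B t).
Proof.
move=> mB; elim: t => [|i t IH].
  by rewrite /cyl (_ : [set` [::]] = set0) ?bigcap_set0//; apply/seteqP; split.
by rewrite cyl_cons; apply: measurableI => //; exact: preimage_meas.
Qed.

(** The events of the variables that are not yet summed are carried along, so that
    the induction can take one of them into the sum. *)
Lemma sum_indep_cyl s t (A : set R) (B : I -> set R) : uniq (s ++ t) ->
  measurable A -> (forall i, measurable (B i)) ->
  Pr (S s @^-1` A `&` cyl B t) = (Pr (S s @^-1` A) * Pr (cyl B t))%E.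
Proof.
elim: s t A B => [|i s IH] t A B.
  move=> _ mA mB; have [A0|A0] := pselect (A 0).
    have -> : S [::] @^-1` A = setT.
      by apply/seteqP; split => // w _; rewrite /= /S big_nil.
    by rewrite setTI probability_setT mul1e.
  have -> : S [::] @^-1` A = set0.
    by apply/seteqP; split => // w; rewrite /= /S big_nil.
  by rewrite set0I measure0 mul0e.
rewrite cons_uniq => /andP[]; rewrite mem_cat negb_or => /andP[nis nit] ust mA mB.
have -> : S (i :: s) @^-1` A =
    (fun w => (Z i w, S s w)) @^-1` ((fun z : R * R => z.1 + z.2) @^-1` A).
  by apply/seteqP; split => w; rewrite /= /S big_cons.
have us' : uniq (s ++ i :: t).
  by rewrite uniq_catC/= mem_cat negb_or nit nis uniq_catC.
have us0 : uniq (s ++ [:: i]).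
  by move: us'; rewrite -cat1s catA cat_uniq => /andP[].
apply: pair_indep_event => //; first exact: mcyl.
- move=> A1 A2 mA1 mA2.
  pose B' j := if j == i then A1 else B j.
  have mB' j : measurable (B' j) by rewrite /B'; case: ifP.
  have Bi : B' i = A1 by rewrite /B' eqxx.
  have cB' : cyl B' t = cyl B t.
    apply: eq_bigcapr => j /= jt; rewrite /B'; case: eqP => // ji.
    by move: nit; rewrite -ji jt.
  have := IH (i :: t) A2 B' us' mA2 mB'.
  rewrite cyl_cons cB' Bi => E1.
  have := IH [:: i] A2 B' us0 mA2 mB'.
  rewrite cyl_cons Bi.
  have -> : cyl B' [::] = setT.
    by rewrite /cyl (_ : [set` [::]] = set0) ?bigcap_set0//; apply/seteqP; split.
  rewrite !setIT => E2.
  rewrite [Z i @^-1` A1 `&` _]setIC E2 -setIA E1 -muleA; congr (_ * _)%E.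
  have := indZ (s := i :: t) (A := B').
  rewrite /= nit (_ : uniq t); last by move: ust; rewrite cat_uniq => /and3P[].
  move=> /(_ isT mB'); rewrite -/(cyl B' (i :: t)) cyl_cons big_cons cB' Bi => ->.
  congr (_ * _)%E; have := indZ (s := t) (A := B').
  rewrite (_ : uniq t); last by move: ust; rewrite cat_uniq => /and3P[].
  by move=> /(_ isT mB'); rewrite -/(cyl B' t) cB' => ->.
- rewrite -[X in measurable X]setTI; apply: measurable_funD => //.
Qed.

Lemma sum_indep i s : uniq (i :: s) ->
  independent2 Pr (fun w => \sum_(j <- s) Z j w) (Z i).
Proof.
move=> uis A B mA mB.
have us : uniq (s ++ [:: i]) by rewrite uniq_catC.
have := sum_indep_cyl (B := fun=> B) us mA (fun=> mB).
rewrite cyl_cons.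
have -> : cyl (fun=> B) [::] = setT.
  by rewrite /cyl (_ : [set` [::]] = set0) ?bigcap_set0//; apply/seteqP; split.
by rewrite setIT.
Qed.

Context (b : R) (b_ge0 : 0 <= b).
Hypothesis Zb : forall i w, `|Z i w| <= b.
Hypothesis Z0 : forall i, \int[Pr]_w Z i w = 0.

Lemma bmf_Z i : bmf (Z i).
Proof. by split => //; exists b. Qed.

Let bmf_S s : bmf (S s).
Proof. by apply: bmf_sum => i; exact: bmf_Z. Qed.

Lemma bmf_expR (U : Om -> R) : bmf U -> bmf (fun w => expR (U w)).
Proof.
move=> [mU [M UM]]; split; first exact: measurableT_comp.
exists (expR M) => w; rewrite ger0_norm ?expR_ge0// ler_expR.
exact: le_trans (ler_norm _) (UM w).
Qed.

(** For a centred variable the linear term vanishes in the mean, and what remains is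
    an exponential, which multiplies well over independent variables. *)
Lemma expR_le_quad (x : R) : expR x <= x + expR (3 * x ^+ 2).
Proof.
have H0 := expR_ge1Dx (3 * x ^+ 2).
have [x3|x3] := leP x 3^-1; last first.
  have : expR x <= expR (3 * x ^+ 2) by rewrite ler_expR; nra.
  lra.
suff : expR x <= 1 + x + x ^+ 2 by nra.
have [x1|x1] := leP x (-1).
  have : expR x <= 1 by rewrite -expR0 ler_expR; lra.
  nra.
have h1 := expR_ge1Dx (- x / 2); have h2 := expR_gt0 (x / 2).
have h3 : expR (x / 2) * expR (- x / 2) = 1.
  by rewrite -expRD mulNr subrr expR0.
have h4 : expR x = expR (x / 2) * expR (x / 2).
  by rewrite -expRD; congr expR; lra.
have h5 : expR (x / 2) * (1 - x / 2) <= 1 by nra.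
have [x0|x0] := leP x 0.
  have g1 := expR_ge1Dx (- x); have g2 := expR_gt0 x.
  have g3 : expR x * expR (- x) = 1 by rewrite -expRD subrr expR0.
  have g4 : expR x * (1 - x) <= 1 by nra.
  have g5 : 1 <= (1 + x + x ^+ 2) * (1 - x) by nra.
  have : expR x * (1 - x) <= (1 + x + x ^+ 2) * (1 - x) by lra.
  by rewrite ler_pM2r//; lra.
have q0 : 0 < 1 - x / 2 by lra.
have E2 : expR (x / 2) <= (1 - x / 2)^-1 by rewrite -ler_pdivlMr ?mul1r in h5.
have : (expR (x / 2) * (1 - x / 2)) ^+ 2 <= 1.
  by rewrite expr_le1// mulr_ge0 ?ltW.
rewrite exprMn (expr2 (expR _)) -h4 => k1.
have k2 : 1 <= (1 + x + x ^+ 2) * (1 - x / 2) ^+ 2 by nra.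
have : expR x * (1 - x / 2) ^+ 2 <= (1 + x + x ^+ 2) * (1 - x / 2) ^+ 2 by lra.
by rewrite ler_pM2r// exprn_gt0.
Qed.

Lemma mgf_one l i : \int[Pr]_w expR (l * Z i w) <= expR (3 * l ^+ 2 * b ^+ 2).
Proof.
have bZ := bmf_Z i.
apply: (@le_trans _ _ (\int[Pr]_w (l * Z i w + expR (3 * l ^+ 2 * b ^+ 2)))).
  apply: expect_le.
  - exact/bmf_expR/bmfZ.
  - by apply: bmfD; [exact: bmfZ|exact: bmf_cst].
  - move=> w; apply: (le_trans (expR_le_quad _)); rewrite lerD2l ler_expR.
    rewrite exprMn -mulrA ler_wpM2l// ler_wpM2l ?sqr_ge0//.
    by rewrite -[Z i w ^+ 2]real_normK ?num_real// lerXn2r ?nnegrE.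
by rewrite expectD ?expectZ ?Z0 ?mulr0 ?add0r ?expect_cst//; [exact: bmfZ|exact: bmf_cst].
Qed.

Lemma mgf_sum l s : uniq s ->
  \int[Pr]_w expR (l * \sum_(i <- s) Z i w) <=
    expR (3 * l ^+ 2 * b ^+ 2 * (size s)%:R).
Proof.
elim: s => [_|i s IH uis].
  rewrite mulr0 expR0 -[leRHS](expect_cst Pr) le_eqVlt; apply/orP; left.
  by apply/eqP; apply: eq_Rintegral => w _; rewrite big_nil mulr0 expR0.
have us : uniq s by case/andP: uis.
have bS := bmf_S s; have bZ := bmf_Z i.
under eq_Rintegral => w _ do rewrite big_cons mulrDr expRD mulrC.
rewrite indep_mul; last first.
- move=> A B mA mB.
  have me : measurable_fun setT (fun x : R => expR (l * x)).
    by apply: measurableT_comp => //; exact: measurable_funM.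
  have mp (D : set R) : measurable D -> measurable ((fun x : R => expR (l * x)) @^-1` D).
    by move=> mD; rewrite -[X in measurable X]setTI; exact: me.
  exact: (sum_indep uis (mp _ mA) (mp _ mB)).
- exact/bmf_expR/bmfZ.
- exact/bmf_expR/bmfZ.
have -> : (size (i :: s))%:R = (size s)%:R + 1 :> R by rewrite natr1.
rewrite mulrDr mulr1 expRD.
apply: ler_pM; rewrite ?IH ?mgf_one//; apply: Rintegral_ge0 => w _; exact: expR_ge0.
Qed.

(** Hoeffding's inequality, with the constant that [expR_le_quad] gives: Chernoff's
    bound at the exponent that optimises [mgf_sum]. *)
Lemma hoeffding s (t : R) : uniq s -> 0 <= t -> 0 < b -> (0 < size s)%N ->
  fine (Pr [set w | t <= `|\sum_(i <- s) Z i w|]) <=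
    2 * expR (- (t ^+ 2 / (12 * (size s)%:R * b ^+ 2))).
Proof.
move=> us t0 b0 s0; set N : R := (size s)%:R; have N0 : 0 < N by rewrite ltr0n.
pose l := t / (6 * N * b ^+ 2); have l0 : 0 <= l.
  by rewrite divr_ge0// !mulr_ge0// ?ltW// sqr_ge0.
have bS : bmf (fun w => \sum_(i <- s) Z i w) by exact: bmf_S.
have [mSs _] := bS.
pose f w := expR (l * \sum_(i <- s) Z i w) + expR (- l * \sum_(i <- s) Z i w).
have bf1 : bmf (fun w => expR (l * \sum_(i <- s) Z i w)) by exact/bmf_expR/bmfZ.
have bf2 : bmf (fun w => expR (- l * \sum_(i <- s) Z i w)) by exact/bmf_expR/bmfZ.
have bf : bmf f by exact: bmfD.
have mA : measurable [set w | t <= `|\sum_(i <- s) Z i w|].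
  rewrite -[X in measurable X]setTI.
  rewrite (_ : [set w | _] = (fun w => `|\sum_(i <- s) Z i w|) @^-1` `[t, +oo[).
    by apply: (measurableT_comp (f := fun x : R => `|x|)) => //; exact: measurable_itv.
  by apply/seteqP; split => w /=; rewrite in_itv/= andbT.
have := @markov_bmf _ _ _ Pr f _ (expR (l * t)) mA bf.
have f0 w : 0 <= f w by rewrite addr_ge0// expR_ge0.
have fA w : [set w | t <= `|\sum_(i <- s) Z i w|] w -> expR (l * t) <= f w.
  move=> /= tS; have [S0|S0] := leP 0 (\sum_(i <- s) Z i w).
    rewrite ger0_norm// in tS; apply: (@le_trans _ _ (expR (l * \sum_(i <- s) Z i w))).
      by rewrite ler_expR ler_wpM2l.
    by rewrite /f lerDl expR_ge0.
  rewrite ltr0_norm// in tS; apply: (@le_trans _ _ (expR (- l * \sum_(i <- s) Z i w))).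
    by rewrite ler_expR mulNr -mulrN ler_wpM2l.
  by rewrite /f lerDr expR_ge0.
move=> /(_ f0 fA); rewrite expectD// => H.
have H1 := mgf_sum l us; have H2 := mgf_sum (- l) us; rewrite sqrrN in H2.
have {}H : expR (l * t) * fine (Pr [set w | t <= `|\sum_(i <- s) Z i w|]) <=
    2 * expR (3 * l ^+ 2 * b ^+ 2 * N) by rewrite -/N in H1 H2; lra.
rewrite -(ler_pM2l (expR_gt0 (l * t))) (le_trans H)//.
rewrite [leRHS]mulrCA ler_pM2l// -expRD ler_expR le_eqVlt; apply/orP; left; apply/eqP.
by rewrite /l; field; rewrite !gt_eqF.
Qed.

Lemma variance_sum s : uniq s ->
  \int[Pr]_w (\sum_(i <- s) Z i w) ^+ 2 = \sum_(i <- s) \int[Pr]_w (Z i w) ^+ 2.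
Proof.
elim: s => [_|i s IH uis].
  rewrite big_nil -[RHS](expect_cst Pr); apply: eq_Rintegral => w _.
  by rewrite big_nil expr0n.
have us : uniq s by case/andP: uis.
have bS : bmf (fun w => \sum_(j <- s) Z j w) by exact: bmf_S.
have bZ := bmf_Z i.
rewrite big_cons -IH//.
transitivity (\int[Pr]_w (Z i w ^+ 2 + (2 * ((\sum_(j <- s) Z j w) * Z i w) +
   (\sum_(j <- s) Z j w) ^+ 2))).
  by apply: eq_Rintegral => w _; rewrite big_cons; ring.
have b2 : bmf (fun w => (\sum_(j <- s) Z j w) * Z i w) by exact: bmfM.
have b3 : bmf (fun w => (\sum_(j <- s) Z j w) ^+ 2) by under eq_fun do rewrite expr2; exact: bmfM.
have b4 : bmf (fun w => Z i w ^+ 2) by under eq_fun do rewrite expr2; exact: bmfM.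
rewrite expectD//; last by apply: bmfD => //; exact: bmfZ.
rewrite expectD//; last exact: bmfZ.
by rewrite expectZ// (indep_mul bS bZ (sum_indep uis)) Z0 mulr0 mulr0 add0r.
Qed.

Lemma chebyshev_sum s (t : R) : uniq s -> 0 < t ->
  fine (Pr [set w | t <= `|\sum_(i <- s) Z i w|]) <=
    (\sum_(i <- s) \int[Pr]_w (Z i w) ^+ 2) / t ^+ 2.
Proof.
move=> us t0; rewrite -variance_sum// ler_pdivlMr ?exprn_gt0// mulrC.
have bS : bmf (fun w => \sum_(i <- s) Z i w) by exact: bmf_S.
have [mSs _] := bS.
apply: markov_bmf.
- rewrite -[X in measurable X]setTI.
  rewrite (_ : [set w | _] = (fun w => `|\sum_(i <- s) Z i w|) @^-1` `[t, +oo[).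
    by apply: (measurableT_comp (f := fun x : R => `|x|)) => //; exact: measurable_itv.
  by apply/seteqP; split => w /=; rewrite in_itv/= andbT.
- by under eq_fun do rewrite expr2; exact: bmfM.
- by move=> w; exact: sqr_ge0.
- move=> w /= tS; rewrite -[leRHS]real_normK ?num_real//.
  by rewrite lerXn2r// ?nnegrE// ltW.
Qed.

End Indep.

(** * The standard Gaussian law *)

Section Density.
Context (R : realType).
Local Notation mu := (@lebesgue_measure R).
Import HBNNSimple.

Lemma ge0_integral_density (nu : {measure set (measurableTypeR R) -> \bar R})
    (g : measurableTypeR R -> R) (f : measurableTypeR R -> \bar R) :
  measurable_fun setT g -> (forall x, 0 <= g x) ->
  (forall A, measurable A -> nu A = (\int[mu]_(x in A) (g x)%:E)%E) ->
  measurable_fun setT f -> (forall x, 0 <= f x)%E ->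
  (\int[nu]_x f x = \int[mu]_x (f x * (g x)%:E))%E.
Proof.
move=> mg g0 nuE mf f0.
have indicE_ (A : set (measurableTypeR R)) : measurable A ->
    (\int[nu]_x (\1_A x)%:E = \int[mu]_x ((\1_A x)%:E * (g x)%:E))%E.
  move=> mA; rewrite integral_indic// setIT nuE// [LHS]integral_mkcond/=.
  by apply: eq_integral => x _; rewrite patchE indicE; case: ifPn => xA;
    rewrite ?mul1e ?mul0e.
have sfE (h : {nnsfun (measurableTypeR R) >-> R}) :
    (\int[nu]_x (h x)%:E = \int[mu]_x ((h x)%:E * (g x)%:E))%E.
  under [LHS]eq_integral do rewrite fimfunE -fsumEFin//.
  rewrite [LHS]ge0_integral_fsum//; last 2 first.
    - by move=> r; exact/measurable_EFinP/measurableT_comp.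
    - by move=> n x _; rewrite EFinM nnfun_muleindic_ge0.
  under [RHS]eq_integral.
    move=> x xD; rewrite fimfunE -fsumEFin// ge0_mule_fsuml; last first.
      by move=> r; rewrite EFinM nnfun_muleindic_ge0.
    over.
  rewrite [RHS]ge0_integral_fsum//; last 2 first.
    - move=> r; apply: emeasurable_funM; last exact/measurable_EFinP.
      by apply/measurable_EFinP; exact/measurableT_comp.
    - move=> n x _; apply: mule_ge0; last by rewrite lee_fin.
      by rewrite EFinM nnfun_muleindic_ge0.
  apply: eq_fsbigr => r _; rewrite integralZl_indic_nnsfun//= indicE_//.
  have [r0|r0] := leP 0 r.
    rewrite -ge0_integralZl//; first by apply: eq_integral => x _; rewrite EFinM muleA.
      by apply: emeasurable_funM; exact/measurable_EFinP.
    by move=> x _; rewrite mule_ge0// lee_fin// g0.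
  rewrite (_ : h @^-1` [set r] = set0); last first.
    apply/seteqP; split => // x /= hx; have : 0 <= h x by exact: fun_ge0.
    by rewrite hx leNgt r0.
  rewrite !integral0_eq ?mule0//.
    by move=> x _; rewrite indic0 mulr0 mul0e.
  by move=> x _; rewrite indic0 mul0e.
pose f_ := nnsfun_approx measurableT mf.
transitivity (lim (\int[nu]_x (f_ n x)%:E @[n --> \oo])%E).
  rewrite -monotone_convergence//=.
  - apply: eq_integral => ? /[!inE] xD; apply/esym/cvg_lim => //=.
    exact: cvg_nnsfun_approx.
  - by move=> n; exact/measurable_EFinP/measurable_funTS.
  - by move=> n ? _; rewrite lee_fin.
  - by move=> ? _ ? ? mn; rewrite lee_fin; exact/lefP/nd_nnsfun_approx.
rewrite (_ : (fun n => \int[nu]_x (f_ n x)%:E)%E =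
    (fun n => \int[mu]_x ((f_ n x)%:E * (g x)%:E))%E); last first.
  by apply/funext => n; exact: sfE.
rewrite -monotone_convergence//=.
- apply: eq_integral => x _; apply/cvg_lim => //=.
  apply: cvgeZr => //; exact: cvg_nnsfun_approx.
- by move=> n; apply: emeasurable_funM; exact/measurable_EFinP.
- by move=> n x _; rewrite mule_ge0// lee_fin// g0.
- move=> x _ n m mn; rewrite lee_wpmul2r// ?lee_fin//.
  exact/lefP/nd_nnsfun_approx.
Qed.

End Density.

Section Gauss.
Context (R : realType).
Local Notation mu := (@lebesgue_measure R).

Definition gauss : probability R R :=
  law [the probability (measurableTypeR R) R of normal_prob 0 1] (@measurable_idR R).

Arguments gauss : simpl never.

Lemma mfunR d' (T : measurableType d') (f : R -> T) :
  measurable_fun setT f -> @measurable_fun _ _ (measurableTypeR R) T setT f.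
Proof. by move=> mf _ A mA; exact: mf. Qed.

Lemma ge0_integral_gauss (f : R -> \bar R) : measurable_fun setT f ->
  (forall x, 0 <= f x)%E ->
  (\int[gauss]_x f x = \int[mu]_x (f x * (normal_pdf 0 1 x)%:E))%E.
Proof.
move=> mf f0.
transitivity (\int[normal_prob 0 1]_x f x)%E.
  rewrite (ge0_integral_pushforward (@measurable_idR R))//.
apply: ge0_integral_density => //; first exact: measurable_normal_pdf.
by move=> x; exact: normal_pdf_ge0.
Qed.

Lemma normal_pdf_affine (m s y : R) : 0 < s ->
  normal_pdf m s (m + s * y) * s = normal_pdf 0 1 y.
Proof.
move=> s0; rewrite !normal_pdfE ?gt_eqF//.
rewrite /normal_fun /normal_peak.
have -> : - (m + s * y - m) ^+ 2 / (s ^+ 2 *+ 2) = - (y - 0) ^+ 2 / (1 ^+ 2 *+ 2).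
  by field; rewrite ?gt_eqF//.
have -> : Num.sqrt (s ^+ 2 * pi *+ 2) = s * Num.sqrt (1 ^+ 2 * pi *+ 2).
  rewrite -mulrnAr sqrtrM ?sqr_ge0// sqrtr_sqr gtr0_norm// expr1n mul1r.
  by [].
rewrite invfM; field; rewrite ?gt_eqF//= sqrtr_gt0 expr1n mul1r.
by rewrite pmulrn_lgt0// pi_gt0.
Qed.

(** A change of variables in the distribution functions. *)
Lemma normal_prob_affine (m s : R) : 0 < s ->
  has_law gauss (fun y => m + s * y) (normal_prob m s).
Proof.
move=> s0.
have ma : measurable_fun setT (fun y : R => m + s * y).
  by apply: measurable_funD => //; exact: measurable_funM.
pose nm : probability R R :=
  law [the probability (measurableTypeR R) R of normal_prob m s] (@measurable_idR R).
suff H A : measurable A -> law gauss ma A = nm A by move=> A mA; exact: H.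
apply: probability_cdf_unique => x.
rewrite lawE /gauss /nm !lawE.
have -> : (fun y => m + s * y) @^-1` `]-oo, x] = `]-oo, (x - m) / s]%classic.
  apply/seteqP; split => y /=; rewrite !in_itv/= ler_pdivlMr// mulrC; lra.
pose F (y : R) := m + s * y.
have FE : F ((x - m) / s) = x by rewrite /F; field; rewrite gt_eqF.
have dF (y : R) : is_derive y 1 F s.
  have h1 : is_derive y 1 (cst m : R -> R) 0 by exact: is_derive_cst.
  have h2 : is_derive y 1 (s *: (id : R -> R)) (s *: 1) by exact: is_deriveZ.
  by have := is_deriveD h1 h2; rewrite add0r scaler1.
have F'E : F^`()%classic = cst s.
  by apply/funext => z; rewrite derive1E; have [] := dF z.
have cF : continuous F by move=> z; apply: differentiable_continuous; apply/derivable1_diffP; have [] := dF z.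
transitivity (\int[mu]_(y in `]-oo, ((x - m) / s)%R]) (((normal_pdf m s \o F) * F^`()%classic) y)%:E)%E.
  transitivity (\int[mu]_(y in `]-oo, ((x - m) / s)%R]) (normal_pdf 0 1 y)%:E)%E => //.
  by apply: eq_integral => y _; rewrite F'E /= -(normal_pdf_affine m y s0).
rewrite -increasing_ge0_integration_by_substitutionNy.
- by rewrite FE.
- by move=> y z _ _ yz; rewrite /F ltrD2l ltr_pM2l.
- by move=> y _; rewrite F'E; exact: cvg_cst.
- by rewrite F'E; exact: is_cvg_cst.
- by rewrite F'E; exact: cvg_cst.
- split; first by move=> y _; have [] := dF y.
  exact/cvg_at_left_filter/cF.
- apply/cvgrNyPle => B.
  exists ((B - m) / s); split; first exact: num_real.
  by move=> y; rewrite ltr_pdivlMr// /F; lra.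
- by apply: continuous_subspaceT; apply: continuous_normal_pdf; rewrite gt_eqF.
- by move=> y _; exact: normal_pdf_ge0.
Qed.

(** Completing the square: this is the stability of Gaussian laws at the level
    of densities. *)
Lemma normal_pdf_mul (s t y w : R) : 0 < s -> 0 < t ->
  let q := Num.sqrt (s ^+ 2 + t ^+ 2) in
  normal_pdf 0 1 y * normal_pdf (s * y) t w =
  normal_pdf 0 q w * normal_pdf (s * w / q ^+ 2) (t / q) y.
Proof.
move=> s0 t0 q.
have st0 : 0 < s ^+ 2 + t ^+ 2 by rewrite addr_gt0// exprn_gt0.
have q0 : 0 < q by rewrite sqrtr_gt0.
have q2 : q ^+ 2 = s ^+ 2 + t ^+ 2 by rewrite sqr_sqrtr// ltW.
rewrite !normal_pdfE ?gt_eqF//; last by rewrite divr_gt0.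
have E : normal_fun 0 1 y * normal_fun (s * y) t w =
    normal_fun 0 q w * normal_fun (s * w / q ^+ 2) (t / q) y.
  rewrite /normal_fun -!expRD; congr expR; rewrite expr_div_n q2.
  by field; rewrite ?gt_eqF.
have P : normal_peak 1 * normal_peak t = normal_peak q * normal_peak (t / q) :> R.
  rewrite /normal_peak -!invfM -!sqrtrM.
  - congr (Num.sqrt _)^-1; rewrite expr_div_n q2.
    by field; rewrite gt_eqF.
  - by rewrite pmulrn_lge0// mulr_ge0 ?sqr_ge0// pi_ge0.
  - by rewrite pmulrn_lge0// mulr_ge0 ?sqr_ge0// pi_ge0.
transitivity (normal_peak 1 * normal_peak t * (normal_fun 0 1 y * normal_fun (s * y) t w)).
  by ring.
by rewrite E P; ring.
Qed.

Lemma normal_stable_pos (s t : R) : 0 < s -> 0 < t ->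
  forall A, measurable A ->
  (gauss \x gauss)%E [set z | A (s * z.1 + t * z.2)] =
  gauss [set y | A (Num.sqrt (s ^+ 2 + t ^+ 2) * y)].
Proof.
move=> s0 t0 A mA.
set q := Num.sqrt _.
have st0 : 0 < s ^+ 2 + t ^+ 2 by rewrite addr_gt0// exprn_gt0.
have q0 : 0 < q by rewrite sqrtr_gt0.
have mst : measurable_fun setT (fun z : R * R => s * z.1 + t * z.2).
  by apply: measurable_funD; apply: measurable_funM.
have mI : measurable_fun setT (fun x : R => (\1_A x : R)) by exact: measurable_indic.
transitivity (\int[(gauss \x gauss)%E]_z (\1_A (s * z.1 + t * z.2) : R)%:E)%E.
  rewrite (_ : (fun z => (\1_A (s * z.1 + t * z.2))%:E) =
     (fun z => (\1_[set z : R * R | A (s * z.1 + t * z.2)] z : R)%:E)).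
    rewrite integral_indic ?setIT//.
    by rewrite -[X in measurable X]setTI; exact: mst.
  by apply/funext => z; rewrite !indicE; congr (_%:R%:E).
rewrite fubini_tonelli1//=; last first.
  by apply/measurable_EFinP; exact: (measurableT_comp mI mst).
have mA' : @measurable _ (measurableTypeR R) A by [].
have inner y : (\int[gauss]_z (\1_A (s * y + t * z) : R)%:E =
    \int[mu]_w ((\1_A w : R)%:E * (normal_pdf (s * y) t w)%:E))%E.
  have maf : measurable_fun setT (fun z : R => s * y + t * z).
    by apply: measurable_funD => //; exact: measurable_funM.
  transitivity (gauss ((fun z => s * y + t * z) @^-1` A)).
    rewrite (_ : (fun z => (\1_A (s * y + t * z))%:E) =
      (fun z => (\1_((fun z => s * y + t * z) @^-1` A) z : R)%:E))//.
    rewrite integral_indic ?setIT//.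
    by rewrite -[X in measurable X]setTI; exact: maf.
  rewrite (normal_prob_affine (s * y) t0 mA) /normal_prob integral_mkcond.
  apply: eq_integral => w _; rewrite patchE indicE.
  by case: ifP => _; rewrite ?mul1e ?mul0e.
rewrite /fubini_F/=.
pose J (y w : measurableTypeR R) : \bar R :=
  ((\1_A w : R) * normal_pdf (s * y) t w * normal_pdf 0 1 y)%:E.
have JE y w : J y w =
    (((\1_A w * normal_pdf 0 q w)%R : R)%:E * (normal_pdf (s * w / q ^+ 2) (t / q) y)%:E)%E.
  rewrite /J -EFinM; congr EFin; have := normal_pdf_mul y w s0 t0.
  by rewrite /= -/q => h; rewrite -mulrA [normal_pdf (s * y) _ _ * _]mulrC h; ring.
have toR d' (T : measurableType d') (f : T -> R) :
    @measurable_fun _ _ T (measurableTypeR R) setT f -> measurable_fun setT f.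
  by move=> mf _ B mB; exact: mf.
have mpdf (sy : R) : @measurable_fun _ _ (measurableTypeR R) R setT (normal_pdf sy t).
  exact: measurable_normal_pdf.
have mJ : measurable_fun setT (fun z : measurableTypeR R * measurableTypeR R => J z.1 z.2).
  apply/measurable_EFinP.
  have m1 : measurable_fun setT (fun z : measurableTypeR R * measurableTypeR R => z.1 : R).
    by apply: toR; exact: measurable_fst.
  have m2 : measurable_fun setT (fun z : measurableTypeR R * measurableTypeR R => z.2 : R).
    by apply: toR; exact: measurable_snd.
  have mp (b : R) : measurable_fun setT (normal_pdf 0 b : R -> R).
    by move=> _ B mB; exact: (measurable_normal_pdf 0 b).
  apply: measurable_funM; last exact: (measurableT_comp (mp 1) m1).
  apply: measurable_funM; first exact: (measurableT_comp mI m2).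
  rewrite (_ : (fun z => _) = (fun z : measurableTypeR R * measurableTypeR R => normal_pdf 0 t (z.2 - s * z.1))).
    apply: (measurableT_comp (mp t)); apply: measurable_funB => //.
    exact: measurable_funM.
  by apply/funext => z; rewrite !normal_pdfE ?gt_eqF// /normal_fun subr0.
have J0 y w : (0 <= J y w)%E.
  by rewrite lee_fin !mulr_ge0// normal_pdf_ge0.
transitivity (\int[mu]_y \int[mu]_w J y w)%E.
  under eq_integral do rewrite inner.
  rewrite ge0_integral_gauss; last 2 first.
  - rewrite (_ : (fun y => _) = fubini_F gauss (fun z => (\1_A (s * z.1 + t * z.2) : R)%:E)).
      apply: measurable_fun_fubini_tonelli_F => //.
      by apply/measurable_EFinP; exact: (measurableT_comp mI mst).
    by apply/funext => y; rewrite -inner.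
  - by move=> y; apply: integral_ge0 => w _; rewrite -EFinM lee_fin mulr_ge0// normal_pdf_ge0.
  apply: eq_integral => y _; rewrite -ge0_integralZr//.
  - apply: emeasurable_funM; apply/measurable_EFinP; first exact: mfunR.
    exact: mpdf.
  - by move=> w _; rewrite -EFinM lee_fin mulr_ge0// normal_pdf_ge0.
  - by rewrite lee_fin normal_pdf_ge0.
transitivity (\int[mu]_w \int[mu]_y J y w)%E.
  exact: (@fubini_tonelli _ _ _ _ R mu mu (fun z => J z.1 z.2)).
transitivity (gauss ((fun y => 0 + q * y) @^-1` A)); last first.
  by congr (gauss _); apply/seteqP; split => y /=; rewrite add0r.
rewrite (normal_prob_affine 0 q0 mA) /normal_prob [RHS]integral_mkcond.
apply: eq_integral => w _.
under eq_integral do rewrite JE.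
rewrite ge0_integralZl//.
- rewrite integral_normal_pdf mule1 patchE indicE.
  by case: ifP => _; rewrite ?mul1r ?mul0r.
- by apply/measurable_EFinP; exact: measurable_normal_pdf.
- by move=> y _; rewrite lee_fin normal_pdf_ge0.
- by rewrite lee_fin mulr_ge0// normal_pdf_ge0.
Qed.

Lemma gauss_affine_law (m s : R) : 0 <= s ->
  has_law gauss (fun y => m + s * y) (gaussian_law m s).
Proof.
rewrite le_eqVlt => /predU1P[<-|s0]; last first.
  by rewrite /gaussian_law gt_eqF//; exact: normal_prob_affine.
rewrite /gaussian_law eqxx => A mA; rewrite diracE.
have [mA'|mA'] := boolP (m \in A).
  rewrite (_ : _ @^-1` A = setT) ?probability_setT//.
  by apply/seteqP; split => // y _ /=; rewrite mul0r addr0; exact/set_mem.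
rewrite (_ : _ @^-1` A = set0) ?measure0//.
apply/seteqP; split => // y /=; rewrite mul0r addr0 => Am.
by move/negP: mA'; apply; exact/mem_set.
Qed.

(** Integrating the factorisation [normal_pdf_mul]: one of the two densities on its
    right-hand side integrates to [1]. *)
Lemma gauss_stable (s t : R) (phi : R -> R) : 0 <= s -> 0 <= t -> bmf phi ->
  \int[gauss]_y \int[gauss]_z phi (s * y + t * z) =
  \int[gauss]_y phi (Num.sqrt (s ^+ 2 + t ^+ 2) * y).
Proof.
rewrite le_eqVlt => /predU1P[<-|s0].
  move=> t0 bphi; rewrite expr0n add0r sqrtr_sqr ger0_norm//.
  under eq_Rintegral => y _.
    under eq_Rintegral => z _ do rewrite mul0r add0r.
    over.
  by rewrite expect_cst.
rewrite le_eqVlt => /predU1P[<-|t0] bphi.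
  rewrite expr0n addr0 sqrtr_sqr gtr0_norm//; apply: eq_Rintegral => y _.
  under eq_Rintegral => z _ do rewrite mul0r addr0.
  by rewrite expect_cst.
set q := Num.sqrt _.
have mst : measurable_fun setT (fun z : R * R => s * z.1 + t * z.2).
  by apply: measurable_funD; apply: measurable_funM.
have mq : measurable_fun setT (fun y : R => q * y) by exact: measurable_funM.
rewrite -(expect_law gauss mq bphi) -(expect_prod gauss gauss (bmf_comp bphi mst)).
have -> : \int[(gauss \x gauss)%E]_z phi (s * z.1 + t * z.2) =
    \int[law (gauss \x gauss)%E mst]_x phi x by rewrite expect_law.
congr fine; apply: eq_measure_integral => A mA _.
exact: normal_stable_pos.
Qed.

(** The exponential tilt of a Gaussian density is a translate of it. *)
Lemma gauss_mgf (l : R) :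
  (\int[gauss]_y (expR (l * y))%:E)%E = (expR (l ^+ 2 / 2))%:E.
Proof.
rewrite ge0_integral_gauss; last 2 first.
- by apply/measurable_EFinP; apply: measurableT_comp => //; exact: measurable_funM.
- by move=> y; rewrite lee_fin expR_ge0.
under eq_integral => y _.
  rewrite -EFinM (_ : expR (l * y) * _ = expR (l ^+ 2 / 2) * normal_pdf l 1 y); last first.
    rewrite !normal_pdfE ?oner_eq0// mulrCA [RHS]mulrCA; congr (_ * _).
    by rewrite /normal_fun -!expRD; congr expR; field.
  rewrite EFinM; over.
rewrite ge0_integralZl ?integral_normal_pdf ?mule1//.
- by apply/measurable_EFinP; exact: measurable_normal_pdf.
- by move=> y _; rewrite lee_fin normal_pdf_ge0.
Qed.

Lemma gauss_exp_abs : (\int[gauss]_y (expR `|y|)%:E < +oo)%E.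
Proof.
have m1 (l : R) : measurable_fun setT (fun y : R => (expR (l * y))%:E).
  by apply/measurable_EFinP; apply: measurableT_comp => //; exact: measurable_funM.
apply: (@le_lt_trans _ _ (\int[gauss]_y ((expR (1 * y))%:E + (expR (- 1 * y))%:E))%E).
  apply: ge0_le_integral => //.
  - by apply/measurable_EFinP; apply: measurableT_comp.
  - by apply: emeasurable_funD; exact: m1.
  - move=> y _; rewrite -EFinD lee_fin mul1r mulN1r.
    have := expR_ge0 y; have := expR_ge0 (- y).
    by case: (leP 0 y) => ?; [rewrite ger0_norm//|rewrite ltr0_norm//]; lra.
by rewrite ge0_integralD//= !gauss_mgf -EFinD ltry.
Qed.

Lemma gauss_integrable (f : R -> R) c : measurable_fun setT f ->
  (forall y, `|f y| <= c * expR `|y|) -> gauss.-integrable setT (EFin \o f).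
Proof.
move=> mf fc; have c0 : 0 <= c.
  by have := fc 0; rewrite normr0 expR0 mulr1; apply: le_trans.
apply/integrableP; split; first exact/measurable_EFinP.
apply: (@le_lt_trans _ _ (\int[gauss]_y (c%:E * (expR `|y|)%:E))%E).
  apply: ge0_le_integral => //.
  - by apply/measurable_EFinP; exact: measurableT_comp.
  - apply: emeasurable_funM => //.
    by apply/measurable_EFinP; apply: measurableT_comp.
  - by move=> y _; rewrite /= lee_fin fc.
rewrite ge0_integralZl//.
- by rewrite lte_mul_pinfty// ?lee_fin//; exact: gauss_exp_abs.
- by apply/measurable_EFinP; apply: measurableT_comp.
Qed.

Lemma normr_le_expR (y : R) : `|y| <= expR `|y|.
Proof. by have := expR_ge1Dx `|y|; lra. Qed.

Lemma pow_le_expR n (y : R) : `|y| ^+ n <= n.+1%:R ^+ n * expR `|y|.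
Proof.
have h : `|y| / n.+1%:R <= expR (`|y| / n.+1%:R).
  by set z := _ / _; have := expR_ge1Dx z; lra.
have n0 : 0 < n.+1%:R :> R by rewrite ltr0n.
have -> : `|y| ^+ n = n.+1%:R ^+ n * (`|y| / n.+1%:R) ^+ n.
  by rewrite -exprMn mulrC divfK// gt_eqF.
rewrite ler_wpM2l ?exprn_ge0//.
apply: (@le_trans _ _ (expR (`|y| / n.+1%:R) ^+ n)).
  by rewrite lerXn2r ?nnegrE ?divr_ge0 ?expR_ge0.
rewrite -expRM_natl ler_expR mulrCA ler_piMr// ler_pdivrMr// mul1r ler_nat.
exact: leqnSn.
Qed.

Lemma integral_gauss (f : R -> R) : gauss.-integrable setT (EFin \o f) ->
  (\int[gauss]_x (f x)%:E = \int[mu]_x (f x * normal_pdf 0 1 x)%:E)%E.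
Proof.
move=> intf; have mf : measurable_fun setT (EFin \o f) by case/integrableP: intf.
rewrite integralE [RHS]integralE; congr (_ - _)%E.
  rewrite ge0_integral_gauss//; last exact: measurable_funepos.
  apply: eq_integral => x _; rewrite !funeposE/= EFinM.
  by rewrite maxe_pMl ?lee_fin ?normal_pdf_ge0// mul0e.
rewrite ge0_integral_gauss//; last exact: measurable_funeneg.
apply: eq_integral => x _; rewrite !funenegE/= -mulNr EFinM.
by rewrite maxe_pMl ?lee_fin ?normal_pdf_ge0// mul0e.
Qed.

Lemma is_derive_normal_pdf (y : R) :
  is_derive y 1 (normal_pdf 0 1 : R -> R) (- y * normal_pdf 0 1 y).
Proof.
have -> : (normal_pdf 0 1 : R -> R) =
    normal_peak 1 *: (expR \o (fun z : R => - 2^-1 * z ^+ 2)).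
  apply/funext => z; rewrite normal_pdfE ?oner_eq0//= /normal_fun.
  by congr (_ * expR _); field.
have h1 : is_derive y 1 (fun z : R => - 2^-1 * z ^+ 2) (- y).
  have h : is_derive y 1 ((id : R -> R) ^+ 2) ((2%:R * y ^+ 1) *: 1).
    exact: is_deriveX.
  have h' : is_derive y 1 (- 2^-1 *: ((id : R -> R) ^+ 2)) (- 2^-1 *: ((2%:R * y ^+ 1) *: 1)).
    exact: is_deriveZ.
  rewrite (_ : - y = - 2^-1 *: ((2%:R * y ^+ 1) *: 1)).
    by rewrite (_ : (fun z => _) = - 2^-1 *: ((id : R -> R) ^+ 2)).
  by rewrite /GRing.scale/=; field.
have h2 : is_derive (- 2^-1 * y ^+ 2) 1 (expR : R -> R) (expR (- 2^-1 * y ^+ 2)).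
  exact: is_derive_expR.
have h3 := is_derive1_comp (f := expR) (g := fun z : R => - 2^-1 * z ^+ 2) h2 h1.
set k := normal_peak 1 : R.
rewrite (_ : - y * _ = k *: (expR (- 2^-1 * y ^+ 2) * - y)).
  exact: is_deriveZ.
rewrite (_ : (k *: _) y = k * expR (- 2^-1 * y ^+ 2))//.
by rewrite /GRing.scale/=; ring.
Qed.

(** Moments that are total derivatives against the density vanish. *)
Lemma gauss_moment0 (F f : R -> R) c :
  continuous f -> (forall y, `|f y| <= c * expR `|y|) ->
  (forall y : R, is_derive y 1 F (f y * normal_pdf 0 1 y)) ->
  (fun n : nat => F n%:R - F (- n%:R)) @ \oo --> 0 ->
  \int[gauss]_y f y = 0.
Proof.
move=> cf fc dF F0; have mf : measurable_fun setT f by exact: continuous_measurable_fun.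
have intf := gauss_integrable mf fc.
pose I (n : nat) := `[- (n.+1%:R : R), n.+1%:R]%classic.
have mI n : measurable (I n) by exact: measurable_itv.
pose u (n : nat) y := (f y * \1_(I n) y)%:E.
have mu_ n : measurable_fun setT (u n).
  by apply/measurable_EFinP; apply: measurable_funM => //; exact: measurable_indic.
have ub n y : (`|u n y| <= (`|f y|)%:E)%E.
  rewrite lee_fin normrM ler_piMr// indicE ger0_norm// lern1.
  by case: (_ \in _).
have cvu : {ae gauss, forall x : R, setT x -> u ^~ x @ \oo --> (f x)%:E}.
  apply: aeW => x _; apply: cvg_near_cst.
  exists (Num.truncn `|x|) => // n /= xn; apply/eqP; rewrite /u indicE mem_set ?mulr1//.
  rewrite /I/= in_itv/= -ler_norml ltW// (lt_le_trans (truncnS_gt _))//.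
  by rewrite ler_nat ltnS.
have mF : measurable_fun setT (EFin \o f) by exact/measurable_EFinP.
have [_ _ cv] := dominated_convergence (mu := gauss) measurableT mu_ mF cvu
  (integrable_norm intf) (aeW _ (fun x n _ => ub n x)).
have uE n : (\int[gauss]_y u n y = (F n.+1%:R - F (- n.+1%:R))%:E)%E.
  rewrite /u integral_gauss; last first.
    apply: (@gauss_integrable _ c).
      by apply: measurable_funM => //; exact: measurable_indic.
    move=> y; apply: le_trans (fc y).
    by have := ub n y; rewrite lee_fin.
  transitivity (\int[mu]_(y in I n) (f y * normal_pdf 0 1 y)%:E)%E.
    rewrite [RHS]integral_mkcond; apply: eq_integral => y _.
    by rewrite patchE indicE; case: ifP => _; rewrite ?mulr1 ?mulr0 ?mul0r.
  have n0 : - n.+1%:R < n.+1%:R :> R by rewrite -subr_gt0 opprK addr_gt0// ltr0n.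
  apply: (@continuous_FTC2 _ (fun y => f y * normal_pdf 0 1 y) F) => //.
  - apply: continuous_subspaceT => y; apply: cvgM; first exact: cf.
    exact: (continuous_normal_pdf (oner_neq0 R)).
  - have cF : continuous F.
      move=> z; apply: differentiable_continuous; apply/derivable1_diffP.
      by have [] := dF z.
    split; first by move=> y _; have [] := dF y.
    + exact/cvg_at_right_filter/cF.
    + exact/cvg_at_left_filter/cF.
  - by move=> y _; rewrite derive1E; have [] := dF y.
have cv' : (fun n => (F n.+1%:R - F (- n.+1%:R))%:E) @ \oo --> (0 : R)%:E.
  apply: cvg_EFin; first by near=> n.
  rewrite (_ : _ \o _ = (fun n : nat => F n.+1%:R - F (- n.+1%:R)))//.
  by rewrite -cvg_shiftS in F0.
rewrite /Rintegral.
have -> : (\int[gauss]_x (f x)%:E = (0 : R)%:E)%E.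
  apply: (cvg_unique _ _ cv'); first exact: ereal_hausdorff.
  by move: cv; rewrite (_ : [sequence _]_n = fun n => (F n.+1%:R - F (- n.+1%:R))%:E)//;
    apply/funext => n; exact: uE.
by [].
Unshelve. all: by end_near. Qed.

Lemma normal_pdfN (y : R) : normal_pdf 0 1 (- y) = normal_pdf 0 1 y.
Proof. by rewrite !normal_pdfE ?oner_eq0// /normal_fun !subr0 sqrrN. Qed.

Lemma gauss_mean : \int[gauss]_y y = 0.
Proof.
apply: (@gauss_moment0 (fun y => - normal_pdf 0 1 y) id 1).
- by move=> y; exact: cvg_id.
- by move=> y; rewrite mul1r; exact: normr_le_expR.
- move=> y; have := is_deriveN (is_derive_normal_pdf y).
  by rewrite mulNr opprK.
- rewrite (_ : (fun n => _) = fun=> 0); first exact: cvg_cst.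
  by apply/funext => n; rewrite normal_pdfN subrr.
Qed.

Lemma gauss_sqr_integrable : gauss.-integrable setT (EFin \o (fun y : R => y ^+ 2)).
Proof.
apply: (@gauss_integrable _ (3%:R ^+ 2)); first exact: measurable_funX.
by move=> y; rewrite normrX; exact: pow_le_expR.
Qed.

Lemma gauss_var : \int[gauss]_y (y ^+ 2) = 1.
Proof.
have : \int[gauss]_y (1 - y ^+ 2) = 0.
  apply: (@gauss_moment0 (fun y => y * normal_pdf 0 1 y) _ (1 + 3%:R ^+ 2)).
  - by move=> y; apply: cvgB; [exact: cvg_cst|exact: exprn_continuous].
  - move=> y; rewrite mulrDl (le_trans (ler_normB _ _))// lerD//.
      by rewrite normr1 mul1r -expR0 ler_expR.
    by rewrite normrX; exact: pow_le_expR.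
  - move=> y; have := is_deriveM (is_derive_id y (1 : R)) (is_derive_normal_pdf y).
    rewrite (_ : (1 - y ^+ 2) * normal_pdf 0 1 y =
      y *: (- y * normal_pdf 0 1 y) + normal_pdf 0 1 y *: 1)//.
    by rewrite /GRing.scale/=; ring.
  - rewrite (_ : (fun n : nat => _) = fun n : nat => 2 * (n%:R * normal_pdf 0 1 n%:R)); last first.
      by apply/funext => n; rewrite normal_pdfN; ring.
    rewrite -[X in _ --> X](mulr0 2); apply: cvgMr.
    rewrite -cvg_shiftS /=; set k := normal_peak 1 : R.
    have k0 : 0 <= k by exact: normal_peak_ge0.
    apply: (@squeeze_cvgr _ _ _ _ (fun=> 0) (fun n => 2 * k * harmonic n)).
    + near=> n; have n0 : 0 < n.+1%:R :> R by rewrite ltr0n.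
      rewrite mulr_ge0 ?ler0n ?normal_pdf_ge0//=.
      rewrite normal_pdfE ?oner_eq0// /normal_fun subr0 expr1n mulr2n -/k.
      set e := expR _.
      have e0 : 0 < e by exact: expR_gt0.
      have h1 : e * expR (n.+1%:R ^+ 2 / (1 + 1)) = 1.
        by rewrite /e -expRD mulNr addNr expR0.
      have h2 := expR_ge1Dx (n.+1%:R ^+ 2 / (1 + 1) : R).
      have h3 : e * (n.+1%:R ^+ 2 / (1 + 1)) <= 1.
        by rewrite -[leRHS]h1 ler_pM2l// (le_trans _ h2)// lerDr ler01.
      rewrite /harmonic/= ler_pdivlMr//.
      set N := n.+1%:R.
      have -> : N * (k * e) * N = (1 + 1) * (k * (e * (N ^+ 2 / (1 + 1)))) by field.
      by rewrite ler_wpM2l// -[leRHS]mulr1 ler_wpM2l.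
    + exact: cvg_cst.
    + by rewrite -[X in _ --> X](mulr0 (2 * k)); apply: cvgMr; exact: cvg_harmonic.
rewrite RintegralB//; last exact: gauss_sqr_integrable.
  by rewrite expect_cst; lra.
exact: (bmf_integrable gauss (bmf_cst _ 1)).
Unshelve. all: by end_near. Qed.

End Gauss.

(** * The central limit theorem *)

Section Smooth.
Context (R : realType).

(** Bounded functions with a second-order expansion that is uniform in the
    base point. *)
Definition smooth3 (phi : R -> R) (C : R) : Prop :=
  exists phi1 phi2 : R -> R, [/\ bmf phi, bmf phi1, bmf phi2 &
    forall x y, `|phi (x + y) - phi x - phi1 x * y - phi2 x * (y ^+ 2 / 2)|
      <= C * `|y| ^+ 3].

Lemma smooth3_bmf phi C : smooth3 phi C -> bmf phi.
Proof. by move=> [phi1 [phi2 []]]. Qed.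

Lemma smooth3_cst c : smooth3 (fun=> c) 0.
Proof.
exists (fun=> 0), (fun=> 0); split; try exact: bmf_cst.
by move=> x y; rewrite subrr !mul0r !subr0 normr0.
Qed.

Lemma smooth3D phi psi C D : smooth3 phi C -> smooth3 psi D ->
  smooth3 (fun x => phi x + psi x) (C + D).
Proof.
move=> [f1 [f2 [bf bf1 bf2 hf]]] [g1 [g2 [bg bg1 bg2 hg]]].
exists (fun x => f1 x + g1 x), (fun x => f2 x + g2 x).
split; try exact: bmfD.
move=> x y; have -> : phi (x + y) + psi (x + y) - (phi x + psi x) -
    (f1 x + g1 x) * y - (f2 x + g2 x) * (y ^+ 2 / 2) =
  (phi (x + y) - phi x - f1 x * y - f2 x * (y ^+ 2 / 2)) +
  (psi (x + y) - psi x - g1 x * y - g2 x * (y ^+ 2 / 2)) by ring.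
by rewrite mulrDl (le_trans (ler_normD _ _))// lerD.
Qed.

Lemma smooth3Z c phi C : smooth3 phi C -> smooth3 (fun x => c * phi x) (`|c| * C).
Proof.
move=> [f1 [f2 [bf bf1 bf2 hf]]].
exists (fun x => c * f1 x), (fun x => c * f2 x).
split; try exact: bmfZ.
move=> x y; have -> : c * phi (x + y) - c * phi x - c * f1 x * y -
    c * f2 x * (y ^+ 2 / 2) =
  c * (phi (x + y) - phi x - f1 x * y - f2 x * (y ^+ 2 / 2)) by ring.
by rewrite normrM -[leRHS]mulrA; apply: ler_wpM2l.
Qed.

Lemma smooth3_sum (I : Type) (s : seq I) (F : I -> R -> R) (C : I -> R) :
  (forall i, smooth3 (F i) (C i)) ->
  exists D, smooth3 (fun x => \sum_(i <- s) F i x) D.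
Proof.
move=> hF; elim: s => [|i s [D IH]].
  by exists 0; under eq_fun do rewrite big_nil; exact: smooth3_cst.
exists (C i + D); under eq_fun do rewrite big_cons; exact: smooth3D.
Qed.

(** Averaging over an independent shift keeps the expansion. *)
Lemma smooth3_avg d (T : measurableType d) (P : probability T R) (U : T -> R)
    phi C : measurable_fun setT U -> smooth3 phi C ->
  smooth3 (fun x => \int[P]_w phi (x + U w)) C.
Proof.
move=> mU [f1 [f2 [bf bf1 bf2 hf]]].
have bavg g : bmf g -> bmf (fun x : R => \int[P]_w g (x + U w)).
  move=> bg; apply: (bmf_fubini_F (gauss R) P (f := fun z : R * T => g (z.1 + U z.2))).
  apply: (bmf_comp bg); apply: measurable_funD; first exact: measurable_fst.
  exact: (measurableT_comp mU measurable_snd).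
have bsh (g : R -> R) (x : R) : bmf g -> bmf (fun w => g (x + U w)).
  by move=> bg; apply: (bmf_comp bg); exact: measurable_funD.
exists (fun x => \int[P]_w f1 (x + U w)), (fun x => \int[P]_w f2 (x + U w)).
split; try exact: bavg.
move=> x y; have b0 := bsh _ (x + y) bf; have b1 := bsh _ x bf.
have b2 := bsh _ x bf1; have b3 := bsh _ x bf2.
rewrite [_ * y]mulrC [_ * (_ / _)]mulrC -!expectZ// -!expectB//; last 4 first.
- by apply: bmfB; [exact: bmfB|exact: bmfZ].
- exact: bmfZ.
- exact: bmfB.
- exact: bmfZ.
apply: expect_norm_le.
  by apply: bmfB; [apply: bmfB; [exact: bmfB|exact: bmfZ]|exact: bmfZ].
move=> w; have := hf (x + U w) y.
by rewrite (_ : x + U w + y = x + y + U w) 1?[f1 _ * _]mulrC 1?[f2 _ * _]mulrC//; ring.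
Qed.

Lemma deriv_bound (f df : R -> R) (y M : R) :
  (forall z : R, is_derive z 1 f (df z)) ->
  (forall z, `|z| <= `|y| -> `|df z| <= M) -> `|f y - f 0| <= M * `|y|.
Proof.
move=> fdf dM.
have cf : continuous f.
  move=> z; apply: differentiable_continuous; apply/derivable1_diffP.
  by have [] := fdf z.
have [y0|y0|->] := ltgtP y 0; last by rewrite subrr !normr0 mulr0.
- have [c cy E] := @MVT _ f df y 0 y0 (fun x _ => fdf x) (continuous_subspaceT cf).
  rewrite distrC E normrM sub0r normrN ler_wpM2r// dM//.
  by move: cy; rewrite in_itv/= => /andP[? ?]; rewrite !ler0_norm; lra.
- have [c cy E] := @MVT _ f df 0 y y0 (fun x _ => fdf x) (continuous_subspaceT cf).
  rewrite E normrM subr0 ler_wpM2r// dM//.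
  by move: cy; rewrite in_itv/= => /andP[? ?]; rewrite !ger0_norm; lra.
Qed.

Lemma is_derive_shift (f : R -> R) (x z d : R) : is_derive (x + z) 1 f d ->
  is_derive z 1 (fun z => f (x + z)) d.
Proof.
move=> h; have h1 : is_derive z 1 (fun z : R => x + z) 1.
  have h2 := is_deriveD (is_derive_cst x z (1 : R)) (is_derive_id z (1 : R)).
  by rewrite add0r in h2.
have := is_derive1_comp (f := f) (g := fun z : R => x + z) h h1.
by rewrite /GRing.scale/= mulr1.
Qed.

(** Taylor's formula: the third derivative controls the remainder. *)
Lemma smooth3_deriv (f f1 f2 f3 : R -> R) C :
  (forall z : R, is_derive z 1 f (f1 z)) -> (forall z : R, is_derive z 1 f1 (f2 z)) ->
  (forall z : R, is_derive z 1 f2 (f3 z)) -> bmf f -> bmf f1 -> bmf f2 ->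
  (forall z, `|f3 z| <= C) -> smooth3 f C.
Proof.
move=> d1 d2 d3 bf bf1 bf2 f3C; exists f1, f2; split => // x y.
have is_lin (a : R) (z : R) : is_derive z 1 (fun z => a * z) a.
  have := is_deriveZ a (is_derive_id z (1 : R)).
  by rewrite /GRing.scale/= mulr1.
have is_sq (a : R) (z : R) : is_derive z 1 (fun z => a * (z ^+ 2 / 2)) (a * z).
  have h : is_derive z 1 ((id : R -> R) ^+ 2) ((2%:R * z ^+ 1) *: 1).
    exact: is_deriveX.
  have := is_deriveZ (a / 2) h; rewrite (_ : (fun z => a * (z ^+ 2 / 2)) = (a / 2) *: (id : R -> R) ^+ 2).
    by rewrite /GRing.scale/= (_ : a / 2 * (2 * z ^+ 1 * 1) = a * z)//; field.
  by apply/funext => u; change (a * (u ^+ 2 / 2) = a / 2 * (u ^+ 2)); field.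
have s2 (z : R) : `|f2 (x + z) - f2 x| <= C * `|z|.
  have := @deriv_bound (fun z => f2 (x + z)) (fun z => f3 (x + z)) z C.
  by rewrite addr0; apply => // u; exact: is_derive_shift.
pose r1 z := f1 (x + z) - f1 x - f2 x * z.
have s1 z : `|z| <= `|y| -> `|r1 z| <= C * `|y| ^+ 2.
  move=> zy; have := @deriv_bound r1 (fun z => f2 (x + z) - f2 x) z (C * `|y|).
  have r10 : r1 0 = 0 by rewrite /r1 addr0 mulr0 subrr subr0.
  rewrite r10 subr0 => h; have y0 := normr_ge0 y.
  have C0 : 0 <= C by exact: le_trans (f3C 0).
  apply: (@le_trans _ _ (C * `|y| * `|z|)); last first.
    by rewrite -mulrA expr2 ler_wpM2l// ler_wpM2l.
  apply: h => u; last first.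
    by move=> uz; apply: (le_trans (s2 u)); rewrite ler_wpM2l// (le_trans uz).
  rewrite -[X in is_derive _ _ _ (X - _)]subr0.
  exact: (is_deriveB (is_deriveB (is_derive_shift (d2 _)) (is_derive_cst (f1 x) u (1 : R))) (is_lin (f2 x) u)).
pose r0 z := f (x + z) - f x - f1 x * z - f2 x * (z ^+ 2 / 2).
have := @deriv_bound r0 r1 y (C * `|y| ^+ 2).
have -> : r0 0 = 0 by rewrite /r0 addr0 expr0n !(mul0r, mulr0) subrr !subr0.
rewrite subr0 -mulrA -exprSr; apply => // u.
rewrite /r1 -[f1 (x + u)]subr0.
exact: (is_deriveB (is_deriveB (is_deriveB (is_derive_shift (d1 _))
  (is_derive_cst (f x) u (1 : R))) (is_lin (f1 x) u)) (is_sq (f2 x) u)).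
Qed.

Definition logistic (x : R) : R := (1 + expR (- x))^-1.

Lemma logistic01 x : 0 < logistic x < 1.
Proof.
have e0 := expR_gt0 (- x); rewrite /logistic invr_gt0 invf_lt1; lra.
Qed.

Lemma is_derive_logistic (x : R) :
  is_derive x 1 logistic (logistic x * (1 - logistic x)).
Proof.
have e0 := expR_gt0 (- x).
have h1 : is_derive x 1 (-%R : R -> R) (-1).
  exact: (is_deriveN (is_derive_id x (1 : R))).
have h2 := is_derive1_comp (f := expR) (g := -%R : R -> R) (is_derive_expR (- x)) h1.
have h3 := is_deriveD (is_derive_cst (1 : R) x (1 : R)) h2.
have n0 : (cst (1 : R) + (expR \o -%R)) x != 0.
  change (1 + expR (- x) != 0); rewrite gt_eqF//; lra.
have h4 := is_deriveV n0 h3.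
rewrite (_ : logistic = (fun y => ((cst (1 : R) + (expR \o -%R)) y)^-1))//.
rewrite (_ : _ * (1 - _) = - (cst (1 : R) + (expR \o -%R)) x ^- 2 *: (0 + expR (- x) * -1))//.
change (logistic x * (1 - logistic x) = - (1 + expR (- x)) ^- 2 * (0 + expR (- x) * -1)).
by rewrite /logistic; field; rewrite gt_eqF//; lra.
Qed.

Lemma measurable_logistic : measurable_fun setT logistic.
Proof.
apply: continuous_measurable_fun => z; apply: differentiable_continuous.
by apply/derivable1_diffP; have [] := is_derive_logistic z.
Qed.

Lemma smooth3_logistic : smooth3 logistic 1.
Proof.
pose s := logistic.
have ds (z : R) : is_derive z 1 s (s z * (1 - s z)) by exact: is_derive_logistic.
have d1s (z : R) : is_derive z 1 (fun z => 1 - s z) (- (s z * (1 - s z))).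
  by have := is_deriveB (is_derive_cst (1 : R) z (1 : R)) (ds z); rewrite sub0r.
have d2s (z : R) : is_derive z 1 (fun z => s z * (1 - s z)) (s z * (1 - s z) * (1 - 2 * s z)).
  have := is_deriveM (ds z) (d1s z).
  rewrite (_ : s z * (1 - s z) * (1 - 2 * s z) =
    s z *: - (s z * (1 - s z)) + (1 - s z) *: (s z * (1 - s z)))//.
  by rewrite /GRing.scale/=; ring.
have d3s (z : R) : is_derive z 1 (fun z => 1 - 2 * s z) (- (2 * (s z * (1 - s z)))).
  have := is_deriveB (is_derive_cst (1 : R) z (1 : R)) (is_deriveZ 2 (ds z)).
  by rewrite sub0r.
have d4s (z : R) : is_derive z 1 (fun z => s z * (1 - s z) * (1 - 2 * s z))
    (s z * (1 - s z) * (1 - 6 * s z * (1 - s z))).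
  have := is_deriveM (d2s z) (d3s z).
  rewrite (_ : s z * (1 - s z) * (1 - 6 * s z * (1 - s z)) =
    (s z * (1 - s z)) *: - (2 * (s z * (1 - s z))) +
    (1 - 2 * s z) *: (s z * (1 - s z) * (1 - 2 * s z)))//.
  by rewrite /GRing.scale/=; ring.
have bs : bmf s.
  split; first exact: measurable_logistic.
  by exists 1 => z; have /andP[? ?] := logistic01 z; rewrite ger0_norm ltW.
have b1 : bmf (fun z => 1 - s z) by apply: bmfB => //; exact: bmf_cst.
have b3 : bmf (fun z => 1 - 2 * s z) by apply: bmfB; [exact: bmf_cst|exact: bmfZ].
apply: (smooth3_deriv ds d2s d4s) => //.
- exact: bmfM.
- by apply: bmfM => //; exact: bmfM.
- move=> z; have /andP[] := logistic01 z; rewrite -/s; set a := s z => a0 a1.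
  have q0 : 0 <= a * (1 - a) by rewrite mulr_ge0//; lra.
  have q1 : a * (1 - a) <= 4^-1.
    by have := sqr_ge0 (2 * a - 1); rewrite expr2; lra.
  rewrite -[6 * a * _]mulrA; move: q0 q1; set q := a * (1 - a) => q0 q1.
  rewrite ler_norml; apply/andP; split; nra.
Qed.

Lemma smooth3_scale (a l : R) : exists C, smooth3 (fun x => logistic (l * (x - a))) C.
Proof.
have [f1 [f2 [bf bf1 bf2 hf]]] := smooth3_logistic.
have bc g : bmf g -> bmf (fun x : R => g (l * (x - a))).
  by move=> bg; apply: (bmf_comp bg); apply: measurable_funM => //; exact: measurable_funB.
exists (`|l| ^+ 3), (fun x => l * f1 (l * (x - a))), (fun x => l ^+ 2 * f2 (l * (x - a))).
split; [exact: bc|by apply/bmfZ/bc|by apply/bmfZ/bc|].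
move=> x y; have := hf (l * (x - a)) (l * y).
rewrite (_ : l * (x - a) + l * y = l * (x + y - a)); last by ring.
rewrite mul1r normrM [(`|l| * `|y|) ^+ 3]exprMn (_ : logistic (l * (x + y - a)) - _ - _ - _ =
  logistic (l * (x + y - a)) - logistic (l * (x - a)) -
  l * f1 (l * (x - a)) * y - l ^+ 2 * f2 (l * (x - a)) * (y ^+ 2 / 2)); last by ring.
by [].
Qed.

Lemma logistic_tail (l x : R) : 0 < l -> 0 < x ->
  logistic (- (l * x)) <= (l * x)^-1 /\ 1 - logistic (l * x) <= (l * x)^-1.
Proof.
move=> l0 x0; have lx : 0 < l * x by exact: mulr_gt0.
have h : 1 + l * x <= expR (l * x) by exact: expR_ge1Dx.
have e0 := expR_gt0 (l * x).
have E : 1 - logistic (l * x) = logistic (- (l * x)).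
  rewrite /logistic opprK expRN; field; rewrite !gt_eqF//=; lra.
rewrite E; suff : logistic (- (l * x)) <= (l * x)^-1 by [].
by rewrite /logistic opprK lef_pV2 ?posrE; lra.
Qed.

(** Heine's theorem for the restriction of [h] to [[-K, K]]. *)
Lemma clamp_unif (h : R -> R) (K e : R) : 0 <= K -> continuous h -> 0 < e ->
  exists2 D, 0 < D & forall x y, `|x - y| <= D ->
    `|h (clamp K x) - h (clamp K y)| <= e.
Proof.
move=> K0 ch e0.
have cK : compact `[- K, K]%classic by exact: segment_compact.
have /compact_near_coveringP cov := cK.
have : \forall d \near (0:R)^'+, `[- K, K]%classic `<=`
    [set x | forall y, `|x - y| <= d -> `|h x - h y| <= e].
  apply: (cov R ((0:R)^'+) (fun d x => forall y, `|x - y| <= d -> `|h x - h y| <= e)) => x xK.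
  have e20 : 0 < e / 2 by rewrite divr_gt0.
  have /cvgr_dist_lt/(_ _ e20) [a /= a0 ha] := ch x.
  have a20 : 0 < a / 2 by rewrite divr_gt0.
  exists (ball x (a / 2), [set d | d < a / 2]) => /=.
    split; first exact: nbhsx_ballx.
    exact: nbhs_right_lt.
  move=> [z d] /= [xz da] y zy.
  have hz : `|h x - h z| < e / 2 by apply: ha => /=; move: xz; rewrite /ball/=; lra.
  have hy : `|h x - h y| < e / 2.
    apply: ha => /=; move: xz; rewrite /ball/= => xz.
    rewrite (_ : x - y = (x - z) + (z - y)); last by ring.
    by rewrite (le_lt_trans (ler_normD _ _))//; lra.
  rewrite (_ : h z - h y = (h x - h y) - (h x - h z)); last by ring.
  by rewrite (le_trans (ler_normB _ _))//; lra.
move=> [a /= a0 ha]; exists (a / 2); first by rewrite divr_gt0.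
move=> x y xy; apply: (ha (a / 2)) => /=.
- by rewrite sub0r normrN gtr0_norm ?divr_gt0//; lra.
- by rewrite divr_gt0.
- exact: clamp_itv.
- exact: le_trans (clamp_lip _ _ _) xy.
Qed.

(** A partition of unity made of differences of translated logistic functions,
    fine and steep enough, turns a bounded uniformly continuous function into
    a smooth one that is uniformly close. *)
Lemma smooth3_approx (h : R -> R) (K e : R) : 0 <= K -> continuous h -> 0 < e ->
  exists phi C, smooth3 phi C /\ forall x, `|phi x - h (clamp K x)| <= e.
Proof.
move=> K0 ch e0; have [B B0 hB] : exists2 B, 0 < B & forall x, `|h (clamp K x)| <= B.
  have [D D0 hD] := clamp_unif K0 ch (@ltr01 R).
  have cK : compact `[- K, K]%classic by exact: segment_compact.
  have hc : {within `[- K, K]%classic, continuous h} by exact: continuous_subspaceT.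
  have [M [_ HM]] := compact_bounded (continuous_compact hc cK).
  exists (`|M| + 1); first by rewrite ltr_pwDr.
  move=> x; apply: (HM (`|M| + 1)); first by rewrite ltr_pwDr// ler_norm.
  by exists (clamp K x) => //; exact: clamp_itv.
have e20 : 0 < e / 2 by rewrite divr_gt0.
have [D D0 hD] := clamp_unif K0 ch e20.
pose dl := D / 2; have dl0 : 0 < dl by rewrite divr_gt0.
pose N := Num.truncn (2 * K / dl) ; have hN : 2 * K < N.+1%:R * dl.
  by rewrite -ltr_pdivrMr//; exact: truncnS_gt.
pose t j : R := - K + j%:R * dl.
pose l : R := dl^-1 * (4 * B * N.+2%:R / e).
have l0 : 0 < l by rewrite mulr_gt0 ?invr_gt0// divr_gt0// !mulr_gt0 ?ltr0n.
pose s (j : nat) x := if j is j'.+1 then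
  (if (j' <= N)%N then logistic (l * (x - t j'.+1)) else 0) else 1.
(* [w j x] carries the value of [h] at [t j]; the weights sum to [1]. *)
pose w j x := s j x - s j.+1 x.
have tl j : t j.+1 = t j + dl by rewrite /t -natr1; ring.
have tm j k : (j <= k)%N -> t j <= t k.
  by move=> jk; rewrite /t lerD2l ler_pM2r// ler_nat.
have w0 j x : 0 <= w j x.
  rewrite /w /s; case: j => [|j].
    by rewrite leq0n subr_ge0; have /andP[_ /ltW] := logistic01 (l * (x - t 1)).
  have /andP[a0 a1] := logistic01 (l * (x - t j.+1)).
  have [jN|jN] := ltnP j N; last by case: ifP => _; rewrite subr0 ?lexx ?(ltW a0).
  rewrite (ltnW jN) subr_ge0 /logistic lef_pV2 ?posrE ?addr_gt0 ?expR_gt0//.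
  by rewrite lerD2l ler_expR lerN2 ler_pM2l// tl; lra.
have w1 x : \sum_(j < N.+2) w j x = 1.
  rewrite -(big_mkord xpredT (fun j => w j x)) /w.
  have := telescope_sumr (fun j => s j x) (leq0n N.+2).
  under eq_bigr do rewrite -opprB; rewrite sumrN => /(congr1 -%R).
  by move=> ->; rewrite /s /= ltnn; ring.
have s1 j x : s j x <= 1.
  case: j => [//|j]; rewrite /s; case: ifP => // _.
  by have /andP[_ /ltW] := logistic01 (l * (x - t j.+1)).
have s0 j x : 0 <= s j x.
  case: j => [//|j]; rewrite /s; case: ifP => // _.
  by have /andP[/ltW] := logistic01 (l * (x - t j.+1)).
have tail x : dl <= x -> (l * x)^-1 <= e / (4 * B * N.+2%:R).
  move=> dx; have N0 : 0 < N.+2%:R :> R by rewrite ltr0n.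
  rewrite -[leRHS]invf_div lef_pV2 ?posrE; last 2 first.
  - by rewrite mulr_gt0// (lt_le_trans dl0).
  - by rewrite divr_gt0// !mulr_gt0.
  rewrite /l [leRHS]mulrAC -[leLHS]mul1r ler_wpM2r//.
    by rewrite ltW// divr_gt0// !mulr_gt0.
  by rewrite mulrC ler_pdivlMr// mul1r.
have far j x : (j < N.+2)%N -> D < `|clamp K (t j) - clamp K x| ->
    w j x <= e / (4 * B * N.+2%:R).
  move=> jN; have Ddl : D = dl + dl by rewrite /dl; lra.
  have tK : - K <= t j by have := tm 0%N j isT; rewrite /t mul0r addr0.
  rewrite Ddl; have [ct|ct] := leP (clamp K x) (clamp K (t j)).
    rewrite ger0_norm ?subr_ge0// => tx.
    have [tx2 tK'] : dl <= t j - x /\ - K < t j.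
      have [[? h1]|[? h1]|[? h1]] := clampP K0 (t j);
      have [[? h2]|[? h2]|[? h2]] := clampP K0 x; move: tx; rewrite h1 h2; lra.
    case: j jN tx2 tK' {tK tx ct} => [|j jN tx2 _].
      by rewrite /t mul0r addr0 ltxx.
    apply: (@le_trans _ _ (s j.+1 x)); first by rewrite /w lerBlDr lerDl.
    rewrite !ltnS in jN; rewrite /s jN; have [+ _] := logistic_tail l0 (lt_le_trans dl0 tx2).
    by rewrite -mulrN opprB => /le_trans; apply; exact: tail.
  rewrite ltr0_norm ?subr_lt0// opprB => tx.
  have [tKK tx2] : t j < K /\ dl <= x - t j.+1.
    rewrite tl; have [[? h1]|[? h1]|[? h1]] := clampP K0 (t j);
    have [[? h2]|[? h2]|[? h2]] := clampP K0 x; move: tx; rewrite h1 h2; lra.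
  have jN' : (j <= N)%N.
    rewrite leqNgt; apply/negP => Nj; have := tm _ _ Nj.
    by move: hN tKK; rewrite {2}/t; lra.
  apply: (@le_trans _ _ (1 - s j.+1 x)); first by rewrite /w lerB.
  rewrite /s jN'; have [_] := logistic_tail l0 (lt_le_trans dl0 tx2).
  by move/le_trans; apply; exact: tail.
have ss j : exists C, smooth3 (fun x => h (clamp K (t j)) * w j x) C.
  suff [C hC] : exists C, smooth3 (fun x => w j x) C.
    by exists (`|h (clamp K (t j))| * C); exact: smooth3Z.
  have sj k : exists C, smooth3 (s k) C.
    case: k => [|k]; first by exists 0; exact: smooth3_cst.
    case kN : (k <= N)%N; rewrite /s/= kN; first exact: smooth3_scale.
    by exists 0; exact: smooth3_cst.
  have [C1 h1] := sj j; have [C2 h2] := sj j.+1.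
  exists (C1 + `|-1| * C2); rewrite /w.
  by under eq_fun do rewrite -mulN1r; apply: smooth3D => //; exact: smooth3Z.
have /choice[Cs hCs] := ss.
have [C hC] := smooth3_sum (index_enum 'I_N.+2) (fun j : 'I_N.+2 => hCs j).
exists (fun x => \sum_(j < N.+2) h (clamp K (t j)) * w j x), C; split => // x.
rewrite -[h (clamp K x)]mul1r -(w1 x) mulr_suml -sumrB.
apply: (le_trans (ler_norm_sum _ _ _)).
have N0 : 0 < N.+2%:R :> R by rewrite ltr0n.
apply: (@le_trans _ _ (\sum_(j < N.+2) (e / 2 * w j x + e / 2 / N.+2%:R))).
  apply: ler_sum => j _; rewrite -[w j x * _]mulrC -mulrBl normrM (ger0_norm (w0 _ _)).
  have c0 : 0 <= e / 2 / N.+2%:R by rewrite divr_ge0// ltW.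
  have [cl|cl] := leP `|clamp K (t j) - clamp K x| D.
    rewrite -[leLHS]addr0 lerD// ler_wpM2r//.
    have := hD (clamp K (t j)) (clamp K x) cl.
    by rewrite !(clamp_id (clamp_itv K0 _)).
  have ww := far _ _ (ltn_ord j) cl; rewrite -[leLHS]add0r lerD ?(mulr_ge0 (ltW e20))//.
  apply: (@le_trans _ _ ((B + B) * (e / (4 * B * N.+2%:R)))).
    by apply: ler_pM => //; rewrite (le_trans (ler_normB _ _))// lerD.
  by rewrite le_eqVlt; apply/orP; left; apply/eqP; field; rewrite !gt_eqF.
rewrite big_split/= -mulr_sumr w1 sumr_const card_ord -[X in _ + X]mulr_natr divfK ?gt_eqF//.
lra.
Qed.

End Smooth.

Section Fprob.
Context d (T : measurableType d) (R : realType) (P : probability T R).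

Lemma fprobU A B : measurable A -> measurable B ->
  fine (P (A `|` B)) <= fine (P A) + fine (P B).
Proof.
move=> mA mB; rewrite -lee_fin EFinD !prob_fine//; last exact: measurableU.
exact: (measureU2 P).
Qed.

Lemma fprob_bigU (I : Type) (s : seq I) (A : I -> set T) :
  (forall i, measurable (A i)) ->
  fine (P (\big[setU/set0]_(i <- s) A i)) <= \sum_(i <- s) fine (P (A i)).
Proof.
move=> mA; elim: s => [|i s IH]; first by rewrite !big_nil measure0.
rewrite !big_cons (le_trans (fprobU _ _))// ?lerD2l//.
exact: bigsetU_measurable.
Qed.

End Fprob.

(** The linear term vanishes in the mean, so the expectation depends on [U] through
    its variance only, up to the third moment. *)
Lemma smooth3_step d (T : measurableType d) (R : realType) (P : probability T R)
    (U : T -> R) (phi phi1 phi2 : R -> R) (C x : R) :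
  measurable_fun setT U ->
  P.-integrable setT (EFin \o U) -> P.-integrable setT (EFin \o (fun w => U w ^+ 2)) ->
  P.-integrable setT (EFin \o (fun w => `|U w| ^+ 3)) ->
  \int[P]_w U w = 0 -> bmf phi ->
  (forall x y, `|phi (x + y) - phi x - phi1 x * y - phi2 x * (y ^+ 2 / 2)|
      <= C * `|y| ^+ 3) ->
  `|\int[P]_w phi (x + U w) - (phi x + phi2 x / 2 * \int[P]_w (U w ^+ 2))| <=
    C * \int[P]_w (`|U w| ^+ 3).
Proof.
move=> mU i1 i2 i3 U0 bphi hphi.
have bp : bmf (fun w => phi (x + U w)).
  by apply: (bmf_comp bphi); exact: measurable_funD.
have i0 := bmf_integrable P bp.
have ic := bmf_integrable P (bmf_cst T (phi x)).
have j1 : P.-integrable setT (EFin \o (fun w => phi1 x * U w)).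
  by have := integrableZl measurableT (phi1 x) i1.
have j2 : P.-integrable setT (EFin \o (fun w => phi2 x / 2 * U w ^+ 2)).
  by have := integrableZl measurableT (phi2 x / 2) i2.
have j3 : P.-integrable setT (EFin \o (fun w => C * `|U w| ^+ 3)).
  by have := integrableZl measurableT C i3.
have k1 : P.-integrable setT (EFin \o (fun w => phi (x + U w) - phi x)).
  exact: (integrableB measurableT i0 ic).
have k2 : P.-integrable setT (EFin \o (fun w => phi (x + U w) - phi x - phi1 x * U w)).
  exact: (integrableB measurableT k1 j1).
have k3 : P.-integrable setT (EFin \o (fun w => phi (x + U w) - phi x - phi1 x * U w
    - phi2 x / 2 * U w ^+ 2)).
  exact: (integrableB measurableT k2 j2).
have -> : \int[P]_w phi (x + U w) - (phi x + phi2 x / 2 * \int[P]_w (U w ^+ 2)) =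
    \int[P]_w (phi (x + U w) - phi x - phi1 x * U w - phi2 x / 2 * U w ^+ 2).
  rewrite RintegralB// RintegralB// RintegralB// RintegralZl// U0 mulr0 subr0.
  by rewrite RintegralZl// expect_cst opprD addrA.
rewrite -RintegralZl//; apply: (le_trans (le_normr_Rintegral measurableT k3)).
apply: le_Rintegral => //; first exact: (integrable_abse k3).
by move=> w _; rewrite -[phi2 x / 2 * _]mulrA [2^-1 * _]mulrC; exact: hphi.
Qed.

Section Lindeberg.
Context d (Om : measurableType d) (R : realType) (Pr : probability Om R).
Context (I : choiceType) (Z : I -> Om -> R).
Hypothesis mZ : forall i, measurable_fun setT (Z i).
Hypothesis indZ : mutually_independent Pr Z.
Context (b : R) (b_ge0 : 0 <= b).
Hypothesis Zb : forall i w, `|Z i w| <= b.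
Hypothesis Z0 : forall i, \int[Pr]_w Z i w = 0.

Let v i := \int[Pr]_w (Z i w) ^+ 2.
Let m3 : R := \int[gauss R]_y (`|y| ^+ 3).

Let bZ i : bmf (Z i). Proof. by split => //; exists b. Qed.

Let bX n i : bmf (fun w => Z i w ^+ n).
Proof.
elim: n => [|n IH]; first by under eq_fun do rewrite expr0; exact: bmf_cst.
by under eq_fun do rewrite exprS; exact: bmfM.
Qed.

Let v_ge0 i : 0 <= v i.
Proof. by apply: Rintegral_ge0 => w _; exact: sqr_ge0. Qed.

Let v_le i : v i <= b ^+ 2.
Proof.
rewrite -[leRHS](expect_cst Pr); apply: expect_le => //; first exact: bmf_cst.
by move=> w; rewrite -real_normK ?num_real// lerXn2r ?nnegrE.
Qed.

Let m3_ge0 : 0 <= m3.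
Proof. by apply: Rintegral_ge0 => y _; exact: exprn_ge0. Qed.

Let gauss_pow_integrable n (c : R) : (gauss R).-integrable setT
  (EFin \o (fun y : R => (c * y) ^+ n)).
Proof.
apply: (@gauss_integrable _ _ (`|c| ^+ n * n.+1%:R ^+ n)).
  by apply: measurable_funX; exact: measurable_funM.
move=> y; rewrite normrX normrM exprMn -mulrA.
by apply: ler_wpM2l; [exact: exprn_ge0|exact: pow_le_expR].
Qed.

(** One summand is replaced by a Gaussian variable of the same variance; the
    expansions agree up to second order. *)
Let step i (c x : R) phi C : 0 <= c -> smooth3 phi C ->
  `|\int[Pr]_w phi (x + c * Z i w) -
    \int[gauss R]_y phi (x + c * Num.sqrt (v i) * y)| <= C * c ^+ 3 * b ^+ 3 * (1 + m3).
Proof.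
move=> c0 [phi1 [phi2 [bphi _ _ hphi]]].
have C0 : 0 <= C.
  by have := hphi 0 1; rewrite normr1 !expr1n !mulr1; apply: le_trans.
have bcZ : bmf (fun w => c * Z i w) by exact: bmfZ.
have A1 : `|\int[Pr]_w phi (x + c * Z i w) -
    (phi x + phi2 x / 2 * (c ^+ 2 * v i))| <= C * (c ^+ 3 * b ^+ 3).
  have bcX n : bmf (fun w => (c * Z i w) ^+ n).
    by under eq_fun do rewrite exprMn; exact: bmfZ.
  have bcN : bmf (fun w => `|c * Z i w| ^+ 3).
    by under eq_fun do rewrite -normrX; exact: bmf_norm.
  have := @smooth3_step _ _ _ Pr (fun w => c * Z i w) phi phi1 phi2 C x.
  rewrite expectZ// Z0 mulr0 (_ : \int[Pr]_w (c * Z i w) ^+ 2 = c ^+ 2 * v i); last first.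
    by rewrite -expectZ//; apply: eq_Rintegral => w _; rewrite exprMn.
  move=> h; apply: (le_trans (h _ _ _ _ erefl _ _)) => //.
  - by case: bcZ.
  - exact: bmf_integrable.
  - exact: bmf_integrable.
  - exact: bmf_integrable.
  - apply: ler_wpM2l => //; rewrite -[leRHS](expect_cst Pr); apply: expect_le => //.
      exact: bmf_cst.
    move=> w; rewrite -exprMn lerXn2r ?nnegrE ?mulr_ge0//.
    by rewrite normrM (ger0_norm c0) ler_wpM2l.
have A2 : `|\int[gauss R]_y phi (x + c * Num.sqrt (v i) * y) -
    (phi x + phi2 x / 2 * (c ^+ 2 * v i))| <= C * (c ^+ 3 * b ^+ 3 * m3).
  set s := c * Num.sqrt (v i).
  have s0 : 0 <= s by rewrite mulr_ge0// sqrtr_ge0.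
  have := @smooth3_step _ _ _ (gauss R) (fun y => s * y) phi phi1 phi2 C x.
  have i3 : (gauss R).-integrable setT (EFin \o (fun y : R => `|s * y| ^+ 3)).
    rewrite (_ : _ \o _ = abse \o (EFin \o (fun y : R => (s * y) ^+ 3))).
      exact: integrable_abse.
    by apply/funext => y /=; rewrite normrX.
  rewrite (_ : \int[gauss R]_y (s * y) ^+ 2 = c ^+ 2 * v i); last first.
    transitivity (\int[gauss R]_y (s ^+ 2 * y ^+ 2)).
      by apply: eq_Rintegral => y _; rewrite exprMn.
    rewrite RintegralZl//; last exact: gauss_sqr_integrable.
    by rewrite gauss_var mulr1 exprMn sqr_sqrtr.
  move=> h; apply: (le_trans (h _ _ _ _ _ _ _)) => //.
  - exact: measurable_funM.
  - by have := gauss_pow_integrable 1 s; under eq_fun do rewrite expr1.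
  - rewrite RintegralZl//; first by rewrite gauss_mean mulr0.
    have := gauss_pow_integrable 1 1; under eq_fun do rewrite expr1 mul1r.
    by [].
  - apply: ler_wpM2l => //.
    rewrite (_ : \int[gauss R]_w _ = s ^+ 3 * m3); last first.
      rewrite -RintegralZl//.
        by apply: eq_Rintegral => y _; rewrite normrM exprMn (ger0_norm s0).
      have := integrable_abse (gauss_pow_integrable 3 1).
      by congr (_.-integrable _ _); apply/funext => y /=; rewrite mul1r normrX.
    apply: ler_wpM2r => //; rewrite exprMn ler_wpM2l ?exprn_ge0//.
    rewrite lerXn2r ?nnegrE ?sqrtr_ge0// -(ger0_norm b_ge0) -sqrtr_sqr.
    by rewrite ler_wsqrtr// -/(v i) v_le.
set p := phi x + _ in A1 A2.
rewrite (_ : _ - _ = (\int[Pr]_w phi (x + c * Z i w) - p) -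
  (\int[gauss R]_y phi (x + c * Num.sqrt (v i) * y) - p)); last by ring.
apply: (le_trans (ler_normB _ _)); lra.
Qed.

(** Lindeberg's replacement: the summands are exchanged for Gaussian variables one
    at a time, and [gauss_stable] merges the Gaussian ones that are already there. *)
Lemma lindeberg s (c x : R) phi C : uniq s -> 0 <= c -> smooth3 phi C ->
  `|\int[Pr]_w phi (x + c * \sum_(i <- s) Z i w) -
    \int[gauss R]_y phi (x + c * Num.sqrt (\sum_(i <- s) v i) * y)| <=
  (size s)%:R * (C * c ^+ 3 * b ^+ 3 * (1 + m3)).
Proof.
move=> + c0 sphi; have bphi := smooth3_bmf sphi.
have bsh (y : R) : bmf (fun z => phi (y + z)).
  by apply: (bmf_comp bphi); exact: measurable_funD.
elim: s x => [x _|i s IH x uis].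
  rewrite mul0r big_nil sqrtr0 mulr0.
  rewrite (_ : \int[Pr]_w _ = phi x); last first.
    by rewrite -[RHS](expect_cst Pr); apply: eq_Rintegral => w _; rewrite big_nil mulr0 addr0.
  rewrite (_ : \int[gauss R]_w _ = phi x) ?subrr ?normr0//.
  by rewrite -[RHS](expect_cst (gauss R)); apply: eq_Rintegral => w _; rewrite mul0r addr0.
have us : uniq s by case/andP: uis.
have bS : bmf (fun w => \sum_(j <- s) Z j w) by exact: bmf_sum.
have mcS : measurable_fun setT (fun w => c * \sum_(j <- s) Z j w).
  by case: (bmfZ c bS).
pose phit y := \int[Pr]_w phi (y + c * \sum_(j <- s) Z j w).
have sphit : smooth3 phit C by exact: smooth3_avg mcS sphi.
have E1 : \int[Pr]_w phi (x + c * \sum_(j <- i :: s) Z j w) =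
    \int[Pr]_w phit (x + c * Z i w).
  have ind : independent2 Pr (Z i) (fun w => \sum_(j <- s) Z j w).
    move=> A B mA mB; rewrite setIC muleC; exact: (sum_indep mZ indZ uis).
  pose f (z : R * R) := phi (x + c * z.1 + c * z.2).
  have bf : bmf f.
    apply: (bmf_comp bphi); apply: measurable_funD; last exact: measurable_funM.
    by apply: measurable_funD => //; exact: measurable_funM.
  have := indep_expect (mZ i) (proj1 bS) ind bf.
  rewrite /f /= => <-; apply: eq_Rintegral => w _.
  by rewrite big_cons mulrDr addrA.
rewrite E1; set s1 := c * Num.sqrt (v i).
set V := \sum_(j <- s) v j; have V0 : 0 <= V by exact: sumr_ge0.
pose s2 := c * Num.sqrt V.
have s10 : 0 <= s1 by rewrite mulr_ge0 ?sqrtr_ge0.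
have s20 : 0 <= s2 by rewrite mulr_ge0 ?sqrtr_ge0.
have E2 : \int[gauss R]_y phi (x + c * Num.sqrt (\sum_(j <- i :: s) v j) * y) =
    \int[gauss R]_y \int[gauss R]_z phi (x + s1 * y + s2 * z).
  have := gauss_stable s10 s20 (bsh x).
  rewrite (_ : Num.sqrt (s1 ^+ 2 + s2 ^+ 2) = c * Num.sqrt (v i + V)); last first.
    by rewrite !exprMn !sqr_sqrtr// -mulrDr sqrtrM ?sqr_ge0// sqrtr_sqr ger0_norm.
  rewrite big_cons => <-; apply: eq_Rintegral => y _; apply: eq_Rintegral => z _.
  by rewrite addrA.
rewrite E2.
have h1 := step i x c0 sphit.
have bphit := smooth3_bmf sphit.
have b1 : bmf (fun y : R => phit (x + s1 * y)).
  by apply: (bmf_comp bphit); apply: measurable_funD => //; exact: measurable_funM.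
have b2 : bmf (fun y : R => \int[gauss R]_z phi (x + s1 * y + s2 * z)).
  apply: (bmf_fubini_F (gauss R) (gauss R) (f := fun z : R * R => phi (x + s1 * z.1 + s2 * z.2))).
  apply: (bmf_comp bphi); apply: measurable_funD; last exact: measurable_funM.
  by apply: measurable_funD => //; exact: measurable_funM.
have h2 : `|\int[gauss R]_y phit (x + s1 * y) -
    \int[gauss R]_y \int[gauss R]_z phi (x + s1 * y + s2 * z)| <=
    (size s)%:R * (C * c ^+ 3 * b ^+ 3 * (1 + m3)).
  rewrite -expectB//; apply: expect_norm_le; first exact: bmfB.
  by move=> y; exact: IH.
set e := C * _ * _ * _ in h1 h2 *.
rewrite /= -natr1 mulrDl mul1r [leRHS]addrC.
rewrite (_ : _ - _ = (\int[Pr]_w phit (x + c * Z i w) - \int[gauss R]_y phit (x + s1 * y)) +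
  (\int[gauss R]_y phit (x + s1 * y) - \int[gauss R]_y \int[gauss R]_z phi (x + s1 * y + s2 * z))); last by ring.
by rewrite (le_trans (ler_normD _ _))// lerD.
Qed.

End Lindeberg.

(** The events [|f| <= k] increase to the whole space. *)
Lemma tail_small d (T : measurableType d) (R : realType) (P : probability T R)
    (f : T -> R) (e : R) : measurable_fun setT f -> 0 < e ->
  exists2 K, 0 <= K & exists A,
    [/\ measurable A, fine (P (~` A)) <= e & forall x, A x -> `|f x| <= K].
Proof.
move=> mf e0; pose A (k : nat) : set T := [set x | `|f x| <= k%:R].
have mA k : measurable (A k).
  rewrite (_ : A k = f @^-1` `[- k%:R, k%:R]%classic).
    by rewrite -[X in measurable X]setTI; exact: mf.
  by apply/seteqP; split => x /=; rewrite in_itv/= -ler_norml.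
have ndA : nondecreasing_seq A.
  by move=> k l kl; apply/subsetPset => x /= /le_trans; apply; rewrite ler_nat.
have UA : \bigcup_k A k = setT.
  apply/seteqP; split => // x _; exists (Num.truncn `|f x|).+1 => //=.
  exact/ltW/truncnS_gt.
have := nondecreasing_cvg_mu (mu := P) mA (bigcup_measurable (fun k _ => mA k)) ndA.
rewrite UA probT => /fine_cvgP[_ /cvgrPdist_le/(_ _ e0)[k _ hk]].
exists k%:R => //; exists (A k); split => //.
have := hk k (leqnn k); rewrite /= probC// fineB ?fin_num_measure//=.
exact: le_trans (ler_norm _).
Qed.

(** Approximation of a bounded continuous test function by smooth ones: the
    smooth functions decide the limit of the expectations as soon as the tails
    are uniformly small. *)
Lemma portmanteau_smooth d (Om : measurableType d) (R : realType)
    (Pr : probability Om R) (T L : nat -> Om -> R) (s : R) :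
  (forall n, measurable_fun setT (T n)) -> (forall n, measurable_fun setT (L n)) ->
  (forall phi C, smooth3 phi C ->
     (fun n => \int[Pr]_w phi (L n w)) @ \oo --> \int[gauss R]_y phi (s * y)) ->
  (forall e, 0 < e -> exists2 K, 0 <= K & forall n,
     exists A, [/\ measurable A, fine (Pr (~` A)) <= e & forall w, A w -> `|L n w| <= K]) ->
  (forall e, 0 < e -> \forall n \near \oo,
     exists A, [/\ measurable A, fine (Pr (~` A)) <= e & forall w, A w -> `|T n w - L n w| <= e]) ->
  forall h : R -> R, continuous h -> (exists M, forall x, `|h x| <= M) ->
    (fun n => \int[Pr]_w h (T n w)) @ \oo --> \int[gauss R]_y h (s * y).
Proof.
move=> mT mL hsm tight close h ch [M hM].
have mh : measurable_fun setT h by exact: continuous_measurable_fun.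
have bh : bmf h by split => //; exists M.
have M0 : 0 <= M by exact: le_trans (hM 0).
apply/cvgrPdist_le => e e0.
(* a share of the total error for each of the replacements below *)
pose a := e / (16 * (1 + M)).
have a0 : 0 < a by rewrite divr_gt0// mulr_gt0// ltr_pwDl.
have ae : (1 + M) * a = e / 16 by rewrite /a; field; lra.
have [K1 K10 tightL] := tight a a0.
have [K2 K20 [AG [mAG PAG hAG]]] := tail_small (gauss R) (f := fun y => s * y)
  (measurable_funM (measurable_cst s) (@measurable_id _ R setT)) a0.
pose K := K1 + K2 + 1; have K0 : 0 <= K by rewrite /K; lra.
have [D D0 hD] := clamp_unif K0 ch a0.
have [phi [C [sphi phih]]] := smooth3_approx K0 ch a0.
have bphi := smooth3_bmf sphi.
have mc : measurable_fun setT (clamp K).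
  by apply: (@lip_measurable _ _ 1) => x y; rewrite mul1r; exact: clamp_lip.
have bhc : bmf (fun x => h (clamp K x)) by exact: (bmf_comp bh).
have dd0 : 0 < Num.min a (Num.min D 1) by rewrite !lt_min a0 D0 ltr01.
near=> n.
have [A [mA PA hA]] : exists A, [/\ measurable A,
    fine (Pr (~` A)) <= Num.min a (Num.min D 1) &
    forall w, A w -> `|T n w - L n w| <= Num.min a (Num.min D 1)].
  by near: n; exact: close.
have h3 : `|\int[gauss R]_y phi (s * y) - \int[Pr]_w phi (L n w)| <= a.
  by near: n; have /cvgrPdist_le := hsm _ _ sphi; exact.
have [B [mB PB hB]] := tightL n.
move: PA; rewrite le_min => /andP[PA _].
have mAB : measurable (A `&` B) by exact: measurableI.
have PAB : fine (Pr (~` (A `&` B))) <= 2 * a.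
  rewrite setCI (le_trans (fprobU _ _ _)) ?lerD//; try exact: measurableC; lra.
have h1 : `|\int[Pr]_w h (T n w) - \int[Pr]_w h (clamp K (L n w))| <= a + 2 * M * (2 * a).
  apply: (@le_trans _ _ (a + 2 * M * fine (Pr (~` (A `&` B))))).
    have bT : bmf (fun w => h (T n w)) by exact: (bmf_comp bh).
    have bL : bmf (fun w => h (clamp K (L n w))) by exact: (bmf_comp bhc).
    apply: (expect_close Pr mAB bT bL (ltW a0)) => //.
    move=> w [Aw Bw]; have Lw := hB w Bw; have := hA w Aw.
    rewrite !le_min => /and3P[_ TD T1].
    rewrite -[T n w](@clamp_id _ K); last first.
      rewrite normr_itv (_ : T n w = (T n w - L n w) + L n w); last by ring.
      by rewrite (le_trans (ler_normD _ _))// /K; lra.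
    exact: hD.
  by rewrite lerD2l ler_wpM2l// mulr_ge0.
have h2 : `|\int[Pr]_w h (clamp K (L n w)) - \int[Pr]_w phi (L n w)| <= a.
  rewrite -expectB; [|exact: (bmf_comp bhc (mL n))|exact: (bmf_comp bphi (mL n))].
  apply: expect_norm_le.
    by apply: bmfB; [exact: (bmf_comp bhc (mL n))|exact: (bmf_comp bphi (mL n))].
  by move=> w; rewrite distrC.
have ms : measurable_fun setT (fun y : R => s * y) by exact: measurable_funM.
have h4 : `|\int[gauss R]_y h (clamp K (s * y)) - \int[gauss R]_y phi (s * y)| <= a.
  rewrite -expectB; [|exact: (bmf_comp bhc ms)|exact: (bmf_comp bphi ms)].
  apply: expect_norm_le.
    by apply: bmfB; [exact: (bmf_comp bhc ms)|exact: (bmf_comp bphi ms)].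
  by move=> y; rewrite distrC.
have h5 : `|\int[gauss R]_y h (s * y) - \int[gauss R]_y h (clamp K (s * y))| <= 0 + 2 * M * a.
  apply: (@le_trans _ _ (0 + 2 * M * fine (gauss R (~` AG)))).
    have bT : bmf (fun y : R => h (s * y)) by exact: (bmf_comp bh).
    have bL : bmf (fun y : R => h (clamp K (s * y))) by exact: (bmf_comp bhc).
    apply: (expect_close (gauss R) mAG bT bL (lexx 0)) => //.
    move=> y /hAG ys; rewrite clamp_id ?subrr ?normr0// normr_itv.
    by rewrite (le_trans ys)// /K; lra.
  by rewrite lerD2l ler_wpM2l// mulr_ge0.
move: h1 h2 h3 h4 h5; rewrite !ler_norml => /andP[? ?] /andP[? ?] /andP[? ?] /andP[? ?] /andP[? ?].
have Ma : 0 <= M * a by rewrite mulr_ge0// ltW.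
have : a + M * a = e / 16 by rewrite -ae; ring.
by move=> ?; apply/andP; split; lra.
Unshelve. all: by end_near.
Qed.

(** * Laws on the line and their limits *)

(** Indicators of half-lines are limits of Lipschitz functions, so that Lipschitz
    test functions decide the equality of laws. *)
Lemma lip_indic_gt (R : realType) (x : R) : exists g : nat -> R -> R,
  [/\ forall k y z, `|g k y - g k z| <= k%:R * `|y - z|, forall k y, 0 <= g k y <= 1 &
      forall y, g ^~ y @ \oo --> (\1_(`]x, +oo[%classic) y : R)].
Proof.
pose g (k : nat) (y : R) : R := 2^-1 * (1 + clamp 1 (2 * k%:R * (y - x) - 1)).
exists g; split.
- move=> k y z; rewrite /g -mulrBr normrM gtr0_norm ?invr_gt0// opprD addrACA subrr add0r.
  apply: (@le_trans _ _ (2^-1 * `|(2 * k%:R * (y - x) - 1) - (2 * k%:R * (z - x) - 1)|)).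
    by rewrite ler_wpM2l ?invr_ge0// clamp_lip.
  rewrite (_ : _ - _ - _ = 2 * k%:R * (y - z)); last by ring.
  rewrite normrM ger0_norm ?mulr_ge0//; lra.
- move=> k y; have := clamp_itv (@ler01 R) (2 * k%:R * (y - x) - 1).
  by rewrite in_itv/= /g => /andP[? ?]; apply/andP; split; lra.
move=> y; apply: cvg_near_cst; rewrite indicE; have [yx|yx] := leP y x.
  rewrite memNset /= ?in_itv/= ?(le_gtF yx)//; near=> k.
  have k0 : 0 <= k%:R :> R by [].
  rewrite /g; have [[? ->]|[h1 ->]|[? ->]] := clampP (@ler01 R) (2 * k%:R * (y - x) - 1); [|nra|nra].
  by rewrite subrr mulr0.
rewrite mem_set /= ?in_itv/= ?yx//.
exists (Num.truncn (y - x)^-1).+1 => //= k /= hk.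
have yx0 : 0 < y - x by rewrite subr_gt0.
have : (y - x)^-1 < k%:R by rewrite (lt_le_trans (truncnS_gt _))// ler_nat.
rewrite -[(y - x)^-1]mul1r ltr_pdivrMr// => kk; rewrite /g.
have [[? ->]|[h1 ->]|[? ->]] := clampP (@ler01 R) (2 * k%:R * (y - x) - 1); lra.
Unshelve. all: by end_near. Qed.

Lemma bmf_dct d (T : measurableType d) (R : realType) (P : probability T R)
    (f_ : nat -> T -> R) (f : T -> R) (M : R) (A : set T) :
  (forall n, measurable_fun setT (f_ n)) -> measurable_fun setT f ->
  (forall n x, `|f_ n x| <= M) -> measurable A -> P A = 1%E ->
  (forall x, A x -> f_ ^~ x @ \oo --> f x) ->
  (fun n => \int[P]_x f_ n x) @ \oo --> \int[P]_x f x.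
Proof.
move=> mf_ mf fM mA PA cvf.
have PC : P (~` A) = 0%E by rewrite probC// PA subee.
have [||h1 _ h3] := @dominated_convergence _ T R P setT measurableT
  (fun n x => (f_ n x)%:E) (EFin \o f) (cst M%:E)
  (fun n => proj2 (measurable_EFinP _ _) (mf_ n)) (proj2 (measurable_EFinP _ _) mf)
  _ (bmf_integrable P (bmf_cst T M)) _.
- exists (~` A); split => //; first exact: measurableC.
  move=> x /= nh Ax; apply: nh => _; apply: cvg_EFin; first exact: nearW.
  exact: cvf.
- by apply: aeW => x n _; rewrite /= lee_fin.
- apply: fine_cvg; rewrite fineK//.
  exact: (integrable_fin_num measurableT h1).
Qed.

Lemma law_eq_lip (R : realType) (mu nu : probability R R) :
  (forall (h : R -> R) K, (forall y z, `|h y - h z| <= K * `|y - z|) ->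
     (exists M, forall x, `|h x| <= M) -> \int[mu]_x h x = \int[nu]_x h x) ->
  forall A, measurable A -> mu A = nu A.
Proof.
move=> H; apply: finite_measure_unique => [|x]; first by rewrite probT ltry.
have mI : measurable (`]x, +oo[%classic : set R) by exact: measurable_itv.
have [g [gl g01 cvg]] := lip_indic_gt x.
have gb k y : `|g k y| <= 1 by have /andP[? ?] := g01 k y; rewrite ger0_norm.
have cvi (m : probability R R) : (fun k => \int[m]_y g k y) @ \oo --> fine (m `]x, +oo[%classic).
  rewrite -expect_indic//; apply: (@bmf_dct _ _ _ m g (\1_(`]x, +oo[%classic)) 1 setT) => //.
  - by move=> k; apply: continuous_measurable_fun; apply: lip_continuous (gl k).
  - exact: probT.
apply: (etrans (esym (prob_fine mu mI))); rewrite -[RHS](prob_fine nu mI); congr EFin.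
apply: (cvg_unique _ (cvi mu)) => //.
rewrite (_ : (fun k => _) = (fun k => \int[nu]_y g k y)); first exact: cvi.
by apply/funext => k; apply: (H _ k%:R) => //; exists 1.
Qed.

(** Test functions pass to the limit on both sides by dominated convergence; a
    vanishing limit variance gives the Dirac mass. *)
Lemma gauss_law_limit d (Om : measurableType d) (R : realType)
    (Pr : probability Om R) (U_ : nat -> Om -> R) (U : Om -> R) (s_ : nat -> R) (s : R)
    (A : set Om) :
  (forall n, measurable_fun setT (U_ n)) -> measurable_fun setT U -> 0 <= s ->
  (forall n h, bmf h -> \int[Pr]_w h (U_ n w) = \int[gauss R]_y h (s_ n * y)) ->
  s_ @ \oo --> s -> measurable A -> Pr A = 1%E ->
  (forall w, A w -> U_ ^~ w @ \oo --> U w) ->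
  has_law Pr U (gaussian_law 0 s).
Proof.
move=> mU_ mU s0 lawU cs mA PA cU B mB.
have ms (c : R) : measurable_fun setT (fun y : R => 0 + c * y).
  by apply: measurable_funD => //; exact: measurable_funM.
rewrite -(gauss_affine_law 0 s0 mB) -(lawE Pr mU) -(lawE (gauss R) (ms s)).
apply: (law_eq_lip _ mB) => h K hK [M hM]; have ch := lip_continuous hK.
have mh : measurable_fun setT h by exact: continuous_measurable_fun.
have bh : bmf h by split => //; exists M.
rewrite (expect_law Pr mU bh) (expect_law (gauss R) (ms s) bh).
have c1 : (fun n => \int[Pr]_w h (U_ n w)) @ \oo --> \int[Pr]_w h (U w).
  apply: (@bmf_dct _ _ _ _ (fun n w => h (U_ n w)) (fun w => h (U w)) M A) => //.
  - by move=> n; exact: measurableT_comp.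
  - exact: measurableT_comp.
  - by move=> w Aw; apply: (cvg_comp _ _ (cU w Aw)); exact: ch.
have c2 : (fun n => \int[gauss R]_y h (0 + s_ n * y)) @ \oo --> \int[gauss R]_y h (0 + s * y).
  apply: (@bmf_dct _ _ _ _ (fun n y => h (0 + s_ n * y)) (fun y => h (0 + s * y)) M setT) => //.
  - by move=> n; exact: (measurableT_comp mh (ms _)).
  - exact: (measurableT_comp mh (ms _)).
  - exact: probT.
  - move=> y _; have c3 : (fun n => 0 + s_ n * y) @ \oo --> 0 + s * y.
      by apply: cvgD; [exact: cvg_cst|apply: cvgM => //; exact: cvg_cst].
    exact: (cvg_comp _ _ c3 (ch _)).
apply: (cvg_unique _ c1) => //; rewrite (_ : (fun n => _) = (fun n => \int[gauss R]_y h (0 + s_ n * y)))//.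
apply/funext => n; rewrite lawU//; apply: eq_Rintegral => y _.
by rewrite add0r.
Qed.

(** * Ridge potentials and their finite nets *)

Section Dotp.
Context (R : realType) (d : nat).
Implicit Types u x y : 'rV[R]_d.

Lemma dotpE u x : dotp u x = \sum_j u ord0 j * x ord0 j.
Proof. by rewrite /dotp mxE; apply: eq_bigr => j _; rewrite mxE. Qed.

Lemma dotpC u x : dotp u x = dotp x u.
Proof. by rewrite !dotpE; apply: eq_bigr => j _; rewrite mulrC. Qed.

Lemma dotpDr u x y : dotp u (x + y) = dotp u x + dotp u y.
Proof.
by rewrite !dotpE -big_split/=; apply: eq_bigr => j _; rewrite mxE mulrDr.
Qed.

Lemma dotpZr u a x : dotp u (a *: x) = a * dotp u x.
Proof.
by rewrite !dotpE mulr_sumr; apply: eq_bigr => j _; rewrite mxE mulrCA.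
Qed.

Lemma dotpNl u x : dotp (- u) x = - dotp u x.
Proof.
by rewrite dotpC -scaleN1r dotpZr dotpC mulN1r.
Qed.

Lemma dotp_ge0 x : 0 <= dotp x x.
Proof. by rewrite dotpE; apply: sumr_ge0 => j _; rewrite -expr2 sqr_ge0. Qed.

Lemma sphere_dotp u : sphere R d u -> dotp u u = 1.
Proof.
rewrite /sphere/= /l2norm => h.
by rewrite -(sqr_sqrtr (dotp_ge0 u)) h expr1n.
Qed.

(** Cauchy-Schwarz against a unit vector, with the defect. *)
Lemma dotp_sphere_sqr u x : sphere R d u ->
  dotp x x = (dotp u x) ^+ 2 + dotp (x - dotp u x *: u) (x - dotp u x *: u).
Proof.
move=> /sphere_dotp u1; set a := dotp u x.
rewrite dotpDr -scaleN1r !dotpZr ![dotp (x + _) _]dotpC !dotpDr !dotpZr u1.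
by rewrite (dotpC x u) -/a; ring.
Qed.

Lemma dotp_sphere_le u x (r : R) : 0 <= r -> sphere R d u -> l2ball d r x -> `|dotp u x| <= r.
Proof.
move=> r0 u1; rewrite /l2ball/= => xr; rewrite -[leLHS]sqrtr_sqr.
apply: le_trans xr; rewrite ler_wsqrtr// (dotp_sphere_sqr x u1).
by rewrite lerDl dotp_ge0.
Qed.

Lemma coord_le x (r : R) j : l2ball d r x -> `|x ord0 j| <= r.
Proof.
rewrite /l2ball/= => xr; rewrite -[leLHS]sqrtr_sqr; apply: le_trans xr.
rewrite ler_wsqrtr// dotpE (bigD1 j)//= -expr2 lerDl.
by apply: sumr_ge0 => k _; rewrite -expr2 sqr_ge0.
Qed.

Lemma sphere_coord u j : sphere R d u -> `|u ord0 j| <= 1.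
Proof. by move=> u1; apply: coord_le; rewrite /l2ball/= u1. Qed.

Lemma continuous_sum (I : Type) (s : seq I) (F : I -> 'rV[R]_d -> R) :
  (forall i, continuous (F i)) -> continuous (fun x => \sum_(i <- s) F i x).
Proof.
move=> cF; elim: s => [|i s IH] x.
  rewrite (_ : (fun x => _) = cst 0); first exact: cst_continuous.
  by apply/funext => y; rewrite big_nil.
rewrite (_ : (fun x => _) = fun x => F i x + \sum_(j <- s) F j x).
  exact: (cvgD (cF i x) (IH x)).
by apply/funext => y; rewrite big_cons.
Qed.

Lemma dotp_continuous u : continuous (dotp u).
Proof.
rewrite (_ : dotp u = fun y => \sum_j u ord0 j * y ord0 j); last first.
  by apply/funext => y; rewrite dotpE.
apply: continuous_sum => j x.
exact: (cvgM (cvg_cst _) (@coord_continuous _ _ _ _ _ _)).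
Qed.

Lemma open_borel (A : set 'rV[R]_d) : open A -> measurable (A : set (borel_rV R d)).
Proof. by move=> oA; apply: sub_sigma_algebra. Qed.

Lemma continuous_borel (f : 'rV[R]_d -> R) : continuous f ->
  measurable_fun setT (f : borel_rV R d -> R).
Proof.
move=> /continuousP cf; apply: (measurability _ (RGenOpens.measurableE R)).
move=> _ [_ [a [b ->] <-]]; rewrite setTI.
by apply: open_borel; apply: cf; exact: interval_open.
Qed.

Lemma measurable_dotp u : measurable_fun setT (dotp u : borel_rV R d -> R).
Proof. by apply: continuous_borel; exact: dotp_continuous. Qed.

Lemma l2norm_continuous : continuous (@l2norm R d).
Proof.
have c : continuous (fun y : 'rV[R]_d => dotp y y).
  rewrite (_ : (fun y => dotp y y) = fun y : 'rV[R]_d => \sum_j y ord0 j * y ord0 j); last first.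
    by apply/funext => y; rewrite dotpE.
  apply: continuous_sum => j x.
  exact: (cvgM (@coord_continuous _ _ _ _ _ _) (@coord_continuous _ _ _ _ _ _)).
by move=> x; apply: (continuous_comp (c x)); exact: sqrt_continuous.
Qed.

Lemma measurable_l2ball (r : R) : measurable (l2ball d r : set (borel_rV R d)).
Proof.
have m := continuous_borel l2norm_continuous.
rewrite (_ : l2ball d r = (@l2norm R d) @^-1` `]-oo, r]%classic); last first.
  by apply/seteqP; split => x /=; rewrite in_itv.
rewrite -[X in measurable X]setTI; apply: m => //; exact: measurable_itv.
Qed.

End Dotp.

(** Two comparisons determine a jump of at most one level. *)
Lemma int_step (a b : int) : (a < b + 2)%R -> (b < a + 2)%R ->
  a = b + (b < a)%R%:R - (a < b)%R%:R.
Proof. by case: ltgtP => /=; lia. Qed.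

Section Ridge.
Context (R : realType) (d : nat) (p r : R) (p_gt1 : 1 < p) (r_gt0 : 0 < r).

(** The limit theorem concerns the dual values of all pairs of a direction and a
    dual function. *)
Definition ridge : Type := ('rV[R]_d * (R -> R))%type.
Implicit Types s t : ridge.

Definition adm t : Prop := sphere R d t.1 /\ class_C p r t.2.
Definition potP t (x : borel_rV R d) : R := fbar r t.2 (dotp t.1 x).
Definition potQ t (y : borel_rV R d) : R := cbar p r t.2 (dotp t.1 y).

Lemma potP_bmf t : adm t -> bmf (potP t).
Proof.
by move=> [_ fC]; apply: (bmf_comp (fbar_bmf p_gt1 r_gt0 fC)); exact: measurable_dotp.
Qed.

Lemma potQ_bmf t : adm t -> bmf (potQ t).
Proof.
by move=> [_ fC]; apply: (bmf_comp (cbar_bmf p_gt1 r_gt0 fC)); exact: measurable_dotp.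
Qed.

Lemma potP_bound t x : adm t -> `|potP t x| <= bndC p r.
Proof. by move=> [_ fC]; exact: fbar_bound. Qed.

Lemma potQ_bound t x : adm t -> `|potQ t x| <= bndC p r.
Proof. by move=> [_ fC]; exact: cbar_bound. Qed.

Definition rclose s t (e : R) : Prop := forall x, l2ball d r x ->
  `|potP s x - potP t x| <= e /\ `|potQ s x - potQ t x| <= e.

Lemma rclose_sym s t e : rclose s t e -> rclose t s e.
Proof. by move=> h x /h[]; rewrite distrC (distrC (potQ s x)). Qed.

Lemma rclose_trans s1 s2 s3 e1 e2 : rclose s1 s2 e1 -> rclose s2 s3 e2 ->
  rclose s1 s3 (e1 + e2).
Proof.
move=> h1 h2 x xr; have [a1 b1] := h1 x xr; have [a2 b2] := h2 x xr; split.
- by rewrite (le_trans (ler_distD (potP s2 x) _ _))// lerD.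
- by rewrite (le_trans (ler_distD (potQ s2 x) _ _))// lerD.
Qed.

Lemma rclose_ridge s t a e : adm s -> adm t -> 0 <= a ->
  (forall j, `|s.1 ord0 j - t.1 ord0 j| <= a) ->
  (forall x, x \in `[- r, r] -> `|s.2 x - t.2 x| <= e) ->
  rclose s t (lipC p r * (d%:R * (a * r)) + e).
Proof.
move=> [s1 sC] [t1 tC] a0 sta ste x xr; have r0 := ltW r_gt0.
have L0 := lipC_gt0 p_gt1 r_gt0.
have st : `|dotp s.1 x - dotp t.1 x| <= d%:R * (a * r).
  rewrite !dotpE -sumrB; apply: (le_trans (ler_norm_sum _ _ _)).
  apply: (@le_trans _ _ (\sum_(j < d) a * r)).
    apply: ler_sum => j _; rewrite -mulrBl normrM ler_pM//.
    exact: coord_le.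
  by rewrite sumr_const card_ord -[X in X <= _]mulr_natl.
have Lst : lipC p r * `|dotp s.1 x - dotp t.1 x| <= lipC p r * (d%:R * (a * r)).
  by rewrite ler_wpM2l// ltW.
split.
- rewrite (le_trans (ler_distD (fbar r s.2 (dotp t.1 x)) _ _))// lerD//.
    by apply: le_trans Lst; exact: fbar_lip.
  by apply: ste; exact: clamp_itv.
- rewrite (le_trans (ler_distD (cbar p r s.2 (dotp t.1 x)) _ _))// lerD//.
    by apply: le_trans Lst; exact: cbar_lip.
  exact: ct_dist.
Qed.

(** ** Codes *)

Let step (m : nat) : R := r / 2 ^+ m.
Let L := lipC p r.

Let step_gt0 m : 0 < step m. Proof. by rewrite divr_gt0// exprn_gt0. Qed.
Let L_gt0 : 0 < L. Proof. exact: lipC_gt0. Qed.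

Definition level (f : R -> R) m (b : bool) (k : nat) : int :=
  Num.floor (f ((-1) ^+ b * (k%:R * step m)) / (L * step m)).

(** A cell of the index set: the grid cells of the coordinates of the direction and,
    on either side of the origin, the steps up and down of the discretised
    function. There are [exp (O (2 ^ m))] cells of diameter [O (2 ^- m)], which is
    few enough for chaining. *)
Definition code (m : nat) t : {ffun 'I_d -> 'I_(2 ^ m.+1).+1} *
    ({ffun bool * 'I_(2 ^ m) -> bool * bool}) :=
  ([ffun j => inord (Num.truncn ((t.1 ord0 j + 1) * 2 ^+ m))],
   [ffun z : bool * 'I_(2 ^ m) =>
      ((level t.2 m z.1 z.2 < level t.2 m z.1 z.2.+1)%R,
       (level t.2 m z.1 z.2.+1 < level t.2 m z.1 z.2)%R)]).

Let node_itv m (b : bool) k : (k <= 2 ^ m)%N ->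
  (-1) ^+ b * (k%:R * step m) \in `[- r, r].
Proof.
move=> km; have r0 := ltW r_gt0; rewrite normr_itv normrMsign ger0_norm ?mulr_ge0 ?(ltW (step_gt0 m))//.
rewrite /step mulrCA ler_piMr//.
by rewrite ler_pdivrMr ?exprn_gt0// mul1r -natrX ler_nat.
Qed.

Let level0 f m b : class_C p r f -> level f m b 0 = 0.
Proof. by move=> [f0 _]; rewrite /level mul0r mulr0 f0 mul0r floor0. Qed.

(** Along the grid a function of the class climbs at most one level at a time,
    so that two comparisons determine the next level. *)
Let level_step f m b k : class_C p r f -> (k < 2 ^ m)%N ->
  level f m b k.+1 = level f m b k + (level f m b k < level f m b k.+1)%R%:R -
    (level f m b k.+1 < level f m b k)%R%:R.
Proof.
move=> [_ fL] km; have Ls : 0 < L * step m by rewrite mulr_gt0.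
have h : `|f ((-1) ^+ b * (k.+1%:R * step m)) / (L * step m) -
    f ((-1) ^+ b * (k%:R * step m)) / (L * step m)| <= 1.
  rewrite -mulrBl normrM (gtr0_norm (x := (L * step m)^-1)) ?invr_gt0// ler_pdivrMr// mul1r.
  apply: (le_trans (fL _ _ (node_itv b km) (node_itv b (ltnW km)))).
  rewrite -/(lipC p r) -/L -mulrBr normrMsign -mulrBl -natr1 addrAC subrr add0r mul1r.
  by rewrite gtr0_norm.
rewrite /level; set x := f _ / _ in h *; set y := f _ / _ in h *.
have /andP[x1 x2] := floor_itv x; have /andP[y1 y2] := floor_itv y.
move: h; rewrite ler_norml => /andP[h1 h2].
have k1 : (Num.floor x < Num.floor y + 2)%R.
  by rewrite -(ltr_int R) rmorphD/=; move: y2; rewrite rmorphD/=; lra.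
have k2 : (Num.floor y < Num.floor x + 2)%R.
  by rewrite -(ltr_int R) rmorphD/=; move: x2; rewrite rmorphD/=; lra.
exact: int_step.
Qed.

Let level_eq m b k s t : adm s -> adm t -> code m s = code m t -> (k <= 2 ^ m)%N ->
  level s.2 m b k = level t.2 m b k.
Proof.
move=> [_ sC] [_ tC] [_ /ffunP E]; elim: k => [_|k IH km]; first by rewrite !level0.
have := E (b, Ordinal km); rewrite !ffunE/= => -[e1 e2].
by rewrite (level_step b sC km) (level_step b tC km) e1 e2 IH// ltnW.
Qed.

Lemma code_close m s t : adm s -> adm t -> code m s = code m t ->
  rclose s t (L * r * (d + 3)%:R / 2 ^+ m).
Proof.
move=> as_ at_ E; have r0 := ltW r_gt0; have two0 : 0 < 2 ^+ m :> R by exact: exprn_gt0.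
rewrite (_ : _ / _ = lipC p r * (d%:R * ((2 ^+ m)^-1 * r)) + 3 * (L * step m)); last first.
  by rewrite natrD /step /L; field; rewrite gt_eqF.
apply: rclose_ridge => //.
- move=> j; have [/ffunP/(_ j)] := E; rewrite !ffunE => /(congr1 (@nat_of_ord _)).
  have bd (u : 'rV[R]_d) : sphere R d u ->
      0 <= (u ord0 j + 1) * 2 ^+ m /\
      (Num.truncn ((u ord0 j + 1) * 2 ^+ m) < (2 ^ m.+1).+1)%N.
    move=> u1; have := sphere_coord j u1; rewrite ler_norml => /andP[u0 u2].
    have u3 : 0 <= (u ord0 j + 1) * 2 ^+ m by rewrite mulr_ge0 ?(ltW two0)//; lra.
    split => //; rewrite ltnS -(ler_nat R).
    apply: (@le_trans _ _ ((u ord0 j + 1) * 2 ^+ m)); first by have /andP[] := truncn_itv u3.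
    by rewrite natrX exprS ler_wpM2r ?(ltW two0)//; lra.
  have [s0 s1] := bd _ (proj1 as_); have [t0 t1] := bd _ (proj1 at_).
  rewrite !inordK// => e.
  have /andP[a1 a2] := truncn_itv s0; have /andP[b1 b2] := truncn_itv t0.
  rewrite e in a1 a2; move: a2 b2; rewrite -natr1 => a2 b2.
  rewrite -(ler_pM2r two0) mulVf ?gt_eqF// -{1}(gtr0_norm two0) -normrM mulrBl.
  by rewrite ler_norml; lra.
- move=> x xr; pose b := x < 0; pose k := Num.truncn (`|x| / step m).
  have sm0 := step_gt0 m; have k0 : 0 <= `|x| / step m by rewrite divr_ge0// ltW.
  have /andP[k1 k2] := truncn_itv k0; rewrite -/k in k1 k2.
  have km : (k <= 2 ^ m)%N.
    rewrite -(ler_nat R); apply: (le_trans k1); rewrite natrX.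
    rewrite ler_pdivrMr// /step mulrC divfK ?gt_eqF//.
    by move: xr; rewrite normr_itv.
  set y := (-1) ^+ b * (k%:R * step m).
  have yr : y \in `[- r, r] by exact: node_itv.
  have xy : `|x - y| <= step m.
    have -> : x = (-1) ^+ b * `|x|.
      rewrite /b; have [x0|x0] := ltP x 0; last by rewrite expr0 mul1r ger0_norm.
      by rewrite expr1 ltr0_norm// mulN1r opprK.
    rewrite -mulrBr normrMsign.
    move: k1 k2; rewrite ler_pdivlMr// ltr_pdivrMr// -natr1 => k1 k2.
    by rewrite ler_norml; lra.
  have Ls : 0 < L * step m by rewrite mulr_gt0.
  have fgy : `|s.2 y - t.2 y| <= L * step m.
    have := level_eq b as_ at_ E km; rewrite /level -/y => e.
    have /andP[a1 a2] := floor_itv (s.2 y / (L * step m)).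
    have /andP[b1 b2] := floor_itv (t.2 y / (L * step m)).
    rewrite e in a1 a2; move: a2 b2; rewrite rmorphD/= => a2 b2.
    have fE : s.2 y - t.2 y =
        (s.2 y / (L * step m) - t.2 y / (L * step m)) * (L * step m).
      by rewrite mulrBl !divfK ?gt_eqF.
    rewrite fE normrM (gtr0_norm Ls) -[leRHS]mul1r ler_wpM2r ?(ltW Ls)//.
    by rewrite ler_norml; lra.
  have sL := proj2 (proj2 as_) _ _ xr yr; have tL := proj2 (proj2 at_) _ _ xr yr.
  have Lxy : L * `|x - y| <= L * step m by rewrite ler_wpM2l// ltW.
  rewrite (le_trans (ler_distD (s.2 y) _ _))//.
  have := ler_distD (t.2 y) (s.2 y) (t.2 x).
  rewrite -/(lipC p r) -/L in sL.
  rewrite -/(lipC p r) -/L distrC in tL.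
  lra.
Qed.

Lemma code_card m : (#|[the finType of ({ffun 'I_d -> 'I_(2 ^ m.+1).+1} *
    ({ffun bool * 'I_(2 ^ m) -> bool * bool}))%type]|%:R : R) <=
  expR ((2 * d + 8)%:R * 2 ^+ m).
Proof.
rewrite card_prod !card_ffun !card_prod !card_bool !card_ord natrM !natrX.
have h n : n.+1%:R <= expR (n%:R : R) by rewrite -natr1 addrC expR_ge1Dx.
have e0 (x : R) : 0 <= expR x by exact: expR_ge0.
rewrite natrD mulrDl expRD; apply: ler_pM => //; rewrite ?exprn_ge0//.
- rewrite (_ : _ * _ = (2 ^ m.+1)%:R * d%:R).
    by rewrite expRM_natr lerXn2r ?nnegrE.
  by rewrite natrM natrX exprS; ring.
- rewrite (_ : 8%:R * _ = 4 * (2 * 2 ^ m)%:R); last by rewrite natrM natrX; ring.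
  rewrite expRM_natr lerXn2r ?nnegrE//.
  by apply: le_trans (h 4); rewrite ler_nat.
Qed.

End Ridge.

(** * Chaining *)

Lemma fprob_bigcup_le d (T : measurableType d) (R : realType) (P : probability T R)
    (A : nat -> set T) (a : nat -> R) (c : R) :
  (forall n, measurable (A n)) -> (forall n, fine (P (A n)) <= a n) ->
  (forall n, \sum_(k < n) a k <= c) -> fine (P (\bigcup_n A n)) <= c.
Proof.
move=> mA Aa ac; pose U n := \big[setU/set0]_(k < n.+1) A k.
have mU n : measurable (U n) by exact: bigsetU_measurable.
have UE : \bigcup_n A n = \bigcup_n U n by rewrite bigcup_bigsetU_bigcup.
have ndU : nondecreasing_seq U.
  by move=> m n mn; apply/subsetPset; apply: subset_bigsetU; rewrite ltnS.
have mA' := bigcup_measurable (fun k (_ : [set: nat] k) => mA k).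
have /fine_cvgP[_ cv] : P \o U @ \oo --> (fine (P (\bigcup_n A n)))%:E.
  rewrite prob_fine// UE.
  by apply: nondecreasing_cvg_mu => //; exact: bigcup_measurable.
rewrite -(cvg_lim (@Rhausdorff R) cv); apply: limr_le; first exact: cvgP cv.
apply: nearW => n /=; apply: le_trans (ac n.+1).
apply: (le_trans (fprob_bigU _ _ _)) => //.
by apply: ler_sum => k _; exact: Aa.
Qed.

Lemma geometric_le (R : realType) (q : R) n : 0 <= q < 1 ->
  \sum_(k < n) q ^+ k <= (1 - q)^-1.
Proof.
move=> /andP[q0 q1]; have q2 : 0 < 1 - q by rewrite subr_gt0.
suff -> : \sum_(k < n) q ^+ k = (1 - q ^+ n) / (1 - q).
  by rewrite ler_piMl ?invr_ge0 ?(ltW q2)// gerBl exprn_ge0.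
elim: n => [|n IH]; first by rewrite big_ord0 expr0 subrr mul0r.
by rewrite big_ord_recr/= IH exprS; field; rewrite gt_eqF.
Qed.

Section Chaining.
Context (R : realType) (T : Type) (S : T -> Prop) (cd : nat -> T -> nat)
  (rp : nat -> nat -> T) (N : nat -> nat) (C B : R).
Hypothesis C_ge0 : 0 <= C.
Hypothesis B_gt0 : 0 < B.
Hypothesis cdN : forall m t, S t -> (cd m t < N m)%N.
Hypothesis NC : forall m, (N m)%:R <= expR (C * 2 ^+ m).

Let rho : R := 3 / 4.

Definition chain_cst : R := Num.sqrt (B * (3 * C + 1)).
Let K := chain_cst.

(** The increments between consecutive levels are subgaussian at scale
    [2 ^- m] and there are at most [exp (3 C 2 ^ m)] of them, so they are
    simultaneously smaller than a multiple of [(3/4) ^ m] outside an event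
    of probability at most [4 / 2 ^ m]: what matters is [(3/4)^2 * 4 > 2]. *)
Lemma chaining d (Om : measurableType d) (Pr : probability Om R) (Z : T -> Om -> R) :
  (forall m k, measurable_fun setT (Z (rp m k))) ->
  (forall t m (x : R), S t -> 0 <= x ->
     fine (Pr [set w | x <= `|Z (rp m (cd m t)) w - Z (rp m.+1 (cd m.+1 t)) w|]) <=
       2 * expR (- (x ^+ 2 * 4 ^+ m / B))) ->
  exists A : nat -> set Om, forall m, [/\ measurable (A m), A m `<=` A m.+1,
    fine (Pr (~` A m)) <= 4 / 2 ^+ m &
    forall w t n, A m w -> S t -> (m <= n)%N ->
      `|Z (rp n (cd n t)) w - Z (rp m (cd m t)) w| <= 4 * K * rho ^+ m].
Proof.
move=> mZ tail.
pose E m (z : nat * nat) : set Om := if `[< exists t, [/\ S t, cd m t = z.1 & cd m.+1 t = z.2] >]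
  then [set w | K * rho ^+ m <= `|Z (rp m z.1) w - Z (rp m.+1 z.2) w|] else set0.
have mE m z : measurable (E m z).
  rewrite /E; case: asboolP => // _.
  rewrite (_ : [set w | _] = (fun w => `|Z (rp m z.1) w - Z (rp m.+1 z.2) w|) @^-1`
    `[K * rho ^+ m, +oo[%classic); last first.
    by apply/seteqP; split => w /=; rewrite in_itv/= andbT.
  rewrite -[X in measurable X]setTI.
  by apply: (measurableT_comp _ (measurable_funB (mZ _ _) (mZ _ _))).
pose s m := [seq (k, l) | k <- iota 0 (N m), l <- iota 0 (N m.+1)].
pose Bad m := \big[setU/set0]_(z <- s m) E m z.
have mBad m : measurable (Bad m) by exact: bigsetU_measurable.
have K2 : K ^+ 2 = B * (3 * C + 1) by rewrite sqr_sqrtr// mulr_ge0 ?(ltW B_gt0)//; move: C_ge0; lra.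
have K0 : 0 <= K by exact: sqrtr_ge0.
have PE m z : fine (Pr (E m z)) <= 2 * expR (- ((3 * C + 1) * 2 ^+ m)).
  rewrite /E; case: asboolP => [[t [St <- <-]]|_]; last first.
    by rewrite measure0/= mulr_ge0 ?expR_ge0.
  have rm0 : 0 <= K * rho ^+ m by rewrite mulr_ge0// exprn_ge0// /rho; lra.
  apply: (le_trans (tail t m _ St rm0)).
  rewrite ler_wpM2l// ler_expR lerN2.
  have -> : (K * rho ^+ m) ^+ 2 * 4 ^+ m / B = (3 * C + 1) * (rho ^+ 2 * 4) ^+ m.
    rewrite exprMn K2 [(rho ^+ 2 * 4) ^+ m]exprMn -!exprM mulnC; field.
    by rewrite gt_eqF.
  apply: ler_wpM2l; first by move: C_ge0; lra.
  by rewrite lerXn2r ?nnegrE// /rho; lra.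
have PBad m : fine (Pr (Bad m)) <= 2 * 2^-1 ^+ m.
  apply: (le_trans (fprob_bigU _ _ (mE m))).
  apply: (@le_trans _ _ (\sum_(z <- s m) 2 * expR (- ((3 * C + 1) * 2 ^+ m)))).
    by apply: ler_sum => z _; exact: PE.
  rewrite big_const_seq count_predT iter_addr_0 size_allpairs !size_iota.
  rewrite -[_ *+ _]mulr_natl mulrCA ler_wpM2l//.
  apply: (@le_trans _ _ (expR (C * 2 ^+ m) * expR (C * 2 ^+ m.+1) * expR (- ((3 * C + 1) * 2 ^+ m)))).
    by rewrite ler_wpM2r ?expR_ge0// natrM ler_pM.
  rewrite -!expRD (_ : _ + _ = - 2 ^+ m); last by rewrite exprS; ring.
  rewrite expRN exprVn lef_pV2 ?posrE ?expR_gt0 ?exprn_gt0//.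
  by apply: le_trans (expR_ge1Dx _); rewrite lerDr.
exists (fun m => ~` \bigcup_k Bad (m + k)%N) => m; split.
- by apply: measurableC; exact: bigcup_measurable.
- apply: subsetC => w [k _ h]; exists k.+1 => //; by rewrite addnS -addSn.
- rewrite setCK; apply: (fprob_bigcup_le (a := fun k => 2 * 2^-1 ^+ (m + k))) => //.
  move=> n; rewrite -mulr_sumr; under eq_bigr do rewrite exprD.
  rewrite -mulr_sumr; have := @geometric_le R 2^-1 n.
  have -> : (1 - 2^-1 : R)^-1 = 2 by field.
  have p0 : 0 <= 2^-1 ^+ m :> R by rewrite exprn_ge0.
  move=> /(_ _)/(ler_wpM2l p0) h; rewrite -exprVn.
  apply: (@le_trans _ _ (2 * (2^-1 ^+ m * 2))); last lra.
  by rewrite ler_wpM2l// h//; apply/andP; split; lra.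
- move=> w t n Aw St mn; rewrite -(subnKC mn); move: (n - m)%N => {mn}n.
  have inc k : `|Z (rp (m + k).+1 (cd (m + k).+1 t)) w - Z (rp (m + k) (cd (m + k) t)) w| <=
      K * rho ^+ m * rho ^+ k.
    rewrite leNgt; apply/negP => h; apply: Aw; exists k => //.
    rewrite /Bad -bigcup_seq; exists (cd (m + k)%N t, cd (m + k).+1 t).
      by apply/allpairsP; exists (cd (m + k)%N t, cd (m + k).+1 t); rewrite !mem_iota !cdN.
    rewrite /E; case: asboolP => [_|]; last by case; exists t.
    by rewrite /= distrC exprD mulrA ltW.
  apply: (@le_trans _ _ (K * rho ^+ m * \sum_(k < n) rho ^+ k)); last first.
    have r01 : 0 <= rho < 1 by rewrite /rho; apply/andP; split; lra.
    have := geometric_le n r01; have -> : (1 - rho)^-1 = 4 by rewrite /rho; field.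
    have p0 : 0 <= K * rho ^+ m by rewrite mulr_ge0// exprn_ge0// /rho; lra.
    by move=> /(ler_wpM2l p0) /le_trans; apply; rewrite mulrC mulrA.
  elim: n => [|n IH]; first by rewrite addn0 subrr normr0 big_ord0 mulr0.
  rewrite addnS big_ord_recr/= mulrDr.
  by rewrite (le_trans (ler_distD (Z (rp (m + n)%N (cd (m + n)%N t)) w) _ _))// addrC lerD.
Qed.

End Chaining.

(** * Nets of indices *)

Lemma expect_close_on d (T : measurableType d) (R : realType) (P : probability T R)
    (A : set T) (f g : T -> R) (e : R) : measurable A -> P A = 1%E -> bmf f -> bmf g ->
  0 <= e -> (forall x, A x -> `|f x - g x| <= e) ->
  `|\int[P]_x f x - \int[P]_x g x| <= e.
Proof.
move=> mA PA bf bg e0 fg; have [_ [M fM]] := bf; have [_ [N gN]] := bg.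
have := expect_close P (M := `|M| + `|N|) mA bf bg e0 fg.
rewrite probC// PA subee// mulr0 addr0; apply => x.
  by rewrite (le_trans (fM x))// (le_trans (ler_norm M))// lerDl.
by rewrite (le_trans (gN x))// (le_trans (ler_norm N))// lerDr.
Qed.

Lemma pow2_small (R : realType) (c e : R) (m : nat) : 0 < e ->
  exists2 n, (m <= n)%N & c / 2 ^+ n <= e.
Proof.
move=> e0; exists (maxn m (Num.truncn (`|c| / e)).+1); first exact: leq_maxl.
set n := maxn _ _; rewrite ler_pdivrMr ?exprn_gt0// mulrC -ler_pdivrMr//.
apply: (@le_trans _ _ (`|c| / e)); first by rewrite ler_wpM2r ?ler_norm ?invr_ge0 ?ltW.
rewrite (le_trans (ltW (truncnS_gt _)))//.
apply: (@le_trans _ _ n%:R); first by rewrite ler_nat leq_maxr.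
by rewrite -natrX ler_nat ltnW// ltn_expl.
Qed.

Section Net.
Context (R : realType) (d : nat) (p r : R) (p_gt1 : 1 < p) (r_gt0 : 0 < r).
Context (S : ridge R d -> Prop) (t0 : ridge R d) (St0 : S t0).
Hypothesis SA : forall t, S t -> adm p r t.

Definition ncode (m : nat) (t : ridge R d) : nat := enum_rank (code p r m t).
Definition nsize (m : nat) : nat := #|[the finType of ({ffun 'I_d -> 'I_(2 ^ m.+1).+1} *
    ({ffun bool * 'I_(2 ^ m) -> bool * bool}))%type]|.

(** The net lies in [S] itself: a cell that meets [S] is represented by one of
    its points in [S]. *)
Definition repn (m k : nat) : ridge R d :=
  if pselect (exists t, S t /\ ncode m t = k) is left h then projT1 (cid h) else t0.
Definition rep m t := repn m (ncode m t).

Definition netC : R := lipC p r * r * (d + 3)%:R.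
Definition entC : R := (2 * d + 8)%:R.

Lemma netC_gt0 : 0 < netC.
Proof. by rewrite /netC mulr_gt0 ?ltr0n ?addnS// mulr_gt0// lipC_gt0. Qed.

Lemma entC_ge0 : 0 <= entC. Proof. by []. Qed.

Lemma ncode_lt m t : (ncode m t < nsize m)%N.
Proof. by rewrite /ncode /nsize; exact: ltn_ord. Qed.

Lemma nsize_le m : (nsize m)%:R <= expR (entC * 2 ^+ m) :> R.
Proof. exact: code_card. Qed.

Lemma repn_in m k : S (repn m k).
Proof. by rewrite /repn; case: pselect => // h; case: cid => t []. Qed.

Lemma rep_in m t : S (rep m t). Proof. exact: repn_in. Qed.

Lemma ncode_rep m t : S t -> ncode m (rep m t) = ncode m t.
Proof.
move=> St; rewrite /rep /repn; case: pselect => [h|[]]; last by exists t.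
by case: cid => s [].
Qed.

Lemma ncode_close m s t : S s -> S t -> ncode m s = ncode m t ->
  rclose p r s t (netC / 2 ^+ m).
Proof.
move=> /SA As /SA At /ord_inj/enum_rank_inj E.
exact: (code_close p_gt1 r_gt0).
Qed.

Lemma rep_close m t : S t -> rclose p r t (rep m t) (netC / 2 ^+ m).
Proof.
by move=> St; apply: ncode_close => //; [exact: rep_in|rewrite ncode_rep].
Qed.

Lemma rep_close_step m t : S t ->
  rclose p r (rep m t) (rep m.+1 t) (2 * netC / 2 ^+ m).
Proof.
move=> St x xr; have [h1 h2] := rclose_trans (rclose_sym (rep_close m St)) (rep_close m.+1 St) xr.
have e : netC / 2 ^+ m + netC / 2 ^+ m.+1 <= 2 * netC / 2 ^+ m.
  have n0 := netC_gt0; have i0 : 0 <= (2 ^+ m)^-1 :> R by rewrite invr_ge0 exprn_ge0.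
  rewrite exprS invfM; have := mulr_ge0 (ltW n0) i0; lra.
by split; exact: le_trans e.
Qed.

End Net.

(** * The empirical process *)

Section Empirical.
Context (R : realType) (d : nat) (p r : R) (p_gt1 : 1 < p) (r_gt0 : 0 < r).
Context (P Q : probability (borel_rV R d) R).
Context (dO : measure_display) (Om : measurableType dO) (Pr : probability Om R).
Context (X Y : nat -> Om -> borel_rV R d).
Hypothesis mX : forall i, measurable_fun setT (X i).
Hypothesis mY : forall i, measurable_fun setT (Y i).
Hypothesis Xr : forall i w, l2ball d r (X i w).
Hypothesis Yr : forall i w, l2ball d r (Y i w).
Hypothesis lawX : forall i, has_law Pr (X i) P.
Hypothesis lawY : forall i, has_law Pr (Y i) Q.

Let XY (k : nat + nat) : Om -> borel_rV R d :=
  match k with inl i => X i | inr j => Y j end.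
Hypothesis indep : mutually_independent Pr XY.

Let mXY k : measurable_fun setT (XY k).
Proof. by case: k. Qed.

Implicit Types s t : ridge R d.
Local Notation potP := (potP r).
Local Notation potQ := (potQ p r).
Local Notation adm := (adm p r).

Definition cpot t (k : nat + nat) (x : borel_rV R d) : R :=
  match k with
  | inl _ => potP t x - \int[P]_z potP t z
  | inr _ => potQ t x - \int[Q]_z potQ t z
  end.

Definition samples (n : nat) : seq (nat + nat) :=
  [seq inl i | i <- iota 0 n] ++ [seq inr j | j <- iota 0 n].
(** [sqrt n] times the centred dual value [(P_n - P) F + (Q_n - Q) F^c]. *)
Definition emp n t (w : Om) : R :=
  (Num.sqrt n%:R)^-1 * \sum_(k <- samples n) cpot t k (XY k w).

Definition dvar s t : R :=
  \int[P]_x (cpot s (inl 0%N) x - cpot t (inl 0%N) x) ^+ 2 +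
  \int[Q]_x (cpot s (inr 0%N) x - cpot t (inr 0%N) x) ^+ 2.

Lemma cpot_bmf t k : adm t -> bmf (cpot t k).
Proof.
move=> At; case: k => i; apply: bmfB; try exact: bmf_cst.
  exact: (potP_bmf p_gt1 r_gt0).
exact: (potQ_bmf p_gt1 r_gt0).
Qed.

Lemma samples_uniq n : uniq (samples n).
Proof.
rewrite cat_uniq !map_inj_uniq ?iota_uniq ?andbT/=; try by move=> ? ? [].
by apply/hasPn => _ /mapP[j _ ->]; apply/negP => /mapP[].
Qed.

Lemma samples_size n : size (samples n) = (2 * n)%N.
Proof. by rewrite size_cat !size_map size_iota mul2n addnn. Qed.

Let dpot s t k (w : Om) : R := cpot s k (XY k w) - cpot t k (XY k w).

Let dpot_bmf s t k : adm s -> adm t -> bmf (dpot s t k).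
Proof.
by move=> As At; apply: bmfB; apply: bmf_comp (mXY k); exact: cpot_bmf.
Qed.

Lemma cpot_mean t k : adm t -> \int[Pr]_w cpot t k (XY k w) = 0.
Proof.
move=> At; have b := cpot_bmf k At; case: k b => i b.
  rewrite -(expect_has_law (mX i) (lawX i) b) /= expectB ?expect_cst ?subrr//.
    exact: (potP_bmf p_gt1 r_gt0).
  exact: bmf_cst.
rewrite -(expect_has_law (mY i) (lawY i) b) /= expectB ?expect_cst ?subrr//.
  exact: (potQ_bmf p_gt1 r_gt0).
exact: bmf_cst.
Qed.

Let dpot_mean s t k : adm s -> adm t -> \int[Pr]_w dpot s t k w = 0.
Proof.
move=> As At; rewrite expectB ?cpot_mean ?subrr//; apply: bmf_comp (mXY k); exact: cpot_bmf.
Qed.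

Let dpot_indep s t : adm s -> adm t -> mutually_independent Pr (dpot s t).
Proof.
move=> As At; apply: (@mutually_independent_comp _ _ _ _ _ _ _ _ _ XY
  (fun k x => cpot s k x - cpot t k x)) => // k.
by have [] := bmfB (cpot_bmf k As) (cpot_bmf k At).
Qed.

Let measurable_ballP : measurable (l2ball d r : set (borel_rV R d)).
Proof. exact: measurable_l2ball. Qed.

Let Pball : P (l2ball d r) = 1%E.
Proof.
rewrite -(lawX 0%N measurable_ballP) (_ : _ @^-1` _ = setT) ?probT//.
by apply/seteqP; split => // w _; exact: Xr.
Qed.

Let Qball : Q (l2ball d r) = 1%E.
Proof.
rewrite -(lawY 0%N measurable_ballP) (_ : _ @^-1` _ = setT) ?probT//.
by apply/seteqP; split => // w _; exact: Yr.
Qed.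

Let dpot_le s t e k w : adm s -> adm t -> rclose p r s t e -> `|dpot s t k w| <= 2 * e.
Proof.
move=> As At st; have e0 : 0 <= e.
  by have [h _] := st _ (Xr 0%N w); exact: le_trans (normr_ge0 _) h.
rewrite /dpot /XY; case: k => i /=.
- rewrite (_ : _ - _ = (potP s (X i w) - potP t (X i w)) -
    (\int[P]_z potP s z - \int[P]_z potP t z)); last by lra.
  rewrite (le_trans (ler_normB _ _))// [leRHS]mulr_natl mulr2n lerD//; first by have [] := st _ (Xr i w).
  apply: (expect_close_on measurable_ballP Pball _ _ e0) => [||x /st[]//].
    exact: (potP_bmf p_gt1 r_gt0).
  exact: (potP_bmf p_gt1 r_gt0).
- rewrite (_ : _ - _ = (potQ s (Y i w) - potQ t (Y i w)) -
    (\int[Q]_z potQ s z - \int[Q]_z potQ t z)); last by lra.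
  rewrite (le_trans (ler_normB _ _))// [leRHS]mulr_natl mulr2n lerD//; first by have [] := st _ (Yr i w).
  apply: (expect_close_on measurable_ballP Qball _ _ e0) => [||x /st[]//].
    exact: (potQ_bmf p_gt1 r_gt0).
  exact: (potQ_bmf p_gt1 r_gt0).
Qed.

Lemma emp_sub n s t w : emp n s w - emp n t w =
  (Num.sqrt n%:R)^-1 * \sum_(k <- samples n) dpot s t k w.
Proof. by rewrite /emp -mulrBr -sumrB. Qed.

Lemma emp_meas n t : adm t -> measurable_fun setT (emp n t).
Proof.
move=> At; have b k : bmf (fun w => cpot t k (XY k w)).
  by apply: bmf_comp (mXY k); exact: cpot_bmf.
by have [] := bmfZ (Num.sqrt n%:R)^-1 (bmf_sum (samples n) b).
Qed.

Lemma emp_lip n s t e w : adm s -> adm t -> rclose p r s t e ->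
  `|emp n s w - emp n t w| <= (Num.sqrt n%:R)^-1 * (2 * n)%:R * (2 * e).
Proof.
move=> As At st; rewrite emp_sub normrM ger0_norm ?invr_ge0 ?sqrtr_ge0//.
rewrite -mulrA ler_wpM2l ?invr_ge0 ?sqrtr_ge0//.
apply: (le_trans (ler_norm_sum _ _ _)).
apply: (@le_trans _ _ (\sum_(k <- samples n) 2 * e)).
  by apply: ler_sum => k _; exact: dpot_le.
by rewrite big_const_seq count_predT iter_addr_0 samples_size -[X in X <= _]mulr_natl.
Qed.

Let emp_event n s t (x : R) : (0 < n)%N ->
  [set w | x <= `|emp n s w - emp n t w|] =
  [set w | Num.sqrt n%:R * x <= `|\sum_(k <- samples n) dpot s t k w|].
Proof.
move=> n0; have s0 : 0 < Num.sqrt n%:R :> R by rewrite sqrtr_gt0 ltr0n.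
have E w : (x <= `|emp n s w - emp n t w|) =
    (Num.sqrt n%:R * x <= `|\sum_(k <- samples n) dpot s t k w|).
  rewrite emp_sub normrM ger0_norm ?invr_ge0 ?(ltW s0)//.
  by rewrite -(ler_pM2l s0) mulrA mulfV ?gt_eqF// mul1r.
by apply/seteqP; split => w /=; rewrite E.
Qed.

(** An increment is a sum of [2 n] independent centred variables that are bounded by
    [2 e]; [hoeffding] applies. *)
Lemma emp_subgauss n s t e (x : R) : (0 < n)%N -> adm s -> adm t -> 0 < e ->
  rclose p r s t e -> 0 <= x ->
  fine (Pr [set w | x <= `|emp n s w - emp n t w|]) <=
    2 * expR (- (x ^+ 2 / (96 * e ^+ 2))).
Proof.
move=> n0 As At e0 st x0; rewrite emp_event//.
have e20 : 0 <= 2 * e by lra.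
have n0' : 0 < n%:R :> R by rewrite ltr0n.
apply: (le_trans (hoeffding (fun k => proj1 (dpot_bmf k As At)) (dpot_indep As At) e20
  (fun k w => dpot_le k w As At st) (fun k => dpot_mean k As At)
  (samples_uniq n) _ _ _)) => //.
- by rewrite mulr_ge0// sqrtr_ge0.
- lra.
- by rewrite samples_size muln_gt0.
rewrite ler_wpM2l// ler_expR lerN2 samples_size exprMn sqr_sqrtr ?ler0n// natrM.
by rewrite le_eqVlt; apply/orP; left; apply/eqP; field; rewrite !gt_eqF.
Qed.

Lemma emp_chebyshev n s t (x : R) : (0 < n)%N -> adm s -> adm t -> 0 < x ->
  fine (Pr [set w | x <= `|emp n s w - emp n t w|]) <= dvar s t / x ^+ 2.
Proof.
move=> n0 As At x0; rewrite emp_event//.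
have n0' : 0 < n%:R :> R by rewrite ltr0n.
have sx : 0 < Num.sqrt n%:R * x by rewrite mulr_gt0// sqrtr_gt0.
have [M [M0 HM]] : exists M : R, 0 <= M /\ forall k w, `|dpot s t k w| <= M.
  exists (4 * bndC p r); split; first by rewrite mulr_ge0// ltW// bndC_gt0.
  have hc u k w : adm u -> `|cpot u k (XY k w)| <= 2 * bndC p r.
    move=> Au; rewrite [leRHS]mulr_natl mulr2n; case: k => i /=;
      rewrite (le_trans (ler_normB _ _))// lerD//.
    - exact: (potP_bound p_gt1 r_gt0).
    - apply: expect_norm_le; first exact: (potP_bmf p_gt1 r_gt0).
      by move=> z; exact: (potP_bound p_gt1 r_gt0).
    - exact: (potQ_bound p_gt1 r_gt0).
    - apply: expect_norm_le; first exact: (potQ_bmf p_gt1 r_gt0).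
      by move=> z; exact: (potQ_bound p_gt1 r_gt0).
  move=> k w; rewrite (le_trans (ler_normB _ _))//.
  by have := hc s k w As; have := hc t k w At; lra.
apply: (le_trans (chebyshev_sum (fun k => proj1 (dpot_bmf k As At)) (dpot_indep As At)
  HM (fun k => dpot_mean k As At) (samples_uniq n) sx)).
rewrite exprMn sqr_sqrtr ?ler0n//.
rewrite (_ : \sum_(k <- samples n) _ = n%:R * dvar s t); last first.
  have bc k : bmf (fun x => cpot s k x - cpot t k x) by apply: bmfB; exact: cpot_bmf.
  have bc2 k : bmf (fun x => (cpot s k x - cpot t k x) ^+ 2).
    by under eq_fun do rewrite expr2; exact: bmfM.
  rewrite big_cat !big_map/= mulrDr; congr (_ + _).
    rewrite (eq_bigr (fun=> \int[P]_x (cpot s (inl 0%N) x - cpot t (inl 0%N) x) ^+ 2)).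
      by rewrite big_const_seq count_predT iter_addr_0 size_iota mulr_natl.
    by move=> i _; rewrite (expect_has_law (mX i) (lawX i) (bc2 (inl i))).
  rewrite (eq_bigr (fun=> \int[Q]_x (cpot s (inr 0%N) x - cpot t (inr 0%N) x) ^+ 2)).
    by rewrite big_const_seq count_predT iter_addr_0 size_iota mulr_natl.
  by move=> i _; rewrite (expect_has_law (mY i) (lawY i) (bc2 (inr i))).
by rewrite le_eqVlt; apply/orP; left; apply/eqP; field; rewrite !gt_eqF.
Qed.

(** Asymptotic equicontinuity with explicit constants: chaining controls what
    happens inside the cells of level [m], and Chebyshev's inequality the finitely
    many representatives of that level. *)
Lemma emp_sup (S : ridge R d -> Prop) (t0 tv : ridge R d) (V a : R) (m n : nat) :
  S t0 -> (forall t, S t -> adm t) -> adm tv -> (forall t, S t -> dvar t tv <= V) ->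
  0 < a -> (0 < n)%N ->
  exists A, [/\ measurable A,
    fine (Pr (~` A)) <= 4 / 2 ^+ m + (nsize d m)%:R * (V / a ^+ 2) &
    forall w t, A w -> S t -> `|emp n t w - emp n tv w| <=
      4 * chain_cst (entC R d) (384 * netC d p r ^+ 2) * (3 / 4) ^+ m + a].
Proof.
move=> St0 SA Atv SV a0 n0.
pose rp := repn p r S t0.
have c0 : 0 < netC d p r by exact: netC_gt0.
have B0 : 0 < 384 * netC d p r ^+ 2 by rewrite mulr_gt0 ?ltr0n ?exprn_gt0.
have rpA m' k : adm (rp m' k) by apply: SA; exact: repn_in.
have [|A hA] := chaining (S := S) (cd := ncode p r) (rp := rp) (N := nsize d) (entC_ge0 R d) B0
  (fun m t _ => ncode_lt p r m t) (nsize_le R d) (Pr := Pr) (Z := emp n)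
  (fun m' k => emp_meas n (rpA m' k)).
  move=> t m' x St x0; have cl := rep_close_step p_gt1 r_gt0 St0 SA m' St.
  have e0 : 0 < 2 * netC d p r / 2 ^+ m' by rewrite divr_gt0 ?exprn_gt0// mulr_gt0.
  apply: (le_trans (emp_subgauss n0 _ _ e0 cl x0)); try exact: rpA.
  rewrite ler_wpM2l// ler_expR lerN2 le_eqVlt; apply/orP; left; apply/eqP.
  rewrite (_ : 4 ^+ m' = (2 ^+ m') ^+ 2); last by rewrite -exprM mulnC exprM expr2 -natrM.
  rewrite (_ : 384%:R = 96%:R * 4 :> R); last by rewrite -natrM.
  by field; rewrite !gt_eqF ?exprn_gt0// ltr0n.
have [mA _ PA hAm] := hA m.
pose Bk k : set Om := [set w | a <= `|emp n (rp m k) w - emp n tv w|].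
have mBk k : measurable (Bk k).
  rewrite /Bk (_ : [set w | _] = (fun w => `|emp n (rp m k) w - emp n tv w|) @^-1`
    `[a, +oo[%classic); last by apply/seteqP; split => w /=; rewrite in_itv/= andbT.
  rewrite -[X in measurable X]setTI.
  by apply: (measurableT_comp _ (measurable_funB (emp_meas n (rpA m k)) (emp_meas n Atv))).
pose Bd := \big[setU/set0]_(k <- iota 0 (nsize d m)) Bk k.
have mBd : measurable Bd by exact: bigsetU_measurable.
exists (A m `&` ~` Bd); split.
- by apply: measurableI => //; exact: measurableC.
- rewrite setCI setCK (le_trans (fprobU _ _ _))//; first exact: measurableC.
  rewrite lerD// (le_trans (fprob_bigU _ _ mBk))//.
  apply: (@le_trans _ _ (\sum_(k <- iota 0 (nsize d m)) V / a ^+ 2)).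
    apply: ler_sum => k _; apply: (le_trans (emp_chebyshev n0 (rpA m k) Atv a0)).
    rewrite ler_wpM2r ?invr_ge0 ?exprn_ge0 ?(ltW a0)//; apply: SV; exact: repn_in.
  by rewrite big_const_seq count_predT iter_addr_0 size_iota -[X in X <= _]mulr_natl.
- move=> w t [Aw nB] St; rewrite (le_trans (ler_distD (emp n (rep p r S t0 m t) w) _ _))// lerD//.
    apply/ler_addgt0Pr => e e0.
    have [n' mn' hn'] := pow2_small ((Num.sqrt n%:R)^-1 * (2 * n)%:R * (2 * netC d p r)) m e0.
    rewrite (le_trans (ler_distD (emp n (rep p r S t0 n' t) w) _ _))// addrC lerD//.
      exact: hAm.
    apply: (le_trans (emp_lip n w (SA _ St) _ (rep_close p_gt1 r_gt0 St0 SA n' St))).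
      by apply: SA; exact: rep_in.
    by apply: le_trans hn'; rewrite !mulrA.
  rewrite ltW// ltNge; apply/negP => h; apply: nB; rewrite /Bd -bigcup_seq.
  exists (ncode p r m t) => //=; rewrite mem_iota/= add0n; exact: ncode_lt.
Qed.

End Empirical.

(** * Near-maximisers of the dual problem *)

Lemma ultra_limit (T : Type) (R : realType) (G : set_system T) (x : T -> R) (M : R) :
  UltraFilter G -> G [set t | `|x t| <= M] -> exists l : R, x @ G --> l.
Proof.
move=> UG GM; have PG : ProperFilter G by exact: ultra_proper.
have cM : compact `[- M, M]%classic by exact: segment_compact.
have [|l [lM cl]] := cM (x @ G) _.
  change (G (x @^-1` `[- M, M]%classic)).
  by apply: (filterS _ GM) => t /= h; rewrite in_itv/= -ler_norml.
exists l => V Vl; have [//|nV] := in_ultra_setVsetC (x @^-1` V) UG.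
have nV' : (x @ G) (~` V) by [].
by have [y []] := cl _ _ nV' Vl.
Qed.

Section NearMax.
Context (R : realType) (d : nat) (p r : R) (p_gt1 : 1 < p) (r_gt0 : 0 < r).
Context (P Q : probability (borel_rV R d) R).
Hypothesis Pball : P (l2ball d r) = 1%E.
Hypothesis Qball : Q (l2ball d r) = 1%E.
Implicit Types s t : ridge R d.
Local Notation adm := (adm p r).
Local Notation potP := (potP r).
Local Notation potQ := (potQ p r).
Local Notation dvar := (dvar p r P Q).
Local Notation cpot := (cpot p r P Q).

Definition dval t : R := \int[P]_x potP t x + \int[Q]_y potQ t y.

Let mball := @measurable_l2ball R d r.

Let intP_close s t e : adm s -> adm t -> 0 <= e -> rclose p r s t e ->
  `|\int[P]_x potP s x - \int[P]_x potP t x| <= e.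
Proof.
move=> As At e0 st; apply: (expect_close_on mball Pball _ _ e0) => [||x /st[]//];
  exact: (potP_bmf p_gt1 r_gt0).
Qed.

Let intQ_close s t e : adm s -> adm t -> 0 <= e -> rclose p r s t e ->
  `|\int[Q]_x potQ s x - \int[Q]_x potQ t x| <= e.
Proof.
move=> As At e0 st; apply: (expect_close_on mball Qball _ _ e0) => [||x /st[]//];
  exact: (potQ_bmf p_gt1 r_gt0).
Qed.

Lemma dval_close s t e : adm s -> adm t -> 0 <= e -> rclose p r s t e ->
  `|dval s - dval t| <= 2 * e.
Proof.
move=> As At e0 st; rewrite /dval opprD addrACA [leRHS]mulr_natl mulr2n.
by apply: (le_trans (ler_normD _ _)); apply: lerD; [exact: intP_close|exact: intQ_close].
Qed.

Lemma cpot_bound t k x : adm t -> `|cpot t k x| <= 2 * bndC p r.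
Proof.
move=> At; rewrite [leRHS]mulr_natl mulr2n; case: k => i /=;
  rewrite (le_trans (ler_normB _ _))// lerD//.
- exact: potP_bound.
- by apply: expect_norm_le; [exact: (potP_bmf p_gt1 r_gt0)|move=> z; exact: potP_bound].
- exact: potQ_bound.
- by apply: expect_norm_le; [exact: (potQ_bmf p_gt1 r_gt0)|move=> z; exact: potQ_bound].
Qed.

Lemma cpot_close s t e k x : adm s -> adm t -> 0 <= e -> rclose p r s t e ->
  l2ball d r x -> `|cpot s k x - cpot t k x| <= 2 * e.
Proof.
move=> As At e0 st xr; have [h1 h2] := st x xr.
rewrite [leRHS]mulr_natl mulr2n; case: k => i /=.
- rewrite (_ : _ - _ = (potP s x - potP t x) -
    (\int[P]_z potP s z - \int[P]_z potP t z)); last by lra.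
  by rewrite (le_trans (ler_normB _ _))// lerD// intP_close.
- rewrite (_ : _ - _ = (potQ s x - potQ t x) -
    (\int[Q]_z potQ s z - \int[Q]_z potQ t z)); last by lra.
  by rewrite (le_trans (ler_normB _ _))// lerD// intQ_close.
Qed.

Lemma dvar_close s t u e : adm s -> adm t -> adm u -> 0 <= e -> rclose p r s t e ->
  `|dvar s u - dvar t u| <= 32 * bndC p r * e.
Proof.
move=> As At Au e0 st; have b0 := bndC_gt0 p_gt1 r_gt0.
have b2 k a b : adm a -> adm b -> bmf (fun x => (cpot a k x - cpot b k x) ^+ 2).
  move=> Aa Ab; under eq_fun do rewrite expr2.
  by apply: bmfM; apply: bmfB; exact: (cpot_bmf p_gt1 r_gt0).
have h k x : l2ball d r x ->
    `|(cpot s k x - cpot u k x) ^+ 2 - (cpot t k x - cpot u k x) ^+ 2| <= 16 * bndC p r * e.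
  move=> xr; rewrite subr_sqr normrM opprB addrA subrK.
  apply: (@le_trans _ _ (2 * e * (8 * bndC p r))); last by lra.
  apply: ler_pM => //; first exact: cpot_close.
  have := cpot_bound k x As; have := cpot_bound k x At; have := cpot_bound k x Au.
  by rewrite !ler_norml => /andP[? ?] /andP[? ?] /andP[? ?]; apply/andP; split; lra.
have e1 : 0 <= 16 * bndC p r * e by rewrite mulr_ge0// mulr_ge0// ltW.
rewrite /dvar opprD addrACA (_ : 32 * _ * _ = 16 * bndC p r * e + 16 * bndC p r * e); last by lra.
rewrite (le_trans (ler_normD _ _))// lerD//.
  apply: (expect_close_on mball Pball _ _ e1) => [||x xr]; [exact: b2|exact: b2|exact: (h (inl 0%N))].
apply: (expect_close_on mball Qball _ _ e1) => [||x xr]; [exact: b2|exact: b2|exact: (h (inr 0%N))].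
Qed.

(** Directions and functions converge pointwise along an ultrafilter; the common
    Lipschitz constant makes the convergence of the ridge functions uniform. *)
Lemma ridge_compact (t_ : nat -> ridge R d) : (forall k, adm (t_ k)) ->
  exists G (t : ridge R d), [/\ UltraFilter G, (\oo : set_system nat) `<=` G, adm t &
    forall e, 0 < e -> \forall k \near G, rclose p r (t_ k) t e].
Proof.
move=> At_; have [G [UG ooG]] := ultraFilterLemma (F := \oo) _.
have PG : ProperFilter G by exact: ultra_proper.
have r0 := ltW r_gt0; have L0 := lipC_gt0 p_gt1 r_gt0.
have /choice[u hu] : forall j, exists l, (fun k => (t_ k).1 ord0 j) @ G --> (l : R).
  move=> j; apply: (@ultra_limit _ _ _ _ 1) => //.
  by apply: filterE => k; apply: sphere_coord; have [] := At_ k.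
have /choice[f hf] : forall x : R, exists l : R, (fun k => fbar r (t_ k).2 x) @ G --> l.
  move=> x; apply: (@ultra_limit _ _ _ _ (bndC p r)) => //.
  by apply: filterE => k; apply: fbar_bound => //; have [] := At_ k.
pose t : ridge R d := (\row_j u j, f).
have fb x : x \in `[- r, r] -> forall k, fbar r (t_ k).2 x = (t_ k).2 x.
  by move=> xr k; rewrite /fbar clamp_id.
have sph : sphere R d t.1.
  have c : (fun k => dotp (t_ k).1 (t_ k).1) @ G --> dotp t.1 t.1.
    rewrite (_ : (fun k => _) = fun k => \sum_j (t_ k).1 ord0 j * (t_ k).1 ord0 j); last first.
      by apply/funext => k; rewrite dotpE.
    rewrite dotpE; elim: (index_enum _) => [|j s IH].
      rewrite big_nil (_ : (fun k => _) = cst 0); first exact: cvg_cst.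
      by apply/funext => k; rewrite big_nil.
    rewrite big_cons (_ : (fun k => _) = fun k => (t_ k).1 ord0 j * (t_ k).1 ord0 j +
      \sum_(j <- s) (t_ k).1 ord0 j * (t_ k).1 ord0 j).
      by apply: cvgD IH; rewrite /t mxE; apply: cvgM; exact: hu.
    by apply/funext => k; rewrite big_cons.
  rewrite /sphere/= /l2norm (_ : dotp _ _ = 1) ?sqrtr1//.
  apply: (cvg_unique _ c) => //.
  rewrite (_ : (fun k => _) = cst 1); first exact: cvg_cst.
  by apply/funext => k; rewrite sphere_dotp//; have [] := At_ k.
have fC : class_C p r f.
  split.
    apply: (cvg_unique _ (hf 0)) => //.
    rewrite (_ : (fun k => _) = cst 0); first exact: cvg_cst.
    apply/funext => k; rewrite fb; first by have [_ []] := At_ k.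
    by rewrite in_itv/= oppr_le0 r0.
  move=> x y xr yr; have c : (fun k => `|fbar r (t_ k).2 x - fbar r (t_ k).2 y|) @ G --> `|f x - f y|.
    by apply: cvg_norm; apply: cvgB; exact: hf.
 
  rewrite -(cvg_lim (@Rhausdorff R) c); apply: limr_le; first exact: cvgP c.
  apply: filterE => k; rewrite !fb//; have [_ [_]] := At_ k; exact.
have At : adm t by [].
exists G, t; split => // e e0.
pose N := (Num.truncn (8 * lipC p r * r / e)).+1.
have N0 : 0 < N%:R :> R by rewrite ltr0n.
pose h : R := r / N%:R; have h0 : 0 < h by rewrite divr_gt0.
have Lh : lipC p r * h <= e / 8.
  have : 8 * lipC p r * r / e < N%:R by exact: truncnS_gt.
  rewrite ltr_pdivrMr// => hN; rewrite /h mulrA ler_pdivrMr//; lra.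
pose node (i : 'I_(2 * N).+1) : R := - r + i%:R * h.
have Nh : N%:R * h = r by rewrite /h mulrC divfK// gt_eqF.
have nodeP x : x \in `[- r, r] -> exists i, node i \in `[- r, r] /\ `|x - node i| <= h.
  rewrite in_itv/= => /andP[x1 x2].
  have xh0 : 0 <= (x + r) / h by rewrite divr_ge0 ?(ltW h0)//; lra.
  have /andP[i1 i2] := truncn_itv xh0; move: i1 i2.
  set i := Num.truncn _; rewrite ler_pdivlMr// ltr_pdivrMr// -natr1 => i1 i2.
  have iN : (i < (2 * N).+1)%N.
    rewrite ltnS -(ler_nat R) -(ler_pM2r h0) natrM -mulrA Nh; lra.
  exists (Ordinal iN); rewrite /node/=; split.
    have ih : 0 <= i%:R * h by rewrite mulr_ge0// ltW.
    by rewrite in_itv/=; lra.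
  by rewrite ler_norml; lra.
pose a := e / (2 * (lipC p r * (d.+1%:R * r))).
have d0 : 0 < d.+1%:R :> R by rewrite ltr0n.
have a0 : 0 < a.
  exact: (divr_gt0 e0 (mulr_gt0 (@ltr0Sn R 1) (mulr_gt0 L0 (mulr_gt0 d0 r_gt0)))).
have ae : lipC p r * (d%:R * (a * r)) <= e / 2.
  apply: (@le_trans _ _ (lipC p r * (d.+1%:R * (a * r)))).
    by rewrite ler_wpM2l ?(ltW L0)// ler_wpM2r ?ler_nat// mulr_ge0// ltW.
  by rewrite le_eqVlt; apply/orP; left; apply/eqP; rewrite /a; field; rewrite !gt_eqF.
have e8 : 0 < e / 8 by rewrite divr_gt0.
have n1 : \forall k \near G, forall j, `|u j - (t_ k).1 ord0 j| <= a.
  by apply: filter_forall => j; have /cvgrPdist_le := hu j; exact.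
have n2 : \forall k \near G, forall i, `|f (node i) - fbar r (t_ k).2 (node i)| <= e / 8.
  by apply: filter_forall => i; have /cvgrPdist_le := hf (node i); exact.
apply: filterS2 n1 n2 => k n1 n2.
have rc : rclose p r (t_ k) t (lipC p r * (d%:R * (a * r)) + e / 2).
  apply: rclose_ridge => //; first exact: ltW.
    by move=> j; rewrite distrC /t mxE.
  move=> x xr; have [i [ir xi]] := nodeP x xr.
  have [_ [_ kL]] := At_ k; have Lx := kL _ _ xr ir; have fL := proj2 fC _ _ xr ir.
  have ni := n2 i; rewrite fb// in ni.
  have Lxi : lipC p r * `|x - node i| <= e / 8.
    by apply: le_trans Lh; rewrite ler_wpM2l// ltW.
  rewrite -/(lipC p r) in Lx fL.
  rewrite (le_trans (ler_distD ((t_ k).2 (node i)) _ _))//.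
  have := ler_distD (f (node i)) ((t_ k).2 (node i)) (f x).
  rewrite distrC in ni; rewrite (distrC (f x)) in fL; rewrite /=; lra.
move=> x xr; have [h1 h2] := rc x xr.
have le1 : lipC p r * (d%:R * (a * r)) + e / 2 <= e by lra.
by split; exact: le_trans le1.
Qed.

(** Otherwise a sequence of near-maximisers would keep its variance, and its limit
    along an ultrafilter would be a maximiser of positive variance. *)
Lemma near_max (tv : ridge R d) : adm tv ->
  (forall t, adm t -> dval tv <= dval t -> dvar t tv = 0) ->
  forall e, 0 < e -> exists2 D, 0 < D & forall t, adm t -> dval tv - dval t <= D ->
    dvar t tv <= e.
Proof.
move=> Atv H e e0; apply: contrapT => nD.
have /choice[t_ ht] : forall k : nat, exists t, [/\ adm t, dval tv - dval t <= k.+1%:R^-1 & e < dvar t tv].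
  move=> k; apply: contrapT => nt; apply: nD; exists k.+1%:R^-1.
    by rewrite invr_gt0 ltr0n.
  by move=> t At dt; rewrite leNgt; apply/negP => et; apply: nt; exists t.
have At_ k : adm (t_ k) by have [] := ht k.
have [G [t [UG ooG At cl]]] := ridge_compact At_.
have PG : ProperFilter G by exact: ultra_proper.
have b0 := bndC_gt0 p_gt1 r_gt0.
have tt : dval tv <= dval t.
  apply/ler_addgt0Pr => a a0; have a4 : 0 < a / 4 by rewrite divr_gt0.
  have n1 : G [set k | k.+1%:R^-1 <= a / 4].
    apply: ooG; near=> k; rewrite /= ltW//; near: k; exact: (near_infty_natSinv_lt (PosNum a4)).
  have [k [/= k1 k2]] := filter_ex (filterI n1 (cl _ a4)).
  have [_ h _] := ht k.
  have := dval_close (At_ k) At (ltW a4) k2; rewrite ler_norml => /andP[? ?].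
  by have := le_trans h k1; lra.
have a0 : 0 < e / (64 * bndC p r) by rewrite divr_gt0// mulr_gt0.
have [k kc] := filter_ex (cl _ a0).
have [_ _ h] := ht k; have := dvar_close (At_ k) At Atv (ltW a0) kc.
rewrite (H t At tt) subr0 (_ : 32 * _ * _ = e / 2); last by field; rewrite gt_eqF.
by rewrite ler_norml => /andP[_]; lra.
Unshelve. all: by end_near.
Qed.

End NearMax.

(** * The covariance *)

Section Covariance.
Context (R : realType) (d : nat) (p r : R) (p_gt1 : 1 < p) (r_gt0 : 0 < r).
Context (P Q : probability (borel_rV R d) R).
Hypothesis Pball : P (l2ball d r) = 1%E.
Hypothesis Qball : Q (l2ball d r) = 1%E.
Implicit Types s t : ridge R d.
Local Notation adm := (adm p r).
Local Notation cpot := (cpot p r P Q).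

(** The covariance between any two indices: the limit process has it on the graph of
    the family of potentials. *)
Definition covp s t : R :=
  \int[P]_x (cpot s (inl 0%N) x * cpot t (inl 0%N) x) +
  \int[Q]_x (cpot s (inr 0%N) x * cpot t (inr 0%N) x).

Lemma Rintegral_full (m : probability (borel_rV R d) R) (D : set (borel_rV R d))
    (g h : borel_rV R d -> R) : measurable D -> m D = 1%E -> bmf h ->
  (forall x, D x -> g x = h x) -> \int[m]_(x in D) g x = \int[m]_x h x.
Proof.
move=> mD mD1 bh gh; congr fine.
rewrite (eq_integral (fun x => (h x)%:E)); last by move=> x; rewrite inE => Dx; rewrite gh.
rewrite [RHS](@negligible_integral _ _ _ m setT (~` D) _ _ measurableT).
- by rewrite setTD setCK.
- exact: measurableC.
- exact: (bmf_integrable m bh).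
- by rewrite probC// mD1 subee.
Qed.

Let cov_expand (m : probability (borel_rV R d) R) (g h : borel_rV R d -> R) : bmf g -> bmf h ->
  \int[m]_x (g x * h x) - (\int[m]_x g x) * (\int[m]_x h x) =
  \int[m]_x ((g x - \int[m]_z g z) * (h x - \int[m]_z h z)).
Proof.
move=> bg bh; set a := \int[m]_x g x; set b := \int[m]_x h x.
have E x : (g x - a) * (h x - b) = g x * h x - (b * g x + (a * h x - a * b)) by ring.
have bgh : bmf (fun x => g x * h x) by exact: bmfM.
have bag : bmf (fun x => b * g x) by exact: bmfZ.
have bah : bmf (fun x => a * h x) by exact: bmfZ.
transitivity (\int[m]_x (g x * h x - (b * g x + (a * h x - a * b)))); last first.
  by apply: eq_Rintegral => x _; rewrite E.
rewrite expectB//; last by apply: bmfD => //; apply: bmfB => //; exact: bmf_cst.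
rewrite expectD//; last by apply: bmfB => //; exact: bmf_cst.
rewrite expectB//; last exact: bmf_cst.
rewrite (expectZ m b bg) (expectZ m a bh) (expect_cst m (a * b)) -/a -/b; ring.
Qed.

Lemma limit_covE (f : 'rV[R]_d -> R -> R) u w : adm (u, f u) -> adm (w, f w) ->
  limit_cov p r P Q f u w = covp (u, f u) (w, f w).
Proof.
move=> Au Aw; have r0 := ltW r_gt0; have mball := @measurable_l2ball R d r.
have PE u' x : adm (u', f u') -> l2ball d r x -> f u' (dotp u' x) = potP r (u', f u') x.
  move=> [/= u1 _] xr; rewrite /potP /fbar/= clamp_id// normr_itv.
  exact: (dotp_sphere_le r0 u1 xr).
have QE u' x : adm (u', f u') -> l2ball d r x ->
    ctransform p r (f u') (dotp u' x) = potQ p r (u', f u') x.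
  move=> [/= u1 _] xr; rewrite /potQ /cbar/= clamp_id// normr_itv.
  exact: (dotp_sphere_le r0 u1 xr).
have bP u' : adm (u', f u') -> bmf (potP r (u', f u')) by exact: (potP_bmf p_gt1 r_gt0).
have bQ u' : adm (u', f u') -> bmf (potQ p r (u', f u')) by exact: (potQ_bmf p_gt1 r_gt0).
rewrite /limit_cov /covp.
rewrite (Rintegral_full mball Pball (bmfM (bP _ Au) (bP _ Aw))); last first.
  by move=> x xr; rewrite !PE.
rewrite (Rintegral_full mball Pball (bP _ Au)); last by move=> x xr; rewrite PE.
rewrite (Rintegral_full mball Pball (bP _ Aw)); last by move=> x xr; rewrite PE.
rewrite (Rintegral_full mball Qball (bmfM (bQ _ Au) (bQ _ Aw))); last first.
  by move=> x xr; rewrite !QE.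
rewrite (Rintegral_full mball Qball (bQ _ Au)); last by move=> x xr; rewrite QE.
rewrite (Rintegral_full mball Qball (bQ _ Aw)); last by move=> x xr; rewrite QE.
rewrite -addrA; congr (_ + _); first exact: (cov_expand P (bP _ Au) (bP _ Aw)).
exact: (cov_expand Q (bQ _ Au) (bQ _ Aw)).
Qed.

Lemma covp_ge0 t : 0 <= covp t t.
Proof.
by rewrite addr_ge0//; apply: Rintegral_ge0 => x _; rewrite -expr2 sqr_ge0.
Qed.

End Covariance.

(** * Projections and the max-sliced distance *)

Section Msw.
Context (R : realType) (d : nat) (p r : R) (p_gt1 : 1 < p) (r_gt0 : 0 < r).
Implicit Types P Q : probability (borel_rV R d) R.
Implicit Types u : 'rV[R]_d.

Definition lawdot P u : probability R R := law P (@measurable_dotp R d u).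

Lemma proj1dE P u : proj1d P u = (lawdot P u : set R -> \bar R).
Proof. by []. Qed.

Lemma lawdot_itv P u : sphere R d u -> P (l2ball d r) = 1%E ->
  lawdot P u `[- r, r]%classic = 1%E.
Proof.
have mI : measurable (`[- r, r]%classic : set R) by exact: measurable_itv.
move=> u1 Pr1; rewrite lawE; apply: (prob_full _ _ _ Pr1).
- exact: measurable_l2ball.
- by rewrite -[X in measurable X]setTI; apply: measurable_dotp.
- by move=> x xr /=; rewrite normr_itv; exact: dotp_sphere_le (ltW r_gt0) u1 xr.
Qed.

Lemma dualR_dval P Q u f : class_C p r f ->
  dualR p r (lawdot P u) (lawdot Q u) f = dval p r P Q (u, f).
Proof.
move=> fC; rewrite /dualR /dval; congr (_ + _).
  by rewrite (expect_law P (measurable_dotp u) (fbar_bmf p_gt1 r_gt0 fC)).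
by rewrite (expect_law Q (measurable_dotp u) (cbar_bmf p_gt1 r_gt0 fC)).
Qed.

Section Ball.
Context (P Q : probability (borel_rV R d) R).
Hypothesis Pball : P (l2ball d r) = 1%E.
Hypothesis Qball : Q (l2ball d r) = 1%E.

Lemma Wpp_dval u : sphere R d u -> exists f, [/\ class_C p r f,
  Wpp p (proj1d P u) (proj1d Q u) = (dval p r P Q (u, f))%:E,
  dval p r P Q (u, f) =
    \int[quantile_coupling (lawdot P u) (lawdot Q u)]_z ccost p r z &
  forall g, class_C p r g -> dval p r P Q (u, g) <= dval p r P Q (u, f)].
Proof.
move=> u1; have [f [fC W E M]] := duality p_gt1 r_gt0 (lawdot_itv u1 Pball) (lawdot_itv u1 Qball).
rewrite dualR_dval// in W E M.
by exists f; split => // g gC; rewrite -dualR_dval//; exact: M.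
Qed.

Lemma potential_dval u f : sphere R d u ->
  kantorovich_potential p r (proj1d P u) (proj1d Q u) f <->
  class_C p r f /\ forall g, class_C p r g -> dval p r P Q (u, g) <= dval p r P Q (u, f).
Proof.
move=> u1; have l1 := lawdot_itv u1 Pball; have l2 := lawdot_itv u1 Qball.
have E g : class_C p r g -> dual_value p r (proj1d P u) (proj1d Q u) g =
    (dval p r P Q (u, g))%:E.
  by move=> gC; rewrite !proj1dE dual_valueE// -(dualR_dval P Q u gC).
split => -[fC M]; split => // g gC.
  by have := M g gC; rewrite !E// lee_fin.
by rewrite !E// lee_fin; exact: M.
Qed.

Lemma dval_bound t : adm p r t -> `|dval p r P Q t| <= 2 * bndC p r.
Proof.
move=> At; rewrite [leRHS]mulr_natl mulr2n (le_trans (ler_normD _ _))// lerD//.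
  by apply: expect_norm_le; [exact: (potP_bmf p_gt1 r_gt0)|move=> x; exact: potP_bound].
by apply: expect_norm_le; [exact: (potQ_bmf p_gt1 r_gt0)|move=> x; exact: potQ_bound].
Qed.

(** The supremum over the directions merges with the one of the dual problem. *)
Lemma MSWpp_sup : MSWpp p P Q = ereal_sup [set (dval p r P Q t)%:E | t in adm p r].
Proof.
apply/eqP; rewrite eq_le; apply/andP; split.
  apply: ge_ereal_sup => _ [u u1 <-]; have [f [fC -> _ _]] := Wpp_dval u1.
  by apply: ereal_sup_ubound; exists (u, f).
apply: ge_ereal_sup => _ [[u f] [/= u1 fC] <-].
have [g [gC W _ M]] := Wpp_dval u1.
apply: (@le_trans _ _ (Wpp p (proj1d P u) (proj1d Q u))).
  by rewrite W lee_fin; exact: M.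
by apply: ereal_sup_ubound; exists u.
Qed.

Lemma MSWpp_fine (u0 : 'rV[R]_d) : sphere R d u0 -> MSWpp p P Q = (fine (MSWpp p P Q))%:E /\
  (forall t, adm p r t -> dval p r P Q t <= fine (MSWpp p P Q)) /\
  (forall c, (forall t, adm p r t -> dval p r P Q t <= c) -> fine (MSWpp p P Q) <= c).
Proof.
move=> u01; have h1 : (MSWpp p P Q <= (2 * bndC p r)%:E)%E.
  rewrite MSWpp_sup; apply: ge_ereal_sup => _ [t At <-]; rewrite lee_fin.
  exact: le_trans (ler_norm _) (dval_bound At).
have A0 : adm p r (u0, fun=> 0 : R) by split => //; exact: (classC0 p_gt1 r_gt0).
have h2 t : adm p r t -> ((dval p r P Q t)%:E <= MSWpp p P Q)%E.
  by move=> At; rewrite MSWpp_sup; apply: ereal_sup_ubound; exists t.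
have fE : MSWpp p P Q = (fine (MSWpp p P Q))%:E.
  rewrite fineK// fin_numE; apply/andP; split.
    by rewrite gt_eqF// (lt_le_trans _ (h2 _ A0))// ltNyr.
  by rewrite lt_eqF// (le_lt_trans h1)// ltry.
split => //; split.
  by move=> t At; rewrite -lee_fin -fE; exact: h2.
move=> c tc; rewrite -lee_fin -fE MSWpp_sup; apply: ge_ereal_sup => _ [t At <-].
by rewrite lee_fin; exact: tc.
Qed.

End Ball.
End Msw.

(** * The spiked model *)

Section Spiked.
Context (R : realType) (d : nat) (p r : R) (p_gt1 : 1 < p) (r_gt0 : 0 < r).
Context (P Q : probability (borel_rV R d) R) (v : 'rV[R]_d).
Hypothesis Pball : P (l2ball d r) = 1%E.
Hypothesis Qball : Q (l2ball d r) = 1%E.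
Hypothesis v1 : sphere R d v.

(** The law of [u^T (X + Z)] is that of [(u^T v) a + b] for independent [a], the
    coordinate of [X] along the spike, and [b = u^T Z]. *)
Lemma spiked_projection (P' : probability (borel_rV R d) R) (dO : measure_display)
    (Om : measurableType dO) (Pr : probability Om R) (X Z : {RV Pr >-> borel_rV R d})
    (u : 'rV[R]_d) :
  P' (l2ball d r) = 1%E ->
  (forall w, ((X w : 'rV[R]_d) <= v)%MS) -> Pr [set w | dotp v (Z w) = 0] = 1%E ->
  independent2 Pr X Z ->
  has_law Pr (fun w => (X w : 'rV[R]_d) + Z w : borel_rV R d) P' ->
  forall phi : R -> R, bmf phi ->
    \int[lawdot P' u]_x phi x =
    \int[lawdot P' v]_a \int[Pr]_w phi (dotp u v * clamp r a + dotp u (Z w)).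
Proof.
move=> Pb Xv Zv ind lawP phi bphi.
have XE w : (X w : 'rV[R]_d) = dotp v (X w) *: v.
  have /sub_rVP[a E] := Xv w.
  by rewrite E dotpZr (sphere_dotp v1) mulr1.
have mX : measurable_fun setT X by exact: measurable_funPT.
have mZ : measurable_fun setT Z by exact: measurable_funPT.
have mXd u' : measurable_fun setT (fun w => dotp u' (X w)) by exact: (measurableT_comp (measurable_dotp u')).
have mZd u' : measurable_fun setT (fun w => dotp u' (Z w)) by exact: (measurableT_comp (measurable_dotp u')).
have mS u' : measurable_fun setT (fun w => dotp u' (X w) + dotp u' (Z w)) by exact: measurable_funD.
have lawu u' : has_law Pr (fun w => dotp u' (X w) + dotp u' (Z w)) (lawdot P' u').
  move=> A mA; have mA' : measurable ((dotp u' : borel_rV R d -> R) @^-1` A).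
    by rewrite -[X in measurable X]setTI; exact: measurable_dotp.
  have := lawP _ mA'; rewrite (_ : _ @^-1` (dotp u' @^-1` A) =
    (fun w => dotp u' (X w) + dotp u' (Z w)) @^-1` A)//.
  by apply/seteqP; split => w /=; rewrite dotpDr.
have mN : measurable [set w | dotp v (Z w) = 0].
  rewrite (_ : [set w | _] = (fun w => dotp v (Z w)) @^-1` [set 0]).
    rewrite -[X in measurable X]setTI; exact: mZd.
  by apply/seteqP; split.
rewrite (expect_has_law (mS u) (lawu u) bphi).
pose psi (z : R * R) : R := phi (dotp u v * clamp r z.1 + z.2).
have mc : measurable_fun setT (clamp r).
  by apply: (@lip_measurable _ _ 1) => x y; rewrite mul1r; exact: (clamp_lip (ltW r_gt0)).
have bpsi : bmf psi.
  apply: (bmf_comp bphi); apply: measurable_funD; last exact: measurable_snd.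
  by apply: measurable_funM => //; apply: (measurableT_comp mc); exact: measurable_fst.
have mI : measurable (`[- r, r]%classic : set R) by exact: measurable_itv.
(* almost surely [v^T Z = 0] and the coordinate lies in [-r, r] *)
have lawv1 : Pr ((fun w => dotp v (X w) + dotp v (Z w)) @^-1` `[- r, r]%classic) = 1%E.
  by rewrite (lawu v _ mI); exact: lawdot_itv.
pose A := [set w | dotp v (Z w) = 0] `&`
  ((fun w => dotp v (X w) + dotp v (Z w)) @^-1` `[- r, r]%classic).
have mA : measurable A.
  apply: measurableI => //; rewrite -[X in measurable X]setTI; exact: mS.
have PA : Pr A = 1%E.
  by apply: prob_setI => //; rewrite -[X in measurable X]setTI; exact: mS.
have E1 : \int[Pr]_w phi (dotp u (X w) + dotp u (Z w)) =
    \int[Pr]_w psi (dotp v (X w), dotp u (Z w)).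
  apply: (expect_ae mA PA) => [||w [/= Z0]].
  - exact: (bmf_comp bphi).
  - by apply: (bmf_comp bpsi); exact: measurable_fun_pair.
  - rewrite Z0 addr0 => xr; rewrite /psi/= clamp_id//; congr (phi (_ + _)).
    by rewrite {1}XE dotpZr mulrC.
have ind' : independent2 Pr (fun w => dotp v (X w)) (fun w => dotp u (Z w)).
  move=> A' B' mA' mB'.
  apply: (ind ((dotp v : borel_rV R d -> R) @^-1` A') ((dotp u : borel_rV R d -> R) @^-1` B')).
    by rewrite -[X in measurable X]setTI; exact: measurable_dotp.
  by rewrite -[X in measurable X]setTI; exact: measurable_dotp.
rewrite E1 (indep_expect (mXd v) (mZd u) ind' bpsi).
have bF : bmf (fun a => \int[Pr]_w psi (a, dotp u (Z w))).
  apply: (bmf_fubini_F (gauss R) Pr (f := fun z : R * Om => psi (z.1, dotp u (Z z.2)))).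
  apply: (bmf_comp bpsi); apply: measurable_fun_pair; first exact: measurable_fst.
  exact: (measurableT_comp (mZd u) measurable_snd).
rewrite (expect_has_law (mS v) (lawu v) bF).
apply: (expect_ae mA PA) => [||w [/= Z0 _]].
- exact: (bmf_comp bF).
- exact: (bmf_comp bF).
- by rewrite Z0 addr0.
Qed.

Hypothesis spiked : spiked_transport_model v P Q.

(** Moving the spike coordinates optimally and keeping [Z] fixed transports
    [P_u] to [Q_u] at [|u^T v| ^ p] times the cost along the spike. *)
Lemma spiked_dval (u : 'rV[R]_d) (f fv : R -> R) : sphere R d u -> class_C p r f ->
  class_C p r fv -> (Wpp p (proj1d P v) (proj1d Q v) = (dval p r P Q (v, fv))%:E) ->
  dval p r P Q (u, f) <= `|dotp u v| `^ p * dval p r P Q (v, fv).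
Proof.
move=> u1 fC fvC WE.
have [dO [Om [Pr [X [Y [Z [XYv Zv ind lawP lawQ]]]]]]] := spiked.
have mZ : measurable_fun setT Z by exact: measurable_funPT.
have mZd : measurable_fun setT (fun w => dotp u (Z w)) by exact: (measurableT_comp (measurable_dotp u)).
have iX : independent2 Pr X Z.
  move=> A B mA mB; have := ind (A `*` setT) B (measurableX mA measurableT) mB.
  by rewrite (_ : _ @^-1` (A `*` setT) = X @^-1` A)//; apply/seteqP; split => w /=; [case|split].
have iY : independent2 Pr Y Z.
  move=> A B mA mB; have := ind (setT `*` A) B (measurableX measurableT mA) mB.
  by rewrite (_ : _ @^-1` (setT `*` A) = Y @^-1` A)//; apply/seteqP; split => w /=; [case|split].
have [g [gC W E M]] := Wpp_dval p_gt1 r_gt0 Pball Qball v1.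
have {}E : dval p r P Q (v, fv) = \int[quantile_coupling (lawdot P v) (lawdot Q v)]_z ccost p r z.
  by move: WE; rewrite W => -[<-].
set pi := quantile_coupling _ _ in E; pose c := dotp u v.
pose T (z : (R * R) * Om) : R * R :=
  (c * clamp r z.1.1 + dotp u (Z z.2), c * clamp r z.1.2 + dotp u (Z z.2)).
have mc : measurable_fun setT (clamp r).
  by apply: (@lip_measurable _ _ 1) => x y; rewrite mul1r; exact: (clamp_lip (ltW r_gt0)).
have mZ2 : measurable_fun setT (fun z : (R * R) * Om => dotp u (Z z.2)).
  exact: (measurableT_comp mZd measurable_snd).
have m1 : measurable_fun setT (fun z : (R * R) * Om => c * clamp r z.1.1 + dotp u (Z z.2)).
  apply: measurable_funD => //; apply: measurable_funM => //.
  by apply: (measurableT_comp mc); apply: (measurableT_comp measurable_fst); exact: measurable_fst.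
have m2 : measurable_fun setT (fun z : (R * R) * Om => c * clamp r z.1.2 + dotp u (Z z.2)).
  apply: measurable_funD => //; apply: measurable_funM => //.
  by apply: (measurableT_comp mc); apply: (measurableT_comp measurable_snd); exact: measurable_fst.
have mT : measurable_fun setT T by exact: measurable_fun_pair.
have [cp1 cp2] := quantile_couplingP (lawdot P v) (lawdot Q v).
have bI (A : set R) : measurable A -> bmf (fun x : R => \1_A x : R) by exact: bmf_indic.
have cpl : coupling (lawdot P u) (lawdot Q u) (law (pi \x Pr)%E mT).
  have aux (P' : probability (borel_rV R d) R) (h : R * R -> R) (X' : {RV Pr >-> borel_rV R d}) :
      P' (l2ball d r) = 1%E -> (forall w, ((X' w : 'rV[R]_d) <= v)%MS) ->
      independent2 Pr X' Z ->
      has_law Pr (fun w => (X' w : 'rV[R]_d) + Z w : borel_rV R d) P' ->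
      measurable_fun setT h -> has_law pi h (lawdot P' v) ->
      forall (A : set R) (F : (R * R) * Om -> R), measurable A -> measurable_fun setT F ->
      (forall z w, F (z, w) = c * clamp r (h z) + dotp u (Z w)) ->
      (pi \x Pr)%E (F @^-1` A) = lawdot P' u A.
    move=> P'b X'v iX' lawP' mh hlaw A F mA mF FE.
    have mFA : measurable (F @^-1` A) by rewrite -[X in measurable X]setTI; exact: mF.
    rewrite -(prob_fine (lawdot P' u) mA) -(prob_fine (pi \x Pr)%E mFA); congr EFin.
    rewrite -(expect_indic _ mA) -(expect_indic _ mFA).
    rewrite (spiked_projection u P'b X'v Zv iX' lawP' (bI A mA)).
    rewrite (expect_prod pi Pr (bmf_indic R mFA)).
    have bF2 : bmf (fun a : R => \int[Pr]_w (\1_A (c * clamp r a + dotp u (Z w)) : R)).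
      apply: (bmf_fubini_F (gauss R) Pr (f := fun z : R * Om => \1_A (c * clamp r z.1 + dotp u (Z z.2)) : R)).
      apply: (bmf_comp (bI A mA)); apply: measurable_funD.
        by apply: measurable_funM => //; exact: (measurableT_comp mc measurable_fst).
      exact: (measurableT_comp mZd measurable_snd).
    rewrite (expect_has_law mh hlaw bF2).
    apply: eq_Rintegral => z _; apply: eq_Rintegral => w _.
    by rewrite !indicE -FE; congr (_%:R); apply/idP/idP; rewrite !inE.
  split => A mA.
  - exact: (aux P fst X Pball (fun w => proj1 (XYv w)) iX lawP measurable_fst cp1 A
      (fun z => c * clamp r z.1.1 + dotp u (Z z.2)) mA m1 (fun _ _ => erefl)).
  - exact: (aux Q snd Y Qball (fun w => proj2 (XYv w)) iY lawQ measurable_snd cp2 A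
      (fun z => c * clamp r z.1.2 + dotp u (Z z.2)) mA m2 (fun _ _ => erefl)).
have l1 := lawdot_itv r_gt0 u1 Pball; have l2 := lawdot_itv r_gt0 u1 Qball.
have := weak_duality p_gt1 r_gt0 fC l1 l2 cpl.
rewrite -/(dualR p r (lawdot P u) (lawdot Q u) f) (dualR_dval p_gt1 r_gt0)// => /le_trans; apply.
have bcc := ccost_bmf p_gt1 r_gt0.
rewrite (expect_law _ mT bcc) E.
rewrite (expect_prod pi Pr (bmf_comp bcc mT)).
rewrite -expectZ//; apply: expect_le.
- exact: (bmf_fubini_F pi Pr (bmf_comp bcc mT)).
- exact: bmfZ.
- move=> z; rewrite -[leRHS](expect_cst Pr); apply: expect_le.
  + exact: (bmf_section1 z (bmf_comp bcc mT)).
  + exact: bmf_cst.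
  + move=> w; rewrite /ccost /cost -powRM//.
    apply: ge0_ler_powR; rewrite ?nnegrE ?mulr_ge0//; first by move: p_gt1; lra.
    apply: (le_trans (clamp_lip (ltW r_gt0) _ _)); rewrite /T/=.
    by rewrite opprD addrACA subrr addr0 -mulrBr normrM.
Qed.

End Spiked.

Section SpikedUnique.
Context (R : realType) (d : nat) (p r : R) (p_gt1 : 1 < p) (r_gt0 : 0 < r).
Context (P Q : probability (borel_rV R d) R) (v : 'rV[R]_d).
Hypothesis Pball : P (l2ball d r) = 1%E.
Hypothesis Qball : Q (l2ball d r) = 1%E.
Hypothesis v1 : sphere R d v.
Hypothesis spiked : spiked_transport_model v P Q.
Hypothesis cc : condition_CC P Q.
Implicit Types s t : ridge R d.
Local Notation adm := (adm p r).
Local Notation dval := (dval p r P Q).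
Local Notation dvar := (dvar p r P Q).
Local Notation cpot := (cpot p r P Q).

(** The sense in which maximisers are unique: constants added to a potential do
    not matter. *)
Let aeq s t : Prop := exists A B, [/\ measurable A, measurable B, P A = 1%E, Q B = 1%E &
  (forall x, A x -> cpot s (inl 0%N) x = cpot t (inl 0%N) x) /\
  (forall x, B x -> cpot s (inr 0%N) x = cpot t (inr 0%N) x)].

Let aeq_sym s t : aeq s t -> aeq t s.
Proof.
move=> [A [B [mA mB PA QB [h1 h2]]]]; exists A, B; split => //.
by split => x /[dup] ? => [/h1|/h2].
Qed.

Let aeq_trans s1 s2 s3 : aeq s1 s2 -> aeq s2 s3 -> aeq s1 s3.
Proof.
move=> [A [B [mA mB PA QB [h1 h2]]]] [A' [B' [mA' mB' PA' QB' [h1' h2']]]].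
exists (A `&` A'), (B `&` B'); split.
- exact: measurableI.
- exact: measurableI.
- exact: prob_setI.
- exact: prob_setI.
- by split => x [Ax Bx]; [rewrite h1// h1'|rewrite h2// h2'].
Qed.

Let aeq_dvar s t : adm s -> adm t -> aeq s t -> dvar s t = 0.
Proof.
move=> As At [A [B [mA mB PA QB [h1 h2]]]].
have b2 k : bmf (fun x => (cpot s k x - cpot t k x) ^+ 2).
  by under eq_fun do rewrite expr2; apply: bmfM; apply: bmfB; exact: (cpot_bmf p_gt1 r_gt0).
rewrite /dvar (expect_ae mA PA (b2 (inl 0%N)) (bmf_cst _ 0)); last first.
  by move=> x /h1 ->; rewrite subrr expr0n.
rewrite (expect_ae mB QB (b2 (inr 0%N)) (bmf_cst _ 0)) ?expect_cst ?addr0//.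
by move=> x /h2 ->; rewrite subrr expr0n.
Qed.

Let aeq_max u f g : sphere R d u -> class_C p r f -> class_C p r g ->
  (forall h, class_C p r h -> dval (u, h) <= dval (u, f)) ->
  dval (u, g) = dval (u, f) -> aeq (u, f) (u, g).
Proof.
move=> u1 fC gC M E.
have l1 := lawdot_itv r_gt0 u1 Pball; have l2 := lawdot_itv r_gt0 u1 Qball.
have [||c [c1 c2]] := potential_unique p_gt1 r_gt0 l1 l2 (cc u1) fC gC.
- by move=> h hC; rewrite !(dualR_dval p_gt1 r_gt0)//; exact: M.
- by rewrite !(dualR_dval p_gt1 r_gt0).
have Au g' : class_C p r g' -> adm (u, g') by [].
set A := [set x : borel_rV R d | fbar r f (dotp u x) - fbar r g (dotp u x) = c].
set B := [set x : borel_rV R d | cbar p r f (dotp u x) - cbar p r g (dotp u x) = - c].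
have bP : bmf (fun x => potP r (u, f) x - potP r (u, g) x).
  by apply: bmfB; exact: (potP_bmf p_gt1 r_gt0).
have bQ : bmf (fun x => potQ p r (u, f) x - potQ p r (u, g) x).
  by apply: bmfB; exact: (potQ_bmf p_gt1 r_gt0).
have mA : measurable A.
  rewrite (_ : A = (fun x => potP r (u, f) x - potP r (u, g) x) @^-1` [set c])//.
  by rewrite -[X in measurable X]setTI; apply: (proj1 bP).
have mB : measurable B.
  rewrite (_ : B = (fun x => potQ p r (u, f) x - potQ p r (u, g) x) @^-1` [set - c])//.
  by rewrite -[X in measurable X]setTI; apply: (proj1 bQ).
have PA : P A = 1%E := c1.
have QB : Q B = 1%E.
  by move: c2; rewrite /lawdot lawE; apply: etrans; congr (Q _).
have eP : \int[P]_x potP r (u, f) x - \int[P]_x potP r (u, g) x = c.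
  rewrite -expectB; [|exact: (potP_bmf p_gt1 r_gt0 (Au _ _))|exact: (potP_bmf p_gt1 r_gt0 (Au _ _))].
  by rewrite (expect_ae mA PA bP (bmf_cst _ c)) ?expect_cst.
have eQ : \int[Q]_x potQ p r (u, f) x - \int[Q]_x potQ p r (u, g) x = - c.
  rewrite -expectB; [|exact: (potQ_bmf p_gt1 r_gt0 (Au _ _))|exact: (potQ_bmf p_gt1 r_gt0 (Au _ _))].
  by rewrite (expect_ae mB QB bQ (bmf_cst _ (- c))) ?expect_cst.
exists A, B; split => //; split => x h; apply/eqP; rewrite -subr_eq0; apply/eqP;
  rewrite /cpot opprB addrACA.
- have h' : potP r (u, f) x - potP r (u, g) x = c by [].
  by move: eP h'; lra.
- have h' : potQ p r (u, f) x - potQ p r (u, g) x = - c by [].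
  by move: eQ h'; lra.
Qed.

(** The direction [- u] with [f] gives the same ridge functions as [u] with the
    reflection of [f]. *)
Let flip (f : R -> R) : R -> R := fun x => f (- x).

Let flip_class f : class_C p r f -> class_C p r (flip f).
Proof.
move=> [f0 fL]; split; first by rewrite /flip oppr0.
move=> x y xr yr; rewrite /flip; apply: le_trans (fL _ _ _ _) _; rewrite ?normr_itv ?normrN -?normr_itv//.
by rewrite -opprD normrN.
Qed.

Let clampN x : clamp r (- x) = - clamp r x.
Proof.
have r0 := ltW r_gt0.
have [[? ->]|[? ->]|[? ->]] := clampP r0 x; have [[? ->]|[? ->]|[? ->]] := clampP r0 (- x); lra.
Qed.

Let flip_potP (u : 'rV[R]_d) f x : potP r (- u, f) x = potP r (u, flip f) x.
Proof. by rewrite /potP/= /fbar dotpNl clampN. Qed.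

Let flip_potQ (u : 'rV[R]_d) f x : potQ p r (- u, f) x = potQ p r (u, flip f) x.
Proof.
rewrite /potQ/= /cbar dotpNl clampN /ctransform; congr inf.
have nz z : z \in `[- r, r] -> - z \in `[- r, r] by rewrite !normr_itv normrN.
apply/seteqP; split => _ [z zr <-]; exists (- z); try exact: nz.
  by rewrite /flip opprK -opprD normrN opprK.
by rewrite -opprD normrN.
Qed.

Let dval_ge0 u f : sphere R d u -> class_C p r f ->
  (forall h, class_C p r h -> dval (u, h) <= dval (u, f)) -> 0 <= dval (u, f).
Proof.
move=> u1 fC M; have [g [gC _ E _]] := Wpp_dval p_gt1 r_gt0 Pball Qball u1.
apply: le_trans (M _ gC); rewrite E; apply: Rintegral_ge0 => z _; exact: cost_ge0.
Qed.

Let zero_potP (u : 'rV[R]_d) x : potP r (u, fun=> 0) x = 0. Proof. by []. Qed.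

Let zero_potQ (u : 'rV[R]_d) x : potQ p r (u, fun=> 0) x = 0.
Proof.
rewrite /potQ /cbar/=; set y := clamp r _; have yr : y \in `[- r, r] by exact: (clamp_itv (ltW r_gt0)).
have C0 := classC0 p_gt1 r_gt0.
apply/eqP; rewrite eq_le; apply/andP; split.
  apply: (le_trans (ct_le p_gt1 r_gt0 y C0 yr)).
  by rewrite subrr /cost normr0 subr0 powR0// gt_eqF//; move: p_gt1; lra.
by apply: (ct_ge p_gt1 r_gt0) => // x' _; rewrite subr0 cost_ge0.
Qed.

Let int_zero (m : probability (borel_rV R d) R) (g : borel_rV R d -> R) :
  (forall x, g x = 0) -> \int[m]_x g x = 0.
Proof.
move=> g0; rewrite (_ : g = fun=> 0); first exact: expect_cst.
by apply/funext.
Qed.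

Let zero_dval u : dval (u, fun=> 0) = 0.
Proof.
rewrite /dval (int_zero P (zero_potP u)) (int_zero Q (zero_potQ u)); exact: addr0.
Qed.

Let zero_cpot u k x : cpot (u, fun=> 0) k x = 0.
Proof.
case: k => i; rewrite /cpot.
  rewrite (int_zero P (zero_potP u)) (zero_potP u x); exact: subrr.
rewrite (int_zero Q (zero_potQ u)) (zero_potQ u x); exact: subrr.
Qed.

(** If the distance along the spike vanishes, [0] is a potential in every direction;
    its ridge functions vanish, whatever the direction. *)
Let zero_aeq u u' : aeq (u, fun=> 0) (u', fun=> 0).
Proof.
have [TP TQ] := (probT P, probT Q).
exists setT, setT; split; [exact: measurableT|exact: measurableT|exact: TP|exact: TQ|].
by split => x _; exact: (etrans (zero_cpot u _ x) (esym (zero_cpot u' _ x))).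
Qed.

(** A maximiser over all directions agrees with the potential along the spike:
    if the distance along the spike is positive, only the directions [v] and
    [- v] reach it; if it vanishes, then all projections agree and every
    potential is almost surely constant. *)
Lemma maximiser_dvar0 fv : class_C p r fv ->
  (forall h, class_C p r h -> dval (v, h) <= dval (v, fv)) ->
  forall t, adm t -> dval (v, fv) <= dval t -> dvar t (v, fv) = 0.
Proof.
move=> fvC Mv [u f] [/= u1 fC] le_t; apply: aeq_dvar => //.
have [g [gC WE _ Mg]] := Wpp_dval p_gt1 r_gt0 Pball Qball v1.
have WE' : Wpp p (proj1d P v) (proj1d Q v) = (dval (v, fv))%:E.
  by rewrite WE; congr EFin; apply/eqP; rewrite eq_le Mv// Mg.
have sp h : class_C p r h -> dval (u, h) <= `|dotp u v| `^ p * dval (v, fv).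
  by move=> hC; exact: (spiked_dval p_gt1 r_gt0 Pball Qball v1 spiked).
have W0 := dval_ge0 v1 fvC Mv; have C0 := classC0 p_gt1 r_gt0.
move: W0; rewrite le_eqVlt => /predU1P[W0|Wpos].
  apply: (aeq_trans (s2 := (u, fun=> 0))); last apply: (aeq_trans (zero_aeq u v)).
    have fE : dval (u, f) = 0.
      have h1 := sp _ fC; rewrite -W0 mulr0 in h1; have h2 := le_t; rewrite -W0 in h2.
      by apply/eqP; rewrite eq_le h1 h2.
    apply: aeq_max => //; last by rewrite zero_dval fE.
    by move=> h hC; have := sp _ hC; rewrite fE -W0 mulr0.
  by apply/aeq_sym/aeq_max => //; rewrite zero_dval W0.
have uv1 : 1 <= `|dotp u v|.
  rewrite leNgt; apply/negP => uv.
  have : `|dotp u v| `^ p < 1.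
    apply: (@lt_le_trans _ _ (1 `^ p)); last by rewrite powR1.
    apply: gt0_ltr_powR; rewrite ?nnegrE//.
    by move: p_gt1; lra.
  by move=> h; have := le_trans le_t (sp _ fC); rewrite -[leLHS]mul1r ler_pM2r// leNgt h.
have uE : u = dotp v u *: v /\ (dotp v u) ^+ 2 = 1.
  have := dotp_sphere_sqr u v1; rewrite (sphere_dotp u1).
  have c1 : 1 <= (dotp v u) ^+ 2.
    by rewrite dotpC -real_normK ?num_real// exprn_ege1.
  set w := u - _ => e; have w0 := dotp_ge0 w.
  have ww : dotp w w = 0 by lra.
  split; last by lra.
  apply/eqP; rewrite -subr_eq0 -/w; apply/eqP/rowP => j; rewrite [RHS]mxE.
  have : w ord0 j ^+ 2 <= dotp w w.
    rewrite dotpE (bigD1 j)//= -expr2 lerDl.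
    by apply: sumr_ge0 => k _; rewrite -expr2 sqr_ge0.
  rewrite ww => h; have : w ord0 j ^+ 2 == 0 by rewrite eq_le h sqr_ge0.
  by rewrite sqrf_eq0 => /eqP.
have Mmax h : class_C p r h -> dval (u, h) <= dval (v, fv) ->
  dval (v, fv) <= dval (u, h) -> dval (u, h) = dval (v, fv).
  by move=> _ a b; apply/eqP; rewrite eq_le a b.
have [uE1 /eqP] := uE; rewrite sqrf_eq1 => /orP[]/eqP c.
  rewrite c scale1r in uE1; rewrite uE1 in le_t *.
  apply/aeq_sym/aeq_max => //; apply/eqP; rewrite eq_le le_t andbT; exact: Mv.
rewrite c scaleN1r in uE1.
have fE x : potP r (u, f) x = potP r (v, flip f) x by rewrite uE1 flip_potP.
have fE' x : potQ p r (u, f) x = potQ p r (v, flip f) x by rewrite uE1 flip_potQ.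
have eP : potP r (u, f) = potP r (v, flip f) by apply/funext.
have eQ : potQ p r (u, f) = potQ p r (v, flip f) by apply/funext.
have dE : dval (u, f) = dval (v, flip f) by rewrite /dval eP eQ.
apply: (aeq_trans (s2 := (v, flip f))).
  have [TP TQ] := (probT P, probT Q).
  exists setT, setT; split; [exact: measurableT|exact: measurableT|exact: TP|exact: TQ|].
  by split => x _; rewrite /cpot ?eP ?eQ.
apply/aeq_sym/aeq_max => //; first exact: flip_class.
by rewrite -dE; apply/eqP; rewrite eq_le le_t andbT dE; apply: Mv; exact: flip_class.
Qed.

End SpikedUnique.

(** * Empirical measures *)

Section EmpiricalMeasure.
Context (R : realType) (d : nat).
Implicit Types x : nat -> borel_rV R d.

Lemma empiricalE n x (A : set (borel_rV R d)) :
  empirical n.+1 x A = (n.+1%:R^-1 * \sum_(i < n.+1) \1_A (x i))%:E.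
Proof.
rewrite /empirical /mscale/= /msum/= EFinM; congr (_ * _)%E.
transitivity (\sum_(k < n.+1) @dirac _ _ (x k) R A)%E; first by [].
by rewrite -sumEFin; apply: eq_bigr => i _; rewrite diracE indicE.
Qed.

Lemma empirical_setT n x : empirical n.+1 x setT = 1%E.
Proof.
rewrite empiricalE (eq_bigr (fun=> 1)); last by move=> i _; rewrite indicT.
by rewrite sumr_const card_ord mulVf// pnatr_eq0.
Qed.

(** The sample size is a successor, so that the empirical measure is a probability. *)
Definition emp_set n x : set (borel_rV R d) -> \bar R := empirical n.+1 x.

HB.instance Definition _ n x := Measure.copy (emp_set n x) (empirical n.+1 x).

HB.instance Definition _ n x :=
  @Measure_isProbability.Build _ _ _ (emp_set n x) (empirical_setT n x).

Definition emp_prob n x : probability (borel_rV R d) R := emp_set n x.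

Lemma emp_probE n x : (emp_prob n x : set _ -> \bar R) = empirical n.+1 x.
Proof. by []. Qed.

Lemma expect_empirical n x (f : borel_rV R d -> R) : bmf f ->
  \int[emp_prob n x]_z f z = n.+1%:R^-1 * \sum_(i < n.+1) f (x i).
Proof.
suff pos g : bmf g -> (forall z, 0 <= g z) ->
    \int[emp_prob n x]_z g z = n.+1%:R^-1 * \sum_(i < n.+1) g (x i).
  move=> bf; have [_ [M fM]] := bf.
  have bM : bmf (fun z => f z + M) by apply: bmfD => //; exact: bmf_cst.
  have := pos _ bM; rewrite expectD//; last exact: bmf_cst.
  rewrite expect_cst big_split/= mulrDr sumr_const card_ord -[M *+ _]mulr_natl.
  rewrite mulKf ?pnatr_eq0// => h; apply: (addIr M); apply: h => z.
  by have := fM z; rewrite ler_norml => /andP[]; lra.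
move=> [mg _] g0; rewrite /Rintegral.
have mg' : measurable_fun setT (EFin \o g) by exact/measurable_EFinP.
have g0' z : (0 <= (EFin \o g) z)%E by rewrite lee_fin.
have -> : (\int[emp_prob n x]_z (g z)%:E)%E = (n.+1%:R^-1 * \sum_(i < n.+1) g (x i))%:E; last by [].
rewrite (_ : (\int[emp_prob n x]_z (g z)%:E)%E = \int[empirical n.+1 x]_z (EFin \o g) z)%E//.
rewrite /empirical ge0_integral_mscale// ge0_integral_measure_sum// EFinM.
congr (_ * _)%E; rewrite -sumEFin; apply: eq_bigr => i _.
by rewrite integral_dirac//= diracT mul1e.
Qed.

Lemma emp_prob_ball n x r : (forall i, (i < n.+1)%N -> l2ball d r (x i)) ->
  emp_prob n x (l2ball d r) = 1%E.
Proof.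
move=> h; rewrite emp_probE empiricalE (eq_bigr (fun=> 1)).
  by rewrite sumr_const card_ord mulVf// pnatr_eq0.
by move=> i _; rewrite indicE mem_set//; exact: h.
Qed.

End EmpiricalMeasure.

Section Measurability.
Context (R : realType) (d : nat) (p : R) (p_gt1 : 1 < p).
Context (dO : measure_display) (Om : measurableType dO).
Context (X Y : nat -> Om -> borel_rV R d).
Hypothesis mX : forall i, measurable_fun setT (X i).
Hypothesis mY : forall i, measurable_fun setT (Y i).
Context (v : 'rV[R]_d) (v1 : sphere R d v).

Definition msw_emp (n : nat) (w : Om) : R :=
  fine (MSWpp p (empirical n (fun i => X i w)) (empirical n (fun i => Y i w))).

Lemma dval_emp r n w t : 0 < r -> adm p r t ->
  dval p r (emp_prob n (fun i => X i w)) (emp_prob n (fun i => Y i w)) t =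
  n.+1%:R^-1 * (\sum_(i < n.+1) potP r t (X i w) + \sum_(i < n.+1) potQ p r t (Y i w)).
Proof.
move=> r0 At; rewrite /dval mulrDr.
by rewrite (expect_empirical _ _ (potP_bmf p_gt1 r0 At)) (expect_empirical _ _ (potQ_bmf p_gt1 r0 At)).
Qed.

(** On the event that all samples lie in a given ball, the distance is a
    supremum over the countably many points of the nets. *)
Lemma measurable_msw n : measurable_fun setT (msw_emp n.+1).
Proof.
pose rad (k : nat) : R := k.+1%:R.
have rad0 k : 0 < rad k by rewrite ltr0n.
pose B k : set Om := \bigcap_(i in `I_n.+1)
  (X i @^-1` l2ball d (rad k) `&` Y i @^-1` l2ball d (rad k)).
have mball k := @measurable_l2ball R d (rad k).
have mB k : measurable (B k).
  apply: bigcap_measurable => [|i _]; first by exists 0%N.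
  apply: measurableI; rewrite -[X in measurable X]setTI.
    exact: mX.
  exact: mY.
have BP k w : B k w <-> forall i, (i < n.+1)%N -> l2ball d (rad k) (X i w) /\ l2ball d (rad k) (Y i w).
  by split => h i /h.
have coverB w : exists k, B k w.
  pose M := \sum_(i < n.+1) (l2norm (X i w) + l2norm (Y i w)).
  exists (Num.truncn M); apply/BP => i ilt.
  have l0 (z : 'rV[R]_d) : 0 <= l2norm z by exact: sqrtr_ge0.
  have iM : l2norm (X i w) + l2norm (Y i w) <= M.
    rewrite /M (bigD1 (Ordinal ilt))//= lerDl; apply: sumr_ge0 => j _.
    by rewrite addr_ge0.
  have Mk : M <= rad (Num.truncn M) by apply: ltW; exact: truncnS_gt.
  have := l0 (X i w); have := l0 (Y i w).
  by rewrite /l2ball/=; split; lra.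
have A0 k : adm p (rad k) (v, fun=> 0 : R) by split => //; exact: (classC0 p_gt1 (rad0 k)).
pose rp k m j := repn p (rad k) (adm p (rad k)) (v, fun=> 0 : R) m j.
have rpA k m j : adm p (rad k) (rp k m j) by exact: repn_in.
pose dv k t w := n.+1%:R^-1 * (\sum_(i < n.+1) potP (rad k) t (X i w) +
  \sum_(i < n.+1) potQ p (rad k) t (Y i w)).
have mdv k t : adm p (rad k) t -> measurable_fun setT (dv k t).
  move=> At; apply: measurable_funM => //; apply: measurable_funD.
    apply: measurable_sum => i; apply: (measurableT_comp _ (mX i)).
    exact: (proj1 (potP_bmf p_gt1 (rad0 k) At)).
  apply: measurable_sum => i; apply: (measurableT_comp _ (mY i)).
  exact: (proj1 (potQ_bmf p_gt1 (rad0 k) At)).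
have key k w c : B k w -> (c < msw_emp n.+1 w) = `[< exists m j, c < dv k (rp k m j) w >].
  move=> /BP Bw; pose P := emp_prob n (fun i => X i w); pose Q := emp_prob n (fun i => Y i w).
  have Pb : P (l2ball d (rad k)) = 1%E by apply: emp_prob_ball => i /Bw[].
  have Qb : Q (l2ball d (rad k)) = 1%E by apply: emp_prob_ball => i /Bw[].
  have [_ [ub lub]] := MSWpp_fine p_gt1 (rad0 k) Pb Qb v1.
  have dE t : adm p (rad k) t -> dval p (rad k) P Q t = dv k t w.
    by move=> At; rewrite dval_emp.
  apply/idP/asboolP => [cM|[m [j h]]].
    apply: contrapT => nE; move: cM; apply/negP; rewrite -leNgt.
    apply: lub => t At; apply/ler_addgt0Pr => e e0.
    have [m _ hm] := pow2_small (2 * netC d p (rad k)) 0 e0.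
    have cl := rep_close p_gt1 (rad0 k) (A0 k) (fun t h => h) m At.
    have Ar : adm p (rad k) (rep p (rad k) (adm p (rad k)) (v, fun=> 0 : R) m t) by exact: rep_in.
    have nC : 0 <= netC d p (rad k) / 2 ^+ m.
      by rewrite divr_ge0 ?exprn_ge0// ltW// netC_gt0.
    have := dval_close p_gt1 (rad0 k) Pb Qb At Ar nC cl.
    rewrite ler_norml => /andP[_ h].
    have h2 : dval p (rad k) P Q (rep p (rad k) (adm p (rad k)) (v, fun=> 0 : R) m t) <= c.
      rewrite dE// leNgt; apply/negP => h3; apply: nE; exists m, (ncode p (rad k) m t); exact: h3.
    by rewrite mulrA in h; lra.
  by apply: (lt_le_trans h); rewrite -dE//; exact: ub.
apply: (measurability _ (RGenOInfty.measurableE R)) => _ [_ [c ->] <-]; rewrite setTI.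
rewrite (_ : _ @^-1` _ = \bigcup_k (B k `&` \bigcup_m \bigcup_j
    (dv k (rp k m j) @^-1` `]c, +oo[%classic))).
  apply: bigcup_measurable => k _; apply: measurableI => //.
  apply: bigcup_measurable => m _; apply: bigcup_measurable => j _.
  by rewrite -[X in measurable X]setTI; apply: mdv.
apply/seteqP; split => w /=; rewrite ?in_itv/= ?andbT.
  have [k Bw] := coverB w; rewrite (key k w c Bw) => /asboolP[m [j h]].
  by exists k => //; split => //; exists m => //; exists j => //=; rewrite in_itv/= h.
move=> [k _ [Bw [m _ [j _]]]]; rewrite /= in_itv/= andbT => h.
by rewrite (key k w c Bw); apply/asboolP; exists m, j.
Qed.

End Measurability.

(** * The limit of the max-sliced distance *)

Lemma sum_iota_sub (R : pzRingType) (n : nat) (F : nat -> R) (c : R) :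
  \sum_(i <- iota 0 n) (F i - c) = \sum_(i < n) F i - n%:R * c.
Proof.
have -> : iota 0 n = index_iota 0 n by rewrite /index_iota subn0.
by rewrite big_mkord sumrB sumr_const card_ord mulr_natl.
Qed.

Section MswLimit.
Context (R : realType) (d : nat) (p r : R) (p_gt1 : 1 < p) (r_gt0 : 0 < r).
Context (P Q : probability (borel_rV R d) R) (v : 'rV[R]_d).
Hypothesis Pball : P (l2ball d r) = 1%E.
Hypothesis Qball : Q (l2ball d r) = 1%E.
Hypothesis v1 : sphere R d v.
Hypothesis spiked : spiked_transport_model v P Q.
Hypothesis cc : condition_CC P Q.
Context (dO : measure_display) (Om : measurableType dO) (Pr : probability Om R).
Context (X Y : nat -> Om -> borel_rV R d).
Hypothesis mX : forall i, measurable_fun setT (X i).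
Hypothesis mY : forall i, measurable_fun setT (Y i).
Hypothesis Xr : forall i w, l2ball d r (X i w).
Hypothesis Yr : forall i w, l2ball d r (Y i w).
Hypothesis lawX : forall i, has_law Pr (X i) P.
Hypothesis lawY : forall i, has_law Pr (Y i) Q.
Hypothesis indep : mutually_independent Pr
  (fun k : nat + nat => match k with inl i => X i | inr j => Y j end).
Context (fv : R -> R).
Hypothesis fvC : class_C p r fv.
Hypothesis fv_max : forall h, class_C p r h -> dval p r P Q (v, h) <= dval p r P Q (v, fv).

Let tv : ridge R d := (v, fv).
Let Atv : adm p r tv. Proof. by []. Qed.
Local Notation dval_of := (dval p r).
Local Notation dval := (dval p r P Q).
Local Notation emp := (emp p r P Q X Y).
Local Notation cpot := (cpot p r P Q).
Let XY (k : nat + nat) : Om -> borel_rV R d :=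
  match k with inl i => X i | inr j => Y j end.
Let b := bndC p r.
Let b_gt0 : 0 < b. Proof. exact: bndC_gt0. Qed.

Let dval_emp_ (n : nat) t w : R :=
  n.+1%:R^-1 * (\sum_(i < n.+1) potP r t (X i w) + \sum_(i < n.+1) potQ p r t (Y i w)).

Let empE n t w : emp n.+1 t w = Num.sqrt n.+1%:R * (dval_emp_ n t w - dval t).
Proof.
rewrite /emp big_cat !big_map /dval_emp_ /dval.
have -> : \sum_(i <- iota 0 n.+1) cpot t (inl i) (X i w) =
    \sum_(i < n.+1) potP r t (X i w) - n.+1%:R * \int[P]_z potP r t z by exact: sum_iota_sub.
have -> : \sum_(i <- iota 0 n.+1) cpot t (inr i) (Y i w) =
    \sum_(i < n.+1) potQ p r t (Y i w) - n.+1%:R * \int[Q]_z potQ p r t z by exact: sum_iota_sub.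
set S1 := \sum_(i < n.+1) potP _ _ _; set S2 := \sum_(i < n.+1) potQ _ _ _ _.
set I1 := \int[P]_z _; set I2 := \int[Q]_z _.
have n0 : n.+1%:R != 0 :> R by rewrite pnatr_eq0.
rewrite /=; have -> : S1 - n.+1%:R * I1 + (S2 - n.+1%:R * I2) =
    n.+1%:R * (n.+1%:R^-1 * (S1 + S2) - (I1 + I2)) by field.
rewrite mulrA; congr (_ * _).
have s0 : Num.sqrt n.+1%:R != 0 :> R by rewrite gt_eqF// sqrtr_gt0 ltr0n.
by rewrite -{2}(@sqr_sqrtr _ n.+1%:R)// expr2 mulKf.
Qed.

(** No direction exceeds the spike, by [spiked_dval]. *)
Let dval_le t : adm p r t -> dval t <= dval tv.
Proof.
move=> [u1 fC]; have [g [gC WE E M]] := Wpp_dval p_gt1 r_gt0 Pball Qball v1.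
have gE : dval (v, g) = dval tv by apply/eqP; rewrite eq_le fv_max// M.
have WE' : Wpp p (proj1d P v) (proj1d Q v) = (dval tv)%:E by rewrite WE gE.
have d0 : 0 <= dval tv.
  by rewrite -gE E; apply: Rintegral_ge0 => z _; exact: cost_ge0.
rewrite [t]surjective_pairing.
apply: (le_trans (spiked_dval p_gt1 r_gt0 Pball Qball v1 spiked u1 fC fvC WE')).
rewrite ler_piMl//; apply: (@le_trans _ _ (1 `^ p)); last by rewrite powR1.
apply: ge0_ler_powR; rewrite ?nnegrE//; first by move: p_gt1; lra.
by apply: dotp_sphere_le => //; rewrite /l2ball/= v1.
Qed.

Let mswE : fine (MSWpp p P Q) = dval tv.
Proof.
have [_ [ub lub]] := MSWpp_fine p_gt1 r_gt0 Pball Qball v1.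
by apply/eqP; rewrite eq_le ub// lub// => t; exact: dval_le.
Qed.

Let T (n : nat) (w : Om) : R := Num.sqrt n%:R * (msw_emp p X Y n w - fine (MSWpp p P Q)).

Let dvar_bound t : adm p r t -> dvar p r P Q t tv <= 32 * b ^+ 2.
Proof.
move=> At; have h k x : (cpot t k x - cpot tv k x) ^+ 2 <= 16 * b ^+ 2.
  have := cpot_bound p_gt1 r_gt0 P Q k x At; have := cpot_bound p_gt1 r_gt0 P Q k x Atv.
  rewrite -/b !ler_norml => /andP[? ?] /andP[? ?]; move: b_gt0; nra.
have b2 k : bmf (fun x => (cpot t k x - cpot tv k x) ^+ 2).
  by under eq_fun do rewrite expr2; apply: bmfM; apply: bmfB; exact: (cpot_bmf p_gt1 r_gt0).
rewrite /dvar (_ : 32 * b ^+ 2 = 16 * b ^+ 2 + 16 * b ^+ 2); last by lra.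
apply: lerD.
  rewrite -[leRHS](expect_cst P); apply: (expect_le P (b2 (inl 0%N)) (bmf_cst _ _)) => x.
  exact: (h (inl 0%N)).
rewrite -[leRHS](expect_cst Q); apply: (expect_le Q (b2 (inr 0%N)) (bmf_cst _ _)) => x.
exact: (h (inr 0%N)).
Qed.

(** Only near-maximisers matter, and there the empirical process is close to
    its value at the potential along the spike. *)
Let T_close e : 0 < e -> \forall n \near \oo,
  exists A, [/\ measurable A, fine (Pr (~` A)) <= e & forall w, A w -> `|T n w - emp n tv w| <= e].
Proof.
move=> e0; pose K0 := 4 * chain_cst (entC R d) (384 * netC d p r ^+ 2).
have K00 : 0 <= K0 by rewrite mulr_ge0// sqrtr_ge0.
have e2 : 0 < e / 2 by rewrite divr_gt0.
have [k _ hk] := pow2_small (2 * K0 + 16) 0 e0.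
pose m := (3 * k)%N.
have k0 : 0 < 2 ^- k :> R by rewrite invr_gt0 exprn_gt0.
have m1 : K0 * (3 / 4) ^+ m <= e / 2.
  apply: (@le_trans _ _ (K0 * 2 ^- k)); last by move: hk; rewrite mulrDl; nra.
  rewrite ler_wpM2l// exprM -exprVn lerXn2r ?nnegrE ?exprn_ge0//; lra.
have m2 : 4 / 2 ^+ m <= e / 4.
  apply: (@le_trans _ _ (4 * 2 ^- k)); last by move: hk; rewrite mulrDl; nra.
  rewrite ler_wpM2l// lef_pV2 ?posrE ?exprn_gt0//.
  by apply: ler_weXn2l; rewrite ?ler1n// /m; lia.
have N0 : 0 <= (nsize d m)%:R :> R by [].
pose N1 : R := (nsize d m)%:R + 1; have N10 : 0 < N1 by rewrite ltr_wpDl.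
pose eta := e / 4 * (e / 2) ^+ 2 / N1.
have eta0 : 0 < eta by rewrite divr_gt0// mulr_gt0 ?exprn_gt0// divr_gt0.
have [D D0 hD] := near_max p_gt1 r_gt0 Pball Qball Atv
  (maximiser_dvar0 p_gt1 r_gt0 Pball Qball v1 spiked cc fvC fv_max) eta0.
pose a2 := N1 * (32 * b ^+ 2) * 4 / e + 1.
have b20 : 0 <= 32 * b ^+ 2 by rewrite mulr_ge0// sqr_ge0.
have c0 : 0 <= N1 * (32 * b ^+ 2) * 4 / e.
  by rewrite divr_ge0 ?(ltW e0)// mulr_ge0// mulr_ge0// ltW.
have a21 : 1 <= a2 by rewrite /a2 lerDr.
have a20 : 0 < a2 by lra.
pose M := K0 * (3 / 4) ^+ m + a2.
pose n0 := (Num.truncn ((M / D) ^+ 2)).+1.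
exists n0 => // -[//|n] /= n0n.
have sn : M <= Num.sqrt n.+1%:R * D.
  rewrite -ler_pdivrMr//; apply: (le_trans (ler_norm _)); rewrite -sqrtr_sqr ler_wsqrtr//.
  by rewrite (le_trans (ltW (truncnS_gt _)))// ler_nat.
have St0 : adm p r tv /\ dval tv - dval tv <= D by rewrite subrr; split => //; exact: ltW.
have [A1 [mA1 PA1 hA1]] := emp_sup p_gt1 r_gt0 mX mY Xr Yr lawX lawY indep m
  (S := fun t => adm p r t /\ dval tv - dval t <= D) St0 (fun t h => proj1 h) Atv
  (fun t h => hD t (proj1 h) (proj2 h)) e2 (ltn0Sn n).
have [A2 [mA2 PA2 hA2]] := emp_sup p_gt1 r_gt0 mX mY Xr Yr lawX lawY indep m
  (S := adm p r) Atv (fun t h => h) Atv (fun t h => dvar_bound h) a20 (ltn0Sn n).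
rewrite -/K0 in hA1 hA2.
exists (A1 `&` A2); split; first exact: measurableI.
  rewrite setCI; apply: (le_trans (fprobU Pr (measurableC mA1) (measurableC mA2))).
  have h1 : (nsize d m)%:R * (eta / (e / 2) ^+ 2) <= e / 4.
    have -> : (nsize d m)%:R * (eta / (e / 2) ^+ 2) = e / 4 * ((nsize d m)%:R / N1).
      by rewrite /eta; field; rewrite !gt_eqF.
    rewrite ler_piMr ?divr_ge0 ?(ltW e0)// ler_pdivrMr// mul1r /N1; lra.
  have h2 : (nsize d m)%:R * (32 * b ^+ 2 / a2 ^+ 2) <= e / 4.
    apply: (@le_trans _ _ (N1 * (32 * b ^+ 2) / a2)).
      rewrite mulrA; apply: ler_pM.
      - by apply: mulr_ge0.
      - by rewrite invr_ge0 exprn_ge0// ltW.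
      - by rewrite ler_wpM2r// /N1; lra.
      by rewrite lef_pV2 ?posrE ?exprn_gt0// expr2 ler_pMl.
    rewrite ler_pdivrMr// /a2; set c := N1 * _ in c0 *.
    have -> : e / 4 * (c * 4 / e + 1) = c + e / 4 by field; rewrite gt_eqF.
    lra.
  by rewrite (_ : e = (e / 4 + e / 4) + (e / 4 + e / 4)) ?lerD//; [apply: le_trans PA1 _; rewrite lerD|apply: le_trans PA2 _; rewrite lerD|lra].
move=> w [A1w A2w].
pose P' := emp_prob n (fun i => X i w); pose Q' := emp_prob n (fun i => Y i w).
have Pb : P' (l2ball d r) = 1%E by apply: emp_prob_ball => i _; exact: Xr.
have Qb : Q' (l2ball d r) = 1%E by apply: emp_prob_ball => i _; exact: Yr.
have [_ [ub lub]] := MSWpp_fine p_gt1 r_gt0 Pb Qb v1.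
pose DV t := dval_of P' Q' t.
have dE t : adm p r t -> DV t = dval_emp_ n t w.
  by move=> At; rewrite /DV (dval_emp p_gt1).
have s0 : 0 < Num.sqrt n.+1%:R :> R by rewrite sqrtr_gt0 ltr0n.
have TE : T n.+1 w - emp n.+1 tv w =
    Num.sqrt n.+1%:R * (msw_emp p X Y n.+1 w - dval_emp_ n tv w).
  by rewrite /T mswE empE; ring.
have lo : dval_emp_ n tv w <= msw_emp p X Y n.+1 w by rewrite -dE//; exact: ub.
rewrite TE ger0_norm; last by rewrite mulr_ge0 ?subr_ge0// ltW.
rewrite mulrC -ler_pdivlMr// lerBlDr; apply: lub => t At.
rewrite -/(DV t) dE// -lerBlDr ler_pdivlMr// mulrC.
have -> : Num.sqrt n.+1%:R * (dval_emp_ n t w - dval_emp_ n tv w) =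
    (emp n.+1 t w - emp n.+1 tv w) - Num.sqrt n.+1%:R * (dval tv - dval t).
  by rewrite !empE; ring.
have g0 : 0 <= dval tv - dval t by rewrite subr_ge0; exact: dval_le.
have [tD|tD] := leP (dval tv - dval t) D.
  have := le_trans (ler_norm _) (hA1 w t A1w (conj At tD)).
  have : 0 <= Num.sqrt n.+1%:R * (dval tv - dval t) by rewrite mulr_ge0// ltW.
  by lra.
have := le_trans (ler_norm _) (hA2 w t A2w At); rewrite -/M => hM.
have : Num.sqrt n.+1%:R * D <= Num.sqrt n.+1%:R * (dval tv - dval t) by rewrite ler_pM2l// ltW.
by lra.
Qed.

Let Zk k (w : Om) : R := cpot tv k (XY k w).

Let mXY k : measurable_fun setT (XY k). Proof. by case: k. Qed.

Let Zk_bmf k : bmf (Zk k).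
Proof. by apply: bmf_comp (mXY k); exact: (cpot_bmf p_gt1 r_gt0). Qed.

Let Zk_le k w : `|Zk k w| <= 2 * b.
Proof. exact: (cpot_bound p_gt1 r_gt0). Qed.

Let Zk_indep : mutually_independent Pr Zk.
Proof.
apply: (@mutually_independent_comp _ _ _ _ _ _ _ _ _ XY (fun k x => cpot tv k x)) => // k.
by have [] := cpot_bmf p_gt1 r_gt0 P Q k Atv.
Qed.

Let Zk_mean k : \int[Pr]_w Zk k w = 0.
Proof. exact: (cpot_mean p_gt1 r_gt0 mX mY lawX lawY k Atv). Qed.

Let sig2 : R := covp p r P Q tv tv.

Let Zk_var n : \sum_(k <- samples n) \int[Pr]_w (Zk k w) ^+ 2 = n%:R * sig2.
Proof.
have b2 k : bmf (fun x => cpot tv k x ^+ 2).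
  by under eq_fun do rewrite expr2; apply: bmfM; exact: (cpot_bmf p_gt1 r_gt0).
rewrite big_cat !big_map/= /sig2 /covp mulrDr; congr (_ + _).
  rewrite (eq_bigr (fun=> \int[P]_x (cpot tv (inl 0%N) x * cpot tv (inl 0%N) x))).
    by rewrite big_const_seq count_predT iter_addr_0 size_iota mulr_natl.
  move=> i _; rewrite -(expect_has_law (mX i) (lawX i) (b2 (inl i))).
  by apply: eq_Rintegral => x _; rewrite expr2.
rewrite (eq_bigr (fun=> \int[Q]_x (cpot tv (inr 0%N) x * cpot tv (inr 0%N) x))).
  by rewrite big_const_seq count_predT iter_addr_0 size_iota mulr_natl.
move=> i _; rewrite -(expect_has_law (mY i) (lawY i) (b2 (inr i))).
by apply: eq_Rintegral => x _; rewrite expr2.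
Qed.

Let sig2_ge0 : 0 <= sig2. Proof. exact: covp_ge0. Qed.

(** [lindeberg] with the scaling [1 / sqrt n]: the error is of order [1 / sqrt n]. *)
Let emp_clt phi C : smooth3 phi C ->
  (fun n => \int[Pr]_w phi (emp n tv w)) @ \oo --> \int[gauss R]_y phi (Num.sqrt sig2 * y).
Proof.
move=> sphi; apply/cvgrPdist_le => e e0.
have C0 : 0 <= C.
  have [f1 [f2 [_ _ _ h]]] := sphi; have := h 0 1.
  by rewrite normr1 !expr1n !mulr1; apply: le_trans.
pose m3 : R := \int[gauss R]_y (`|y| ^+ 3).
have m30 : 0 <= m3 by apply: Rintegral_ge0 => y _; exact: exprn_ge0.
pose K := 2 * (C * (2 * b) ^+ 3 * (1 + m3)).
have K0 : 0 <= K.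
  by rewrite mulr_ge0// mulr_ge0 ?addr_ge0// mulr_ge0// exprn_ge0// mulr_ge0// ltW.
exists (Num.truncn ((K / e) ^+ 2)).+1 => // -[//|n] /= hn.
have s0 : 0 < Num.sqrt n.+1%:R :> R by rewrite sqrtr_gt0 ltr0n.
have sn : K <= Num.sqrt n.+1%:R * e.
  rewrite -ler_pdivrMr//; apply: (le_trans (ler_norm _)); rewrite -sqrtr_sqr ler_wsqrtr//.
  by rewrite (le_trans (ltW (truncnS_gt _)))// ler_nat.
have b2 : 0 <= 2 * b by rewrite mulr_ge0// ltW.
have i0 : 0 <= (Num.sqrt n.+1%:R)^-1 :> R by rewrite invr_ge0 ltW.
have := lindeberg (fun k => proj1 (Zk_bmf k)) Zk_indep b2 Zk_le Zk_mean 0 (samples_uniq n.+1) i0 sphi.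
rewrite Zk_var sqrtrM ?ler0n// [_^-1 * (_ * Num.sqrt sig2)]mulrA mulVf ?gt_eqF// mul1r samples_size.
rewrite distrC.
have -> : \int[Pr]_w phi (0 + (Num.sqrt n.+1%:R)^-1 * \sum_(k <- samples n.+1) Zk k w) =
    \int[Pr]_w phi (emp n.+1 tv w) by apply: eq_Rintegral => w _; rewrite add0r.
have -> : \int[gauss R]_y phi (0 + Num.sqrt sig2 * y) = \int[gauss R]_y phi (Num.sqrt sig2 * y).
  by apply: eq_Rintegral => y _; rewrite add0r.
move=> h; apply: (le_trans h); rewrite -/m3.
have -> : (2 * n.+1)%:R * (C * (Num.sqrt n.+1%:R)^-1 ^+ 3 * (2 * b) ^+ 3 * (1 + m3)) =
    K / Num.sqrt n.+1%:R.
  rewrite natrM -{1}(@sqr_sqrtr _ n.+1%:R) ?ler0n// /K; field; rewrite gt_eqF//.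
by rewrite ler_pdivrMr// mulrC.
Qed.

Let emp_tight e : 0 < e -> exists2 K, 0 <= K & forall n,
  exists A, [/\ measurable A, fine (Pr (~` A)) <= e & forall w, A w -> `|emp n tv w| <= K].
Proof.
move=> e0; pose K := sig2 / e + 1; have K1 : 1 <= K by rewrite /K lerDr divr_ge0// ltW.
exists K => [|n]; first lra.
have mE : measurable_fun setT (emp n tv) by exact: (emp_meas p_gt1 r_gt0).
exists (~` [set w | K <= `|emp n tv w|]).
have mA : measurable [set w | K <= `|emp n tv w|].
  rewrite (_ : [set w | _] = (fun w => `|emp n tv w|) @^-1` `[K, +oo[%classic).
    by rewrite -[X in measurable X]setTI; apply: (measurableT_comp _ mE).
  by apply/seteqP; split => w /=; rewrite in_itv/= andbT.
split; [exact: measurableC| |by move=> w /= /negP; rewrite -ltNge => /ltW].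
rewrite setCK; case: n mE mA => [|n] mE mA.
  rewrite (_ : [set w | _] = set0) ?measure0 ?ltW//.
  apply/seteqP; split => w //=; rewrite /emp sqrtr0 invr0 mul0r normr0; lra.
have s0 : 0 < Num.sqrt n.+1%:R :> R by rewrite sqrtr_gt0 ltr0n.
have sK : 0 < Num.sqrt n.+1%:R * K by rewrite mulr_gt0//; lra.
have := chebyshev_sum (fun k => proj1 (Zk_bmf k)) Zk_indep Zk_le Zk_mean (samples_uniq n.+1) sK.
rewrite Zk_var exprMn sqr_sqrtr ?ler0n//.
have -> : [set w | Num.sqrt n.+1%:R * K <= `|\sum_(k <- samples n.+1) Zk k w|] =
    [set w | K <= `|emp n.+1 tv w|].
  have E w : (Num.sqrt n.+1%:R * K <= `|\sum_(k <- samples n.+1) Zk k w|) = (K <= `|emp n.+1 tv w|).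
    rewrite /emp normrM ger0_norm ?invr_ge0 ?(ltW s0)//.
    by rewrite -[in RHS](ler_pM2l s0) mulrA mulfV ?gt_eqF// mul1r.
  by apply/seteqP; split => w /=; rewrite E.
move=> h; apply: (le_trans h).
rewrite invfM mulrACA mulfV ?pnatr_eq0// mul1r ler_pdivrMr ?exprn_gt0//; last by lra.
have : sig2 <= e * K by rewrite /K mulrDr mulrCA mulfV ?gt_eqF// mulr1 mulr1 lerDl ltW.
move=> hK; apply: (le_trans hK); rewrite ler_pM2l// expr2 ler_peMl//; lra.
Qed.

Lemma msw_limit (h : R -> R) : continuous h -> (exists M, forall x, `|h x| <= M) ->
  (fun n => \int[Pr]_w h (T n w)) @ \oo --> \int[gauss R]_y h (Num.sqrt sig2 * y).
Proof.
apply: (@portmanteau_smooth _ Om R Pr T (fun n => emp n tv) (Num.sqrt sig2) _ _ emp_clt emp_tight T_close) => n.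
- case: n => [|n].
    rewrite (_ : T 0 = cst 0); first exact: measurable_cst.
    by apply/funext => w; rewrite /T sqrtr0 mul0r.
  apply: measurable_funM => //; apply: measurable_funB => //.
  exact: (measurable_msw p_gt1 mX mY v1).
- exact: (emp_meas p_gt1 r_gt0).
Qed.

End MswLimit.

(** * Independent Gaussian variables on the unit interval *)

Lemma bmf_eq d (T : measurableType d) (R : realType) (f g : T -> R) :
  bmf f -> f =1 g -> bmf g.
Proof. by move=> bf /funext <-. Qed.

(** The density is even. *)
Lemma gauss_opp (R : realType) (phi : R -> R) : bmf phi ->
  \int[gauss R]_y phi (- y) = \int[gauss R]_y phi y.
Proof.
move=> bphi; have mo : measurable_fun setT (fun y : R => - y) by exact: measurableT_comp.
suff H : has_law (gauss R) (fun y : R => - y) (gauss R) by rewrite -(expect_has_law mo H bphi).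
move=> A mA.
have mA' : measurable ((fun y : R => - y) @^-1` A) by rewrite -[X in measurable X]setTI; exact: mo.
have mI (B : set R) : measurable B -> measurable_fun setT (fun x : R => (\1_B x : R)%:E).
  by move=> mB; apply/measurable_EFinP/measurable_indic.
have gE B : measurable B -> gauss R B = (\int[lebesgue_measure]_x ((\1_B x)%:E * (normal_pdf 0 1 x)%:E))%E.
  move=> mB; rewrite -ge0_integral_gauss.
  - by rewrite integral_indic// setIT.
  - exact: mI.
  - by move=> y; rewrite lee_fin.
rewrite !gE//.
have mN : @measurable_fun _ _ R (measurableTypeR R) setT (-%R) by exact: mo.
pose f (x : measurableTypeR R) := ((\1_A x)%:E * (normal_pdf 0 1 x)%:E)%E.
have mf : measurable_fun setT f.
  apply: emeasurable_funM; first exact: mI.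
  by apply/measurable_EFinP; exact: measurable_normal_pdf.
have f0 x : (0 <= f x)%E by rewrite mule_ge0// lee_fin// normal_pdf_ge0.
transitivity (\int[@lebesgue_measure R]_x f (- (x : R))%R)%E.
  by apply: eq_integral => x _; rewrite /f normal_pdfN /= !indicE.
have h := @ge0_integral_pushforward _ _ (measurableTypeR R) (measurableTypeR R) R (-%R)
  (mfunR mN) (@lebesgue_measure R) setT f measurableT mf (fun y _ => f0 y).
rewrite preimage_setT in h; apply: (etrans (esym h)).
by apply: eq_measure_integral => B mB _; exact: lebesgue_measureN.
Qed.

Lemma gauss_add (R : realType) (s t : R) (phi : R -> R) : 0 <= t -> bmf phi ->
  \int[gauss R]_y \int[gauss R]_z phi (s * y + t * z) =
  \int[gauss R]_y phi (Num.sqrt (s ^+ 2 + t ^+ 2) * y).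
Proof.
move=> t0 bphi; have [s0|s0] := leP 0 s; first exact: gauss_stable.
have bF : bmf (fun y : R => \int[gauss R]_z phi (s * y + t * z)).
  apply: (bmf_fubini_F (gauss R) (gauss R) (f := fun z : R * R => phi (s * z.1 + t * z.2))).
  by apply: (bmf_comp bphi); apply: measurable_funD; apply: measurable_funM.
have Ns0 : 0 <= - s by rewrite oppr_ge0 ltW.
apply: (etrans (esym (gauss_opp bF))); rewrite -[s ^+ 2]sqrrN; apply: (etrans _ (gauss_stable Ns0 t0 bphi)).
by apply: eq_Rintegral => y _; apply: eq_Rintegral => z _; rewrite mulrN mulNr.
Qed.

Lemma expect_swap d1 d2 (T1 : measurableType d1) (T2 : measurableType d2) (R : realType)
    (P1 : probability T1 R) (P2 : probability T2 R) (f : T1 * T2 -> R) : bmf f ->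
  \int[P1]_x \int[P2]_y f (x, y) = \int[P2]_y \int[P1]_x f (x, y).
Proof.
move=> bf; congr fine.
transitivity (\int[P1]_x \int[P2]_y (EFin \o f) (x, y))%E.
  by apply: eq_integral => x _; rewrite -EFin_expect//; exact: bmf_section1.
rewrite (Fubini (bmf_integrable (P1 \x P2)%E bf)).
by apply: eq_integral => y _; rewrite -EFin_expect//; exact: bmf_section2.
Qed.

(** Both sides are finite measures in [A]; they agree on half-lines. *)
Lemma indep_half d (Om : measurableType d) (R : realType) (Pr : probability Om R)
    (U : Om -> R) (E : set Om) : measurable_fun setT U -> measurable E ->
  (forall x, Pr (U @^-1` `]x, +oo[%classic `&` E) = (Pr (U @^-1` `]x, +oo[%classic) * Pr E)%E) ->
  forall A, measurable A -> Pr (U @^-1` A `&` E) = (Pr (U @^-1` A) * Pr E)%E.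
Proof.
move=> mU mE H A mA.
have pE0 : 0 <= fine (Pr E) by exact: fine_ge0.
have H' (B : set R) : measurable B ->
    pushforward (mrestr Pr mE) U B = pushforward (mscale (NngNum pE0) Pr) U B.
  move: B; refine (@finite_measure_unique R
    (measure_function_pushforward__canonical__measure_function_Measure (mrestr Pr mE) mU)
    (measure_function_pushforward__canonical__measure_function_Measure
       (mscale (NngNum pE0) Pr) mU) _ _) => [|x].
    rewrite /= /pushforward /mrestr preimage_setT setTI.
    by rewrite (le_lt_trans (probability_le1 Pr mE))// ltry.
  by rewrite /= /pushforward /mrestr /mscale/= H prob_fine// muleC.
by have := H' A mA; rewrite /pushforward /mrestr /mscale/= prob_fine// muleC.
Qed.

Lemma indep_of_half_lines d (Om : measurableType d) (R : realType) (Pr : probability Om R)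
    (U V : Om -> R) : measurable_fun setT U -> measurable_fun setT V ->
  (forall x y, Pr (U @^-1` `]x, +oo[%classic `&` V @^-1` `]y, +oo[%classic) =
     (Pr (U @^-1` `]x, +oo[%classic) * Pr (V @^-1` `]y, +oo[%classic))%E) ->
  independent2 Pr U V.
Proof.
move=> mU mV H A B mA mB.
have mpre (W : Om -> R) C : measurable_fun setT W -> measurable C -> measurable (W @^-1` C).
  by move=> mW mC; rewrite -[X in measurable X]setTI; exact: mW.
have mI x : measurable (`]x, +oo[%classic : set R) by exact: measurable_itv.
rewrite setIC muleC; apply: (indep_half mV (mpre _ _ mU mA)) => // y.
rewrite setIC muleC; apply: (indep_half mU (mpre _ _ mV (mI y))) => // x.
Qed.

Section Split.
Context (R : realType).
Implicit Types x y : R.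

Definition bit x : R := if 2^-1 <= x then 1 else 0.
Definition dbl x : R := 2 * x - bit x.

Let bit01 x : bit x = 0 \/ bit x = 1.
Proof. by rewrite /bit; case: ifP; [right|left]. Qed.

Let bitE : bit = \1_(`[2^-1, +oo[%classic).
Proof. by apply/funext => x; rewrite indicE mem_setE in_itv/= andbT /bit; case: ifP. Qed.

Let bmf_bit : bmf bit.
Proof. by rewrite bitE; apply: bmf_indic; exact: measurable_itv. Qed.

Let measurable_dbl : measurable_fun setT dbl.
Proof. by apply: measurable_funB; [exact: measurable_funM|case: bmf_bit]. Qed.

Let unif_cdf (t : R) : fine (unif R `]-oo, t]%classic) = Num.max 0 (Num.min 1 t).
Proof.
have u01 : fine (unif R `]-oo, 1]%classic) = 1 by rewrite unif_le// ler01 lexx.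
have [t0|t0] := ltP t 0.
  have : (unif R `]-oo, t]%classic <= unif R `]-oo, 0%R]%classic)%E.
    by apply: le_measure; rewrite ?inE//; apply: subset_itvl; rewrite bnd_simp ltW.
  rewrite (@unif_le _ 0) ?lexx ?ler01// measure_le0 => /eqP ->; rewrite /= min_r ?max_l//; lra.
have [t1|t1] := leP t 1.
  by rewrite unif_le ?t0// max_r// .
have : (unif R `]-oo, 1%R]%classic <= unif R `]-oo, t]%classic)%E.
  by apply: le_measure; rewrite ?inE//; apply: subset_itvl; rewrite bnd_simp ltW.
rewrite (@unif_le _ 1) ?lexx ?ler01// => h; rewrite max_r//.
have := probability_le1 (unif R) (measurable_itv `]-oo, t]) => h2.
by apply/eqP; rewrite eq_le -!lee_fin prob_fine// h h2.
Qed.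

Let unif_bit : \int[unif R]_x bit x = 2^-1.
Proof.
rewrite bitE expect_indic// unifE//.
have -> : `[2^-1, +oo[ `&` `[0, 1] = `[2^-1, 1]%classic :> set R.
  by apply/seteqP; split => x /=; rewrite !in_itv/= ?andbT;
    [case=> -> /andP[_ ->]|move=> /andP[h ->]; split => //; rewrite andbT; lra].
rewrite lebesgue_measure_itv/= lte_fin ifT; first by rewrite /=; lra.
lra.
Qed.

(** A uniform number is half of a uniform number plus a fair bit. *)
Lemma unif_self (h : R -> R) : bmf h ->
  \int[unif R]_x h x = 2^-1 * (\int[unif R]_y h (y / 2) + \int[unif R]_y h ((1 + y) / 2)).
Proof.
move=> bh; pose g (z : R * R) : R := (bit z.1 + z.2) / 2.
have mg : measurable_fun setT g.
  apply: measurable_funM => //; apply: measurable_funD => //.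
  by apply: measurableT_comp => //; case: bmf_bit.
have ib (a b : R) : \int[unif R]_s (b + bit s * (a - b)) = 2^-1 * (b + a).
  rewrite expectD; [|exact: bmf_cst|exact: bmfM bmf_bit (bmf_cst _ _)].
  rewrite (_ : \int[unif R]_x (bit x * (a - b)) = (a - b) * \int[unif R]_x bit x).
    rewrite unif_bit expect_cst; lra.
  by rewrite -expectZ//; apply: eq_Rintegral => x _; rewrite mulrC.
have key (k : R -> R) : bmf k -> \int[law (unif R \x unif R)%E mg]_x k x =
    2^-1 * (\int[unif R]_y k (y / 2) + \int[unif R]_y k ((1 + y) / 2)).
  move=> bk; rewrite expect_law// expect_prod; last exact: (bmf_comp bk).
  rewrite -ib; apply: eq_Rintegral => s _; rewrite /g/=.
  case: (bit01 s) => ->; first by rewrite mul0r addr0; apply: eq_Rintegral => y _; rewrite add0r.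
  by rewrite mul1r addrC subrK.
rewrite -key//; congr fine; apply: eq_measure_integral => A mA _.
apply: probability_cdf_unique => // x.
have mI (t : R) : measurable (`]-oo, t]%classic : set R) by exact: measurable_itv.
apply: (etrans (esym (prob_fine _ (mI x)))); rewrite -[RHS](prob_fine _ (mI x)); congr EFin.
rewrite -[RHS]expect_indic// key; last exact: bmf_indic.
have iE (c : R) : \int[unif R]_y (\1_(`]-oo, x]%classic) ((c + y) / 2) : R) =
    fine (unif R `]-oo, 2 * x - c]%classic).
  rewrite -expect_indic//; apply: eq_Rintegral => y _.
  rewrite !indicE !mem_setE !in_itv/=; congr (nat_of_bool _)%:R.
  by apply/idP/idP => ?; lra.
have := iE 0; under eq_Rintegral do rewrite add0r.
move=> ->; rewrite iE !unif_cdf subr0.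
have mmP (t : R) : [\/ t <= 0 /\ Num.max 0 (Num.min 1 t) = 0,
    0 <= t <= 1 /\ Num.max 0 (Num.min 1 t) = t | 1 <= t /\ Num.max 0 (Num.min 1 t) = 1].
  have [t0|t0] := leP t 0.
    by apply: Or31; split => //; rewrite min_r ?max_l//; lra.
  have [t1|t1] := leP t 1; first by apply: Or32; rewrite max_r ?(ltW t0) ?t1.
  by apply: Or33; split; [exact: ltW|rewrite max_r].
by have [[? ->]|[/andP[? ?] ->]|[? ->]] := mmP x;
  have [[? ->]|[/andP[? ?] ->]|[? ->]] := mmP (2 * x);
  have [[? ->]|[/andP[? ?] ->]|[? ->]] := mmP (2 * x - 1); lra.
Qed.

Lemma unif_split (f : R -> R -> R) : bmf (fun x => f (bit x) (dbl x)) ->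
    bmf (f 0) -> bmf (f 1) ->
  \int[unif R]_x f (bit x) (dbl x) =
    2^-1 * (\int[unif R]_y f 0 y + \int[unif R]_y f 1 y).
Proof.
move=> bf b0 b1; rewrite unif_self//.
have mI : measurable (`]0, 1[%classic : set R) by exact: measurable_itv.
have bm c : bmf (fun y : R => f (bit ((c + y) / 2)) (dbl ((c + y) / 2))).
  by apply: (bmf_comp bf); apply: measurable_funM => //; exact: measurable_funD.
congr (_ * (_ + _)).
  have := bm 0; under eq_fun do rewrite add0r; move=> bm0.
  apply: (expect_ae mI (unif_oo R) bm0 b0) => y /=; rewrite in_itv/= => /andP[y0 y1].
  have -> : bit (y / 2) = 0 by rewrite /bit ifF//; apply/negbTE; rewrite -ltNge; lra.
  have -> // : dbl (y / 2) = y.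
  by rewrite /dbl /bit ifF ?subr0; [field|apply/negbTE; rewrite -ltNge; lra].
apply: (expect_ae mI (unif_oo R) (bm 1) b1) => y /=; rewrite in_itv/= => /andP[y0 y1].
have h : 2^-1 <= (1 + y) / 2 by lra.
have -> : bit ((1 + y) / 2) = 1 by rewrite /bit h.
have -> // : dbl ((1 + y) / 2) = y.
by rewrite /dbl /bit h; field.
Qed.

(** The binary digits of a number, distributed into two numbers: those of even
    rank give [unzip], those of odd rank give [unzip (dbl x)]. *)
Fixpoint unzipn (n : nat) x : R :=
  if n is n'.+1 then (bit x + unzipn n' (dbl (dbl x))) / 2 else 0.

Let unzipn01 n x : 0 <= unzipn n x <= 1.
Proof.
elim: n x => [|n IH] x /=; first by rewrite lexx ler01.
by have /andP[? ?] := IH (dbl (dbl x)); case: (bit01 x) => ->; apply/andP; split; lra.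
Qed.

Let unzipn_nd x : nondecreasing_seq (unzipn ^~ x).
Proof.
apply/nondecreasing_seqP => n; elim: n x => [|n IH] x /=.
  by have /andP[] := unzipn01 1 x.
by rewrite ler_wpM2r ?invr_ge0// lerD2l; exact: IH.
Qed.

Definition unzip x : R := limn (unzipn ^~ x).

Let unzip_cvg x : unzipn ^~ x @ \oo --> unzip x.
Proof.
apply: nondecreasing_is_cvgn; first exact: unzipn_nd.
by exists 1 => _ [n _ <-]; have /andP[] := unzipn01 n x.
Qed.

Lemma unzip01 x : 0 <= unzip x <= 1.
Proof.
apply/andP; split.
  by apply: (limr_ge (cvgP _ (@unzip_cvg x))); apply: nearW => n; have /andP[] := unzipn01 n x.
by apply: (limr_le (cvgP _ (@unzip_cvg x))); apply: nearW => n; have /andP[] := unzipn01 n x.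
Qed.

Let unzipE x : unzip x = (bit x + unzip (dbl (dbl x))) / 2.
Proof.
apply: (cvg_unique _ (_ : (fun n => unzipn n.+1 x) @ \oo --> _)) => //.
  by rewrite (cvg_shiftS (unzipn ^~ x)); exact: unzip_cvg.
apply: cvgM; last exact: cvg_cst.
by apply: cvgD; [exact: cvg_cst|exact: unzip_cvg].
Qed.

Lemma measurable_unzip : measurable_fun setT unzip.
Proof.
apply: (@measurable_fun_cvg _ _ _ _ unzipn) => [n|x _]; last exact: unzip_cvg.
elim: n => [|n IH] /=; first exact: measurable_cst.
apply: measurable_funM => //; apply: measurable_funD; first by case: bmf_bit.
by apply: (measurableT_comp IH); exact: (measurableT_comp measurable_dbl measurable_dbl).
Qed.

Definition unzip2 x : R := unzip (dbl x).

Lemma measurable_unzip2 : measurable_fun setT unzip2.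
Proof. exact: (measurableT_comp measurable_unzip measurable_dbl). Qed.

Let lipf (F : R * R -> R) (a c : R) :=
  forall z z', `|F z - F z'| <= a * `|z.1 - z'.1| + c * `|z.2 - z'.2|.

Let Tf (F : R * R -> R) : R * R -> R :=
  fun z => 2^-1 * (F (z.2 / 2, z.1) + F ((1 + z.2) / 2, z.1)).

Let Tf_lip F a c : lipf F a c -> lipf (Tf F) c (a / 2).
Proof.
move=> Fl z z'; rewrite /Tf.
have h1 := Fl (z.2 / 2, z.1) (z'.2 / 2, z'.1).
have h2 := Fl ((1 + z.2) / 2, z.1) ((1 + z'.2) / 2, z'.1).
rewrite /= (_ : z.2 / 2 - z'.2 / 2 = (z.2 - z'.2) / 2) in h1; last by field.
rewrite /= (_ : (1 + z.2) / 2 - (1 + z'.2) / 2 = (z.2 - z'.2) / 2) in h2; last by field.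
have nE : `|(z.2 - z'.2) / 2| = `|z.2 - z'.2| / 2 by rewrite normrM (@ger0_norm _ 2^-1) ?invr_ge0.
rewrite nE in h1 h2.
rewrite -mulrBr normrM ger0_norm ?invr_ge0// opprD addrACA.
by have := ler_normD (F (z.2 / 2, z.1) - F (z'.2 / 2, z'.1))
  (F ((1 + z.2) / 2, z.1) - F ((1 + z'.2) / 2, z'.1)); lra.
Qed.

Let Tf_bmf F : bmf F -> bmf (Tf F).
Proof.
have mh c : measurable_fun setT (fun z : R * R => ((c + z.2) / 2, z.1)).
  by apply/measurable_fun_pair => //; apply: measurable_funM => //; exact: measurable_funD.
move=> bF; apply: bmfZ; apply: bmfD; last exact: (bmf_comp bF (mh 1)).
by apply: (bmf_eq (bmf_comp bF (mh 0))) => z; rewrite /= add0r.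
Qed.

Let m12 : measurable_fun setT (fun x => (unzip x, unzip2 x)).
Proof.
by apply/measurable_fun_pair; [exact: measurable_unzip|exact: measurable_unzip2].
Qed.

Let Tf_unzip F : bmf F ->
  \int[unif R]_x F (unzip x, unzip2 x) = \int[unif R]_x Tf F (unzip x, unzip2 x).
Proof.
move=> bF; pose f (b y : R) := F ((b + unzip2 y) / 2, unzip y).
have mf c : measurable_fun setT (fun y => ((c + unzip2 y) / 2, unzip y)).
  apply/measurable_fun_pair; last exact: measurable_unzip.
  by apply: measurable_funM => //; apply: measurable_funD => //; exact: measurable_unzip2.
have bf c : bmf (f c) := bmf_comp bF (mf c).
have fE x : F (unzip x, unzip2 x) = f (bit x) (dbl x) by rewrite /f -unzipE.
under eq_Rintegral do rewrite fE.
rewrite unif_split//; last first.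
  by apply: (bmf_eq (bmf_comp bF m12)) => x; rewrite fE.
rewrite /Tf expectZ; last first.
  apply: bmfD; last exact: bf.
  by apply: (bmf_eq (bf 0)) => x; rewrite /f add0r.
rewrite expectD; last 2 first.
- by apply: (bmf_eq (bf 0)) => x; rewrite /f add0r.
- exact: bf.
by congr (_ * (_ + _)); apply: eq_Rintegral => x _; rewrite /f add0r.
Qed.

Let Tf_prod F : bmf F ->
  \int[unif R]_x \int[unif R]_y F (x, y) = \int[unif R]_x \int[unif R]_y Tf F (x, y).
Proof.
move=> bF; rewrite (expect_swap (unif R) (unif R) bF); apply: eq_Rintegral => y _.
have bh : bmf (fun x => F (x, y)) by exact: bmf_section2.
have bc c : bmf (fun x : R => F ((c + x) / 2, y)).
  by apply: (bmf_comp bh); apply: measurable_funM => //; exact: measurable_funD.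
have b0 : bmf (fun x : R => F (x / 2, y)).
  by apply: (bmf_eq (bc 0)) => x; rewrite add0r.
by rewrite unif_self// /Tf/= expectZ ?expectD//; exact: bmfD.
Qed.

(** The law of the two halves of the digits and the product law are both fixed by
    [Tf], which contracts the norm [a + 3/2 c] of the Lipschitz constants by the
    factor [3/4]; hence they agree on Lipschitz functions. *)
Let unzip_lip n F a c : bmf F -> 0 <= a -> 0 <= c -> lipf F a c ->
  `|\int[unif R]_x F (unzip x, unzip2 x) - \int[unif R]_x \int[unif R]_y F (x, y)| <=
    (3 / 4) ^+ n * (2 * (a + 3 / 2 * c)).
Proof.
have mI : measurable (`]0, 1[%classic : set R) by exact: measurable_itv.
elim: n F a c => [|n IH] F a c bF a0 c0 Fl; last first.
  rewrite Tf_unzip// Tf_prod//.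
  have a20 : 0 <= a / 2 by rewrite divr_ge0.
  apply: (le_trans (IH _ _ _ (Tf_bmf bF) c0 a20 (Tf_lip Fl))).
  have q0 : 0 <= (3 / 4) ^+ n :> R by rewrite exprn_ge0// divr_ge0.
  by rewrite exprSr -[leRHS]mulrA; apply: (ler_wpM2l q0); lra.
have near0 x y : 0 <= x <= 1 -> 0 <= y <= 1 -> `|F (x, y) - F (0, 0)| <= a + c.
  move=> /andP[x0 x1] /andP[y0 y1]; apply: (le_trans (Fl _ _)).
  rewrite /= !subr0 !ger0_norm//; nra.
have h1 : `|\int[unif R]_x F (unzip x, unzip2 x) - F (0, 0)| <= a + c.
  rewrite -[F (0, 0)](expect_cst (unif R)); apply: (expect_close_on (A := setT)) => //.
  - exact: probT.
  - exact: (bmf_comp bF m12).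
  - exact: bmf_cst.
  - lra.
  - by move=> x _; apply: near0; exact: unzip01.
have h2 : `|\int[unif R]_x \int[unif R]_y F (x, y) - F (0, 0)| <= a + c.
  rewrite -[F (0, 0)](expect_cst (unif R)).
  apply: (expect_close_on mI (unif_oo R)).
  - exact: (bmf_fubini_F (unif R) (unif R) bF).
  - exact: bmf_cst.
  - lra.
  move=> x /=; rewrite in_itv/= => /andP[x0 x1].
  rewrite -[F (0, 0)](expect_cst (unif R)).
  apply: (expect_close_on mI (unif_oo R)).
  - exact: bmf_section1.
  - exact: bmf_cst.
  - lra.
  move=> y /=; rewrite in_itv/= => /andP[y0 y1].
  by apply: near0; rewrite ?ltW.
rewrite expr0 mul1r (le_trans (ler_distD (F (0, 0)) _ _))//.
rewrite [X in _ + X]distrC; lra.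
Qed.

Lemma unzip_pair (u v : R -> R) K M :
  (forall x y, `|u x - u y| <= K * `|x - y|) -> (forall x y, `|v x - v y| <= K * `|x - y|) ->
  (forall x, `|u x| <= M) -> (forall x, `|v x| <= M) ->
  \int[unif R]_x (u (unzip x) * v (unzip2 x)) = \int[unif R]_x u x * \int[unif R]_x v x.
Proof.
move=> ul vl u1 v1.
have K0 : 0 <= K by have := le_trans (normr_ge0 _) (ul 1 0); rewrite subr0 normr1 mulr1.
have M0 : 0 <= M := le_trans (normr_ge0 _) (u1 0).
have bu : bmf u.
  by split; [apply: continuous_measurable_fun; exact: lip_continuous ul|exists M].
have bv : bmf v.
  by split; [apply: continuous_measurable_fun; exact: lip_continuous vl|exists M].
pose F (z : R * R) : R := u z.1 * v z.2.
have bF : bmf F by apply: bmfM; [exact: (bmf_comp bu)|exact: (bmf_comp bv)].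
have Fl : lipf F (K * M) (M * K).
  move=> z z'; rewrite /F.
  have -> : u z.1 * v z.2 - u z'.1 * v z'.2 = (u z.1 - u z'.1) * v z.2 + u z'.1 * (v z.2 - v z'.2) by ring.
  rewrite (le_trans (ler_normD _ _))// !normrM lerD//.
    by rewrite mulrAC ler_pM.
  by rewrite -mulrA ler_pM.
have -> : \int[unif R]_x u x * \int[unif R]_x v x = \int[unif R]_x \int[unif R]_y F (x, y).
  rewrite mulrC -expectZ//; apply: eq_Rintegral => x _.
  by rewrite mulrC -expectZ.
apply/eqP; rewrite -subr_eq0 -normr_le0; apply/ler_addgt0Pr => e e0; rewrite add0r.
have q1 : `|3 / 4 : R| < 1 by rewrite ger0_norm; lra.
have KM0 : 0 <= K * M by exact: mulr_ge0.
have MK0 : 0 <= M * K by exact: mulr_ge0.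
have : (fun n => (3 / 4) ^+ n * (2 * (K * M + 3 / 2 * (M * K)))) @ \oo -->
    (0 * (2 * (K * M + 3 / 2 * (M * K))) : R) by apply: cvgMr_tmp; exact: cvg_expr.
rewrite mul0r => /cvgrPdist_le /(_ e e0) [n _ /(_ n (leqnn n))].
rewrite /= sub0r normrN => h; apply: le_trans (unzip_lip n bF KM0 MK0 Fl) _.
by apply: le_trans h; exact: ler_norm.
Qed.

Let unzip_laws (h : R -> R) K : (forall y z, `|h y - h z| <= K * `|y - z|) ->
  (exists M, forall x, `|h x| <= M) ->
  \int[unif R]_x h (unzip x) = \int[unif R]_x h x /\
  \int[unif R]_x h (unzip2 x) = \int[unif R]_x h x.
Proof.
move=> hl [M hM].
have K0 : 0 <= K by have := le_trans (normr_ge0 _) (hl 1 0); rewrite subr0 normr1 mulr1.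
have M0 : 0 <= M := le_trans (normr_ge0 _) (hM 0).
have hM1 x : `|h x| <= M + 1 by rewrite (le_trans (hM x))// lerDl.
have c1 (x : R) : `|1 : R| <= M + 1 by rewrite normr1; lra.
have cl (x y : R) : `|1 - 1 : R| <= K * `|x - y| by rewrite subrr normr0 mulr_ge0.
have e1 := expect_cst (unif R) 1.
split.
  have := unzip_pair hl cl hM1 c1; rewrite e1 mulr1 => <-.
  by apply: eq_Rintegral => x _; rewrite mulr1.
have := unzip_pair cl hl c1 hM1; rewrite e1 mul1r => <-.
by apply: eq_Rintegral => x _; rewrite mul1r.
Qed.

Lemma unzip_law : has_law (unif R) unzip (unif R).
Proof.
move=> A mA; rewrite -(lawE (unif R) measurable_unzip).
apply: (law_eq_lip _ mA) => h K hl [M hM].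
have bh : bmf h by split; [apply: continuous_measurable_fun; exact: lip_continuous hl|exists M].
by rewrite expect_law//; have [] := unzip_laws hl (ex_intro _ M hM).
Qed.

Lemma unzip2_law : has_law (unif R) unzip2 (unif R).
Proof.
move=> A mA; rewrite -(lawE (unif R) measurable_unzip2).
apply: (law_eq_lip _ mA) => h K hl [M hM].
have bh : bmf h by split; [apply: continuous_measurable_fun; exact: lip_continuous hl|exists M].
by rewrite expect_law//; have [] := unzip_laws hl (ex_intro _ M hM).
Qed.

Lemma unzip_indep : independent2 (unif R) unzip unzip2.
Proof.
apply: indep_of_half_lines; [exact: measurable_unzip|exact: measurable_unzip2|move=> x y].
have mI z : measurable (`]z, +oo[%classic : set R) by exact: measurable_itv.
rewrite unzip_law// unzip2_law//.
have mE : measurable (unzip @^-1` `]x, +oo[%classic `&` unzip2 @^-1` `]y, +oo[%classic).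
  by apply: measurableI; rewrite -[X in measurable X]setTI;
    [apply: measurable_unzip|apply: measurable_unzip2].
rewrite (esym (prob_fine (unif R) mE)) (esym (prob_fine (unif R) (mI x))).
rewrite (esym (prob_fine (unif R) (mI y))) -EFinM; congr EFin.
have [g [gl g01 gc]] := lip_indic_gt x; have [k [kl k01 kc]] := lip_indic_gt y.
have gb n z : `|g n z| <= 1 by have /andP[? ?] := g01 n z; rewrite ger0_norm.
have kb n z : `|k n z| <= 1 by have /andP[? ?] := k01 n z; rewrite ger0_norm.
have mg n : measurable_fun setT (g n).
  by apply: continuous_measurable_fun; exact: lip_continuous (gl n).
have mk n : measurable_fun setT (k n).
  by apply: continuous_measurable_fun; exact: lip_continuous (kl n).
have c1 : (fun n => \int[unif R]_z (g n (unzip z) * k n (unzip2 z))) @ \oo -->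
    \int[unif R]_z (\1_(unzip @^-1` `]x, +oo[%classic `&` unzip2 @^-1` `]y, +oo[%classic) z : R).
  apply: (bmf_dct (M := 1) (A := setT)) => //.
  - move=> n; apply: measurable_funM.
      exact: (measurableT_comp (mg n) measurable_unzip).
    exact: (measurableT_comp (mk n) measurable_unzip2).
  - by move=> n z; rewrite normrM mulr_ile1.
  - exact: probT.
  - move=> z _; rewrite indicI; apply: cvgM; [exact: (gc (unzip z))|exact: (kc (unzip2 z))].
have ci (h : nat -> R -> R) t : (forall n, measurable_fun setT (h n)) -> (forall n z, `|h n z| <= 1) ->
    (forall z, h ^~ z @ \oo --> (\1_(`]t, +oo[%classic) z : R)) ->
    (fun n => \int[unif R]_z h n z) @ \oo --> fine (unif R `]t, +oo[%classic).
  move=> mh hb hc; rewrite -expect_indic//.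
  by apply: (bmf_dct (M := 1) (A := setT)) => //; exact: probT.
rewrite -expect_indic//; apply: (cvg_unique _ c1) => //.
rewrite (_ : (fun n => _) = (fun n => \int[unif R]_z g n z * \int[unif R]_z k n z)).
  by apply: cvgM; exact: ci.
by apply/funext => n; exact: (unzip_pair (gl n) (kl n) (gb n) (kb n)).
Qed.

(** Splitting off the digits of even rank again and again leaves a sequence of
    independent uniform numbers. *)
Fixpoint nrm (k : nat) x : R :=
  if k is k'.+1 then nrm k' (unzip2 x) else quantile (gauss R) (unzip x).

Lemma measurable_nrm k : measurable_fun setT (nrm k).
Proof.
elim: k => [|k IH]; last exact: (measurableT_comp IH measurable_unzip2).
exact: (measurableT_comp (measurable_quantile (gauss R)) measurable_unzip).
Qed.

(** Independence and normality of the sequence, in the form that is used below: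
    the head is independent of the tail, to which the induction hypothesis applies,
    and [gauss_add] merges the two. *)
Lemma nrm_comb (n : nat) (c : nat -> R) (phi : R -> R) : bmf phi ->
  \int[unif R]_x phi (\sum_(k < n) c k * nrm k x) =
  \int[gauss R]_y phi (Num.sqrt (\sum_(k < n) c k ^+ 2) * y).
Proof.
elim: n c phi => [|n IH] c phi bphi.
  rewrite big_ord0 sqrtr0.
  transitivity (\int[unif R]_x phi 0); first by apply: eq_Rintegral => x _; rewrite big_ord0.
  rewrite expect_cst -[LHS](expect_cst (gauss R)).
  by apply: eq_Rintegral => y _; rewrite mul0r.
pose S (y : R) := \sum_(k < n) c k.+1 * nrm k y.
pose q := quantile (gauss R).
have mq : measurable_fun setT q by exact: measurable_quantile.
have mS : measurable_fun setT S.
  by apply: measurable_sum => k; apply: measurable_funM => //; exact: measurable_nrm.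
pose Phi (z : R * R) : R := phi (c 0%N * q z.1 + S z.2).
have bPhi : bmf Phi.
  apply: (bmf_comp bphi); apply: measurable_funD.
    by apply: measurable_funM => //; exact: (measurableT_comp mq).
  exact: (measurableT_comp mS).
transitivity (\int[unif R]_x Phi (unzip x, unzip2 x)).
  by apply: eq_Rintegral => x _; rewrite big_ord_recl.
rewrite (indep_expect measurable_unzip measurable_unzip2 unzip_indep bPhi).
pose s := Num.sqrt (\sum_(k < n) c k.+1 ^+ 2).
have bG : bmf (fun a : R => \int[gauss R]_z phi (c 0%N * a + s * z)).
  apply: (bmf_fubini_F (gauss R) (gauss R) (f := fun z : R * R => phi (c 0%N * z.1 + s * z.2))).
  by apply: (bmf_comp bphi); apply: measurable_funD; apply: measurable_funM.
transitivity (\int[unif R]_x \int[gauss R]_z phi (c 0%N * q x + s * z)).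
  have bG' : bmf (fun x : R => \int[gauss R]_z phi (c 0%N * q x + s * z)) by exact: (bmf_comp bG).
  rewrite (expect_has_law measurable_unzip unzip_law bG'); apply: eq_Rintegral => x _.
  have bx : bmf (fun y => Phi (unzip x, y)) by exact: bmf_section1.
  rewrite -(expect_has_law measurable_unzip2 unzip2_law bx) /Phi/=.
  have bpx : bmf (fun t => phi (c 0%N * q (unzip x) + t)).
    by apply: (bmf_comp bphi); exact: measurable_funD.
  exact: (IH (fun k => c k.+1) _ bpx).
rewrite -(expect_has_law mq (@quantile_law R (gauss R)) bG) gauss_add//.
  by apply: eq_Rintegral => y _; rewrite big_ord_recl sqr_sqrtr// sumr_ge0// => k _; exact: sqr_ge0.
exact: sqrtr_ge0.
Qed.

End Split.

(** * Gaussian families with a given covariance *)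

Section Cholesky.
Context (R : realType).
Implicit Types (K : nat -> nat -> R) (s : seq (R * nat)).

Definition qform K s : R := \sum_(x <- s) \sum_(y <- s) x.1 * y.1 * K x.2 y.2.

(** Gaussian elimination of the first [n] indices; the quotients whose
    denominator vanishes are zero, as they should. *)
Fixpoint schur K (n : nat) (i j : nat) : R :=
  if n is k.+1 then schur K k i j - schur K k i k * schur K k k j / schur K k k k else K i j.

Definition chol K (k i : nat) : R := schur K k i k / Num.sqrt (schur K k k k).

Section Fix.
Context (K : nat -> nat -> R).
Hypothesis Ksym : forall i j, K i j = K j i.
Hypothesis Kpsd : forall s, 0 <= qform K s.
Local Notation schur := (schur K).
Local Notation chol := (chol K).

Let schur_sym n i j : schur n i j = schur n j i.
Proof.
elim: n i j => [|k IH] i j /=; first exact: Ksym.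
by rewrite IH (IH i k) (IH k j) [schur k k i * _]mulrC.
Qed.

Let qform_cons (L : nat -> nat -> R) (Lsym : forall i j, L i j = L j i) t k s :
  qform L ((t, k) :: s) = t ^+ 2 * L k k + 2 * t * (\sum_(x <- s) x.1 * L x.2 k) + qform L s.
Proof.
rewrite /qform big_cons big_cons/=.
under [X in _ + X]eq_bigr do rewrite big_cons/=.
rewrite big_split/= (_ : \sum_(i <- s) i.1 * t * L i.2 k = t * \sum_(x <- s) x.1 * L x.2 k); last first.
  by rewrite mulr_sumr; apply: eq_bigr => x _; rewrite mulrCA mulrA.
rewrite (_ : \sum_(j <- s) t * j.1 * L k j.2 = t * \sum_(x <- s) x.1 * L x.2 k); last first.
  by rewrite mulr_sumr; apply: eq_bigr => x _; rewrite Lsym mulrA.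
ring.
Qed.

(** Eliminating an index means minimising the form over its coefficient. *)
Let schur_psd n s : 0 <= qform (schur n) s.
Proof.
elim: n s => [|k IH] s; first exact: Kpsd.
pose B := \sum_(x <- s) x.1 * schur k x.2 k.
have -> : qform (schur k.+1) s = qform (schur k) s - B ^+ 2 / schur k k k.
  rewrite /qform/= expr2 /B mulr_suml mulr_suml -sumrB; apply: eq_bigr => x _.
  rewrite mulr_sumr mulr_suml -sumrB; apply: eq_bigr => y _.
  by rewrite (schur_sym k k y.2); ring.
have := IH ((- B / schur k k k, k) :: s); rewrite qform_cons; last exact: schur_sym.
have [->|k0] := eqVneq (schur k k k) 0.
  by rewrite invr0 !mulr0 mul0r add0r subr0.
rewrite -/B => h; apply: le_trans h _; rewrite le_eqVlt; apply/orP; left; apply/eqP.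
by field.
Qed.

Let schur_diag0 k i : schur k k k = 0 -> schur k i k = 0.
Proof.
move=> k0; apply/eqP/negPn/negP => ik0.
pose c := schur k i i.
have := schur_psd k [:: (- (c + 1) / (2 * schur k i k), k); (1, i)].
rewrite qform_cons ?big_seq1/=; last exact: schur_sym.
rewrite k0 mulr0 add0r mul1r /qform !big_seq1/= !mul1r -/c.
have -> : 2 * (- (c + 1) / (2 * schur k i k)) * schur k i k = - (c + 1).
  by field; rewrite ik0.
lra.
Qed.

Let schur_row0 n i j : (i < n)%N -> schur n i j = 0.
Proof.
elim: n j => [//|n IH] j; rewrite ltnS leq_eqVlt => /predU1P[->|ilt] /=; last first.
  by rewrite !IH// !mul0r subrr.
have [n0|n0] := eqVneq (schur n n n) 0.
  by rewrite schur_sym (schur_diag0 _ n0) n0 !mul0r subrr.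
by rewrite mulrAC mulfV// mul1r subrr.
Qed.

Let chol_row0 k i : (i < k)%N -> chol k i = 0.
Proof. by move=> ik; rewrite /chol schur_row0// mul0r. Qed.

(** Nothing is left of row [i] once its index is eliminated. *)
Lemma chol_sum n i j : (i < n)%N -> K i j = \sum_(k < n) chol k i * chol k j.
Proof.
move=> ilt; suff : K i j = \sum_(k < n) chol k i * chol k j + schur n i j.
  by rewrite schur_row0// addr0.
elim: n {ilt} => [|n IH]; first by rewrite big_ord0 add0r.
rewrite big_ord_recr/= IH -addrA; congr (_ + _).
suff -> : chol n i * chol n j = schur n i n * schur n n j / schur n n n by rewrite addrC subrK.
have n0 : 0 <= schur n n n.
  have := schur_psd n [:: (1, n)].
  by rewrite /qform !big_seq1 !mul1r.
rewrite /chol (schur_sym n n j) -{3}(sqr_sqrtr n0) expr2 invfM; ring.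
Qed.

Let W (i : nat) (x : R) : R := \sum_(k < i.+1) chol k i * nrm k x.

Let WE n i x : (i < n)%N -> W i x = \sum_(k < n) chol k i * nrm k x.
Proof.
move=> ilt; rewrite /W (big_ord_widen n (fun k => chol k i * nrm k x))// big_mkcond.
apply: eq_bigr => k _; rewrite ltnS; case: leqP => // ik.
by rewrite chol_row0// mul0r.
Qed.

(** The Cholesky factor turns independent variables into a family with covariance
    [K]. *)
Lemma gauss_family : exists W : nat -> R -> R,
  (forall i, measurable_fun setT (W i)) /\
  forall s phi, bmf phi -> \int[unif R]_x phi (\sum_(z <- s) z.1 * W z.2 x) =
    \int[gauss R]_y phi (Num.sqrt (qform K s) * y).
Proof.
exists W; split => [i|s phi bphi].
  by apply: measurable_sum => k; apply: measurable_funM => //; exact: measurable_nrm.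
have [n hn] : exists n, forall z, z \in s -> (z.2 < n)%N.
  elim: s => [|z s [n IH]]; first by exists 0%N.
  exists (maxn z.2.+1 n) => z'; rewrite inE => /predU1P[->|/IH h]; first exact: leq_maxl.
  by rewrite (leq_trans h)// leq_maxr.
pose c k := \sum_(z <- s) z.1 * chol k z.2.
have -> : qform K s = \sum_(k < n) c k ^+ 2.
  rewrite /qform (eq_big_seq (fun z => \sum_(k < n) \sum_(y <- s) (z.1 * chol k z.2) * (y.1 * chol k y.2))).
    rewrite exchange_big; apply: eq_bigr => k _; rewrite /c expr2 mulr_suml.
    by apply: eq_bigr => z _; rewrite mulr_sumr.
  move=> z /hn zn; rewrite exchange_big; apply: eq_bigr => y _.
  by rewrite (chol_sum _ zn) mulr_sumr; apply: eq_bigr => k _; ring.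
rewrite -nrm_comb//; apply: eq_Rintegral => x _; congr phi.
rewrite (eq_big_seq (fun z => \sum_(k < n) z.1 * chol k z.2 * nrm k x)).
  by rewrite exchange_big; apply: eq_bigr => k _; rewrite /c mulr_suml.
move=> z /hn zn; rewrite (WE _ zn) mulr_sumr; apply: eq_bigr => k _; exact: mulrA.
Qed.

End Fix.
End Cholesky.

(** * Moments of Gaussian variables *)

Lemma same_law_integral d1 d2 (T1 : measurableType d1) (T2 : measurableType d2)
    (R : realType) (P1 : probability T1 R) (P2 : probability T2 R)
    (U1 : T1 -> R) (U2 : T2 -> R) (g : R -> R) :
  measurable_fun setT U1 -> measurable_fun setT U2 ->
  (forall A : set R, measurable A -> P1 (U1 @^-1` A) = P2 (U2 @^-1` A)) ->
  measurable_fun setT g -> P2.-integrable setT (EFin \o (g \o U2)) ->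
  P1.-integrable setT (EFin \o (g \o U1)) /\ \int[P1]_x g (U1 x) = \int[P2]_x g (U2 x).
Proof.
move=> m1 m2 E mg i2; have mg' : measurable_fun setT (EFin \o g) by exact/measurable_EFinP.
have eqm (f : R -> \bar R) : (\int[pushforward P1 U1]_y f y = \int[pushforward P2 U2]_y f y)%E.
  by apply: eq_measure_integral => A mA _; exact: E.
have i1 : P1.-integrable setT (EFin \o (g \o U1)).
  apply/integrableP; split; first by apply/measurable_EFinP; exact: measurableT_comp.
  have mn : measurable_fun setT (fun y => `|(EFin \o g) y|%E) by exact: measurableT_comp.
  have h1 := @ge0_integral_pushforward _ _ _ _ R U1 m1 P1 setT _ measurableT mn
    (fun y _ => abse_ge0 _).
  have h2 := @ge0_integral_pushforward _ _ _ _ R U2 m2 P2 setT _ measurableT mn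
    (fun y _ => abse_ge0 _).
  rewrite preimage_setT in h1; rewrite preimage_setT in h2.
  have /integrableP [_] := i2; apply: le_lt_trans.
  by rewrite le_eqVlt; apply/orP; left; apply/eqP; apply: (etrans (esym h1)); rewrite eqm.
split => //; congr fine.
have h1 := @integral_pushforward _ _ _ _ R U1 m1 P1 setT (EFin \o g) mg'.
have h2 := @integral_pushforward _ _ _ _ R U2 m2 P2 setT (EFin \o g) mg'.
rewrite preimage_setT in h1; rewrite preimage_setT in h2.
apply: (etrans (esym (h1 i1 measurableT))); apply: etrans (h2 i2 measurableT); exact: eqm.
Qed.

Section GaussMoments.
Context (R : realType) (dO : measure_display) (Om : measurableType dO).
Context (Pr : probability Om R) (X : Om -> R) (m s : R).
Hypothesis mX : measurable_fun setT X.
Hypothesis s_ge0 : 0 <= s.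
Hypothesis lawX : has_law Pr X (gaussian_law m s).

Let ma : measurable_fun setT (fun y : R => m + s * y).
Proof. by apply: measurable_funD => //; exact: measurable_funM. Qed.

Let laws (A : set R) : measurable A -> Pr (X @^-1` A) = gauss R ((fun y => m + s * y) @^-1` A).
Proof.
move=> mA; have h1 := lawX mA; have h2 := gauss_affine_law m s_ge0 mA.
exact: (etrans h1 (esym h2)).
Qed.

Lemma gaussian_expect (h : R -> R) : bmf h ->
  \int[Pr]_w h (X w) = \int[gauss R]_y h (m + s * y).
Proof.
move=> bh; have [mh _] := bh.
have [_ E] := @same_law_integral _ _ _ _ R Pr (gauss R) X _ h mX ma laws mh
  (bmf_integrable _ (bmf_comp bh ma)).
exact: E.
Qed.

Let id_integrable : (gauss R).-integrable setT (EFin \o (fun y : R => y)).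
Proof.
by apply: (@gauss_integrable _ _ 1) => // y; rewrite mul1r normr_le_expR.
Qed.

Lemma gaussian_integrable : Pr.-integrable setT (EFin \o X) /\ \int[Pr]_w X w = m.
Proof.
have i2 : (gauss R).-integrable setT (EFin \o (idfun \o (fun y : R => m + s * y))).
  apply: (@gauss_integrable _ _ (`|m| + `|s|)) => // y.
  rewrite /= (le_trans (ler_normD _ _))// mulrDl lerD//.
    by rewrite ler_peMr// -[1]expR0 ler_expR.
  by rewrite normrM ler_wpM2l// normr_le_expR.
have [i1 E] := @same_law_integral _ _ _ _ R Pr (gauss R) X _ idfun mX ma laws
  (@measurable_id _ _ setT) i2.
split; first exact: i1.
rewrite [LHS]E; rewrite RintegralD//.
- by rewrite Rintegral_cst// probT mulr1 RintegralZl// gauss_mean mulr0 addr0.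
- exact: (bmf_integrable (gauss R) (bmf_cst _ m)).
- apply: (@gauss_integrable _ _ `|s|); first exact: measurable_funM.
  by move=> y; rewrite normrM ler_wpM2l// normr_le_expR.
Qed.

Lemma gaussian_sqr_integrable :
  Pr.-integrable setT (EFin \o (fun w => X w ^+ 2)) /\ \int[Pr]_w X w ^+ 2 = m ^+ 2 + s ^+ 2.
Proof.
have i1 : (gauss R).-integrable setT (EFin \o (fun=> m ^+ 2)).
  exact: (bmf_integrable (gauss R) (bmf_cst _ _)).
have i2 : (gauss R).-integrable setT (EFin \o (fun y : R => 2 * m * s * y)).
  apply: (@gauss_integrable _ _ `|2 * m * s|); first exact: measurable_funM.
  by move=> y; rewrite normrM ler_wpM2l// normr_le_expR.
have i3 : (gauss R).-integrable setT (EFin \o (fun y : R => s ^+ 2 * y ^+ 2)).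
  apply: (@gauss_integrable _ _ (s ^+ 2 * 3%:R ^+ 2)).
    by apply: measurable_funM => //; exact: measurable_funX.
  move=> y; rewrite normrM ger0_norm ?sqr_ge0// -mulrA ler_wpM2l ?sqr_ge0//.
  by rewrite normrX; exact: pow_le_expR.
have i23 := integrableD measurableT i2 i3.
have i123 := integrableD measurableT i1 i23.
have sE (y : R) : (m + s * y) ^+ 2 = m ^+ 2 + (2 * m * s * y + s ^+ 2 * y ^+ 2) by ring.
have i : (gauss R).-integrable setT (EFin \o ((fun x : R => x ^+ 2) \o (fun y : R => m + s * y))).
  by apply: eq_integrable i123 => // y _; rewrite /= sE !EFinD.
have [j E] := @same_law_integral _ _ _ _ R Pr (gauss R) X _ _ mX ma laws
  (@measurable_funX _ _ _ _ _ 2 (@measurable_id _ _ setT)) i.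
split; first exact: j.
transitivity (\int[gauss R]_y (m ^+ 2 + (2 * m * s * y + s ^+ 2 * y ^+ 2))).
  by rewrite [LHS]E; apply: eq_Rintegral => y _; rewrite sE.
have i23' : (gauss R).-integrable setT (EFin \o (fun y : R => 2 * m * s * y + s ^+ 2 * y ^+ 2)).
  by apply: eq_integrable i23 => // y _; rewrite /= !EFinD.
rewrite (RintegralD measurableT i1 i23') (RintegralD measurableT i2 i3).
rewrite Rintegral_cst// probT mulr1 RintegralZl//.
  rewrite RintegralZl//; last exact: gauss_sqr_integrable.
  by rewrite gauss_mean gauss_var mulr0 add0r mulr1.
Qed.

End GaussMoments.

(** Chernoff bound. *)
Lemma gauss_tail (R : realType) (s V x : R) : 0 < V -> s ^+ 2 <= V -> 0 <= x ->
  fine (gauss R [set y | x <= `|s * y|]) <= 2 * expR (- (x ^+ 2 / (2 * V))).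
Proof.
move=> V0 sV x0.
have mS (t : R) : measurable ([set y : R | x <= t * y]).
  rewrite (_ : [set y | _] = ( *%R t) @^-1` `[x, +oo[%classic).
    by rewrite -[X in measurable X]setTI; apply: measurable_funM.
  by apply/seteqP; split => y /=; rewrite in_itv/= andbT.
have half t : t ^+ 2 <= V -> fine (gauss R [set y | x <= t * y]) <= expR (- (x ^+ 2 / (2 * V))).
  move=> tV; rewrite -lee_fin prob_fine//.
  pose l := x / V.
  have ml (c : R) : measurable_fun setT (fun y : R => (expR (c * y))%:E).
    by apply/measurable_EFinP; apply: measurableT_comp => //; exact: measurable_funM.
  apply: (@le_trans _ _ (\int[gauss R]_y ((expR (- (l * x)))%:E * (expR (l * t * y))%:E))%E).
    have <- : (\int[gauss R]_y (\1_[set y : R | x <= t * y] y)%:E = gauss R [set y | (x <= t * y)%R])%E.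
      by rewrite integral_indic// setIT.
    apply: ge0_le_integral => //.
    - by apply/measurable_EFinP/measurable_indic.
    - by apply: emeasurable_funM => //; exact: measurable_cst.
    move=> y _; rewrite -EFinM lee_fin -expRD indicE; case: (boolP (y \in _)) => [|_]; last exact: expR_ge0.
    rewrite inE /= => xy; rewrite -[leLHS]expR0 ler_expR.
    have l0 : 0 <= l by rewrite divr_ge0// ltW.
    by rewrite addrC subr_ge0 -mulrA ler_wpM2l.
  rewrite ge0_integralZl//.
  rewrite gauss_mgf -EFinM lee_fin -expRD ler_expR.
  have -> : - (x ^+ 2 / (2 * V)) = - (l * x) + l ^+ 2 * V / 2 by rewrite /l; field; rewrite gt_eqF.
  by rewrite lerD2l exprMn ler_wpM2r// ler_wpM2l// sqr_ge0.
have -> : [set y : R | x <= `|s * y|] = [set y | x <= s * y] `|` [set y | x <= - s * y].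
  apply/seteqP; split => y /=; rewrite mulNr ler_normr; first by case/orP => h; [left|right].
  by case=> ->; rewrite ?orbT.
rewrite (le_trans (fprobU _ (mS _) (mS _)))// (_ : 2 * _ = expR (- (x ^+ 2 / (2 * V))) + expR (- (x ^+ 2 / (2 * V)))); last by ring.
by rewrite lerD ?half// sqrrN.
Qed.

(** * Tight processes *)

Section Codes.
Context (R : realType) (T : choiceType) (A : set T) (c : nat -> T -> nat) (N : nat -> nat).
Hypothesis cN : forall m t, A t -> (c m t < N m)%N.
Context (dO : measure_display) (Om : measurableType dO) (Pr : probability Om R).
Context (G : T -> Om -> R) (ev : nat -> set Om) (dl : nat -> R).
Hypothesis mG : forall t, measurable_fun setT (G t).
Hypothesis mev : forall m, measurable (ev m).
Hypothesis ev_nd : forall m, ev m `<=` ev m.+1.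
Hypothesis ev_prob : forall e, 0 < e -> exists m, fine (Pr (~` ev m)) <= e.
Hypothesis dl_cvg : forall e, 0 < e -> exists m, forall n, (m <= n)%N -> dl n <= e.
Hypothesis osc : forall w m s t, ev m w -> A s -> A t -> c m s = c m t -> `|G s w - G t w| <= dl m.
Hypothesis G0 : forall w t, (forall m, ~ ev m w) -> G t w = 0.

Let good : set Om := \bigcup_m ev m.

Let mgood : measurable good.
Proof. by apply: bigcup_measurable => m _; exact: mev. Qed.

Let ev_le m n : (m <= n)%N -> ev m `<=` ev n.
Proof.
move=> /subnKC <-; elim: (n - m)%N => [|k IH] w; first by rewrite addn0.
by rewrite addnS => /IH; exact: ev_nd.
Qed.

Lemma uniform_nbhsP (g : {uniform` A -> R}) (U : set {uniform` A -> R}) :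
  nbhs g U <-> exists2 e : R, 0 < e & forall h : T -> R, (forall t, A t -> `|g t - h t| < e) -> U h.
Proof.
split=> [/uniform_nbhs [E []]|[e e0 eU]].
  rewrite -entourage_ballE => -[e e0 eE] EU.
  by exists e => // h hg; apply: EU => t At; apply: eE; exact: hg.
apply/uniform_nbhs; exists [set xy | ball xy.1 e xy.2]; split.
  by rewrite -entourage_ballE; exists e.
by move=> h hg; apply: eU => t At; exact: hg.
Qed.

Let gval m i (w : Om) : R :=
  if pselect (exists t, A t /\ c m t = i) is left h then G (projT1 (cid h)) w else 0.

Let measurable_gval m i : measurable_fun setT (gval m i).
Proof. by rewrite /gval; case: pselect => h; [exact: mG|exact: measurable_cst]. Qed.

Let gval_close m t w : ev m w -> A t -> `|G t w - gval m (c m t) w| <= dl m.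
Proof.
move=> ew At; rewrite /gval; case: pselect => [h|[]]; last by exists t.
by case: cid => s [As cs] /=; exact: osc.
Qed.

Let gsum m w : R := \sum_(i < N m) `|gval m i w|.

Let gval_bound m t w : ev m w -> A t -> `|G t w| <= gsum m w + dl m.
Proof.
move=> ew At; rewrite -[G t w](subrK (gval m (c m t) w)) addrC.
rewrite (le_trans (ler_normD _ _))// lerD//; last exact: gval_close.
rewrite /gsum (bigD1 (Ordinal (cN m At)))//= lerDl.
by apply: sumr_ge0 => i _.
Qed.

Let path (w : Om) : {uniform` A -> R} := fun t => G t w.

(** A triple stands for a level, one integer for each of its cells and the inverse
    of a mesh: the values of the step function are multiples of that mesh. *)
Let step (z : nat * seq int * nat) (t : T) : R :=
  (nth 0 z.1.2 (c z.1.1 t))%:~R / z.2.+1%:R.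

Let near_step (z : nat * seq int * nat) : set Om :=
  good `&` [set w | forall t, A t -> `|G t w - step z t| <= 2 / z.2.+1%:R].

Let jrep (m n i j : nat) (P : T -> set Om) : set Om :=
  if pselect (exists t, [/\ A t, c m t = i & c n t = j]) is left h
  then P (projT1 (cid h)) else setT.

(** Countably many points decide whether a path is close to a step function:
    one for each pair of a cell of the step function and a cell of a finer
    level. *)
Let measurable_near_step z : measurable (near_step z).
Proof.
pose P (t : T) : set Om := [set w | `|G t w - step z t| <= 2 / z.2.+1%:R].
have mP t : measurable (P t).
  rewrite (_ : P t = (fun w => `|G t w - step z t|) @^-1` `]-oo, 2 / z.2.+1%:R]%classic).
    rewrite -[X in measurable X]setTI.
    by apply: (measurableT_comp _ (measurable_funB (mG t) (measurable_cst _))).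
  by apply/seteqP; split => w /=; rewrite in_itv.
have -> : near_step z = good `&`
    \bigcap_n \bigcap_i \bigcap_j jrep z.1.1 n i j P.
  apply/seteqP; split=> w [gw hw]; split => //.
    move=> n _ i _ j _; rewrite /jrep; case: pselect => // h.
    by case: cid => t [At _ _] /=; exact: hw.
  move=> t At; apply/ler_addgt0Pr => e e0; have [m0 _ ew] := gw.
  have [m1 hm1] := dl_cvg e0; pose n := maxn m0 m1.
  have := hw n Logic.I (c z.1.1 t) Logic.I (c n t) Logic.I.
  rewrite /jrep; case: pselect => [h|[]]; last by exists t.
  case: cid => s [As cs1 cs2] /=; rewrite /P/= => hs.
  have st : step z s = step z t by rewrite /step cs1.
  rewrite -[G t w](subrK (G s w)) -addrA addrC (le_trans (ler_normD _ _))//.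
  rewrite lerD//; first by rewrite -st.
  apply: le_trans (hm1 n (leq_maxr _ _)).
  by apply: osc => //; apply: ev_le ew; exact: leq_maxl.
apply: measurableI => //.
do 3 (apply: bigcap_measurable => // ? _).
by rewrite /jrep; case: pselect => // h; exact: mP.
Qed.

(** A path in an open set is close to one of countably many step functions that have
    a neighbourhood in the set. *)
Let path_open (U : set {uniform` A -> R}) : open U -> measurable (path @^-1` U).
Proof.
move=> oU.
pose inU (z : nat * seq int * nat) :=
  forall h : T -> R, (forall t, A t -> `|h t - step z t| <= 2 / z.2.+1%:R) -> U h.
pose D n := if @choice.unpickle (nat * seq int * nat)%type n is Some z then
  (if pselect (inU z) then near_step z else set0) else set0.
pose Z := if pselect (U (fun=> 0)) then ~` good else set0.
have -> : path @^-1` U = \bigcup_n D n `|` Z.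
  apply/seteqP; split => w /=; last first.
    case=> [[n _]|]; rewrite /D /Z.
      case: choice.unpickle => // z; case: pselect => // h [_ hw].
      by apply: h => t At; exact: hw.
    case: pselect => // U0 ng; rewrite (_ : path w = fun=> 0)//.
    apply/funext => t; apply: G0 => m ew; apply: ng; by exists m.
  move=> Uw; have [gw|ng] := pselect (good w); last first.
    right; rewrite /Z; case: pselect => // -[].
    rewrite (_ : (fun=> 0) = path w)//; apply/funext => t; apply/esym/G0 => m ew.
    by apply: ng; exists m.
  left; have [m0 _ ew] := gw.
  have /uniform_nbhsP [e e0 eU] : nbhs (path w) U by exact: open_nbhs_nbhs.
  have [k _ hk] := pow2_small 4 0 (divr_gt0 e0 (@ltr0n R 2)).
  pose K := (2 ^ k)%N; have K0 : (0 < K)%N by rewrite expn_gt0.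
  have KE : K.-1.+1 = K by rewrite prednK.
  have K0R : 0 < K%:R :> R by rewrite ltr0n.
  have iK : 0 < K%:R^-1 :> R by rewrite invr_gt0.
  have eK : 4 / K%:R < e by rewrite /K natrX (le_lt_trans hk)// ltr_pdivrMr//; lra.
  have [m1 hm1] := dl_cvg iK; pose m := maxn m0 m1.
  have ew' : ev m w by apply: ev_le ew; exact: leq_maxl.
  pose zs := [seq Num.floor (K%:R * gval m i w) | i <- iota 0 (N m)].
  pose z := (m, zs, K.-1).
  have stepE t : A t -> `|G t w - step z t| <= 2 / K%:R.
    move=> At; have h1 := gval_close ew' At; have h2 := hm1 m (leq_maxr _ _).
    rewrite /step /z/= KE (nth_map 0%N) ?size_iota ?cN// nth_iota ?cN// add0n.
    set g := gval m (c m t) w in h1 *.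
    have /andP[f1 f2] := floor_itv (K%:R * g).
    have -> : G t w - (Num.floor (K%:R * g))%:~R / K%:R =
      (G t w - g) + (K%:R * g - (Num.floor (K%:R * g))%:~R) / K%:R by field; rewrite gt_eqF.
    rewrite (le_trans (ler_normD _ _))// (_ : 2 / K%:R = K%:R^-1 + K%:R^-1); last by lra.
    rewrite lerD ?(le_trans h1)// normrM [X in _ * X]gtr0_norm// ler_piMl ?(ltW iK)//.
    rewrite ger0_norm ?subr_ge0//; move: f2; rewrite intrD; lra.
  exists (choice.pickle z) => //; rewrite /D choice.pickleK; case: pselect => [hU|[]] /=.
    by split => // t At; rewrite /z/= KE; exact: stepE.
  move=> h; rewrite /z/= KE => hs; apply: eU => t At.
  apply: (le_lt_trans (ler_distD (step z t) _ _)); apply: le_lt_trans eK.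
  rewrite (_ : 4 / K%:R = 2 / K%:R + 2 / K%:R); last by lra.
  by rewrite lerD ?stepE// distrC hs.
apply: measurableU; last first.
  by rewrite /Z; case: pselect => h /=; [exact: measurableC|exact: measurable0].
apply: bigcup_measurable => n _; rewrite /D; case: choice.unpickle => // z.
by case: pselect => h /=; [exact: measurable_near_step|exact: measurable0].
Qed.

Let Kset (m0 : nat) (B : R) : set {uniform` A -> R} :=
  [set g | (forall t, A t -> `|g t| <= B) /\
    forall j, (m0 <= j)%N -> forall s t, A s -> A t -> c j s = c j t -> `|g s - g t| <= dl j].

(** The bounds concern at most two points at a time, so they pass to pointwise
    limits. *)
Let Kset_approx m0 B (g : T -> R) :
  (forall e, 0 < e -> forall s t, A s -> A t -> exists h : T -> R,
     [/\ Kset m0 B h, `|g s - h s| <= e & `|g t - h t| <= e]) -> Kset m0 B g.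
Proof.
move=> H; split => [t At|j jm s t As At cst].
  apply/ler_addgt0Pr => e e0; have [h [[hB _] h1 _]] := H e e0 t t At At.
  rewrite -[g t](subrK (h t)) addrC (le_trans (ler_normD _ _))// lerD//; exact: hB.
apply/ler_addgt0Pr => e e0; have e2 : 0 < e / 2 by rewrite divr_gt0.
have [h [[_ ho] h1 h2]] := H _ e2 s t As At.
have := ho j jm s t As At cst; move: h1 h2; rewrite !ler_norml.
by move=> /andP[? ?] /andP[? ?] /andP[? ?]; apply/andP; split; lra.
Qed.

Let closed_Kset m0 B : closed (Kset m0 B).
Proof.
move=> g cg; apply: Kset_approx => e e0 s t As At.
have /cg [h [Kh hg]] : nbhs g [set h : {uniform` A -> R} | forall t, A t -> `|g t - h t| < e].
  by apply/uniform_nbhsP; exists e.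
by exists h; split => //; apply/ltW/hg.
Qed.

(** An ultrafilter of such functions converges pointwise, hence uniformly, as
    finitely many cells control all the values up to a small error. *)
Let compact_Kset m0 B : compact (Kset m0 B).
Proof.
rewrite compact_ultra => F UF FK.
have PF : ProperFilter F by exact: ultra_proper.
have ex t : exists l : R, A t -> (fun g : {uniform` A -> R} => g t) @ F --> l.
  have [At|nA] := pselect (A t); last by exists 0.
  have [|l hl] := @ultra_limit _ _ F (fun g : {uniform` A -> R} => g t) B UF.
    by apply: filterS FK => g [hB _]; exact: hB.
  by exists l.
have [l hl] := choice ex.
have near_l e t : 0 < e -> A t -> F [set g | `|l t - g t| < e].
  move=> e0 At; have /cvgrPdist_lt := hl t At; exact.
have Kl : Kset m0 B l.
  apply: Kset_approx => e e0 s t As At.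
  have : F (Kset m0 B `&` ([set g | `|l s - g s| < e] `&` [set g | `|l t - g t| < e])).
    by do 2 (apply: filterI => //); exact: near_l.
  by move=> /filter_ex [h [Kh [h1 h2]]]; exists h; split => //; exact: ltW.
exists l; split => // V /uniform_nbhsP [e e0 eV].
have e4 : 0 < e / 4 by rewrite divr_gt0.
have [m1 hm1] := dl_cvg e4; pose m := maxn m0 m1.
have dm : dl m <= e / 4 by apply: hm1; exact: leq_maxr.
have fin : \forall g \near F, forall i : 'I_(N m), forall h : exists t, A t /\ c m t = i,
    `|l (projT1 (cid h)) - g (projT1 (cid h))| < e / 4.
  apply: filter_forall => i; have [h|nh] := pselect (exists t, A t /\ c m t = i); last first.
    by apply: filterS FK => g _ h.
  have Ah : A (projT1 (cid h)) by case: (cid h) => t [].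
  apply: filterS (near_l _ _ e4 Ah) => g hg h'.
  by rewrite (Prop_irrelevance h' h).
apply: filterS (filterI FK fin) => g [[_ go] hg]; apply: eV => t At.
have h : exists s, A s /\ c m s = Ordinal (cN m At) by exists t.
have := hg (Ordinal (cN m At)) h; case: cid => s [/= As cs] hs.
have := go m (leq_maxl _ _) s t As At cs; have := (proj2 Kl) m (leq_maxl _ _) s t As At cs.
move: hs; rewrite !ler_norml !ltr_norml.
by move=> /andP[? ?] /andP[? ?] /andP[? ?]; apply/andP; split; lra.
Qed.

(** With high probability a path is bounded and oscillates little on all fine cells;
    such functions form a compact set. *)
Lemma codes_tight : tight_in_linfty Pr A G.
Proof.
split=> [w|U oU|e e0]; last first.
- have e2 : 0 < e / 2 by rewrite divr_gt0.
  have [m0 hm0] := ev_prob e2.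
  have mf : measurable_fun setT (gsum m0).
    apply: measurable_sum => i; apply: measurableT_comp => //; exact: measurable_gval.
  have [K K0 [A1 [mA1 PA1 hA1]]] := tail_small Pr mf e2.
  exists (Kset m0 (K + dl m0)); split; [exact: compact_Kset|exact: closed_Kset|].
  have mE : measurable (ev m0 `&` A1) by exact: measurableI.
  apply: (@le_trans _ _ (Pr (ev m0 `&` A1))).
    rewrite -(setCK (ev m0 `&` A1)) probC; last exact: measurableC.
    rewrite -(prob_fine Pr (measurableC mE)) -EFinB lee_fin lerD2l lerN2 setCI.
    apply: (le_trans (fprobU Pr (measurableC (mev m0)) (measurableC mA1))); lra.
  apply: le_measure; rewrite ?inE//.
    rewrite -[X in measurable X]setCK; apply: measurableC; rewrite preimage_setC.
    apply: path_open; exact/closed_openC/closed_Kset.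
  move=> w [ew Aw]; split => [t At|j jm s t As At cst].
    apply: (le_trans (gval_bound ew At)); rewrite lerD2r.
    by rewrite (le_trans (ler_norm _))// hA1.
  by apply: osc => //; exact: ev_le ew.
- exact: path_open.
have [[m _ ew]|ng] := pselect (good w).
  by exists (gsum m w + dl m) => t At; exact: gval_bound.
by exists 0 => t At; rewrite G0 ?normr0// => m ew; apply: ng; exists m.
Qed.

End Codes.

(** * The Gaussian limit process *)

Arguments unif : simpl never.

Section LimitProcess.
Context (R : realType) (d : nat) (p r : R) (p_gt1 : 1 < p) (r_gt0 : 0 < r).
Context (P Q : probability (borel_rV R d) R) (v : 'rV[R]_d) (f : 'rV[R]_d -> R -> R).
Hypothesis Pball : P (l2ball d r) = 1%E.
Hypothesis Qball : Q (l2ball d r) = 1%E.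
Hypothesis v1 : sphere R d v.
Hypothesis fadm : forall u, sphere R d u -> adm p r (u, f u).
Local Notation cpot := (cpot p r P Q).
Local Notation covp := (covp p r P Q).
Local Notation adm := (adm p r).
Implicit Types s t : ridge R d.

Let mball := @measurable_l2ball R d r.

Let bc k t : adm t -> bmf (cpot t k).
Proof. exact: (cpot_bmf p_gt1 r_gt0). Qed.

Lemma covp_sym s t : covp s t = covp t s.
Proof. rewrite /covp; apply: f_equal2.
  by apply: eq_Rintegral => x _; exact: mulrC.
by apply: eq_Rintegral => x _; exact: mulrC. Qed.

Let expect_sqr_sum (m : probability (borel_rV R d) R) (g : nat -> borel_rV R d -> R)
    (s : seq (R * nat)) : (forall i, bmf (g i)) ->
  \int[m]_x (\sum_(z <- s) z.1 * g z.2 x) ^+ 2 =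
  \sum_(z <- s) \sum_(y <- s) z.1 * y.1 * \int[m]_x (g z.2 x * g y.2 x).
Proof.
move=> bg.
have b2 z y : bmf (fun x => z * y * 1 * 0 + z * y * (g 0%N x * g 0%N x)).
  by apply: bmfD; [exact: bmf_cst|apply: bmfZ; exact: bmfM].
transitivity (\int[m]_x \sum_(z <- s) \sum_(y <- s) z.1 * y.1 * (g z.2 x * g y.2 x)).
  apply: eq_Rintegral => x _; rewrite expr2 mulr_suml; apply: eq_bigr => z _.
  by rewrite mulr_sumr; apply: eq_bigr => y _; rewrite mulrACA.
have bzy (z y : R * nat) : bmf (fun x => z.1 * y.1 * (g z.2 x * g y.2 x)).
  by apply: bmfZ; exact: bmfM.
rewrite expect_sum; last by move=> z; apply: bmf_sum => y; exact: bzy.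
apply: eq_bigr => z _; rewrite expect_sum; last by move=> y; exact: bzy.
by apply: eq_bigr => y _; rewrite expectZ//; exact: bmfM.
Qed.

Lemma qform_covp (tt : nat -> ridge R d) (s : seq (R * nat)) : (forall i, adm (tt i)) ->
  qform (fun i j => covp (tt i) (tt j)) s =
  \int[P]_x (\sum_(z <- s) z.1 * cpot (tt z.2) (inl 0%N) x) ^+ 2 +
  \int[Q]_x (\sum_(z <- s) z.1 * cpot (tt z.2) (inr 0%N) x) ^+ 2.
Proof.
move=> At.
rewrite (expect_sqr_sum P (g := fun i => cpot (tt i) (inl 0%N)))//; last by move=> i; exact: bc.
rewrite (expect_sqr_sum Q (g := fun i => cpot (tt i) (inr 0%N)))//; last by move=> i; exact: bc.
rewrite /qform -big_split; apply: eq_bigr => z _; rewrite -big_split; apply: eq_bigr => y _.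
by rewrite /= -mulrDr.
Qed.

Let covp_close s t s' t' e : adm s -> adm t -> adm s' -> adm t' -> 0 <= e ->
  rclose p r s s' e -> rclose p r t t' e ->
  `|covp s t - covp s' t'| <= 16 * bndC p r * e.
Proof.
move=> As At As' At' e0 ss tt; have b0 := bndC_gt0 p_gt1 r_gt0.
have h k x : l2ball d r x ->
    `|cpot s k x * cpot t k x - cpot s' k x * cpot t' k x| <= 8 * bndC p r * e.
  move=> xr; have h1 := cpot_close p_gt1 r_gt0 Pball Qball k As As' e0 ss xr.
  have h2 := cpot_close p_gt1 r_gt0 Pball Qball k At At' e0 tt xr.
  have h3 := cpot_bound p_gt1 r_gt0 P Q k x At.
  have h4 := cpot_bound p_gt1 r_gt0 P Q k x As'.
  have -> : cpot s k x * cpot t k x - cpot s' k x * cpot t' k x =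
    (cpot s k x - cpot s' k x) * cpot t k x + cpot s' k x * (cpot t k x - cpot t' k x) by ring.
  rewrite (le_trans (ler_normD _ _))// !normrM.
  apply: (@le_trans _ _ (2 * e * (2 * bndC p r) + 2 * bndC p r * (2 * e))); last by lra.
  by rewrite lerD// ler_pM.
have e1 : 0 <= 8 * bndC p r * e by rewrite mulr_ge0// mulr_ge0// ltW.
rewrite opprD addrACA (_ : 16 * _ * _ = 8 * bndC p r * e + 8 * bndC p r * e); last by lra.
rewrite (le_trans (ler_normD _ _))// lerD//.
  apply: (expect_close_on mball Pball _ _ e1) => [||x xr]; [| |exact: (h (inl 0%N))].
    by apply: bmfM; exact: bc.
  by apply: bmfM; exact: bc.
apply: (expect_close_on mball Qball _ _ e1) => [||x xr]; [| |exact: (h (inr 0%N))].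
  by apply: bmfM; exact: bc.
by apply: bmfM; exact: bc.
Qed.

Let S t : Prop := exists2 u, sphere R d u & t = (u, f u).
Let t0 : ridge R d := (v, f v).
Let St0 : S t0. Proof. by exists v. Qed.
Let SA t : S t -> adm t. Proof. by case=> u u1 ->; exact: fadm. Qed.
Let Sf u : sphere R d u -> S (u, f u). Proof. by exists u. Qed.

Let rp := repn p r S t0.
Let tt (i : nat) : ridge R d := if @choice.unpickle (nat * nat)%type i is Some z then rp z.1 z.2 else t0.
Let idx (m k : nat) : nat := choice.pickle (m, k).

Let tt_idx m k : tt (idx m k) = rp m k.
Proof. by rewrite /tt /idx choice.pickleK. Qed.

Let Att i : adm (tt i).
Proof. by rewrite /tt; case: choice.unpickle => [z|]; apply: SA => //; exact: repn_in. Qed.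

Let K i j := covp (tt i) (tt j).

Let netc := netC d p r.
Let netc_gt0 : 0 < netc. Proof. exact: netC_gt0. Qed.

Let code_ m u : nat := ncode p r m (u, f u).

(** Only the countably many members of the nets are indices of the Gaussian family.
    Chaining shows that its values along the representatives of a point converge,
    uniformly outside an event of small probability, and the limits inherit the
    cell-wise modulus as well as the Gaussian laws. *)
Lemma gaussian_limit_exists :
  exists (G : 'rV[R]_d -> R -> R) , [/\ forall u, measurable_fun setT (G u),
    tight_in_linfty (unif R) (sphere R d) G &
    forall n (t : 'I_n -> 'rV[R]_d) (a : 'I_n -> R), (forall i, sphere R d (t i)) ->
      has_law (unif R) (fun w => \sum_(i < n) a i * G (t i) w)
        (gaussian_law 0 (Num.sqrt (\sum_(i < n) \sum_(j < n)
           a i * a j * covp (t i, f (t i)) (t j, f (t j)))))].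
Proof.
have [||W [mW Wlaw]] := @gauss_family R K.
- by move=> i j; exact: covp_sym.
- by move=> s; rewrite qform_covp// addr_ge0//; apply: Rintegral_ge0 => x _; exact: sqr_ge0.
(* the index type of the chaining: points of [S] on the left, indices of the
   Gaussian family on the right *)
pose Z (t : ridge R d + nat) : R -> R := if t is inr i then W i else fun=> 0.
pose cd m (t : ridge R d + nat) : nat := if t is inl t' then ncode p r m t' else 0%N.
pose S' (t : ridge R d + nat) : Prop := if t is inl t' then S t' else False.
have B0 : 0 < 64 * netc ^+ 2 by rewrite mulr_gt0 ?exprn_gt0.
have cdN m (t : ridge R d + nat) : S' t -> (cd m t < nsize d m)%N by case: t => // t _; exact: ncode_lt.
have [||ev hev] := chaining (S := S') (cd := cd) (rp := fun m k => inr (idx m k)) (N := nsize d)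
  (entC_ge0 R d) B0 cdN (nsize_le R d) (Pr := unif R) (Z := Z).
- by move=> m k; exact: mW.
- move=> [t|//] m x St x0; rewrite /Z /cd /=.
  set i := idx m _; set j := idx m.+1 _.
  pose s : seq (R * nat) := [:: (1, i); (-1, j)].
  pose A : set R := [set y | x <= `|y|].
  have mA : measurable A.
    rewrite (_ : A = (fun y : R => `|y|) @^-1` `[x, +oo[%classic).
      have mn : measurable_fun setT (fun y : R => `|y|) by exact: measurableT_comp.
      by rewrite -[X in measurable X]setTI; exact: mn.
    by apply/seteqP; split => y /=; rewrite in_itv/= andbT.
  have sE w : \sum_(z <- s) z.1 * W z.2 w = W i w - W j w.
    by rewrite big_cons big_seq1/= mul1r mulN1r.
  have mW2 : measurable_fun setT (fun w => W i w - W j w) by exact: measurable_funB.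
  have mA2 : measurable [set w | x <= `|W i w - W j w|].
    by rewrite -[X in measurable X]setTI; exact: (mW2 measurableT A mA).
  have mA3 : measurable [set y | x <= `|Num.sqrt (qform K s) * y|].
    rewrite -[X in measurable X]setTI.
    have mm : measurable_fun setT ( *%R (Num.sqrt (qform K s))) by exact: measurable_funM.
    exact: (mm measurableT A mA).
  have -> : fine (unif R [set w | x <= `|W i w - W j w|]) =
      fine (gauss R [set y | x <= `|Num.sqrt (qform K s) * y|]).
    rewrite -(expect_indic (unif R) mA2) -(expect_indic (gauss R) mA3).
    have := Wlaw s (\1_A) (bmf_indic R mA); under eq_Rintegral do rewrite sE.
    by [].
  have cl := rep_close_step p_gt1 r_gt0 St0 SA m St.
  set e := 2 * netC d p r / 2 ^+ m in cl.
  have e0 : 0 < e by rewrite divr_gt0 ?exprn_gt0// mulr_gt0.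
  have q8 : qform K s <= 8 * e ^+ 2.
    rewrite qform_covp// (_ : 8 * e ^+ 2 = 4 * e ^+ 2 + 4 * e ^+ 2); last by lra.
    have h k x' : l2ball d r x' -> `|(\sum_(z <- s) z.1 * cpot (tt z.2) k x') ^+ 2 - 0| <= 4 * e ^+ 2.
      move=> xr; rewrite big_cons big_seq1/= mul1r mulN1r subr0 ger0_norm ?sqr_ge0//.
      have := cpot_close p_gt1 r_gt0 Pball Qball k (Att i) (Att j) (ltW e0) _ xr.
      rewrite /i /j !tt_idx => /(_ cl); rewrite ler_norml => /andP[? ?]; nra.
    have bs k : bmf (fun x' => (\sum_(z <- s) z.1 * cpot (tt z.2) k x') ^+ 2).
      under eq_fun do rewrite expr2.
      by apply: bmfM; apply: bmf_sum => z; apply: bmfZ; exact: bc.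
    have e4 : 0 <= 4 * e ^+ 2 by rewrite mulr_ge0// sqr_ge0.
    apply: lerD.
      have := expect_close_on mball Pball (bs (inl 0%N)) (bmf_cst _ 0) e4 (h (inl 0%N)).
      by rewrite expect_cst subr0 => /(le_trans (ler_norm _)).
    have := expect_close_on mball Qball (bs (inr 0%N)) (bmf_cst _ 0) e4 (h (inr 0%N)).
    by rewrite expect_cst subr0 => /(le_trans (ler_norm _)).
  have V0 : 0 < 8 * e ^+ 2 by rewrite mulr_gt0// exprn_gt0.
  have qV : Num.sqrt (qform K s) ^+ 2 <= 8 * e ^+ 2.
    rewrite sqr_sqrtr// qform_covp// addr_ge0//; apply: Rintegral_ge0 => x' _; exact: sqr_ge0.
  apply: (le_trans (gauss_tail V0 qV x0)).
  rewrite ler_wpM2l// ler_expR lerN2 le_eqVlt; apply/orP; left; apply/eqP.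
  rewrite /e (_ : 4 ^+ m = (2 ^+ m) ^+ 2); last by rewrite -exprM mulnC exprM expr2 -natrM.
  by rewrite /netc; field; rewrite !gt_eqF ?exprn_gt0.
pose C0 := 4 * chain_cst (entC R d) (64 * netc ^+ 2).
have C00 : 0 <= C0 by rewrite mulr_ge0// sqrtr_ge0.
pose good := \bigcup_m ev m.
have mev m : measurable (ev m) by case: (hev m).
have mgood : measurable good by apply: bigcup_measurable => m _; exact: mev.
have inc w u m n : ev m w -> sphere R d u -> (m <= n)%N ->
    `|W (idx n (code_ n u)) w - W (idx m (code_ m u)) w| <= C0 * (3 / 4) ^+ m.
  by move=> ew u1 mn; have [_ _ _ h] := hev m; exact: (h w (inl (u, f u)) n ew (Sf u1) mn).
have ev_le m n : (m <= n)%N -> ev m `<=` ev n.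
  move=> /subnKC <-; elim: (n - m)%N => [|k IH] w; first by rewrite addn0.
  by rewrite addnS => /IH; have [_ h _ _] := hev (m + k)%N; exact: h.
have small e : 0 < e -> exists m, forall n, (m <= n)%N -> C0 * (3 / 4) ^+ n <= e.
  move=> e0; have q1 : `|3 / 4 : R| < 1 by rewrite ger0_norm; lra.
  have : (fun n => C0 * (3 / 4) ^+ n) @ \oo --> (C0 * 0 : R) by apply: cvgMl_tmp; exact: cvg_expr.
  rewrite mulr0 => /cvgrPdist_le /(_ e e0) [m _ hm]; exists m => n mn.
  by have := hm n mn; rewrite /= sub0r normrN => /(le_trans (ler_norm _)).
pose Wn u n w : R := \1_good w * W (idx n (code_ n u)) w.
pose G u w : R := if `[< sphere R d u >] then limn (fun n => Wn u n w) else 0.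
have Gcvg u w : sphere R d u -> (fun n => Wn u n w) @ \oo --> G u w.
  move=> u1; rewrite /G asboolT//; have [gw|ng] := pselect (good w); last first.
    rewrite (_ : (fun n => Wn u n w) = fun=> 0); first exact: is_cvg_cst.
    by apply/funext => n; rewrite /Wn indicE memNset// mul0r.
  apply: cauchy_cvg; apply/cauchy_exP => e e0; have e2 : 0 < e / 2 by rewrite divr_gt0.
  have [m0 _ ew] := gw; have [m1 hm1] := small _ e2; pose m := maxn m0 m1.
  exists (Wn u m w); exists m => // n /= mn; rewrite /ball/= /Wn indicE mem_set// !mul1r distrC.
  apply: (@le_lt_trans _ _ (C0 * (3 / 4) ^+ m)).
    by apply: inc => //; apply: ev_le ew; exact: leq_maxl.
  by rewrite (le_lt_trans (hm1 m (leq_maxr _ _)))// ltr_pdivrMr//; lra.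
have mWn u n : measurable_fun setT (Wn u n).
  by apply: measurable_funM; [exact: measurable_indic|exact: mW].
have mG u : measurable_fun setT (G u).
  have [u1|nu] := pselect (sphere R d u).
    by apply: (measurable_fun_cvg (mWn u)) => w _; exact: Gcvg.
  rewrite (_ : G u = cst 0); first exact: measurable_cst.
  by apply/funext => w; rewrite /G asboolF.
have G0 w u : (forall m, ~ ev m w) -> G u w = 0.
  move=> nev; rewrite /G; case: asboolP => // u1.
  rewrite (_ : (fun n => Wn u n w) = fun=> 0); first exact: lim_cst.
  apply/funext => n; rewrite /Wn indicE memNset ?mul0r// => -[m _]; exact: nev.
have Gclose w u m : ev m w -> sphere R d u -> `|G u w - W (idx m (code_ m u)) w| <= C0 * (3 / 4) ^+ m.
  move=> ew u1; have gw : good w by exists m.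
  apply/ler_addgt0Pr => e e0; have /cvgrPdist_le := Gcvg u w u1; move=> /(_ e e0) [n0 _ hn].
  have := hn (maxn n0 m) (leq_maxl _ _); rewrite /= /Wn indicE mem_set// mul1r => h.
  rewrite (le_trans (ler_distD (W (idx (maxn n0 m) (code_ (maxn n0 m) u)) w) _ _))// addrC.
  by rewrite lerD// inc// leq_maxr.
have goodP : unif R good = 1%E.
  apply/eqP; rewrite eq_le probability_le1//=.
  rewrite -(prob_fine (unif R) mgood) lee_fin; apply/ler_addgt0Pr => e e0.
  have [m _ hm] := pow2_small 4 0 e0; have [_ _ pm _] := hev m.
  have : fine (unif R (~` good)) <= fine (unif R (~` ev m)).
    rewrite fine_le ?fin_num_measure//; try exact: measurableC.
    by apply: le_measure; rewrite ?inE; [exact: measurableC|exact: measurableC|apply: subsetC; exact: bigcup_sup].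
  have -> : fine (unif R (~` good)) = 1 - fine (unif R good).
    by rewrite probC// fineB// fin_num_measure.
  lra.
exists G; split => //.
  apply: (@codes_tight _ _ _ code_ (nsize d) _ _ _ _ G ev (fun m => 2 * (C0 * (3 / 4) ^+ m))) => //.
  - by move=> m u _; exact: ncode_lt.
  - by move=> m; have [_ h _ _] := hev m.
  - move=> e e0; have [m _ hm] := pow2_small 4 0 e0; exists m; have [_ _ pm _] := hev m.
    exact: le_trans pm hm.
  - move=> e e0; have e2 : 0 < e / 2 by rewrite divr_gt0.
    by have [m hm] := small _ e2; exists m => n /hm; rewrite ler_pdivlMr// mulrC.
  - move=> w m s t ew s1 t1 E.
    rewrite (le_trans (ler_distD (W (idx m (code_ m s)) w) _ _))// mulr2n mulrDl mul1r lerD//.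
      exact: Gclose.
    by rewrite E distrC; exact: Gclose.
move=> n t a t1.
pose sk k := [seq (a i, idx k (code_ k (t i))) | i <- enum 'I_n].
have sumE k (F : R * nat -> R) : \sum_(z <- sk k) F z = \sum_(i < n) F (a i, idx k (code_ k (t i))).
  by rewrite big_map big_enum.
set q := \sum_(i < n) _.
apply: (@gauss_law_limit _ R R (unif R) (fun k w => \sum_(z <- sk k) z.1 * W z.2 w) _
  (fun k => Num.sqrt (qform K (sk k))) _ good) => //.
- move=> k; apply: measurable_sum => z; exact: measurable_funM.
- by apply: measurable_sum => i; exact: measurable_funM.
- by move=> k h bh; exact: Wlaw.
- have qc : (fun k => qform K (sk k)) @ \oo --> q.
    rewrite (_ : (fun k => qform K (sk k)) = (fun k => \sum_(i < n) \sum_(j < n)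
        a i * a j * covp (rep p r S t0 k (t i, f (t i))) (rep p r S t0 k (t j, f (t j))))); last first.
      apply/funext => k; rewrite /qform sumE; apply: eq_bigr => i _; rewrite sumE.
      by apply: eq_bigr => j _; rewrite /K !tt_idx.
    apply: cvg_big => [|i _]; first exact: add_continuous.
    apply: cvg_big => [|j _]; first exact: add_continuous.
    apply: cvgMl_tmp; apply/cvgrPdist_le => e e0.
    have [k0 hk0] : exists k0, forall k, (k0 <= k)%N -> 16 * bndC p r * netc / 2 ^+ k <= e.
      have [k0 _ hk0] := pow2_small (16 * bndC p r * netc) 0 e0; exists k0 => k k0k.
      apply: le_trans hk0; apply: ler_wpM2l.
        by rewrite mulr_ge0// ?(ltW netc_gt0)// mulr_ge0// ltW// bndC_gt0.
      by rewrite lef_pV2 ?posrE ?exprn_gt0// ler_weXn2l// ler1n.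
    exists k0 => // k /= /hk0; apply: le_trans; rewrite -[leRHS]mulrA.
    apply: covp_close; try exact: fadm; try (by apply: SA; exact: rep_in).
    - by rewrite divr_ge0 ?(ltW netc_gt0)// exprn_ge0.
    - exact: (rep_close p_gt1 r_gt0 St0 SA k (Sf (t1 i))).
    - exact: (rep_close p_gt1 r_gt0 St0 SA k (Sf (t1 j))).
  exact: (cvg_comp _ _ qc (@sqrt_continuous R q)).
- move=> w gw; rewrite (_ : (fun k => _) = fun k => \sum_(i < n) a i * Wn (t i) k w).
    apply: cvg_big => [|i _]; first exact: add_continuous.
    by apply: cvgMl_tmp; exact: Gcvg.
  by apply/funext => k; rewrite sumE; apply: eq_bigr => i _; rewrite /Wn indicE mem_set// mul1r.
Qed.

End LimitProcess.

(** * Reduction to samples in the ball *)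

(** The complement of the ball is a countable union of compact shells that avoid the
    support. *)
Lemma ball_full (R : realType) (d : nat) (r : R) (P : probability (borel_rV R d) R) :
  msupport (P : set 'rV[R]_d -> \bar R) `<=` l2ball d r -> P (l2ball d r) = 1%E.
Proof.
move=> PS; have mB : measurable (l2ball d r : set (borel_rV R d)) by exact: measurable_l2ball.
pose K n : set 'rV[R]_d := [set x : 'rV[R]_d | forall j, `[- n%:R, n%:R]%classic (x ord0 j)] `&`
  [set x : 'rV[R]_d | r + n.+1%:R^-1 <= l2norm x].
have cK n : compact (K n).
  apply: compact_closedI.
    by apply: (@rV_compact R d (fun=> `[- n%:R, n%:R]%classic)) => _; exact: segment_compact.
  rewrite (_ : [set x | _] = (@l2norm R d) @^-1` [set z | r + n.+1%:R^-1 <= z])//.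
  by apply: closed_comp; [move=> x _; exact: l2norm_continuous|exact: closed_ge].
have KS n : K n `<=` ~` msupport (P : set 'rV[R]_d -> \bar R).
  move=> x [_ /= xr] /PS; rewrite /l2ball/= => h.
  by have := le_trans xr h; rewrite gerDl leNgt invr_gt0 ltr0n.
have mo (U : set 'rV[R]_d) : open U -> measurable ((fun x : borel_rV R d => x : 'rV[R]_d) @^-1` U).
  by move=> oU; exact: open_borel.
have [V [oV KV V0]] := @msupport_null _ _ _ _ P (fun x : borel_rV R d => x : 'rV[R]_d) mo
  (P : set 'rV[R]_d -> \bar R) K (fun _ => erefl) cK KS.
suff nB : P (~` l2ball d r) = 0%E.
  by rewrite -[l2ball d r]setCK probC ?nB ?sube0//; exact: measurableC.
apply/eqP; rewrite -measure_le0 -V0; apply: le_measure; rewrite ?inE.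
- exact: measurableC.
- exact: mo.
move=> x /negP; rewrite -ltNge => xr; apply: KV.
pose n := (Num.truncn (l2norm x + (l2norm x - r)^-1)).+1.
have nP : l2norm x + (l2norm x - r)^-1 < n%:R by exact: truncnS_gt.
have g0 : 0 < l2norm x - r by rewrite subr_gt0.
have ei : 0 < (l2norm x - r)^-1 by rewrite invr_gt0.
have x0 : 0 <= l2norm x by exact: sqrtr_ge0.
exists n => //; split.
  move=> j /=; rewrite in_itv/= -ler_norml.
  have : l2ball d n%:R x by rewrite /l2ball/=; lra.
  exact: coord_le.
rewrite /= addrC -lerBrDr -[leRHS]invrK lef_pV2 ?posrE ?ltr0n//.
have : n%:R <= n.+1%:R :> R by rewrite ler_nat.
lra.
Qed.

Section Cut.
Context (R : realType) (d : nat) (r : R).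

(** The samples lie in the ball almost surely; moving the others to the origin makes
    it certain and changes neither laws nor independence. *)
Definition cut (x : borel_rV R d) : borel_rV R d :=
  if pselect (l2ball d r x) then x else (0 : 'rV[R]_d).

Lemma cut_id x : l2ball d r x -> cut x = x.
Proof. by rewrite /cut; case: pselect. Qed.

Lemma cut_ball x : 0 <= r -> l2ball d r (cut x).
Proof.
move=> r0; rewrite /cut; case: pselect => //= _.
by rewrite /l2ball/= /l2norm dotpE big1 ?sqrtr0// => j _; rewrite mxE mul0r.
Qed.

Lemma measurable_cut : measurable_fun setT cut.
Proof.
have mB : measurable (l2ball d r : set (borel_rV R d)) by exact: measurable_l2ball.
move=> _ A mA; rewrite setTI.
have -> : cut @^-1` A = (A `&` l2ball d r) `|`
    (if pselect (A (0 : 'rV[R]_d)) then ~` l2ball d r else set0).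
  apply/seteqP; split=> x; rewrite /cut/=.
    case: pselect => [xB Ax|xB A0] /=; first by left.
    by right; case: pselect.
  case=> [[Ax xB]|]; first by case: pselect.
  by case: pselect => // A0 /= nB; case: pselect.
apply: measurableU; first exact: measurableI.
by case: pselect => h /=; [exact: measurableC|exact: measurable0].
Qed.

Lemma cut_law dO (Om : measurableType dO) (Pr : probability Om R)
    (P : probability (borel_rV R d) R) (X : Om -> borel_rV R d) :
  P (l2ball d r) = 1%E -> has_law Pr X P -> has_law Pr (fun w => cut (X w)) P.
Proof.
move=> Pb lX A mA; have mB : measurable (l2ball d r : set (borel_rV R d)) by exact: measurable_l2ball.
have mC : measurable (cut @^-1` A).
  by rewrite -[X in measurable X]setTI; exact: measurable_cut.
apply: (etrans (lX _ mC)); apply: (etrans (esym (prob_fine P mC))).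
rewrite -[RHS](prob_fine P mA) -(expect_indic P mC) -(expect_indic P mA); congr EFin.
apply: (expect_ae mB Pb (bmf_indic R mC) (bmf_indic R mA)) => x xB.
by rewrite !indicE; congr (nat_of_bool _)%:R; apply/idP/idP; rewrite !inE /= cut_id.
Qed.

End Cut.

Section SampleLimit.
Context (R : realType) (d : nat) (p r : R) (p_gt1 : 1 < p) (r_gt0 : 0 < r).
Context (P Q : probability (borel_rV R d) R) (v : 'rV[R]_d).
Hypothesis Pball : P (l2ball d r) = 1%E.
Hypothesis Qball : Q (l2ball d r) = 1%E.
Hypothesis v1 : sphere R d v.
Hypothesis spiked : spiked_transport_model v P Q.
Hypothesis cc : condition_CC P Q.
Context (dO : measure_display) (Om : measurableType dO) (Pr : probability Om R).
Context (X Y : nat -> Om -> borel_rV R d).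
Hypothesis mX : forall i, measurable_fun setT (X i).
Hypothesis mY : forall i, measurable_fun setT (Y i).
Hypothesis lawX : forall i, has_law Pr (X i) P.
Hypothesis lawY : forall i, has_law Pr (Y i) Q.
Hypothesis indep : mutually_independent Pr
  (fun k : nat + nat => match k with inl i => X i | inr j => Y j end).

Let T (n : nat) (w : Om) : R := Num.sqrt n%:R * (msw_emp p X Y n w - fine (MSWpp p P Q)).

Lemma measurable_statistic n : measurable_fun setT (T n).
Proof.
case: n => [|n].
  rewrite (_ : T 0 = cst 0); first exact: measurable_cst.
  by apply/funext => w; rewrite /T sqrtr0 mul0r.
apply: measurable_funM => //; apply: measurable_funB => //.
exact: (measurable_msw p_gt1 mX mY v1).
Qed.

Let in_ball : set Om := \bigcap_i (X i @^-1` l2ball d r `&` Y i @^-1` l2ball d r).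

Let in_ball_full : measurable in_ball /\ Pr in_ball = 1%E.
Proof.
have mB : measurable (l2ball d r : set (borel_rV R d)) by exact: measurable_l2ball.
have mXi i : measurable (X i @^-1` l2ball d r).
  by rewrite -[X in measurable X]setTI; exact: mX.
have mYi i : measurable (Y i @^-1` l2ball d r).
  by rewrite -[X in measurable X]setTI; exact: mY.
have mI i := measurableI _ _ (mXi i) (mYi i).
have m : measurable in_ball by apply: bigcap_measurable => // i _; exact: mI.
split => //.
have : fine (Pr (\bigcup_i ~` (X i @^-1` l2ball d r `&` Y i @^-1` l2ball d r))) <= 0.
  apply: (fprob_bigcup_le (a := fun=> 0)) => [n|n|n]; first exact: measurableC.
    have hX : Pr (X n @^-1` l2ball d r) = 1%E by apply: etrans Pball; exact: lawX.
    have hY : Pr (Y n @^-1` l2ball d r) = 1%E by apply: etrans Qball; exact: lawY.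
    by rewrite probC// (prob_setI (mXi n) (mYi n) hX hY) subee.
  by rewrite big1.
rewrite -setC_bigcap -/in_ball probC// fineB ?fin_num_measure//= => h.
apply/eqP; rewrite eq_le probability_le1//= -(prob_fine Pr m) lee_fin; move: h; lra.
Qed.

Lemma statistic_limit (fv : R -> R) : class_C p r fv ->
  (forall h, class_C p r h -> dval p r P Q (v, h) <= dval p r P Q (v, fv)) ->
  forall h : R -> R, continuous h -> (exists M, forall x, `|h x| <= M) ->
  (fun n => \int[Pr]_w h (T n w)) @ \oo -->
    \int[gauss R]_y h (Num.sqrt (covp p r P Q (v, fv) (v, fv)) * y).
Proof.
move=> fvC fv_max h ch hb; have [M hM] := hb.
pose X' i w := cut r (X i w); pose Y' i w := cut r (Y i w).
have mX' i : measurable_fun setT (X' i) by exact: (measurableT_comp (measurable_cut r) (mX i)).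
have mY' i : measurable_fun setT (Y' i) by exact: (measurableT_comp (measurable_cut r) (mY i)).
have mh : measurable_fun setT h by exact: continuous_measurable_fun.
have indep' : mutually_independent Pr
    (fun k : nat + nat => match k with inl i => X' i | inr j => Y' j end).
  have := mutually_independent_comp (g := fun=> cut r) (fun=> measurable_cut r) indep.
  by congr mutually_independent; apply/funext => -[].
have lim := msw_limit p_gt1 r_gt0 Pball Qball v1 spiked cc mX' mY'
  (fun i w => cut_ball (X i w) (ltW r_gt0)) (fun i w => cut_ball (Y i w) (ltW r_gt0))
  (fun i => cut_law Pball (lawX i)) (fun i => cut_law Qball (lawY i)) indep' fvC fv_max ch hb.
have [mI PI] := in_ball_full.
have mT' n : measurable_fun setT
    (fun w => Num.sqrt n%:R * (msw_emp p X' Y' n w - fine (MSWpp p P Q))).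
  case: n => [|n].
    rewrite (_ : (fun w => _) = cst 0); first exact: measurable_cst.
    by apply/funext => w; rewrite sqrtr0 mul0r.
  apply: measurable_funM => //; apply: measurable_funB => //.
  exact: (measurable_msw p_gt1 mX' mY' v1).
suff E : (fun n => \int[Pr]_w h (T n w)) = (fun n => \int[Pr]_w h (Num.sqrt n%:R *
    (msw_emp p X' Y' n w - fine (MSWpp p P Q)))) by rewrite E; exact: lim.
apply/funext => n; apply: (expect_ae mI PI).
- by split; [exact: (measurableT_comp mh (measurable_statistic n))|exists M].
- by split; [exact: (measurableT_comp mh (mT' n))|exists M].
move=> w Iw; have EX : (fun i => X i w) = (fun i => X' i w).
  by apply/funext => i; rewrite /X' cut_id//; have [] := Iw i Logic.I.
have EY : (fun i => Y i w) = (fun i => Y' i w).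
  by apply/funext => i; rewrite /Y' cut_id//; have [] := Iw i Logic.I.
by rewrite /T /msw_emp EX EY.
Qed.

End SampleLimit.

(** * The limit law *)

Lemma has_law_eq d d' (Om : measurableType d) (T : measurableType d') (R : realType)
    (Pr : probability Om R) (X Y : Om -> T) (mu nu : set T -> \bar R) :
  has_law Pr X mu -> X = Y -> mu = nu -> has_law Pr Y nu.
Proof. by move=> h <- <-. Qed.

Lemma gaussian_marginal dO (Om : measurableType dO) (R : realType) (Pr : probability Om R)
    (T : Type) (A : set T) (G : T -> Om -> R) (t : T) :
  gaussian_process_on Pr A G -> A t ->
  exists m s : R, 0 <= s /\ has_law Pr (G t) (gaussian_law m s).
Proof.
move=> gG At; have [m [s [s0 h]]] := gG 1%N (fun=> t) (fun=> 1) (fun=> At).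
exists m, s; split => //; apply: (has_law_eq h) => //.
by apply/funext => w; rewrite big_ord1 mul1r.
Qed.

Section Centered.
Context (dO : measure_display) (Om : measurableType dO) (R : realType) (Pr : probability Om R).
Context (T : choiceType) (A : set T) (c cov : T -> T -> R) (G : T -> {RV Pr >-> R}).
Hypothesis tG : tight_in_linfty Pr A (fun t => G t : Om -> R).
Hypothesis lG : forall n (t : 'I_n -> T) (a : 'I_n -> R), (forall i, A (t i)) ->
  has_law Pr (fun w => \sum_(i < n) a i * G (t i) w)
    (gaussian_law 0 (Num.sqrt (\sum_(i < n) \sum_(j < n) a i * a j * c (t i) (t j)))).
Hypothesis c_ge0 : forall s t, A s -> A t -> 0 <= c s s + 2 * c s t + c t t.
Hypothesis c_cov : forall s t, A s -> A t -> c s t = c t s /\ cov s t = c s t.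

Let mG t : measurable_fun setT (G t). Proof. by []. Qed.

Let law1 t : A t -> has_law Pr (G t) (gaussian_law 0 (Num.sqrt (c t t))).
Proof.
move=> At; apply: (has_law_eq (lG (fun i : 'I_1 => 1) (fun=> At))).
  by apply/funext => w; rewrite big_ord1 mul1r.
by rewrite !big_ord1 !mul1r.
Qed.

Let law2 s t : A s -> A t ->
  has_law Pr (fun w => G s w + G t w) (gaussian_law 0 (Num.sqrt (c s s + 2 * c s t + c t t))).
Proof.
move=> As At; pose k (i : 'I_2) := if val i == 0%N then s else t.
have Ak i : A (k i) by rewrite /k; case: ifP.
apply: (has_law_eq (lG (fun=> 1) Ak)).
  by apply/funext => w; rewrite !big_ord_recl big_ord0 !mul1r addr0.
congr (gaussian_law 0 (Num.sqrt _)); rewrite !big_ord_recl !big_ord0 /k/= !mul1r !addr0.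
by have [-> _] := c_cov At As; lra.
Qed.

Let sqr_law (X : Om -> R) (q : R) : measurable_fun setT X -> 0 <= q ->
  has_law Pr X (gaussian_law 0 (Num.sqrt q)) ->
  Pr.-integrable setT (EFin \o (fun w => X w ^+ 2)) /\ \int[Pr]_w X w ^+ 2 = q.
Proof.
move=> mX q0 lX; have [iX ->] := gaussian_sqr_integrable mX (sqrtr_ge0 q) lX.
by split => //; rewrite expr0n add0r sqr_sqrtr.
Qed.

(** Linear combinations of one and two variables give the variances, and
    polarisation gives the covariances. *)
Lemma centered_gaussian : tight_centered_gaussian A cov G.
Proof.
split => //.
- move=> n t a At; exists 0; eexists; split; last exact: lG.
  exact: sqrtr_ge0.
- move=> t At; have [iX EX] := gaussian_integrable (mG t) (sqrtr_ge0 (c t t)) (law1 At).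
  by rewrite expectation_def -[LHS]fineK ?[fine _]EX//; exact: (integrable_fin_num measurableT iX).
- move=> s t As At; have [cst ->] := c_cov As At.
  have d0 u : A u -> 0 <= c u u by move=> Au; have := c_ge0 Au Au; lra.
  have [is2 Es] := sqr_law (mG s) (d0 s As) (law1 As).
  have [it2 Et] := sqr_law (mG t) (d0 t At) (law1 At).
  have [ist Est] := sqr_law (measurable_funD (mG s) (mG t)) (c_ge0 As At) (law2 As At).
  have i1 := integrableB measurableT ist is2.
  have i2 := integrableB measurableT i1 it2.
  have i3 := integrableZl measurableT 2^-1 i2.
  have e1 w : G s w * G t w = 2^-1 * ((G s w + G t w) ^+ 2 - G s w ^+ 2 - G t w ^+ 2) by field.
  rewrite unlock; transitivity (\int[Pr]_w (2^-1 * ((G s w + G t w) ^+ 2 - G s w ^+ 2 - G t w ^+ 2))%:E)%E.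
    by apply: eq_integral => w _; rewrite e1.
  have i3' : Pr.-integrable setT (EFin \o (fun w => 2^-1 * ((G s w + G t w) ^+ 2 - G s w ^+ 2 - G t w ^+ 2))).
    exact: i3.
  rewrite -[LHS]fineK; last exact: (integrable_fin_num measurableT i3').
  congr EFin; change (\int[Pr]_w (2^-1 * ((G s w + G t w) ^+ 2 - G s w ^+ 2 - G t w ^+ 2)) = c s t).
  have i1' : Pr.-integrable setT (EFin \o (fun w => (G s w + G t w) ^+ 2 - G s w ^+ 2)) by exact: i1.
  have i2' : Pr.-integrable setT (EFin \o (fun w => (G s w + G t w) ^+ 2 - G s w ^+ 2 - G t w ^+ 2)).
    exact: i2.
  rewrite RintegralZl// (RintegralB measurableT i1' it2) (RintegralB measurableT ist is2).
  by rewrite Est Es Et; lra.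
Qed.

End Centered.

Lemma qform2 (R : realType) (K : nat -> nat -> R) : K 1%N 0%N = K 0%N 1%N ->
  qform K [:: (1, 0%N); (1, 1%N)] = K 0%N 0%N + 2 * K 0%N 1%N + K 1%N 1%N.
Proof. by rewrite /qform !big_cons !big_nil/= !mul1r !addr0 => ->; ring. Qed.

Section CovpAdd.
Context (R : realType) (d : nat) (p r : R) (p_gt1 : 1 < p) (r_gt0 : 0 < r).
Context (P Q : probability (borel_rV R d) R).

Lemma covp_add_ge0 (s t : ridge R d) : adm p r s -> adm p r t ->
  0 <= covp p r P Q s s + 2 * covp p r P Q s t + covp p r P Q t t.
Proof.
move=> As At; pose tt i := if i == 0%N then s else t.
have Att i : adm p r (tt i) by rewrite /tt; case: ifP.
pose K i j := covp p r P Q (tt i) (tt j).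
have KE : qform K [:: (1, 0%N); (1, 1%N)] = K 0%N 0%N + 2 * K 0%N 1%N + K 1%N 1%N.
  by apply: qform2; exact: covp_sym.
suff : 0 <= qform K [:: (1, 0%N); (1, 1%N)] by rewrite KE.
rewrite (qform_covp p_gt1 r_gt0 P Q _ Att).
by apply: addr_ge0; apply: Rintegral_ge0 => x _; exact: sqr_ge0.
Qed.

End CovpAdd.

Theorem theorem3p2 (R : realType) (d : nat) (p r : R) (v : 'rV[R]_d)
  (P Q : probability (borel_rV R d) R)
  (p_gt1 : 1 < p) (r_gt0 : 0 < r) (v_unit : sphere R d v)
  (suppP : msupport (P : set 'rV[R]_d -> \bar R) `<=` l2ball d r)
  (suppQ : msupport (Q : set 'rV[R]_d -> \bar R) `<=` l2ball d r)
  (spiked : spiked_transport_model v P Q)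
  (cc : condition_CC P Q)
  (dO : measure_display) (Om : measurableType dO) (Pr : probability Om R)
  (X Y : nat -> {RV Pr >-> borel_rV R d})
  (lawX : forall i, has_law Pr (X i) P)
  (lawY : forall i, has_law Pr (Y i) Q)
  (indep : mutually_independent Pr
     (fun k : nat + nat => match k with inl i => X i | inr j => Y j end)) :
  (forall u, sphere R d u ->
     exists f, kantorovich_potential p r (proj1d P u) (proj1d Q u) f) /\
  forall f : 'rV[R]_d -> R -> R,
    (forall u, sphere R d u ->
       kantorovich_potential p r (proj1d P u) (proj1d Q u) (f u)) ->
    (exists (dG : measure_display) (OmG : measurableType dG)
       (PrG : probability OmG R) (G : 'rV[R]_d -> {RV PrG >-> R}),
       tight_centered_gaussian (sphere R d) (limit_cov p r P Q f) G) /\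
    (forall (dG : measure_display) (OmG : measurableType dG)
       (PrG : probability OmG R) (G : 'rV[R]_d -> {RV PrG >-> R}),
       tight_centered_gaussian (sphere R d) (limit_cov p r P Q f) G ->
       cvg_in_distribution Pr PrG
         (fun n w => Num.sqrt n%:R *
            (fine (MSWpp p (empirical n (fun i => X i w))
                           (empirical n (fun i => Y i w)))
             - fine (MSWpp p P Q)))
         (G v)).
Proof.
have Pball := ball_full suppP; have Qball := ball_full suppQ.
split=> [u u1|f fpot].
  have [f [fC _ _ M]] := Wpp_dval p_gt1 r_gt0 Pball Qball u1.
  by exists f; apply/(potential_dval p_gt1 r_gt0 Pball Qball f u1).
have fmax u : sphere R d u -> class_C p r (f u) /\
    forall g, class_C p r g -> dval p r P Q (u, g) <= dval p r P Q (u, f u).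
  by move=> u1; apply/(potential_dval p_gt1 r_gt0 Pball Qball (f u) u1); exact: fpot.
have fadm u : sphere R d u -> adm p r (u, f u).
  by move=> u1; split => //; have [] := fmax u u1.
have covE u w : sphere R d u -> sphere R d w ->
    limit_cov p r P Q f u w = covp p r P Q (u, f u) (w, f w).
  by move=> u1 w1; exact: (limit_covE p_gt1 r_gt0 Pball Qball (fadm u u1) (fadm w w1)).
split; last first.
  move=> dG OmG PrG G [_ gG mean cov].
  have [m [s [s0 lawG]]] := gaussian_marginal gG v_unit.
  have mG : measurable_fun setT (G v) by [].
  have [iG EG] := gaussian_integrable mG s0 lawG.
  have [iG2 EG2] := gaussian_sqr_integrable mG s0 lawG.
  have m0 : m = 0.
    rewrite -EG /Rintegral; have := mean v v_unit; rewrite expectation_def => ->.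
    by [].
  have s2 : s ^+ 2 = covp p r P Q (v, f v) (v, f v).
    rewrite -covE//; have := cov v v v_unit v_unit; rewrite unlock => h.
    move: EG2; rewrite m0 expr0n add0r => <-; rewrite /Rintegral.
    by under eq_integral do rewrite expr2; rewrite h.
  have sE : s = Num.sqrt (covp p r P Q (v, f v) (v, f v)) by rewrite -s2 sqrtr_sqr ger0_norm.
  have mX i : measurable_fun setT (X i) by [].
  have mY i : measurable_fun setT (Y i) by [].
  split => // [n|h ch hb].
    exact: (measurable_statistic p_gt1 P Q v_unit mX mY).
  have [M hM] := hb.
  have bh : bmf h by split; [exact: continuous_measurable_fun|exists M].
  rewrite (gaussian_expect mG s0 lawG bh) m0 sE.
  under [X in _ --> X]eq_Rintegral do rewrite add0r.
  have [fC fM] := fmax v v_unit.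
  exact: (statistic_limit p_gt1 r_gt0 Pball Qball v_unit spiked cc mX mY lawX lawY indep fC fM ch hb).
have [G0 [mG tG lG]] := gaussian_limit_exists p_gt1 r_gt0 Pball Qball v_unit fadm.
pose G u : {RV (unif R) >-> R} := HB.pack (G0 u) (@isMeasurableFun.Build _ _ _ _ (G0 u) (mG u)).
exists _, R, (unif R), G.
pose c u w := covp p r P Q (u, f u) (w, f w).
apply: (@centered_gaussian _ _ _ (unif R) _ (sphere R d) c _ G tG lG) => [u w u1 w1|u w u1 w1].
  by apply: covp_add_ge0 => //; exact: fadm.
by split; [exact: covp_sym|exact: covE].
Qed.
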